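(* Let $\varphi \in \mathrm{B}_b(I)$. For each $y \in O$ define the linear operator $\mathcal{A}_y \colon \mathrm{B}_b(I) \to \mathrm{B}_b(I)$ by $$\mathcal{A}_y \varphi(x) := \mathcal{L}\varphi(x) - \int_I \mathbf{1}_{h^{-1}(y)^c}(z)\, \varphi(z)\, \lambda(x, \mathrm{d}z), \quad x \in I,$$ and let $\mathsf{1} \colon I \to \mathbb{R}$ be the function identically equal to $1$. Then the process $\pi(\varphi) = (\pi_t(\varphi))_{t \ge 0}$ satisfies, for all $t \ge 0$ and $\mathbb{P}$-a.s., $$\pi_t(\varphi) = H_{Y_0}[\mu](\varphi) + \int_0^t \int_I \mathcal{A}_{Y_{s-}} \varphi(x)\, \pi_{s-}(\mathrm{d}x)\, \mathrm{d}s - \int_0^t \pi_{s-}(\varphi) \int_I \mathcal{A}_{Y_{s-}} \mathsf{1}(x)\, \pi_{s-}(\mathrm{d}x)\, \mathrm{d}s + \sum_{0 < \tau_n \le t} \bigl\{ H_{Y_{\tau_n}}[\mu_n](\varphi) - \pi_{\tau_n-}(\varphi) \bigr\},$$ or, in differential form, $$\frac{\mathrm{d}}{\mathrm{d}t}\pi_t(\varphi) = \pi_t(\mathcal{A}_{Y_{\tau_n}} \varphi) - \pi_t(\varphi)\, \pi_t(\mathcal{A}_{Y_{\tau_n}} \mathsf{1}), \quad t \in [\tau_n, \tau_{n+1}),\ n \in \mathbb{N}_0, \qquad \pi_{\tau_n}(\varphi) = H_{Y_{\tau_n}}[\mu_n](\varphi), \quad n \in \mathbb{N}_0,$$ where the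 (random) measures $\mu_n$ on $(I, \mathcal{I})$ are given by $\mu_0 := \mu$ and $$\mu_n(\mathrm{d}z) := \mathbf{1}_{h^{-1}(Y_{\tau_n-})^c}(z) \int_I \lambda(x, \mathrm{d}z)\, \pi_{\tau_n-}(\mathrm{d}x), \quad n \in \mathbb{N}.$$
   Context: **Setting.** $I$ and $O$ are complete separable metric spaces with Borel $\sigma$-algebras $\mathcal{I}$, $\mathcal{O}$; $\mathrm{B}_b(I)$ is the set of bounded Borel functions $I \to \mathbb{R}$; $\mathcal{P}(I)$, $\mathcal{M}_+(I)$ are the sets of Borel probability, resp. finite nonnegative, measures on $I$; $\mathbb{N} = \{1,2,\dots\}$, $\mathbb{N}_0 = \mathbb{N}\cup\{0\}$. For a measure $\nu$, $\nu(\varphi) := \int_I \varphi\,\mathrm{d}\nu$ and $\varphi\nu$ is the measure with density $\varphi$ w.r.t. $\nu$. The map $h \colon I \to O$ is measurable and surjective, neither one-to-one nor constant. On a complete probability space $(\Omega, \mathcal{F}, \mathbb{P})$, $X = (X_t)_{t\ge0}$ is an $I$-valued continuous-time homogeneous pure jump Markov process with initial law $\mu \in \mathcal{P}(I)$ (law of $X_0$). Its jump times and positions are $T_0 = 0$, $T_n = \inf\{t > T_{n-1} : X_t \ne X_{T_{n-1}}\}$, $\xi_n = X_{T_n}$. With $\mathcal{X}_t := \sigma(X_s, 0 \le s \le t) \vee \mathcal{N}$ ($\mathcal{N}$ the $\mathbb{P}$-null sets), its dynamics are given by a rate transition measure $\lambda$, a transition kernel from $(I, \mathcal{I})$ into itself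 (with $\lambda(x,\{x\}) = 0$) such that, for all $n \in \mathbb{N}_0$, $t \ge 0$, $A \in \mathcal{I}$, $$\mathbb{P}(T_{n+1} - T_n > t,\ \xi_{n+1} \in A \mid \mathcal{X}_{T_n}) = \frac{\lambda(\xi_n, A)}{\lambda(\xi_n, I)} e^{-\lambda(\xi_n, I)t}, \quad \mathbb{P}\text{-a.s.}$$ (states $x$ with $\lambda(x,I)=0$ are absorbing). Write $\lambda(x) := \lambda(x, I)$. Standing assumption: $\sup_{x \in I} \lambda(x) < +\infty$. The generator is $\mathcal{L}f(x) := \int_I [f(z) - f(x)]\,\lambda(x, \mathrm{d}z)$, $f \in \mathrm{B}_b(I)$. The observed process is $Y_t = h(X_t)$, with jump times $\tau_0 = 0$, $\tau_n = \inf\{t > \tau_{n-1} : Y_t \ne Y_{\tau_{n-1}}\}$, and completed natural filtration $\mathcal{Y}_t := \sigma(Y_s, 0 \le s \le t) \vee \mathcal{N}$. **Filtering process.** $\pi = (\pi_t)_{t \ge 0}$ is the $\mathcal{P}(I)$-valued process with $\pi_t(\varphi) = \mathbb{E}[\varphi(X_t) \mid \mathcal{Y}_t]$ $\mathbb{P}$-a.s. for all $t \ge 0$, $\varphi \in \mathrm{B}_b(I)$; a version with càdlàg paths ($t \mapsto \pi_t(A)$ càdlàg for every $A \in \mathcal{I}$) is used and $\pi_{t-}$ denotes its left limit at $t$. **Operator $H$.** For $\nu \in \mathcal{M}_+(I)$ there is a family $(\rho_y)_{y \in O}$ of probability measures on $(I,\mathcal{I})$ such that for all $\varphi \in \mathrm{B}_b(I)$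 and $\nu \circ h^{-1}$-almost all $y$, $\frac{\mathrm{d}((\varphi\nu) \circ h^{-1})}{\mathrm{d}(\nu \circ h^{-1})}(y) = \int_I \varphi\,\mathrm{d}\rho_y$, and $\rho_y(h^{-1}(y)) = 1$ for $\nu\circ h^{-1}$-a.e. $y$. One sets $H_y[\nu] := \rho_y$ if $y \in \operatorname{supp}(\nu \circ h^{-1})$ and $H_y[\nu] := \nu_y$ otherwise, where $\nu_y$ is an arbitrary fixed probability measure on $I$ with $\nu_y(h^{-1}(y)) = 1$. The versions are chosen so that the quantities $H_{Y_{\tau_n}}[\mu_n](\varphi)$ are random variables. Statements at index $n$ are understood on $\{\tau_n < +\infty\}$.
   Formalization: The versions in the definition of H are assumed jointly measurable: (ν,y) ↦ H_y[ν](A) is measurable on {y ∈ supp(ν∘h⁻¹)} for every A in 𝓘; merely asking that the H_{Y_{τ_n}}[μ_n](φ) be random variables does not suffice. *)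

(* Defs.v *)
From HB Require Import structures.
From mathcomp Require Import all_boot all_order all_algebra.
From mathcomp Require Import all_classical all_reals all_analysis.
From mathcomp Require Import measurable_realfun ring.

Set Implicit Arguments.
Unset Strict Implicit.
Unset Printing Implicit Defensive.

Import Order.TTheory GRing.Theory Num.Theory.
Import numFieldNormedType.Exports.

Local Open Scope classical_set_scope.
Local Open Scope ring_scope.

#[short(type="completeMetricType")]
HB.structure Definition CompleteMetric (R : numDomainType) :=
  {T of CompletePseudoMetric R T & PseudoMetric_isMetric R T}.

Definition separable (T : topologicalType) : Prop :=
  exists D : set T, countable D /\ dense D.

Notation borel T := (g_sigma_algebraType (@open T)).

Definition Bb d (T : measurableType d) (R : realType) (phi : T -> R) : Prop :=
  measurable_fun setT phi /\ bounded_fun phi.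

(* The left limit of a path at t, in a topological space. *)
Definition left_lim (R : realType) (T : ptopologicalType) (x : R -> T) (t : R)
  : T := lim (x s @[s --> t^'-]).

(* n-th jump time; it is +oo when there are fewer than n jumps, since the
   infimum of the empty set is +oo. *)
Fixpoint jump_time (R : realType) (T : Type) (x : R -> T) (n : nat) : \bar R :=
  if n is m.+1 then
    ereal_inf [set t%:E | t in
      [set t | (jump_time x m < t%:E)%E /\ x t <> x (fine (jump_time x m))]]
  else 0%E.

(* Right-continuous and with left limits for the discrete topology, i.e.
   piecewise constant with finitely many jumps on bounded time intervals. *)
Definition pure_jump_path (R : realType) (T : Type) (x : R -> T) : Prop :=
  forall t, 0 <= t ->
    (\forall s \near t^'+, x s = x t) /\
    (0 < t -> exists a, \forall s \near t^'-, x s = a).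

Section probability_notions.
Context d (Om : measurableType d) (R : realType) (P : probability Om R).

(* sigma(Z_s, 0 <= s <= t) augmented with the P-null sets. *)
Definition completed_natural_filtration d' (E : measurableType d')
    (Z : R -> Om -> E) (t : R) : set_system Om :=
  <<s [set A | (exists s B, [/\ 0 <= s <= t, measurable B & A = Z s @^-1` B])
               \/ P.-negligible A] >>.

Definition stopped_sigma_algebra (F : R -> set_system Om) (T : Om -> \bar R)
    : set_system Om :=
  [set A | measurable A /\
           forall t, 0 <= t -> F t (A `&` [set w | (T w <= t%:E)%E])].

(* W is a version of the conditional expectation E[Z | G]. *)
Definition is_cond_exp (G : set_system Om) (Z W : Om -> R) : Prop :=
  [/\ forall B, measurable B -> G (W @^-1` B),
      P.-integrable setT (EFin \o W) &
      forall A, G A -> \int[P]_(w in A) W w = \int[P]_(w in A) Z w].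

Definition homogeneous_markov d' (E : measurableType d') (X : R -> Om -> E)
    : Prop :=
  exists p : R -> R.-pker E ~> E, forall s t A, 0 <= s -> 0 <= t ->
    measurable A ->
    is_cond_exp (completed_natural_filtration X s)
      (\1_(X (s + t) @^-1` A)) (fun w => fine (p t (X s w) A)).

(* Restricting both sides to T_{n+1} < +oo, resp. T_n < +oo, is what makes
   xi_{n+1}, resp. xi_n, meaningful. In an absorbing state the quotient is
   0 / 0 = 0, so that the equation forces T_{n+1} = +oo. *)
Definition has_rate d' (E : measurableType d') (X : R -> Om -> E)
    (lam : R.-fker E ~> E) : Prop :=
  let T n w := jump_time (X^~ w) n in
  let xi n w := X (fine (T n w)) w in
  forall n t A, 0 <= t -> measurable A ->
    is_cond_exp
      (stopped_sigma_algebra (completed_natural_filtration X) (T n))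
      (\1_[set w | (T n w + t%:E < T n.+1 w)%E /\ (T n.+1 w < +oo)%E /\
                   A (xi n.+1 w)])
      (fun w => \1_[set w | (T n w < +oo)%E] w *
         (fine (lam (xi n w) A) / fine (lam (xi n w) setT) *
          expR (- fine (lam (xi n w) setT) * t))).

End probability_notions.

Section generator.
Context d (E : measurableType d) (R : realType) (lam : R.-fker E ~> E).

Definition generator (f : E -> R) (x : E) : R := \int[lam x]_z (f z - f x).

(* A_y f *)
Definition opA (F : Type) (h : E -> F) (y : F) (f : E -> R) (x : E) : R :=
  generator f x - \int[lam x]_z (\1_(~` (h @^-1` [set y])) z * f z).

(* A |-> \int lam(x, A) nu(dx) *)
Definition kernel_mixture (nu : probability E R) (A : set E) : \bar R :=
  (\int[nu]_x lam x A)%E.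

Section kernel_mixture_measure.
Variable nu : probability E R.
Local Notation km := (kernel_mixture nu).

Let km0 : km set0 = 0%E.
Proof.
by rewrite /km; under eq_integral do rewrite measure0; exact: integral0.
Qed.

Let km_ge0 A : (0 <= km A)%E. Proof. exact: integral_ge0. Qed.

Let km_sigma_additive : semi_sigma_additive km.
Proof.
move=> U mU tU mUU; rewrite [X in _ --> X](_ : _ =
  (\int[nu]_x (\sum_(n <oo) lam x (U n)))%E); last first.
  apply: eq_integral => x _.
  by apply/esym/cvg_lim => //; exact/measure_semi_sigma_additive.
apply/cvg_closeP; split.
  by apply: is_cvg_nneseries => n _ _; exact: integral_ge0.
rewrite closeE// integral_nneseries// => n.
exact: measurable_kernel.
Qed.

HB.instance Definition _ :=
  isMeasure.Build _ _ _ km km0 km_ge0 km_sigma_additive.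

Let km_fin : fin_num_fun km.
Proof.
apply: lty_fin_num_fun; have /measure_fam_uubP[r hr] := measure_uub lam.
apply: (@le_lt_trans _ _ (\int[nu]_x r%:num%:E)%E).
  apply: ge0_le_integral => //; first exact: measurable_kernel.
  by move=> x _; exact/ltW/hr.
by rewrite integral_cst//= probability_setT mule1 ltry.
Qed.

HB.instance Definition _ := Measure_isFinite.Build _ _ _ km km_fin.

End kernel_mixture_measure.
End generator.

(* A_y is a linear operator from B_b to B_b. *)
Section Bb_opA.
Context d (E : measurableType d) (R : realType).
Implicit Types f g : E -> R.

Lemma BbP f : Bb f <->
  measurable_fun setT f /\ exists M : R, forall x, `|f x| <= M.
Proof.
split=> -[mf [M HM]]; split => //.
  by exists (M + 1) => x; apply: HM.2 => //; rewrite ltrDl.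
exists M; split; first exact: num_real.
by move=> N MN x _ /=; exact: le_trans (HM x) (ltW MN).
Qed.

Lemma BbD f g : Bb f -> Bb g -> Bb (f \+ g).
Proof.
move=> /BbP[mf [M HM]] /BbP[mg [N HN]]; apply/BbP; split.
  exact: measurable_funD.
by exists (M + N) => x; rewrite (le_trans (ler_normD _ _))// lerD.
Qed.

Lemma BbM f g : Bb f -> Bb g -> Bb (f \* g).
Proof.
move=> /BbP[mf [M HM]] /BbP[mg [N HN]]; apply/BbP; split.
  exact: measurable_funM.
by exists (M * N) => x; rewrite normrM ler_pM.
Qed.

Lemma Bb_cst (a : R) : Bb (cst a : E -> R).
Proof. by apply/BbP; split; [exact: measurable_cst|exists `|a|]. Qed.

Lemma BbN f : Bb f -> Bb (\- f).
Proof.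
move=> /(BbM (Bb_cst (-1))); congr Bb; apply/funext => x /=.
by rewrite mulN1r.
Qed.

Lemma Bb_indic (D : set E) : measurable D -> Bb (\1_D : E -> R).
Proof.
move=> mD; apply/BbP; split; first exact: measurable_indic.
by exists 1 => x; rewrite indicE ger0_norm// lern1 leq_b1.
Qed.

Lemma Bb_integrable (m : {finite_measure set E -> \bar R}) f :
  Bb f -> m.-integrable setT (EFin \o f).
Proof.
move=> [mf bf]; apply: measurable_bounded_integrable => //.
by rewrite ltey_eq fin_num_measure.
Qed.

Variable lam : R.-fker E ~> E.

Lemma Bb_kernel_integrable f x : Bb f -> (lam x).-integrable setT (EFin \o f).
Proof.
move=> [mf bf]; apply: measurable_bounded_integrable => //.
have /measure_fam_uubP[r hr] := measure_uub lam.
exact: lt_le_trans (hr x) (leey _).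
Qed.

Lemma Bb_kernel_integral f : Bb f -> Bb (fun x => \int[lam x]_z f z).
Proof.
move=> Bf; have /BbP[mf [M HM]] := Bf; apply/BbP; split.
  apply: (@measurableT_comp _ _ _ _ _ _ fine _
    (fun x => \int[lam x]_z (f z)%:E)%E).
    exact: fine_measurable.
  under eq_fun do rewrite integralE.
  apply: emeasurable_funB; apply: measurable_fun_integral_kernel => //.
  - by move=> U mU; exact: measurable_kernel.
  - by apply: measurable_funepos; exact/measurable_EFinP.
  - by move=> U mU; exact: measurable_kernel.
  - by apply: measurable_funeneg; exact/measurable_EFinP.
have /measure_fam_uubP[r hr] := measure_uub lam.
exists (M * r%:num) => x.
apply: (le_trans (le_normr_Rintegral measurableT (Bb_kernel_integrable x Bf))).
apply: (@le_trans _ _ (\int[lam x]_(z in setT) (cst M) z)).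
  apply: le_Rintegral => //.
  - apply/Bb_kernel_integrable/BbP; split; first exact: measurableT_comp.
    by exists M => z; rewrite normr_id.
  - exact/Bb_kernel_integrable/Bb_cst.
rewrite Rintegral_cst// ler_wpM2l//; first exact: le_trans (HM point).
rewrite -lee_fin fineK ?ltW//.
by rewrite ge0_fin_numE//; exact: lt_le_trans (hr x) (leey _).
Qed.

Lemma generatorE f x : Bb f ->
  generator lam f x = \int[lam x]_z f z - f x * \int[lam x]_z cst 1 z.
Proof.
move=> Bf; rewrite /generator RintegralB//.
- by rewrite !Rintegral_cst// mul1r.
- exact: Bb_kernel_integrable.
- exact/Bb_kernel_integrable/Bb_cst.
Qed.

Variables (F : Type) (h : E -> F) (y : F).
Hypothesis mh : measurable (h @^-1` [set y]).

Lemma Bb_opA f : Bb f -> Bb (opA lam h y f).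
Proof.
move=> Bf.
have -> : opA lam h y f =
    ((fun x => \int[lam x]_z f z) \+
     \- (f \* (fun x => \int[lam x]_z cst 1 z))) \+
    \- (fun x => \int[lam x]_z (\1_(~` (h @^-1` [set y])) \* f) z).
  by apply/funext => x; rewrite /opA generatorE.
apply: BbD; last first.
  by apply/BbN/Bb_kernel_integral/BbM => //; exact/Bb_indic/measurableC.
apply: BbD; first exact: Bb_kernel_integral.
by apply/BbN/BbM => //; exact/Bb_kernel_integral/Bb_cst.
Qed.

Lemma opA_linear (a : R) f g x : Bb f -> Bb g ->
  opA lam h y (fun z => a * f z + g z) x =
  a * opA lam h y f x + opA lam h y g x.
Proof.
move=> Bf Bg.
have Baf : Bb (fun z => a * f z) by exact: (BbM (Bb_cst a)).
have Bi (k : E -> R) : Bb k -> Bb (fun z => \1_(~` (h @^-1` [set y])) z * k z).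
  by move=> Bk; exact: (BbM (Bb_indic (measurableC mh)) Bk).
have L (k l : E -> R) : Bb k -> Bb l -> \int[lam x]_z (a * k z + l z) =
    a * \int[lam x]_z k z + \int[lam x]_z l z.
  move=> Bk Bl; rewrite RintegralD ?RintegralZl//.
  - exact: Bb_kernel_integrable.
  - by apply: Bb_kernel_integrable; exact: (BbM (Bb_cst a)).
  - exact: Bb_kernel_integrable.
rewrite /opA !generatorE//; last exact: (BbD Baf Bg).
have -> : \int[lam x]_z (\1_(~` (h @^-1` [set y])) z * (a * f z + g z)) =
    \int[lam x]_z (a * (\1_(~` (h @^-1` [set y])) z * f z) +
                   \1_(~` (h @^-1` [set y])) z * g z).
  by apply: eq_Rintegral => z _; rewrite mulrDr mulrCA.
rewrite !L//; [|exact: Bi..].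
by ring.
Qed.

End Bb_opA.

Section image_law.
Context d d' (E : measurableType d) (F : measurableType d') (R : realType).
Variable h : {mfun E >-> F}.

Definition image_law (m : set E -> \bar R) : set F -> \bar R :=
  pushforward m h.

Section finite_measure.
Variable m : {finite_measure set E -> \bar R}.

Let il0 : image_law m set0 = 0%E. Proof. exact: measure0. Qed.

Let il_ge0 A : (0 <= image_law m A)%E. Proof. exact: measure_ge0. Qed.

Let il_sigma_additive : semi_sigma_additive (image_law m).
Proof.
rewrite /image_law; apply: measure_semi_sigma_additive.
exact: measurable_funPT.
Qed.

HB.instance Definition _ :=
  isMeasure.Build _ _ _ (image_law m) il0 il_ge0 il_sigma_additive.

Let il_fin : fin_num_fun (image_law m).
Proof.
by move=> A mA; apply: fin_num_measure; exact: measurable_funPTI.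
Qed.

HB.instance Definition _ := Measure_isFinite.Build _ _ _ (image_law m) il_fin.

End finite_measure.

Section charge.
Variable c : {charge set E -> \bar R}.

Definition image_charge : set F -> \bar R := pushforward c h.

Let ic0 : image_charge set0 = 0%E. Proof. exact: charge0. Qed.

Let ic_fin : fin_num_fun image_charge.
Proof.
move=> A mA; rewrite /image_charge /pushforward; apply: fin_num_measure; exact: measurable_funPTI.
Qed.

Let ic_sigma_additive : semi_sigma_additive image_charge.
Proof.
rewrite /image_charge; apply: charge_semi_sigma_additive.
exact: measurable_funPT.
Qed.

HB.instance Definition _ :=
  isCharge.Build _ _ _ image_charge ic0 ic_fin ic_sigma_additive.

End charge.
End image_law.

Section finite_measure_space.
Context d (E : measurableType d) (R : realType).

Definition finite_measures : Type := {finite_measure set E -> \bar R}.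

HB.instance Definition _ := gen_eqMixin finite_measures.
HB.instance Definition _ := gen_choiceMixin finite_measures.
HB.instance Definition _ := isPointed.Build finite_measures mzero.

Definition evaluation_preimages : set_system finite_measures :=
  [set S | exists (A : set E) (B : set (\bar R)),
    [/\ measurable A, measurable B & S = [set m : finite_measures | B (m A)]]].

(* M_+(E) with the sigma-algebra generated by the evaluations m |-> m(A). *)
Definition finite_measure_space := g_sigma_algebraType evaluation_preimages.

End finite_measure_space.
Arguments finite_measure_space {d} E R.

Section polish.
Local Open Scope charge_scope.
Context (R : realType) (I O : completeMetricType R).
Implicit Type h : {mfun borel I >-> borel O}.

Definition msupport (m : set (borel O) -> \bar R) : set O :=
  [set y | forall U : set O, open U -> U y -> (0 < m U)%E].

Lemma measurable_off_fiber h (y : O) :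
  measurable (~` (h @^-1` [set y]) : set (borel I)).
Proof.
apply: measurableC; rewrite -[X in measurable X]setTI.
apply: (measurable_funPT h) => //.
rewrite -[X in measurable X]setCK; apply: measurableC.
apply: sub_sigma_algebra; rewrite openC.
exact/accessible_closed_set1/hausdorff_accessible/metric_hausdorff.
Qed.

(* H nu y disintegrates nu along h. Each of the first two clauses determines
   H nu only up to a (nu o h^-1)-null set that may depend on nu; the last clause
   says that the versions for different nu are chosen jointly measurably, so
   that H can be evaluated at a random measure and a random point. It is
   restricted to y in supp (nu o h^-1): outside, H nu y is an arbitrary
   probability on the fibre h^-1(y), which in general cannot be chosen Borel
   measurably in y. *)
Definition disintegration_operator h
    (H : {finite_measure set (borel I) -> \bar R} -> O ->
         probability (borel I) R) : Prop :=
  [/\ forall (nu : {finite_measure set (borel I) -> \bar R})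
        (phi : borel I -> R) (iphi : nu.-integrable setT (EFin \o phi)),
        Bb phi ->
        {ae image_law h nu, forall y : borel O,
           ('d (image_charge h (induced_charge iphi)) '/d (image_law h nu)) y
           = (\int[H nu y]_x phi x)%:E},
      forall nu : {finite_measure set (borel I) -> \bar R},
        {ae image_law h nu, forall y : borel O,
          H nu y (h @^-1` [set y]) = 1%E},
      forall (nu : {finite_measure set (borel I) -> \bar R}) (y : O),
        ~ msupport (image_law h nu) y ->
        H nu y (h @^-1` [set y]) = 1%E &
      forall A : set (borel I), measurable A ->
        measurable_fun
          ([set p | msupport (image_law h (p.1 : finite_measures (borel I) R))
                      p.2] : set (finite_measure_space (borel I) R * borel O))
          (fun p => H p.1 p.2 A)].

(* 1_{h^-1(y)^c}(z) * int lam(x, dz) nu(dx) *)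
Definition jump_measure h (lam : R.-fker (borel I) ~> (borel I))
    (nu : probability (borel I) R) (y : O)
    : {finite_measure set (borel I) -> \bar R} :=
  mrestr (kernel_mixture lam nu) (measurable_off_fiber h y).

End polish.

(* Main.v *)
(* The almost sure identities are all obtained from defects whose integral over
   any event of a time cell is quadratic in the length of the cell, so that
   nothing remains after summing over the cells of a grid and refining it.

   Between jumps: the rate of X at its jump times and the memoryless property of
   the exponential law give, at a deterministic time s, the law of the first jump
   after s given the past, whence
     E[1_A 1_{no jump of Y in (s, s+r]} f(X_{s+r})]
       = E[1_A (f + r K f)(X_s)] + O(r^2 P(A)),
   where K f x = \int_{h z = h x} f(z) lam(x, dz) - lam(x) f(x), which is A_{h x} f
   at x. On the event that Y does not jump, the past of Y up to s + r coincides
   with its past up to s, so conditioning gives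
     pi_{s+r}(f) (1 + r pi_s(K 1)) = pi_s(f) + r pi_s(K f) + O(r^2).
   This holds at all rational times at once, hence at all times by
   right-continuity, and yields the differential equation.

   At jumps: let sigma be the first jump time of Y after s, and M the measure
   1_{h^-1(Y_s)^c}(z) \int lam(x, dz) pi_{sigma-}(dx). A quadratic increment
   estimate shows that, given the observation strictly before sigma, X_sigma has
   law M / M(1) on {sigma <= s + r}; conditioning moreover on Y_sigma turns M
   into its disintegration H. The filter at s + r differs from the filter at
   sigma by O(r), and the event that it misses the mean of phi under H by more
   than a fixed amount has probability O(r^2) on one cell. *)

Require Import Defs.
From HB Require Import structures.
From mathcomp Require Import all_boot all_order all_algebra.
From mathcomp Require Import all_classical all_reals all_analysis.
From mathcomp Require Import measurable_realfun ring lra.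

Set Implicit Arguments.
Unset Strict Implicit.
Unset Printing Implicit Defensive.

Import Order.TTheory GRing.Theory Num.Theory.
Import numFieldNormedType.Exports.

Local Open Scope classical_set_scope.
Local Open Scope ring_scope.

(** * Bounded Borel functions *)

(** The filter is given only as a conditional expectation at each deterministic time, while the
    equation must hold at random jump times and outside one null set for all times. Conditioning
    therefore takes place only at the ends of a cell, and regularity of the paths carries the result
    to the jump. No identity is divided by a random denominator. Bayes' formula is used multiplied
    out, and the law at a jump in the form [E[1_C (f(X_sigma) M(1) - M(f))] = 0], because [M(1)] has
    no positive lower bound. That [M(1) > 0] at every jump is a separate estimate ([small_prob]),
    and the size of [M(1)] is compared with the precision only once the path is fixed. The
    disintegration holds off a null set depending on the measure, so it cannot be evaluated directly
    at the random [M]: it is integrated first ([disint_mean_int]), then tested under the joint law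
    of [M] and [X_sigma] ([conditional_law]). The mesh condition [10 * (L * r) <= 1] keeps the
    conditional probability of no observed jump in a cell above one half; the other numerical
    constants only add up errors. *)

Section bounded_integral.
Context d (T : measurableType d) (R : realType).
Implicit Types (f g : T -> R) (m : {measure set T -> \bar R}).

Lemma Bb_add f g : Bb f -> Bb g -> Bb (fun x => f x + g x).
Proof. exact: BbD. Qed.

Lemma Bb_opp f : Bb f -> Bb (fun x => - f x).
Proof. exact: BbN. Qed.

Lemma Bb_sub f g : Bb f -> Bb g -> Bb (fun x => f x - g x).
Proof. by move=> bf bg; apply: BbD => //; exact: BbN. Qed.

Lemma Bb_mul f g : Bb f -> Bb g -> Bb (fun x => f x * g x).
Proof. exact: BbM. Qed.

Lemma Bb_const (a : R) : Bb (fun _ : T => a).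
Proof. exact: Bb_cst. Qed.

Lemma Bb_norm f : Bb f -> Bb (fun x => `|f x|).
Proof.
move=> /BbP[mf [M HM]]; apply/BbP; split; first exact: measurableT_comp.
by exists M => x; rewrite normr_id.
Qed.

Lemma Bb_sum n (F : nat -> T -> R) :
  (forall k, (k < n)%N -> Bb (F k)) -> Bb (fun x => \sum_(k < n) F k x).
Proof.
elim: n => [|n IH] H.
  by rewrite (_ : (fun x => _) = cst 0);
    [exact: Bb_cst|apply/funext => x; rewrite big_ord0].
rewrite (_ : (fun x => _) = fun x => \sum_(k < n) F k x + F n x); last first.
  by apply/funext => x; rewrite big_ord_recr.
by apply: Bb_add; [apply: IH => k kn; apply: H; exact: ltnW|exact: H].
Qed.

Lemma Bb_ind (A : set T) : measurable A -> Bb (fun x => \1_A x : R).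
Proof. exact: Bb_indic. Qed.

Lemma Bb_bool (p : T -> bool) : measurable [set x | p x] ->
  Bb (fun x => (p x)%:R : R).
Proof.
move=> mp; rewrite (_ : (fun x => _) = \1_[set x | p x]); first exact: Bb_indic.
apply/funext => x; rewrite indicE; congr (nat_of_bool _)%:R.
by apply/idP/idP; rewrite inE.
Qed.

Lemma Bb_le f (M : R) : measurable_fun setT f -> (forall x, `|f x| <= M) -> Bb f.
Proof. by move=> mf H; apply/BbP; split=> //; exists M. Qed.

Lemma Bb_meas f : Bb f -> measurable_fun setT f.
Proof. by case. Qed.

Lemma Bb_exists_bound f : Bb f -> exists2 M : R, 0 < M & forall x, `|f x| <= M.
Proof.
move=> /BbP[_ [M HM]]; exists (`|M| + 1).
  by rewrite (le_lt_trans (normr_ge0 M))// ltrDl.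
by move=> x; rewrite (le_trans (HM x))// (le_trans (ler_norm M))// lerDl.
Qed.

Variables (m : {measure set T -> \bar R}) (mT : (m setT < +oo)%E).

Lemma Bb_int f : Bb f -> m.-integrable setT (EFin \o f).
Proof. by move=> [mf bf]; exact: measurable_bounded_integrable. Qed.

Lemma intD f g : Bb f -> Bb g ->
  \int[m]_x (f x + g x) = \int[m]_x f x + \int[m]_x g x.
Proof. by move=> bf bg; rewrite RintegralD//; exact: Bb_int. Qed.

Lemma intB f g : Bb f -> Bb g ->
  \int[m]_x (f x - g x) = \int[m]_x f x - \int[m]_x g x.
Proof. by move=> bf bg; rewrite RintegralB//; exact: Bb_int. Qed.

Lemma intZ (a : R) f : Bb f -> \int[m]_x (a * f x) = a * \int[m]_x f x.
Proof. by move=> bf; rewrite RintegralZl//; exact: Bb_int. Qed.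

Lemma intN f : Bb f -> \int[m]_x (- f x) = - \int[m]_x f x.
Proof.
by move=> bf; under eq_Rintegral do rewrite -mulN1r; rewrite intZ// mulN1r.
Qed.

Lemma int_sum n (F : nat -> T -> R) : (forall k, (k < n)%N -> Bb (F k)) ->
  \int[m]_x (\sum_(k < n) F k x) = \sum_(k < n) \int[m]_x F k x.
Proof.
elim: n => [|n IH] H.
  rewrite big_ord0; under eq_Rintegral do rewrite big_ord0.
  by rewrite Rintegral_cst// mul0r.
under eq_Rintegral do rewrite big_ord_recr/=.
rewrite intD; [|by apply: Bb_sum => k kn; apply: H; exact: ltnW|exact: H].
by rewrite IH ?big_ord_recr// => k kn; apply: H; exact: ltnW.
Qed.

Lemma int_le f g : Bb f -> Bb g -> (forall x, f x <= g x) ->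
  \int[m]_x f x <= \int[m]_x g x.
Proof. by move=> bf bg fg; apply: le_Rintegral => //; exact: Bb_int. Qed.

Lemma int_ge0 f : (forall x, 0 <= f x) -> 0 <= \int[m]_x f x.
Proof. by move=> f0; exact: Rintegral_ge0. Qed.

Lemma int_norm f : Bb f -> `|\int[m]_x f x| <= \int[m]_x `|f x|.
Proof. by move=> bf; apply: le_normr_Rintegral => //; exact: Bb_int. Qed.

Lemma int_cst (a : R) : \int[m]_x a = a * fine (m setT).
Proof. by rewrite Rintegral_cst. Qed.

Lemma int_bound f (M : R) : Bb f -> (forall x, `|f x| <= M) ->
  `|\int[m]_x f x| <= M * fine (m setT).
Proof.
move=> bf fM; rewrite (le_trans (int_norm bf))// -int_cst.
by apply: int_le => //; [exact: Bb_norm|exact: Bb_cst].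
Qed.

Lemma int_norm_le f g : Bb f -> Bb g -> (forall x, `|f x| <= g x) ->
  `|\int[m]_x f x| <= \int[m]_x g x.
Proof.
by move=> bf bg fg; rewrite (le_trans (int_norm bf))//; apply: int_le => //;
  exact: Bb_norm.
Qed.

Lemma int_indic (A : set T) : measurable A -> \int[m]_x (\1_A x : R) = fine (m A).
Proof. by move=> mA; rewrite /Rintegral integral_indic// setIT. Qed.

Lemma int_setE (A : set T) f : measurable A ->
  \int[m]_(x in A) f x = \int[m]_x (\1_A x * f x).
Proof.
move=> mA; rewrite Rintegral_mkcond; apply: eq_Rintegral => x _.
by rewrite patchE indicE; case: ifPn => xA; rewrite ?mul1r ?mul0r.
Qed.

(** Dominated convergence with the constant [M], integrable because [m] is finite. Measurability and
    boundedness of [f] pass to the limit, so they are returned and not assumed. *)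
Lemma bounded_cvg_int (F : nat -> T -> R) f (M : R) :
  (forall n, measurable_fun setT (F n)) -> (forall n x, `|F n x| <= M) ->
  (forall x, F n x @[n --> \oo] --> f x) ->
  Bb f /\ \int[m]_x F n x @[n --> \oo] --> \int[m]_x f x.
Proof.
move=> mF FM Ff.
have mf : measurable_fun setT f.
  by apply: (measurable_fun_cvg mF) => x _; exact: Ff.
have fM x : `|f x| <= M.
  have Fa : `|F n x| @[n --> \oo] --> `|f x| by apply: cvg_norm; exact: Ff.
  by apply: (cvgr_to_le Fa); apply: nearW => n; exact: FM.
split; first exact: (Bb_le mf fM).
have iM : m.-integrable setT (EFin \o cst M) by apply: Bb_int; exact: Bb_cst.
have [||||+ _ H] := @dominated_convergence _ _ _ m setT measurableT
  (fun n x => (F n x)%:E) (EFin \o f) (EFin \o cst M) _ _ _ iM.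
- by move=> n; exact/measurable_EFinP.
- exact/measurable_EFinP.
- by apply: aeW => x _; apply: cvg_EFin; [exact: nearW|exact: Ff].
- by apply: aeW => x n _; rewrite /= lee_fin; exact: FM.
move=> fi; apply: fine_cvg; rewrite fineK; last exact: integrable_fin_num.
exact: H.
Qed.

End bounded_integral.

(** * Monotone classes *)

Section layers.
Context (R : realType).

(** For [0 <= f <= 1] this is [floor (N f) / N], written as an average of indicators of superlevel
    sets: a linear statement known for those sets passes to [f] with uniform error [1 / N]. *)
Definition layers (T : Type) (N : nat) (f : T -> R) (x : T) : R :=
  N%:R^-1 * \sum_(k < N) (k.+1%:R / N%:R <= f x)%R%:R.

Lemma layers_count (N : nat) (x : R) : 0 <= x <= N%:R ->
  x - 1 <= \sum_(k < N) ((k.+1)%:R <= x)%R%:R <= x.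
Proof.
elim: N => [|N IH] /andP[x0 xN].
  by rewrite big_ord0; move: x0 xN; rewrite mulr0n => *; apply/andP; split; lra.
rewrite big_ord_recr/=; have [xN'|xN'] := leP x N%:R.
  have -> : (N.+1%:R <= x) = false.
    by apply/negbTE; rewrite -ltNge (le_lt_trans xN')// ltr_nat.
  by rewrite addr0; apply: IH; rewrite x0 xN'.
have -> : \sum_(i < N) ((i.+1)%:R <= x)%R%:R = N%:R :> R.
  rewrite -[RHS](_ : \sum_(i < N) 1 = _); last first.
    by rewrite sumr_const card_ord.
  apply: eq_bigr => i _; have -> // : (i.+1%:R <= x).
  by rewrite (le_trans _ (ltW xN'))// ler_nat.
have {}xN : x <= N%:R + 1 by rewrite -natr1 in xN.
have [xN1|xN1] := leP N.+1%:R x.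
  rewrite -natr1 in xN1; apply/andP; rewrite mulr1n; split; lra.
by rewrite -natr1 in xN1; apply/andP; split; rewrite mulr0n; lra.
Qed.

Lemma layers_approx (T : Type) (N : nat) (f : T -> R) x : (0 < N)%N ->
  0 <= f x <= 1 -> `|layers N f x - f x| <= N%:R^-1.
Proof.
move=> N0 /andP[f0 f1]; have N0' : 0 < N%:R :> R by rewrite ltr0n.
have /andP[l1 l2] : N%:R * f x - 1 <=
    \sum_(k < N) ((k.+1)%:R <= N%:R * f x)%R%:R <= N%:R * f x.
  by apply: layers_count; rewrite mulr_ge0 ?ler0n//= -[leRHS]mulr1 ler_wpM2l.
have E : \sum_(k < N) ((k.+1)%:R <= N%:R * f x)%R%:R =
         \sum_(k < N) (k.+1%:R / N%:R <= f x)%R%:R :> R.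
  by apply: eq_bigr => k _; rewrite ler_pdivrMr// mulrC.
rewrite /layers -E -(ler_pM2l N0') -[X in X * `|_|]gtr0_norm// -normrM.
rewrite mulrBr mulrA divff ?gt_eqF// mul1r ler_norml; apply/andP; split; lra.
Qed.

End layers.

Section bounded_induction.
Context d (T : measurableType d) (R : realType).

Lemma Bb_layers N (f : T -> R) : measurable_fun setT f -> Bb (layers N f).
Proof.
move=> mf; apply: Bb_mul; first exact: Bb_const.
apply: (@Bb_sum _ _ _ N (fun k x => (k.+1%:R / N%:R <= f x)%R%:R)) => k _.
by apply: Bb_bool; rewrite -[X in measurable X]setTI;
  exact: (measurable_fun_ler (measurable_cst _) mf).
Qed.

(** An affine change brings [f] into [[0, 1]], where [layers] converges uniformly. Closure under
    uniform limits is then enough; it can be checked even for families of measures indexed by a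
    filter, where dominated convergence does not apply. *)
Lemma Bb_induction (Q : (T -> R) -> Prop) :
  (forall A, measurable A -> Q \1_A) ->
  (forall f g, Bb f -> Bb g -> Q f -> Q g -> Q (fun x => f x + g x)) ->
  (forall a f, Bb f -> Q f -> Q (fun x => a * f x)) ->
  (forall (F : nat -> T -> R) f, Bb f -> (forall n, Bb (F n)) ->
    (forall n, Q (F n)) ->
    (forall n x, `|F n x - f x| <= n.+1%:R^-1) -> Q f) ->
  forall f, Bb f -> Q f.
Proof.
move=> Q1 QD QZ Qlim f Bf; have [M M0 fM] := Bb_exists_bound Bf.
pose g x := (2 * M)^-1 * (f x + M).
have M2 : 0 < 2 * M by rewrite mulr_gt0.
have Bg : Bb g by apply: Bb_mul; [exact: Bb_const|apply: Bb_add => //; exact: Bb_const].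
have g01 x : 0 <= g x <= 1.
  have := fM x; rewrite ler_norml => /andP[f1 f2].
  by rewrite /g mulrC ler_pdivlMr// ler_pdivrMr// mul0r mul1r; lra.
have Qc a : Q (fun=> a).
  rewrite (_ : (fun=> a) = fun x => a * \1_setT x); last first.
    by apply/funext => x; rewrite indicE in_setT mulr1.
  by apply: QZ; [exact: Bb_ind|exact: Q1].
have Ql N : Q (layers N g).
  have BQ k : Bb (fun x => (k.+1%:R / N%:R <= g x)%R%:R : R) /\
              Q (fun x => (k.+1%:R / N%:R <= g x)%R%:R : R).
    have mk : measurable [set x | k.+1%:R / N%:R <= g x].
      rewrite -[X in measurable X]setTI.
      exact: (measurable_fun_ler (measurable_cst _) (Bb_meas Bg)).
    split; first exact: Bb_bool.
    rewrite (_ : (fun x => _) = \1_[set x | k.+1%:R / N%:R <= g x]); first exact: Q1.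
    apply/funext => x; rewrite indicE; congr (nat_of_bool _)%:R.
    by apply/idP/idP; rewrite inE.
  rewrite /layers; apply: QZ.
    by apply: (@Bb_sum _ _ _ N (fun k x => (k.+1%:R / N%:R <= g x)%R%:R)) => k _;
      apply: (BQ k).1.
  suff: forall n, Q (fun x => \sum_(k < n) (k.+1%:R / N%:R <= g x)%R%:R) by exact.
  elim=> [|n IH].
    by rewrite (_ : (fun x => _) = fun=> 0)//; apply/funext => x; rewrite big_ord0.
  rewrite (_ : (fun x => _) = fun x => \sum_(k < n) (k.+1%:R / N%:R <= g x)%R%:R +
      (n.+1%:R / N%:R <= g x)%R%:R); last first.
    by apply/funext => x; rewrite big_ord_recr.
  apply: QD (IH) (BQ n).2; last exact: (BQ n).1.
  by apply: (@Bb_sum _ _ _ n (fun k x => (k.+1%:R / N%:R <= g x)%R%:R)) => k _;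
    apply: (BQ k).1.
(* With [K.+1 * n.+1] levels, the factor [K.+1 >= 2 * M] absorbs the dilation by [2 * M] and leaves
   the error [n.+1%:R^-1]. *)
have [K HK] : exists K : nat, 2 * M <= K.+1%:R.
  exists (Num.truncn (2 * M)); exact/ltW/truncnS_gt.
pose F n x := 2 * M * layers (K.+1 * n.+1) g x + (- M).
apply: (Qlim F) => // [n|n|n x].
- apply: Bb_add; [|exact: Bb_const]; apply: Bb_mul; [exact: Bb_const|].
  exact/Bb_layers/Bb_meas.
- apply: QD => //; [|exact: Bb_const|].
    apply: Bb_mul; [exact: Bb_const|]; exact/Bb_layers/Bb_meas.
  by apply: QZ => //; exact/Bb_layers/Bb_meas.
have -> : F n x - f x = 2 * M * (layers (K.+1 * n.+1) g x - g x).
  by rewrite /F /g; field; rewrite gt_eqF.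
rewrite normrM gtr0_norm//.
apply: (@le_trans _ _ (K.+1%:R * (K.+1 * n.+1)%:R^-1)).
  by apply: ler_pM => //; [exact: ltW|exact: layers_approx].
by rewrite natrM invfM mulrA divff ?mul1r// pnatr_eq0.
Qed.

End bounded_induction.

(** * Adapted weights in place of indicators *)

Section weights.
Context d (T : measurableType d) (R : realType) (P : probability T R).
Implicit Types (F : set_system T) (U b : T -> R).

Let PT : (P setT < +oo)%E.
Proof. by rewrite probability_setT ltry. Qed.

(** The superlevel sets of [b] belong to [F], so [layers] of [b / c] is a nonnegative combination of
    indicators of [F]-sets; the remainder is at most [c / N] times the integral of [|U|]. *)
Lemma weight_le0 F U b (c : R) : (forall A, F A -> measurable A) ->
  Bb U -> (forall A, F A -> \int[P]_w (\1_A w * U w) <= 0) ->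
  (forall w, 0 <= b w <= c) -> (forall x, F [set w | x <= b w]) ->
  measurable_fun setT b ->
  \int[P]_w (b w * U w) <= 0.
Proof.
move=> FM BU FU bc Fb mb.
wlog c0 : c bc / 0 < c.
  move=> /(_ (`|c| + 1)); apply; last by rewrite ltr_wpDl.
  by move=> w; have /andP[-> bw] := bc w; rewrite (le_trans bw)// (le_trans (ler_norm _))// lerDl.
pose g w := c^-1 * b w.
have g01 w : 0 <= g w <= 1.
  have /andP[b0 b1] := bc w.
  by rewrite /g mulrC ler_pdivlMr// ler_pdivrMr// mul0r mul1r b0.
have mg : measurable_fun setT g by apply: measurable_funM => //; exact: measurable_cst.
have Bb_b : Bb b.
  by apply: (@Bb_le _ _ _ _ c) => // w; have /andP[? ?] := bc w; rewrite ger0_norm.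
have Bg : Bb g by apply: Bb_mul; [exact: Bb_const|exact: Bb_b].
have step N : (0 < N)%N ->
    \int[P]_w (b w * U w) <= c * N%:R^-1 * \int[P]_w `|U w|.
  move=> N0.
  have BlU : Bb (fun w => c * layers N g w * U w).
    by apply: Bb_mul => //; apply: Bb_mul; [exact: Bb_const|]; exact: Bb_layers.
  have L0 : \int[P]_w (c * layers N g w * U w) <= 0.
    pose G k w : R := \1_[set w | c * (k.+1%:R / N%:R) <= b w] w * U w.
    have mk k : measurable [set w | c * (k.+1%:R / N%:R) <= b w] by apply: FM.
    have BG k : Bb (G k) by apply: Bb_mul => //; exact: Bb_ind.
    under eq_Rintegral => w _.
      rewrite (_ : _ * U w = c * N%:R^-1 * \sum_(k < N) G k w); last first.
        rewrite /layers -!mulrA; congr (_ * (_ * _)).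
        rewrite mulr_suml; apply: eq_bigr => k _; congr (_ * _).
        rewrite indicE; congr (nat_of_bool _)%:R.
        rewrite /g [c^-1 * _]mulrC ler_pdivlMr// [_ * c]mulrC.
        by apply/idP/idP; rewrite inE.
      over.
    rewrite intZ//; last by apply: Bb_sum.
    rewrite int_sum//; apply: mulr_ge0_le0; first by rewrite mulr_ge0// ?invr_ge0 ltW.
    by apply: sumr_le0 => k _; exact: FU.
  have -> : \int[P]_w (b w * U w) =
     \int[P]_w (c * layers N g w * U w) +
     \int[P]_w ((b w - c * layers N g w) * U w).
    rewrite -intD//; last first.
      by apply: Bb_mul => //; apply: Bb_sub => //; apply: Bb_mul; [exact: Bb_const|];
        exact: Bb_layers.
    by apply: eq_Rintegral => w _; ring.
  apply: (@le_trans _ _ (0 + c * N%:R^-1 * \int[P]_w `|U w|)); last by rewrite add0r.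
  apply: lerD => //; rewrite -intZ//; last exact: Bb_norm.
  apply: int_le => //.
  - by apply: Bb_mul => //; apply: Bb_sub => //; apply: Bb_mul; [exact: Bb_const|];
      exact: Bb_layers.
  - by apply: Bb_mul; [exact: Bb_const|]; exact: Bb_norm.
  move=> w; apply: le_trans (ler_norm _) _; rewrite normrM; apply: ler_wpM2r => //.
  have -> : b w - c * layers N g w = - c * (layers N g w - g w).
    by rewrite /g; field; rewrite gt_eqF.
  rewrite normrM normrN (gtr0_norm c0) ler_pM2l//.
  exact: layers_approx.
(* If the integral [I] were positive, an [N] above [c * J / I] would contradict [step N]. *)
have [//|p0] := leP (\int[P]_w (b w * U w)) 0.
set I := \int[P]_w (b w * U w) in p0 step *.
set J := \int[P]_w `|U w| in step.
have J0 : 0 <= J by apply: int_ge0.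
set n := Num.truncn (c * J / I); have := step n.+1 isT.
have n0 : 0 < n.+1%:R :> R by rewrite ltr0n.
rewrite mulrAC ler_pdivlMr// leNgt => /negP[].
by have := truncnS_gt (c * J / I); rewrite ltr_pdivrMr// [X in _ < X -> _]mulrC.
Qed.


Lemma weight_eq0 F U b (c : R) : (forall A, F A -> measurable A) ->
  Bb U -> (forall A, F A -> \int[P]_w (\1_A w * U w) = 0) ->
  (forall w, 0 <= b w <= c) -> (forall x, F [set w | x <= b w]) ->
  measurable_fun setT b ->
  \int[P]_w (b w * U w) = 0.
Proof.
move=> FM BU FU bc Fb mb.
have Bb_b : Bb b.
  by apply: (@Bb_le _ _ _ _ c) => // w; have /andP[? ?] := bc w; rewrite ger0_norm.
apply/eqP; rewrite eq_le; apply/andP; split.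
  by apply: (@weight_le0 F U b c) => // A FA; rewrite FU.
rewrite -oppr_le0 -intN//; last exact: Bb_mul.
under eq_Rintegral do rewrite -mulrN.
apply: (@weight_le0 F (fun w => - U w) b c) => //; first exact: Bb_opp.
move=> A FA; under eq_Rintegral do rewrite mulrN.
by rewrite intN ?FU ?oppr0//; apply: Bb_mul => //; exact/Bb_ind/FM.
Qed.

(** [weight_le0] is applied to [U - k] and to [- U - k], the sign being [(-1) ^+ e]. *)
Lemma weight_approx F U b (c k : R) : (forall A, F A -> measurable A) ->
  Bb U ->
  (forall A, F A -> `|\int[P]_w (\1_A w * U w)| <= k * \int[P]_w \1_A w) ->
  (forall w, 0 <= b w <= c) -> (forall x, F [set w | x <= b w]) ->
  measurable_fun setT b ->
  `|\int[P]_w (b w * U w)| <= k * \int[P]_w b w.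
Proof.
move=> FM BU FU bc Fb mb.
have Bb_b : Bb b.
  by apply: (@Bb_le _ _ _ _ c) => // w; have /andP[? ?] := bc w; rewrite ger0_norm.
have key (e : bool) : (-1) ^+ e * \int[P]_w (b w * U w) <= k * \int[P]_w b w.
  have BeU : Bb (fun w => (-1) ^+ e * U w) by apply: Bb_mul => //; exact: Bb_const.
  have BbU : Bb (fun w => b w * U w) by exact: Bb_mul.
  have B1 : Bb (fun w => (-1) ^+ e * (b w * U w)) by exact/Bb_mul/BbU/Bb_const.
  have B2 : Bb (fun w => k * b w) by exact/Bb_mul/Bb_b/Bb_const.
  rewrite -subr_le0 -!intZ// -intB//.
  under eq_Rintegral => w _.
    rewrite (_ : _ - _ = b w * ((-1) ^+ e * U w - k)); last by ring.
    over.
  apply: (@weight_le0 F _ b c) => //; first by apply: Bb_sub => //; exact: Bb_const.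
  move=> A FA; have BA : Bb (fun w => \1_A w : R) by exact/Bb_ind/FM.
  under eq_Rintegral => w _.
    rewrite (_ : \1_A w * _ = (-1) ^+ e * (\1_A w * U w) - k * \1_A w); last by ring.
    over.
  have BAU : Bb (fun w => \1_A w * U w) by exact: Bb_mul.
  have B3 : Bb (fun w => (-1) ^+ e * (\1_A w * U w)) by exact/Bb_mul/BAU/Bb_const.
  have B4 : Bb (fun w => k * \1_A w) by exact/Bb_mul/BA/Bb_const.
  rewrite intB// !intZ//.
  rewrite subr_le0 (le_trans _ (FU _ FA))//.
  by rewrite (le_trans (ler_norm _))// normrM normrX normrN1 expr1n mul1r.
rewrite ler_norml; have := key true; have := key false.
by rewrite expr0 expr1 mul1r mulN1r => ? ?; apply/andP; split; lra.
Qed.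

End weights.

Section pi_lambda.

Lemma pi_lambda d (T : measurableType d) (G Q : set_system T) :
  setI_closed G -> Q setT -> G `<=` Q ->
  (forall A, <<s G >> A -> Q A -> Q (~` A)) ->
  (forall F : (set T)^nat, (forall n, <<s G >> (F n)) -> trivIset setT F ->
     (forall n, Q (F n)) -> Q (\bigcup_n F n)) ->
  forall A, <<s G >> A -> Q A.
Proof.
move=> GI QT GQ QC QU A.
exact: (@dynkin_induction _ (g_sigma_algebraType G) G Q).
Qed.

Lemma indic_bigcup_cvg (T : Type) (R : realType) (F : (set T)^nat) x :
  \1_(\bigcup_(k < n) F k) x @[n --> \oo] --> (\1_(\bigcup_k F k) x : R).
Proof.
rewrite [X in _ --> X]indicE; have [|] := boolP (x \in _).
  rewrite inE => -[k _ Fkx]; apply: cvg_near_cst; near=> n.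
  rewrite indicE mem_set//; exists k => //=; near: n; exact: nbhs_infty_gt.
rewrite notin_setE => nF; apply: cvg_near_cst; apply: nearW => n.
rewrite indicE memNset// => -[k _ Fkx]; apply: nF; exists k => //.
Unshelve. all: by end_near. Qed.

Lemma indic_bigcupS (T : Type) (R : realType) (F : (set T)^nat) n x :
  trivIset setT F ->
  \1_(\bigcup_(k < n.+1) F k) x =
  \1_(\bigcup_(k < n) F k) x + \1_(F n) x :> R.
Proof.
move=> tF; rewrite !indicE; have [Fnx|Fnx] := boolP (x \in F n).
  rewrite mem_set; last by exists n => //=; exact: set_mem.
  rewrite memNset ?add0r// => -[k /= kn Fkx].
  have := tF k n I I (ex_intro _ x (conj Fkx (set_mem Fnx))) => kn'.
  by rewrite kn' ltnn in kn.
rewrite addr0; congr (nat_of_bool _)%:R; apply/idP/idP; rewrite !inE.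
  move=> -[k /=]; rewrite ltnS leq_eqVlt => /predU1P[->|kn] Fkx.
    by move: Fnx; rewrite mem_set.
  by exists k.
by move=> -[k /= kn Fkx]; exists k => //=; exact: ltnW.
Qed.

Section disjoint_sums.
Context d (T : measurableType d) (R : realType)
  (m : {measure set T -> \bar R}) (mT : (m setT < +oo)%E).

Lemma int_le0_bigcup (F : (set T)^nat) (U : T -> R) : Bb U ->
  (forall n, measurable (F n)) -> trivIset setT F ->
  (forall n, \int[m]_x (\1_(F n) x * U x) <= 0) ->
  \int[m]_x (\1_(\bigcup_n F n) x * U x) <= 0.
Proof.
move=> BU mF tF QF.
have Q n : \int[m]_x (\1_(\bigcup_(k < n) F k) x * U x) <= 0.
  elim: n => [|n IH].
    by under eq_Rintegral do rewrite bigcup_mkord big_ord0 indic0 mul0r;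
      rewrite int_cst// mul0r.
  under eq_Rintegral do rewrite (indic_bigcupS _ _ _ tF) mulrDl.
  have mU : measurable (\bigcup_(k < n) F k) by exact: bigcup_measurable.
  rewrite intD//; [|exact: Bb_mul (Bb_ind _ mU) BU|exact: Bb_mul (Bb_ind _ _) BU].
  by rewrite -[leRHS]addr0 lerD.
have [M M0 UM] := Bb_exists_bound BU.
have [|||_ H] := @bounded_cvg_int _ _ _ m mT
  (fun n x => \1_(\bigcup_(k < n) F k) x * U x)
  (fun x => \1_(\bigcup_k F k) x * U x) M.
- move=> n; apply: Bb_meas; apply: Bb_mul => //; apply: Bb_ind.
  exact: bigcup_measurable.
- move=> n x; rewrite normrM (le_trans _ (UM x))//.
  by rewrite ler_piMl// indicE; case: (_ \in _); rewrite ?normr1 ?normr0.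
- by move=> x; apply: cvgM; [exact: indic_bigcup_cvg|exact: cvg_cst].
by apply: (cvgr_to_le H); exact: nearW.
Qed.

Lemma int_eq0_bigcup (F : (set T)^nat) (U : T -> R) : Bb U ->
  (forall n, measurable (F n)) -> trivIset setT F ->
  (forall n, \int[m]_x (\1_(F n) x * U x) = 0) ->
  \int[m]_x (\1_(\bigcup_n F n) x * U x) = 0.
Proof.
move=> BU mF tF QF; apply/eqP; rewrite eq_le; apply/andP; split.
  by apply: int_le0_bigcup => // n; rewrite QF.
have mU : measurable (\bigcup_n F n) by exact: bigcupT_measurable.
rewrite -oppr_le0 -intN//; last exact: Bb_mul (Bb_ind _ mU) BU.
under eq_Rintegral do rewrite -mulrN.
apply: int_le0_bigcup => //; first exact: Bb_opp.
move=> n; under eq_Rintegral do rewrite mulrN.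
by rewrite intN ?QF ?oppr0//; exact: Bb_mul (Bb_ind _ (mF n)) BU.
Qed.

Lemma int_eq0_generated (G : set_system T) (U : T -> R) :
  setI_closed G -> (forall A, <<s G >> A -> measurable A) -> Bb U ->
  \int[m]_x U x = 0 -> (forall A, G A -> \int[m]_x (\1_A x * U x) = 0) ->
  forall A, <<s G >> A -> \int[m]_x (\1_A x * U x) = 0.
Proof.
move=> GI GM BU U0 GU; apply: pi_lambda => //.
- by under eq_Rintegral do rewrite indicE in_setT mul1r.
- move=> A GA QA.
  under eq_Rintegral => x _.
    rewrite (_ : _ * _ = U x - \1_A x * U x); last first.
      by rewrite !indicE in_setC; case: (x \in A) => /=; ring.
    over.
  rewrite intB ?U0 ?QA ?subr0//; apply: Bb_mul => //; exact/Bb_ind/GM.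
- by move=> F GF tF QF; apply: int_eq0_bigcup => // n; exact: GM.
Qed.

End disjoint_sums.

End pi_lambda.

(** * Conditional laws *)

Section real_convergence.
Context (R : realType) (S : Type) (F : set_system S) (FF : Filter F).

Lemma cvgR_distP (f : S -> R) (l : R) :
  (forall e : R, 0 < e -> \forall s \near F, `|f s - l| <= e) -> f @ F --> l.
Proof.
move=> H; apply/cvgrPdist_le => e e0; have := H e e0; apply: filterS => s.
by rewrite distrC.
Qed.

Lemma cvgR_dist (f : S -> R) (l : R) : f @ F --> l ->
  forall e : R, 0 < e -> \forall s \near F, `|f s - l| <= e.
Proof.
move=> /cvgrPdist_le H e e0; have := H e e0; apply: filterS => s.
by rewrite distrC.
Qed.

End real_convergence.

Lemma small_invS (R : realType) (e : R) : 0 < e -> exists n, n.+1%:R^-1 <= e.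
Proof.
move=> e0; exists (Num.truncn e^-1); rewrite invf_ple ?posrE//.
exact/ltW/truncnS_gt.
Qed.

Lemma dist3_le (R : realType) (a b c d n e : R) : `|a - b| <= n ->
  `|c - d| <= n -> `|a - c| <= e / 3 -> n <= e / 3 -> `|b - d| <= e.
Proof.
rewrite !ler_norml => /andP[? ?] /andP[? ?] /andP[? ?] ?.
by apply/andP; split; lra.
Qed.

Section setwise_convergence.
Context d (T : measurableType d) (R : realType).

Lemma int_close (m : {measure set T -> \bar R}) (mT : (m setT < +oo)%E)
    (f g : T -> R) (e : R) : Bb f -> Bb g -> (forall x, `|f x - g x| <= e) ->
  `|\int[m]_x f x - \int[m]_x g x| <= e * fine (m setT).
Proof.
move=> Bf Bg fg; rewrite -intB//; apply: int_bound => //; exact: Bb_sub.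
Qed.

Lemma probabilityT_lty (m : probability T R) : (m setT < +oo)%E.
Proof. by rewrite probability_setT ltry. Qed.

Lemma int_close_prob (m : probability T R) (f g : T -> R) (e : R) :
  Bb f -> Bb g -> (forall x, `|f x - g x| <= e) ->
  `|\int[m]_x f x - \int[m]_x g x| <= e.
Proof.
move=> Bf Bg fg; rewrite (le_trans (int_close (probabilityT_lty m) Bf Bg fg))//.
by rewrite (congr1 fine (probability_setT m) : fine (m setT) = 1) mulr1.
Qed.

(** A uniform approximation costs at most its precision under every probability of the family, so
    [F] may be any proper filter, such as the one-sided neighbourhoods of a time. *)
Lemma setwise_cvg_int (S : Type) (F : set_system S) (FF : ProperFilter F)
    (nu : S -> probability T R) (nu0 : probability T R) :
  (forall A, measurable A -> nu s A @[s --> F] --> nu0 A) ->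
  forall f, Bb f -> \int[nu s]_x f x @[s --> F] --> \int[nu0]_x f x.
Proof.
move=> nuA; apply: Bb_induction.
- move=> A mA; rewrite int_indic//; under eq_fun do rewrite int_indic//.
  apply: fine_cvg; rewrite fineK ?fin_num_measure//; exact: nuA.
- move=> f g Bf Bg cf cg; rewrite intD ?probabilityT_lty//.
  by under eq_fun do rewrite intD ?probabilityT_lty//; exact: cvgD.
- move=> a f Bf cf; rewrite intZ ?probabilityT_lty//.
  under eq_fun do rewrite intZ ?probabilityT_lty//.
  by apply: cvgM => //; exact: cvg_cst.
- move=> G f Bf BG cG Gf; apply: cvgR_distP => e e0.
  have [|n ne] := @small_invS R (e / 3); first by rewrite divr_gt0.
  have H : \forall s \near F, `|\int[nu s]_x G n x - \int[nu0]_x G n x| <= e / 3.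
    by apply: cvgR_dist (cG n) _ _; rewrite divr_gt0.
  near=> s; have H1 : `|\int[nu s]_x G n x - \int[nu s]_x f x| <= n.+1%:R^-1.
    exact: int_close_prob (BG n) Bf (Gf n).
  have H2 : `|\int[nu0]_x G n x - \int[nu0]_x f x| <= n.+1%:R^-1.
    exact: int_close_prob (BG n) Bf (Gf n).
  have H3 : `|\int[nu s]_x G n x - \int[nu0]_x G n x| <= e / 3 by near: s.
  exact: dist3_le H1 H2 H3 ne.
Unshelve. all: by end_near. Qed.

End setwise_convergence.

Section conditional_law.
Context d1 d2 d3 (Om : measurableType d1) (E : measurableType d2)
  (E' : measurableType d3) (R : realType) (P : probability Om R).
Variables (Z : Om -> E) (V : Om -> E') (kap : Om -> {measure set E' -> \bar R})
  (a a' : Om -> R) (c : R).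
Hypothesis mZ : measurable_fun setT Z.
Hypothesis mV : measurable_fun setT V.
Hypothesis kapT : forall w, (kap w setT <= c%:E)%E.
Hypothesis mkap : forall B, measurable B ->
  measurable_fun setT (fun w => kap w B).
Hypothesis Ba : Bb a.
Hypothesis Ba' : Bb a'.
Hypothesis rect : forall A B, measurable A -> measurable B ->
  \int[P]_w (a w * (\1_A (Z w) * \1_B (V w))) =
  \int[P]_w (a' w * (\1_A (Z w) * fine (kap w B))).

Let kapfin w : (kap w setT < +oo)%E.
Proof. by rewrite (le_lt_trans (kapT w))// ltry. Qed.

Let kap_le w B : measurable B -> fine (kap w B) <= c.
Proof.
move=> mB; rewrite -lee_fin fineK; last first.
  by rewrite ge0_fin_numE// (le_lt_trans _ (kapfin w))// le_measure// inE.
by rewrite (le_trans _ (kapT w))// le_measure// inE.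
Qed.

Let c0 : 0 <= c.
Proof.
have w := point : Om; rewrite -lee_fin (le_trans _ (kapT w))//.
Qed.

Let Bpair g : Bb g -> Bb (fun w => g (Z w, V w) : R).
Proof.
move=> /BbP[mg [M gM]]; apply/BbP; split; last by exists M => w.
by apply: (measurableT_comp mg); exact: measurable_fun_pair.
Qed.

Let Bsec (g : E * E' -> R) x : Bb g -> Bb (fun z => g (x, z)).
Proof.
move=> /BbP[mg [M gM]]; apply/BbP; split; last by exists M => w.
by apply: (measurableT_comp mg); exact: measurable_pair1.
Qed.

(** Measurability of the inner integral is carried through the induction, because each closure step
    integrates it against [a']. *)
Let Q (g : E * E' -> R) := measurable_fun setT (fun w => \int[kap w]_z g (Z w, z)) /\
  \int[P]_w (a w * g (Z w, V w)) = \int[P]_w (a' w * \int[kap w]_z g (Z w, z)).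

Let int_kap_bound g M w : Bb g -> (forall x, `|g x| <= M) ->
  `|\int[kap w]_z g (Z w, z)| <= M * c.
Proof.
move=> Bg gM.
rewrite (le_trans (int_bound (kapfin w) (Bsec _ Bg) (fun z => gM _)))//.
by apply: ler_wpM2l; [exact: le_trans (gM point)|exact: kap_le].
Qed.

Let Bint g : Bb g -> measurable_fun setT (fun w => \int[kap w]_z g (Z w, z)) ->
  Bb (fun w => \int[kap w]_z g (Z w, z)).
Proof.
move=> Bg mg; have [M M0 gM] := Bb_exists_bound Bg.
by apply: (@Bb_le _ _ _ _ (M * c)) => // w; exact: int_kap_bound.
Qed.

Let QD g1 g2 : Bb g1 -> Bb g2 -> Q g1 -> Q g2 -> Q (fun x => g1 x + g2 x).
Proof.
move=> B1 B2 [m1 e1] [m2 e2].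
have E0 w : \int[kap w]_z (g1 (Z w, z) + g2 (Z w, z)) =
   \int[kap w]_z g1 (Z w, z) + \int[kap w]_z g2 (Z w, z).
  by rewrite intD//; exact: Bsec.
split; first by under eq_fun do rewrite E0; exact: measurable_funD.
under eq_Rintegral do rewrite mulrDr.
under [RHS]eq_Rintegral do rewrite E0 mulrDr.
rewrite !intD ?probabilityT_lty ?e1 ?e2//; apply: Bb_mul => //;
  do ?[exact: Bpair|exact: Bint].
Qed.

Let QZ b g : Bb g -> Q g -> Q (fun x => b * g x).
Proof.
move=> Bg [mg eg].
have E0 w : \int[kap w]_z (b * g (Z w, z)) = b * \int[kap w]_z g (Z w, z).
  by rewrite intZ//; exact: Bsec.
split.
  by under eq_fun do rewrite E0; apply: measurable_funM => //; exact: measurable_cst.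
under eq_Rintegral do rewrite mulrCA.
under [RHS]eq_Rintegral do rewrite E0 mulrCA.
rewrite !intZ ?probabilityT_lty ?eg//; apply: Bb_mul => //;
  do ?[exact: Bpair|exact: Bint].
Qed.

Let Qlim (F : nat -> E * E' -> R) (g : E * E' -> R) (M : R) : (forall n, Bb (F n)) -> Bb g ->
  (forall n x, `|F n x| <= M) -> (forall x, F n x @[n --> \oo] --> g x) ->
  (forall n, Q (F n)) -> Q g.
Proof.
move=> BF Bg FM Fg QF.
have lim w : \int[kap w]_z F n (Z w, z) @[n --> \oo] -->
    \int[kap w]_z g (Z w, z).
  apply: (@bounded_cvg_int _ _ _ (kap w) (kapfin w)
    (fun n z => F n (Z w, z)) (fun z => g (Z w, z)) M _ _ _).2 => //.
  by move=> n; apply/Bb_meas/Bsec.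
have mlim : measurable_fun setT (fun w => \int[kap w]_z g (Z w, z)).
  apply: (@measurable_fun_cvg _ _ _ _
    (fun n w => \int[kap w]_z F n (Z w, z))) => // n.
  exact: (QF n).1.
split=> //.
have [A A0 aA] := Bb_exists_bound Ba; have [A' A'0 aA'] := Bb_exists_bound Ba'.
have l1 : \int[P]_w (a w * F n (Z w, V w)) @[n --> \oo] -->
    \int[P]_w (a w * g (Z w, V w)).
  apply: (@bounded_cvg_int _ _ _ P (probabilityT_lty P)
    (fun n w => a w * F n (Z w, V w)) (fun w => a w * g (Z w, V w)) (A * M) _ _ _).2.
  - by move=> n; apply/Bb_meas/Bb_mul => //; exact: Bpair.
  - by move=> n x; rewrite normrM ler_pM.
  - by move=> w; apply: cvgM => //; exact: cvg_cst.
have l2 : \int[P]_w (a' w * \int[kap w]_z F n (Z w, z)) @[n --> \oo] -->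
    \int[P]_w (a' w * \int[kap w]_z g (Z w, z)).
  apply: (@bounded_cvg_int _ _ _ P (probabilityT_lty P)
    (fun n w => a' w * \int[kap w]_z F n (Z w, z))
    (fun w => a' w * \int[kap w]_z g (Z w, z)) (A' * (M * c)) _ _ _).2.
  - by move=> n; apply/Bb_meas/Bb_mul => //; exact: (Bint (BF n) (QF n).1).
  - move=> n w; rewrite normrM ler_pM//; exact: int_kap_bound.
  - by move=> w; apply: cvgM => //; exact: cvg_cst.
apply: (cvg_unique (@Rhausdorff R) l1).
rewrite (_ : (fun n => _) = fun n => \int[P]_w (a' w * \int[kap w]_z F n (Z w, z)))//.
by apply/funext => n; exact: (QF n).2.
Qed.

Let Qrect A B : measurable A -> measurable B -> Q \1_(A `*` B).
Proof.
move=> mA mB.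
have E1 x y : \1_(A `*` B) (x, y) = \1_A x * \1_B y :> R.
  by rewrite !indicE in_setX/=; case: (_ \in A); case: (_ \in B);
    rewrite ?mulr1 ?mulr0.
have E2 w : \int[kap w]_z \1_(A `*` B) (Z w, z) =
    \1_A (Z w) * fine (kap w B) :> R.
  under eq_Rintegral do rewrite E1.
  by rewrite intZ ?int_indic//; exact: Bb_ind.
split.
  under eq_fun do rewrite E2; apply: measurable_funM.
    by apply: (@measurableT_comp _ _ _ _ _ _ (\1_A : E -> R)) => //; exact: measurable_indic.
  exact: measurableT_comp (fine_measurable measurableT) (mkap mB).
under eq_Rintegral do rewrite E1.
by under [RHS]eq_Rintegral do rewrite E2; exact: rect.
Qed.

Let Qset C : measurable C -> Q \1_C.
Proof.
have QT : Q \1_setT by rewrite -setXTT; exact: Qrect.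
rewrite measurable_prod_measurableType => mC.
apply: (@pi_lambda _ _ _ (fun C => Q \1_C) _ _ _ _ _ _ mC).
- move=> _ _ [A1 mA1 [B1 mB1 <-]] [A2 mA2 [B2 mB2 <-]].
  by rewrite -setXI; exists (A1 `&` A2); [exact: measurableI|];
    exists (B1 `&` B2); [exact: measurableI|].
- exact: QT.
- by move=> _ [A mA [B mB <-]]; exact: Qrect.
- move=> A mA QA.
  rewrite (_ : \1__ = (fun x => 1 * \1_setT x + (-1) * \1_A x)); last first.
    apply/funext => x; rewrite !indicE in_setC in_setT.
    by case: (x \in A) => /=; ring.
  have mA' : measurable A by rewrite measurable_prod_measurableType.
  have BT : Bb (fun x : E * E' => 1 * \1_setT x : R).
    by apply: Bb_mul; [exact: Bb_const|exact: Bb_ind].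
  have BA : Bb (fun x : E * E' => (-1) * \1_A x : R).
    by apply: Bb_mul; [exact: Bb_const|exact: Bb_ind].
  exact: QD BT BA (QZ 1 (Bb_ind _ measurableT) QT) (QZ (-1) (Bb_ind _ mA') QA).
- move=> F mF tF QF.
  have {}mF n : measurable (F n) by rewrite measurable_prod_measurableType.
  have mU n : measurable (\bigcup_(k < n) F k) by exact: bigcup_measurable.
  apply: (@Qlim (fun n => \1_(\bigcup_(k < n) F k)) _ 1).
  + by move=> n; exact: Bb_ind.
  + by apply: Bb_ind; exact: bigcupT_measurable.
  + by move=> n x; rewrite indicE; case: (_ \in _); rewrite ?normr1 ?normr0.
  + by move=> x; exact: indic_bigcup_cvg.
  + elim=> [|n IH].
      rewrite bigcup_mkord big_ord0 (_ : \1__ = fun x => 0 * \1_setT x).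
        by apply: QZ => //; exact: Bb_ind.
      by apply/funext => x; rewrite indic0 mul0r.
    rewrite (_ : \1__ = fun x => \1_(\bigcup_(k < n) F k) x + \1_(F n) x).
      exact: QD (Bb_ind _ (mU n)) (Bb_ind _ (mF n)) IH (QF n).
    by apply/funext => x; exact: indic_bigcupS.
Qed.

(** Under the weight [a], [kap] is an unnormalised conditional law of [V] given [Z]; [a'] is the
    weight left after conditioning. Rectangles give sets by a pi-lambda argument, sets give
    functions by [Bb_induction]. The kernel is indexed by [w], which lets the random jump measure
    serve both as [Z] and as [kap]. *)
Lemma conditional_law g : Bb g ->
  Bb (fun w => \int[kap w]_z g (Z w, z)) /\
  \int[P]_w (a w * g (Z w, V w)) = \int[P]_w (a' w * \int[kap w]_z g (Z w, z)).
Proof.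
move=> Bg; suff [mg e] : Q g by split=> //; exact: Bint.
apply: (@Bb_induction _ _ _ Q Qset QD QZ) Bg.
move=> F f Bf BF QF Ff; have [M M0 fM] := Bb_exists_bound Bf.
apply: (@Qlim F f (M + 1) BF Bf _ _ QF).
- move=> n x; rewrite -(subrK (f x) (F n x)) (le_trans (ler_normD _ _))//.
  rewrite addrC lerD// (le_trans (Ff n x))// invf_le1 ?ltr0n//.
  by rewrite ler1n.
- move=> x; apply: cvgR_distP => e e0; near=> n.
  rewrite (le_trans (Ff n x))// ltW//; near: n.
  exact: (near_infty_natSinv_lt (PosNum e0)).
Unshelve. all: by end_near. Qed.

End conditional_law.

(** * Jump times of a path *)

Section one_sided_neighbourhoods.
Context (R : realType).

Lemma near_rightP (s : R) (Q : set R) : (\forall r \near s^'+, Q r) <->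
  exists2 e : R, 0 < e & forall r, s < r < s + e -> Q r.
Proof.
split.
  move=> /nbhs_ballP[e /= e0 He]; exists e => // r /andP[sr re].
  by apply: He => //=; rewrite /ball/= ltr0_norm ?subr_lt0//; lra.
move=> [e e0 He]; apply/nbhs_ballP; exists e => //= r; rewrite /ball/= => re sr.
by apply: He; rewrite sr; move: re; rewrite ltr0_norm ?subr_lt0//; lra.
Qed.

Lemma near_leftP (s : R) (Q : set R) : (\forall r \near s^'-, Q r) <->
  exists2 e : R, 0 < e & forall r, s - e < r < s -> Q r.
Proof.
split.
  move=> /nbhs_ballP[e /= e0 He]; exists e => // r /andP[sr re].
  by apply: He => //=; rewrite /ball/= gtr0_norm ?subr_gt0//; lra.
move=> [e e0 He]; apply/nbhs_ballP; exists e => //= r; rewrite /ball/= => re sr.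
by apply: He; rewrite sr andbT; move: re; rewrite gtr0_norm ?subr_gt0//; lra.
Qed.

Lemma rat_between (a b : R) : a < b -> exists q : rat, a < ratr q < b.
Proof.
by move=> /rat_in_itvoo[q]; rewrite in_itv/= => ?; exists q.
Qed.

End one_sided_neighbourhoods.

Section jump_paths.
Context (R : realType) (T : Type).
Implicit Types (x : R -> T) (s t u : R).

Definition first_jump x s : \bar R :=
  ereal_inf [set t%:E | t in [set t | s < t /\ x t <> x s]].

Variable x : R -> T.
Hypothesis xJ : pure_jump_path x.

Lemma path_right s : 0 <= s -> exists2 e : R, 0 < e & forall r, s <= r < s + e -> x r = x s.
Proof.
move=> s0; have [/near_rightP[e e0 He] _] := xJ s0; exists e => // r.
by rewrite le_eqVlt => /andP[/predU1P[->//|sr] re]; apply: He; rewrite sr.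
Qed.

Lemma path_left s : 0 < s ->
  exists2 e : R, 0 < e & exists a, forall r, s - e < r < s -> x r = a.
Proof.
move=> s0; have [_ /(_ s0)[a /near_leftP[e e0 He]]] := xJ (ltW s0).
by exists e => //; exists a.
Qed.

Lemma first_jump_const s t : s <= t -> (t%:E < first_jump x s)%E -> x t = x s.
Proof.
rewrite le_eqVlt => /predU1P[->//|st] tf; apply: contrapT => xts.
by move: tf; rewrite ltNge => /negP; apply; apply: ereal_inf_lbound; exists t.
Qed.

Lemma first_jump_gt s : 0 <= s -> (s%:E < first_jump x s)%E.
Proof.
move=> s0; have [e e0 He] := path_right s0.
apply: (@lt_le_trans _ _ (s + e)%:E); first by rewrite lte_fin ltrDl.
apply: le_ereal_inf_tmp => _ [t [st xts] <-]; rewrite lee_fin leNgt; apply/negP => te.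
by apply: xts; apply: He; rewrite (ltW st).
Qed.

(** The infimum is attained: if the path had the value [x s] at [u], right-continuity would prolong
    its constancy beyond [u]. *)
Lemma first_jump_neq s u : 0 <= s -> first_jump x s = u%:E -> x u <> x s.
Proof.
move=> s0 fu xus; have su : s < u by rewrite -lte_fin -fu first_jump_gt.
have [e e0 He] := path_right (le_trans s0 (ltW su)).
suff : ((u + e)%:E <= u%:E)%E by rewrite lee_fin gerDl leNgt e0.
rewrite -[leRHS]fu; apply: le_ereal_inf_tmp => _ [t [st xts] <-].
rewrite lee_fin leNgt; apply/negP => te; apply: xts.
have [tu|ut] := ltP t u; last by rewrite He ?ut.
by apply: first_jump_const; [exact: ltW|rewrite fu lte_fin].
Qed.

Lemma first_jump_cases s : 0 <= s ->
  first_jump x s = +oo%E \/ exists2 u : R, s < u & first_jump x s = u%:E.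
Proof.
move=> s0; have := first_jump_gt s0; case: (first_jump x s) => [u| |] //.
  by rewrite lte_fin => su; right; exists u.
by left.
Qed.

Lemma first_jump_leP s t : 0 <= s ->
  (first_jump x s <= t%:E)%E <-> exists2 r, s < r <= t & x r <> x s.
Proof.
move=> s0; split; last first.
  move=> [r /andP[sr rt] xr]; apply: (@le_trans _ _ r%:E); last by rewrite lee_fin.
  by apply: ereal_inf_lbound; exists r.
have [->|[u su fu]] := first_jump_cases s0; first by rewrite leye_eq.
rewrite fu lee_fin => ut; exists u; first by rewrite su.
exact: first_jump_neq fu.
Qed.

(* Right-continuity lets a witness at r < t be moved to a rational. *)
Lemma first_jump_le_rat s t : 0 <= s -> (first_jump x s <= t%:E)%E <->
  (s < t /\ x t <> x s) \/
  exists q : rat, s < ratr q < t /\ x (ratr q) <> x s.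
Proof.
move=> s0; split.
  move=> /(first_jump_leP _ s0)[r /andP[sr]].
  rewrite le_eqVlt => /predU1P[<- xr|rt xr]; first by left.
  have [e e0 He] := path_right (le_trans s0 (ltW sr)).
  have [|q /andP[rq qe]] := @rat_between _ r (Num.min t (r + e)).
    by rewrite lt_min rt ltrDl.
  move: qe; rewrite lt_min => /andP[qt qe]; right; exists q; split.
    by rewrite qt (lt_trans sr).
  by rewrite He// qe ltW.
move=> [[st xt]|[q [/andP[sq qt] xq]]]; apply/(first_jump_leP _ s0).
  by exists t; rewrite ?st/=.
by exists (ratr q) => //; rewrite sq ltW.
Qed.

Lemma first_jump_id s t : s <= t -> (t%:E < first_jump x s)%E ->
  first_jump x t = first_jump x s.
Proof.
move=> st tf; have xts := first_jump_const st tf.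
apply/eqP; rewrite eq_le; apply/andP; split; apply: le_ereal_inf_tmp => _ [r [tr xr] <-].
  apply: ereal_inf_lbound; exists r => //; split; last by rewrite xts.
  rewrite ltNge; apply/negP => rt; apply: xr.
  by apply: first_jump_const; [exact: ltW|rewrite (le_lt_trans _ tf)// lee_fin].
apply: ereal_inf_lbound; exists r => //; split; first exact: le_lt_trans tr.
by rewrite -xts.
Qed.

Local Notation Tn := (jump_time x).

Lemma jump_timeS n s : Tn n = s%:E -> Tn n.+1 = first_jump x s.
Proof.
move=> E; rewrite /= E /first_jump; under eq_set do rewrite lte_fin.
by [].
Qed.


Lemma jump_timeS_pinfty n : Tn n = +oo%E -> Tn n.+1 = +oo%E.
Proof.
move=> E; rewrite /= E (_ : [set t%:E | t in _] = set0) ?ereal_inf0//.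
by rewrite -subset0 => y [t [H _] _]; rewrite ltNge leey in H.
Qed.

Lemma jump_time_ge0 n : (0 <= Tn n)%E.
Proof.
elim: n => [//|n IH]; move: IH; case E : (Tn n) => [s| |] // s0.
  rewrite (jump_timeS E); rewrite lee_fin in s0.
  by rewrite (le_trans _ (ltW (first_jump_gt s0)))// lee_fin.
by rewrite jump_timeS_pinfty.
Qed.

Lemma jump_time_cases n : Tn n = +oo%E \/ exists2 s : R, 0 <= s & Tn n = s%:E.
Proof.
have := jump_time_ge0 n; case: (Tn n) => [s| |]// s0; last by left.
by right; exists s.
Qed.

Lemma jump_time_le n : (Tn n <= Tn n.+1)%E.
Proof.
have [E|[s s0 E]] := jump_time_cases n; first by rewrite E jump_timeS_pinfty.
by rewrite E (jump_timeS E) ltW// first_jump_gt.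
Qed.

Lemma jump_time_lt n : (Tn n < +oo)%E -> (Tn n < Tn n.+1)%E.
Proof.
have [->//|[s s0 E] _] := jump_time_cases n.
by rewrite E (jump_timeS E) first_jump_gt.
Qed.

Lemma jump_time_mono n m : (n <= m)%N -> (Tn n <= Tn m)%E.
Proof.
move=> /subnK <-; elim: (m - n)%N => [//|k IH].
by rewrite addSn (le_trans IH)// jump_time_le.
Qed.

Lemma jump_time_const n t : (Tn n <= t%:E < Tn n.+1)%E -> x t = x (fine (Tn n)).
Proof.
have [->|[s s0 E]] := jump_time_cases n; first by rewrite leye_eq.
by rewrite E (jump_timeS E) lee_fin => /andP[? ?] /=; exact: first_jump_const.
Qed.

Lemma jump_time_first_jump n t : (Tn n <= t%:E < Tn n.+1)%E ->
  first_jump x t = Tn n.+1.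
Proof.
have [->|[s s0 E]] := jump_time_cases n; first by rewrite leye_eq.
by rewrite E (jump_timeS E) lee_fin => /andP[? ?]; exact: first_jump_id.
Qed.

Lemma jump_time_unbounded t : exists n, (t%:E < Tn n)%E.
Proof.
apply: contrapT => /forallNP H.
have {}H n : (Tn n <= t%:E)%E by rewrite leNgt; apply/negP/H.
have TE n : Tn n = (fine (Tn n))%:E.
  by have := H n; have [->|[s s0 ->]//] := jump_time_cases n; rewrite leye_eq.
pose u n := fine (Tn n).
have ut n : u n <= t by rewrite -lee_fin -TE.
have uS n : u n < u n.+1.
  rewrite -lte_fin -!TE; apply: jump_time_lt.
  by rewrite (le_lt_trans (H n))// ltry.
have u0 n : 0 <= u n by rewrite -lee_fin -TE jump_time_ge0.
have hs : has_sup (range u) by split; [exists (u 0), 0|exists t => _ [n _ <-]].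
have us n : u n < sup (range u).
  by apply: lt_le_trans (uS n) _; apply: ub_le_sup; [exact: hs.2|exists n.+1].
have [e e0 [a He]] := path_left (le_lt_trans (u0 0) (us 0)).
have [_ [n _ <-] un] := sup_adherent e0 hs.
have E1 : x (u n) = a by apply: He; rewrite un us.
have E2 : x (u n.+1) = a by apply: He; rewrite us (lt_trans un)// uS.
apply: (@first_jump_neq (u n) (u n.+1)) => //; last by rewrite E1.
by rewrite /u -TE; apply/esym/jump_timeS/TE.
Qed.

Lemma jump_time_locate t : 0 <= t -> exists n, (Tn n <= t%:E < Tn n.+1)%E.
Proof.
move=> t0; have [n tn] := jump_time_unbounded t.
elim: n tn => [|n IH] tn; first by rewrite /= lte_fin ltNge t0 in tn.
by have [/IH//|nt] := ltP t%:E (Tn n); exists n; rewrite nt.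
Qed.

Lemma jump_time_locate_unique n m t : (Tn n <= t%:E < Tn n.+1)%E ->
  (Tn m <= t%:E < Tn m.+1)%E -> n = m.
Proof.
suff H i j : (Tn i <= t%:E)%E -> (t%:E < Tn j.+1)%E -> (i <= j)%N.
  by move=> /andP[? ?] /andP[? ?]; apply/eqP; rewrite eqn_leq !H.
move=> H1 H2; rewrite leqNgt; apply/negP => /jump_time_mono ji.
by have := le_lt_trans (le_trans ji H1) H2; rewrite ltxx.
Qed.

(** A rational [p] between the [n]-th jump and the next one has that next one as its first jump, so
    the event reduces to [Tn n <= p] and to path values at countably many times. Adaptedness of jump
    times then follows by induction on [n]. *)
Lemma jump_timeS_le_rat n t : (Tn n.+1 <= t%:E)%E <->
  exists p : rat, [/\ 0 <= (ratr p : R) < t, (Tn n <= (ratr p : R)%:E)%E &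
    x t <> x (ratr p : R) \/
    exists q : rat, (ratr p : R) < (ratr q : R) < t /\ x (ratr q : R) <> x (ratr p : R)].
Proof.
split.
  have [E|[s s0 E]] := jump_time_cases n; first by rewrite jump_timeS_pinfty.
  rewrite (jump_timeS E) => /[dup] ft.
  have [->|[u su fu]] := first_jump_cases s0; first by rewrite leye_eq.
  rewrite fu lee_fin => ut; have [p /andP[sp pu]] := rat_between su.
  have fp : first_jump x (ratr p : R) = first_jump x s.
    by apply: first_jump_id; [exact: ltW|rewrite fu lte_fin].
  have p0 : 0 <= ratr p :> R by rewrite (le_trans s0)// ltW.
  exists p; split.
  - by rewrite p0 (lt_le_trans pu).
  - by rewrite E lee_fin ltW.
  - move: ft; rewrite -fp => /(first_jump_le_rat _ p0)[[_ ?]|?]; [by left|by right].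
move=> [p [/andP[p0 pt] Tp H]]; rewrite leNgt; apply/negP => tT.
suff : (first_jump x (ratr p : R) <= t%:E)%E.
  rewrite (@jump_time_first_jump n) ?leNgt ?tT//.
  by rewrite -leNgt Tp (lt_trans _ tT)// lte_fin.
by apply/first_jump_le_rat => //; case: H => [?|?]; [left|right].
Qed.

(** The value at the random time [Tn n] is read at [t] if the path has not moved since, otherwise at
    a rational time before the next jump. *)
Lemma jump_time_pos_rat n t (B : set T) :
  ((Tn n <= t%:E)%E /\ B (x (fine (Tn n)))) <->
  ((Tn n <= t%:E < Tn n.+1)%E /\ B (x t)) \/
  exists p : rat, [/\ 0 <= (ratr p : R) < t, (Tn n <= (ratr p : R)%:E < Tn n.+1)%E &
     B (x (ratr p : R))].
Proof.
split=> [[Tt Bx]|].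
  have [tT|Tt'] := ltP t%:E (Tn n.+1).
    by left; rewrite Tt; split => //; rewrite (jump_time_const (n := n)) ?Tt.
  have [E|[s s0 E]] := jump_time_cases n; first by rewrite E leye_eq in Tt.
  have [|[u su]] := first_jump_cases s0; rewrite -(jump_timeS E) => E'.
    by rewrite E' leye_eq in Tt'.
  rewrite E' lee_fin in Tt'; have [p /andP[sp pu]] := rat_between su.
  have pT : (Tn n <= (ratr p : R)%:E < Tn n.+1)%E by rewrite E E' lee_fin lte_fin ltW.
  right; exists p; split => //; last by rewrite (jump_time_const pT).
  by rewrite (le_trans s0 (ltW sp)) (lt_le_trans pu).
by move=> [[/[dup] tT /andP[-> _]]|[p [/andP[_ pt] /[dup] tT /andP[Tp _]]]];
  rewrite (jump_time_const tT)// => ?; split=> //; rewrite (le_trans Tp)// lee_fin ltW.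
Qed.

End jump_paths.

(** * Completed filtrations *)

#[local] Arguments jump_time : simpl never.

Section sigma_algebra_sets.
Context (T : Type) (F : set_system T).
Hypothesis HF : sigma_algebra setT F.

Lemma sa_not (A : set T) : F A -> F [set w | ~ A w].
Proof. by case: HF => _ FC _ /FC; rewrite setTD. Qed.

Lemma sa_exn (A : nat -> set T) : (forall n, F (A n)) ->
  F [set w | exists n, A n w].
Proof.
case: HF => _ _ FU /FU; rewrite (_ : \bigcup_k A k = [set w | exists n, A n w])//.
by apply/seteqP; split => w /= [n]; [exists n|exists n].
Qed.

Lemma sa_false (A : set T) : (forall w, ~ A w) -> F A.
Proof. by move=> A0; rewrite (_ : A = set0); [case: HF|rewrite -subset0]. Qed.

Lemma sa_true (A : set T) : (forall w, A w) -> F A.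
Proof.
move=> AT; rewrite (_ : A = [set w | ~ set0 w]).
  by apply: sa_not; case: HF.
by apply/seteqP; split => w // _ [].
Qed.

Lemma sa_ex (C : countType) (A : C -> set T) : (forall n, F (A n)) ->
  F [set w | exists n, A n w].
Proof.
move=> FA; pose B n : set T := if unpickle n is Some c then A c else set0.
rewrite (_ : [set _ | _] = [set w | exists n, B n w]).
  by apply: sa_exn => n; rewrite /B; case: unpickle => //; case: HF.
apply/seteqP; split => w /= [n]; last by rewrite /B; case: unpickle => // c; exists c.
by exists (pickle n); rewrite /B pickleK.
Qed.

Lemma sa_or (A B : set T) : F A -> F B -> F [set w | A w \/ B w].
Proof.
move=> FA FB; rewrite (_ : [set _ | _] = [set w | exists b : bool, (if b then A else B) w]).
  by apply: sa_ex => -[].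
by apply/seteqP; split => w /= => [[?|?]|[[] ?]];
  [exists true|exists false|left|right].
Qed.

Lemma sa_iff (A B : set T) : (forall w, A w <-> B w) -> F B -> F A.
Proof using HF.
by move=> AB; rewrite (_ : B = A)//; apply/seteqP; split => w /AB.
Qed.

Lemma sa_and (A B : set T) : F A -> F B -> F [set w | A w /\ B w].
Proof.
move=> FA FB; apply: (@sa_iff _ [set w | ~ (~ A w \/ ~ B w)]).
  by move=> w /=; split=> [[? ?] [|]//|/not_orP[/contrapT ? /contrapT ?]].
by apply/sa_not/sa_or; apply: sa_not.
Qed.

Lemma sa_andp (c : Prop) (A : set T) : (c -> F A) -> F [set w | c /\ A w].
Proof.
have [Hc|nc _] := pselect c; last by apply: sa_false => w [].
by move=> /(_ Hc); apply: sa_iff => w /=; split => [[]|].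
Qed.

Lemma sa_negb (b : T -> bool) : F [set w | b w] -> F [set w | ~~ b w].
Proof.
by move=> /sa_not; apply: sa_iff => w /=; split => /negP.
Qed.

Lemma sa_andb (b c : T -> bool) : F [set w | b w] -> F [set w | c w] ->
  F [set w | b w && c w].
Proof.
move=> Fb Fc; apply: sa_iff (sa_and Fb Fc) => w /=.
by split=> [/andP[]|[? ?]] //; apply/andP.
Qed.

Lemma sa_all (C : countType) (A : C -> set T) : (forall n, F (A n)) ->
  F [set w | forall n, A n w].
Proof.
move=> FA; apply: (@sa_iff _ [set w | ~ exists n, ~ A n w]).
  by move=> w /=; split => [H [n]|/forallNP H n]; [exact|apply: contrapT].
by apply: sa_not; apply: sa_ex => n; exact: sa_not.
Qed.

Lemma sa_imp (A B : set T) : F A -> F B -> F [set w | A w -> B w].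
Proof.
move=> FA FB; apply: (@sa_iff _ [set w | ~ A w \/ B w]); last first.
  by apply: sa_or => //; exact: sa_not.
move=> w /=; split=> [H|[//|//]].
by have [/H|] := pselect (A w); [right|left].
Qed.

Lemma sa_impp (c : Prop) (A : set T) : (c -> F A) -> F [set w | c -> A w].
Proof.
have [Hc|nc _] := pselect c; last by apply: sa_true => w.
by move=> /(_ Hc); apply: sa_iff => w /=; split => [|//]; apply.
Qed.

Lemma sa_setI (A B : set T) : F A -> F B -> F (A `&` B).
Proof. exact: sa_and. Qed.

Lemma sa_bigcup (A : (set T)^nat) : (forall n, F (A n)) -> F (\bigcup_n A n).
Proof. by case: HF => _ _; apply. Qed.

End sigma_algebra_sets.

Section traces.
Context (T : Type).
Implicit Types (G J : set_system T) (E : set T).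

Lemma g_sigma_algebraP G : sigma_algebra setT <<s G >>.
Proof. exact: smallest_sigma_algebra. Qed.

(** The sets sharing their trace on [E] with some [J]-set form a sigma-algebra. This compares two
    pasts on an event, such as the absence of jumps, that the smaller past does not know. *)
Lemma trace_generated G J E : sigma_algebra setT J ->
  (forall A, G A -> exists2 B, J B & A `&` E = B `&` E) ->
  forall A, <<s G >> A -> exists2 B, J B & A `&` E = B `&` E.
Proof.
move=> HJ GJ; apply: smallest_sub => //; split.
- by exists set0; [case: HJ|].
- move=> A [B JB AB]; exists (~` B); first exact: sa_not.
  rewrite setTD; apply/seteqP; split => w [nA Ew]; split=> // H; apply: nA.
    by have : (B `&` E) w by []; rewrite -AB => -[].
  by have : (A `&` E) w by []; rewrite AB => -[].
- move=> A HA.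
  have {}HA n : {B | J B & A n `&` E = B `&` E}.
    by apply/cid2; exact: HA.
  exists (\bigcup_n s2val (HA n)).
    by apply: sa_bigcup => // n; exact: (s2valP (HA n)).
  rewrite !setI_bigcupl; apply: eq_bigcupr => n _; exact: (s2valP' (HA n)).
Qed.

(** Complements are taken inside [E], which therefore has to belong to [J]. *)
Lemma trace_sub G J E : sigma_algebra setT J -> J E ->
  (forall A, G A -> J (A `&` E)) -> forall A, <<s G >> A -> J (A `&` E).
Proof.
move=> HJ JE GJ; apply: smallest_sub => //; split.
- by rewrite /= set0I; case: HJ.
- move=> A JA; apply: (sa_iff HJ (B := [set w | E w /\ ~ (A `&` E) w])).
    by move=> w /=; split=> [[[_ nA] Ew]|[Ew nA]]; [split=> // -[]|split=> //; split=> // Aw; exact: nA].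
  by apply: sa_and => //; exact: sa_not.
- by move=> A JA; rewrite /= setI_bigcupl; exact: sa_bigcup.
Qed.

End traces.

(** A countable base of a separable metric space has this property; it turns events such as
    [Z r w <> Z s w] into countably many conditions. *)
Definition separates_points d (E : measurableType d) (U : (set E)^nat) :=
  (forall k, measurable (U k)) /\
  forall x y : E, x <> y -> exists k, U k x /\ ~ U k y.

(* A non-reducing copy of the completed filtration: the original unfolds to an
   intersection, hence to a product type, which confuses [apply]. *)
Record filtration d (Om : measurableType d) (R : realType)
    (P : probability Om R) d' (E : measurableType d') (Z : R -> Om -> E) (t : R)
    (A : set Om) : Prop :=
  Filtration { filtration_completed : completed_natural_filtration P Z t A }.

Lemma filtrationE d (Om : measurableType d) (R : realType)
    (P : probability Om R) d' (E : measurableType d') (Z : R -> Om -> E) :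
  completed_natural_filtration P Z = filtration P Z.
Proof.
by apply/funext => t; apply/seteqP; split => A; [exact: Filtration|case].
Qed.

Section filtration.
Context d (Om : measurableType d) (R : realType) (P : probability Om R).
Hypothesis P_complete : measure_is_complete P.
Context d' (E : measurableType d').
Variables (U : (set E)^nat) (US : separates_points U).
Variable Z : R -> Om -> E.
Hypothesis Z_meas : forall t, 0 <= t -> measurable_fun setT (Z t).
Hypothesis Z_jump : forall w, pure_jump_path (Z^~ w).

Implicit Types (r s t : R) (n : nat) (A : set Om) (B : set E).

Local Notation F := (filtration P Z).
Local Notation Tn n w := (jump_time (Z^~ w) n).

Lemma filtration_sigma t : sigma_algebra setT (F t).
Proof. rewrite -filtrationE; exact: smallest_sigma_algebra. Qed.
Local Notation HF := (filtration_sigma _).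

Lemma filtration_gen s t B : 0 <= s <= t -> measurable B -> F t [set w | B (Z s w)].
Proof. by move=> st mB; split; apply: sub_gen_smallest; left; exists s, B. Qed.

Lemma filtration_negligible t A : P.-negligible A -> F t A.
Proof. by move=> nA; split; apply: sub_gen_smallest; right. Qed.

Lemma filtration_mono s t A : s <= t -> F s A -> F t A.
Proof.
move=> st; rewrite -!filtrationE; move: A; apply: smallest_sub; first exact: smallest_sigma_algebra.
move=> A [[r [B [/andP[r0 rs] mB ->]]]|nA]; apply: sub_gen_smallest; last by right.
by left; exists r, B; rewrite r0 (le_trans rs).
Qed.

Lemma filtration_measurable t A : F t A -> measurable A.
Proof.
rewrite -filtrationE; move: A; apply: smallest_sub; first exact: sigma_algebra_measurable.
move=> A [[r [B [/andP[r0 rs] mB ->]]]|nA]; last exact: P_complete.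
by rewrite -[X in measurable X]setTI; exact: Z_meas.
Qed.

Lemma filtration_trace t (J : set_system Om) (C : set Om) :
  sigma_algebra setT J ->
  (forall s B, 0 <= s <= t -> measurable B ->
     exists2 G, J G & [set w | B (Z s w)] `&` C = G `&` C) ->
  (forall A, P.-negligible A -> J A) ->
  forall A, F t A -> exists2 G, J G & A `&` C = G `&` C.
Proof.
move=> HJ H1 H2; rewrite -filtrationE; apply: trace_generated => // A [[s [B [st mB ->]]]|nA].
  exact: H1.
by exists A => //; exact: H2.
Qed.


Lemma filtration_neq r s t : 0 <= r <= t -> 0 <= s <= t ->
  F t [set w | Z r w <> Z s w].
Proof.
move=> rt st; apply: (sa_iff HF (B := [set w | exists k, U k (Z r w) /\ ~ U k (Z s w)])).
  move=> w /=; split; first exact: US.2.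
  by move=> [k [Ur Us]] rs; rewrite rs in Ur.
apply: sa_exn => [|k]; first exact: HF.
apply: (sa_and HF); first exact: filtration_gen (US.1 k).
by apply: (sa_not HF); exact: filtration_gen (US.1 k).
Qed.

Lemma filtration_first_jump_le s t : 0 <= s ->
  F t [set w | (first_jump (Z^~ w) s <= t%:E)%E].
Proof.
move=> s0.
apply: (sa_iff HF (B := [set w | (s < t /\ Z t w <> Z s w) \/
  exists q : rat, s < ratr q < t /\ Z (ratr q) w <> Z s w])).
  by move=> w; exact: first_jump_le_rat.
apply: (sa_or HF).
  apply: (sa_andp HF) => st; apply: filtration_neq; first by rewrite lexx (le_trans s0)// ltW.
  by rewrite s0 ltW.
apply: (sa_ex HF) => q; apply: (sa_andp HF) => /andP[sq qt].
by apply: filtration_neq; rewrite ?s0 ?(ltW qt) ?(ltW (lt_trans sq qt)) ?andbT// (le_trans s0)// ltW.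
Qed.

Lemma filtration_first_jump_gt s t : 0 <= s ->
  F t [set w | (t%:E < first_jump (Z^~ w) s)%E].
Proof.
move=> s0; under eq_set do rewrite ltNge.
exact/(sa_negb HF)/filtration_first_jump_le.
Qed.

Lemma filtration_jump_time_le n t : F t [set w | (Tn n w <= t%:E)%E].
Proof.
elim: n t => [|n IH] t.
  have [t0|t0] := leP 0 t; [apply: (sa_true HF) => w|apply: (sa_false HF) => w] => /=.
    by rewrite lee_fin.
  by rewrite lee_fin leNgt t0.
apply: (sa_iff HF (B := [set w | exists p : rat, 0 <= (ratr p : R) < t /\
   ((Tn n w <= (ratr p : R)%:E)%E /\
    (Z t w <> Z (ratr p : R) w \/
    exists q : rat, (ratr p : R) < (ratr q : R) < t /\
      Z (ratr q : R) w <> Z (ratr p : R) w))])).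
  move=> w /=; rewrite -[(ereal_inf _ <= _)%E]/(Tn n.+1 w <= t%:E)%E.
  rewrite (jump_timeS_le_rat (Z_jump w)).
  by split=> -[p]; [move=> [? ? ?]; exists p|move=> [? [? ?]]; exists p].
apply: (sa_ex HF) => p; apply: (sa_andp HF) => /andP[p0 pt].
have p0t : 0 <= (ratr p : R) <= t by rewrite p0 ltW.
apply: (sa_and HF); first exact: filtration_mono (ltW pt) (IH _).
apply: (sa_or HF).
  by apply: filtration_neq => //; rewrite lexx (le_trans p0)// ltW.
apply: (sa_ex HF) => q; apply: (sa_andp HF) => /andP[pq qt].
by apply: filtration_neq => //; rewrite (le_trans p0 (ltW pq)) ltW.
Qed.

Lemma filtration_jump_time_gt n t : F t [set w | (t%:E < Tn n w)%E].
Proof.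
under eq_set do rewrite ltNge.
exact/(sa_negb HF)/filtration_jump_time_le.
Qed.

Lemma filtration_between n t : F t [set w | (Tn n w <= t%:E < Tn n.+1 w)%E].
Proof.
apply: (sa_andb HF); first exact: filtration_jump_time_le.
exact: filtration_jump_time_gt.
Qed.

Lemma filtration_jump_pos n t B : 0 <= t -> measurable B ->
  F t [set w | (Tn n w <= t%:E)%E /\ B (Z (fine (Tn n w)) w)].
Proof.
move=> t0 mB; apply: (sa_iff HF (B := [set w |
  ((Tn n w <= t%:E < Tn n.+1 w)%E /\ B (Z t w)) \/
  exists p : rat, 0 <= (ratr p : R) < t /\
   ((Tn n w <= (ratr p : R)%:E < Tn n.+1 w)%E /\ B (Z (ratr p : R) w))])).
  move=> w /=; apply: iff_trans (jump_time_pos_rat (Z_jump w) n t B) _.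
  split=> -[?|[p]]; [by left| |by left|].
  - by move=> [? ? ?]; right; exists p.
  - by move=> [? [? ?]]; right; exists p.
apply: (sa_or HF).
  apply: (sa_and HF); first exact: filtration_between.
  by apply: filtration_gen => //; rewrite t0 lexx.
apply: (sa_ex HF) => p; apply: (sa_andp HF) => /andP[p0 pt].
apply: (filtration_mono (ltW pt)); apply: (sa_and HF); first exact: filtration_between.
by apply: filtration_gen => //; rewrite p0 lexx.
Qed.

Lemma ereal_measurable (f : Om -> \bar R) :
  (forall t, measurable [set w | (f w <= t%:E)%E]) -> measurable_fun setT f.
Proof.
move=> mf; apply: (measurability (@ErealGenOInfty.G R)).
  exact: ErealGenOInfty.measurableE.
move=> _ [_ [t ->] <-]; rewrite setTI.
rewrite (_ : _ @^-1` _ = ~` [set w | (f w <= t%:E)%E]); first exact: measurableC.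
apply/seteqP; split => w /=; rewrite in_itv/= andbT.
  by rewrite ltNge => /negP.
by move=> /negP; rewrite -ltNge.
Qed.

Lemma first_jump_measurable s : 0 <= s ->
  measurable_fun setT (fun w => first_jump (Z^~ w) s).
Proof.
move=> s0; apply: ereal_measurable => t.
exact: filtration_measurable (filtration_first_jump_le t s0).
Qed.

Lemma jump_time_measurable n : measurable_fun setT (fun w => Tn n w).
Proof.
apply: ereal_measurable => t.
exact: filtration_measurable (filtration_jump_time_le n t).
Qed.

(** Right after [th w] the path keeps its value, so [Z (th w) w] lies in [B] exactly when the values
    at all rational times between [th w] and some later rational [q] do. The random time [th] may be
    any nonnegative random variable, for instance one that is not a stopping time. *)
Lemma evaluation_measurable (th : Om -> R) : (forall w, 0 <= th w) ->
  measurable_fun setT th -> measurable_fun setT (fun w => Z (th w) w).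
Proof.
move=> th0 mth _ B mB; rewrite setTI.
have HM := @sigma_algebra_measurable _ Om.
have lt (q : rat) : measurable [set w | th w < (ratr q : R)].
  by rewrite -[X in measurable X]setTI; apply: measurable_fun_ltr mth _ _ _ _.
apply: (sa_iff HM (B := [set w | exists q : rat, th w < (ratr q : R) /\
   forall p : rat, th w < (ratr p : R) -> (ratr p : R) < (ratr q : R) ->
     B (Z (ratr p : R) w)])).
  move=> w; have [e e0 He] := path_right (Z_jump w) (th0 w); split=> /=.
    move=> Bw; have [|q /andP[tq qe]] := @rat_between _ (th w) (th w + e).
      by rewrite ltrDl.
    exists q; split=> // p tp pq; rewrite He// ltW//=.
    exact: lt_trans qe.
  move=> [q [tq H]].
  have [|p /andP[tp]] := @rat_between _ (th w) (Num.min (ratr q) (th w + e)).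
    by rewrite lt_min tq ltrDl.
  rewrite lt_min => /andP[pq pe]; rewrite -(He (ratr p)) ?(ltW tp)//.
  exact: H.
apply: (sa_ex HM) => q; apply: (sa_and HM); first exact: lt.
apply: (@sa_all _ _ HM rat (fun p => [set w | th w < (ratr p : R) -> (ratr p : R) < (ratr q : R) -> B (Z (ratr p) w)])) => p.
have [p0|p0] := leP 0 (ratr p : R); last first.
  by apply: (sa_true HM) => w /= /(le_lt_trans (th0 w)); rewrite ltNge ltW.
apply: (sa_imp HM); first exact: lt.
apply: (@sa_impp _ _ HM (ratr p < ratr q :> R) [set w | B (Z (ratr p) w)]) => _.
by rewrite -[X in measurable X]setTI; exact: Z_meas.
Qed.

Lemma jump_pos_measurable n :
  measurable_fun setT (fun w => Z (fine (Tn n w)) w).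
Proof.
apply: evaluation_measurable => [w|]; first exact/fine_ge0/jump_time_ge0.
exact: measurableT_comp (fine_measurable measurableT) (jump_time_measurable n).
Qed.

Lemma stopped_sigma n :
  sigma_algebra setT (stopped_sigma_algebra F (fun w => Tn n w)).
Proof.
split.
- by split=> // t _; rewrite set0I; apply: (sa_false HF) => w [].
- move=> A [mA FA]; split; first by rewrite setTD; exact: measurableC.
  move=> t t0; apply: (sa_iff HF (B := [set w | (Tn n w <= t%:E)%E /\
      ~ (A `&` [set w | (Tn n w <= t%:E)%E]) w])).
    move=> w /=; split=> [[[_ nA] ?]|[? H]].
      by split=> // -[].
    by split=> //; split=> // Aw; apply: H.
  apply: (sa_and HF); first exact: filtration_jump_time_le.
  by apply: (sa_not HF); exact: FA.
- move=> A HA; split; first by apply: bigcupT_measurable => k; exact: (HA k).1.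
  move=> t t0; rewrite setI_bigcupl; apply: (sa_bigcup HF) => k.
  exact: (HA k).2.
Qed.

Lemma stopped_jump_time_le n s : 0 <= s ->
  stopped_sigma_algebra F (fun w => Tn n w) [set w | (Tn n w <= s%:E)%E].
Proof.
move=> s0; split; first exact: filtration_measurable (filtration_jump_time_le n s).
move=> t t0; rewrite (_ : _ `&` _ = [set w | (Tn n w <= (Num.min s t)%:E)%E]).
  apply: filtration_mono (filtration_jump_time_le n _).
  by rewrite ge_min lexx orbT.
apply/seteqP; split => w /=; rewrite EFin_min le_min; first by case=> -> ->.
by move=> /andP[].
Qed.

(** No information arrives between the [n]-th jump and [s]: on [Tn n <= s < Tn n.+1], the value at a
    time [u <= s] is either observed before the jump or equal to the value at the jump. *)
Lemma trace_stopped n s A : 0 <= s -> F s A ->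
  exists2 B, stopped_sigma_algebra F (fun w => Tn n w) B &
    A `&` [set w | (Tn n w <= s%:E < Tn n.+1 w)%E] =
    B `&` [set w | (Tn n w <= s%:E < Tn n.+1 w)%E].
Proof.
move=> s0; apply: filtration_trace; [exact: stopped_sigma| |].
move=> u B /andP[u0 us] mB.
(* Both alternatives force [Tn n w <= s], so that measurability of the whole set follows from its
   trace at [t = s]. *)
exists [set w | ((Tn n w <= u%:E)%E /\ B (Z (fine (Tn n w)) w)) \/
   [/\ (u%:E < Tn n w)%E, (Tn n w <= s%:E)%E & B (Z u w)]].
  have FA t : 0 <= t -> F t ([set w | ((Tn n w <= u%:E)%E /\ B (Z (fine (Tn n w)) w)) \/
   [/\ (u%:E < Tn n w)%E, (Tn n w <= s%:E)%E & B (Z u w)]] `&`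
     [set w | (Tn n w <= t%:E)%E]).
    move=> t0; apply: (sa_iff HF (B := [set w |
      ((Tn n w <= (Num.min u t)%:E)%E /\ B (Z (fine (Tn n w)) w)) \/
      (u < t /\ ((u%:E < Tn n w)%E /\ ((Tn n w <= (Num.min s t)%:E)%E /\ B (Z u w))))])).
      move=> w /=; rewrite !EFin_min !le_min; split.
        move=> [[[-> ?]|[H1 -> ?]] H2]; [by left; rewrite H2|].
        by right; rewrite -lte_fin (lt_le_trans H1 H2) H1 H2.
      by move=> [[/andP[-> ->] ?]|[? [? [/andP[? ?] ?]]]]; split=> //; [left|right].
    apply: (sa_or HF).
      apply: filtration_mono (filtration_jump_pos _ _ mB); first by rewrite ge_min lexx orbT.
      by rewrite le_min u0.
    apply: (sa_andp HF) => ut; apply: (sa_and HF).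
      exact: filtration_mono (ltW ut) (filtration_jump_time_gt _ _).
    apply: (sa_and HF); last by apply: filtration_gen => //; rewrite u0 ltW.
    by apply: filtration_mono (filtration_jump_time_le n _); rewrite ge_min lexx orbT.
  split; last exact: FA.
  have := filtration_measurable (FA s s0); apply: (sa_iff (@sigma_algebra_measurable _ Om)).
  move=> w /=; split; last by case.
  by move=> [[H1 ?]|[? ? ?]]; split => //; [left| |right] => //; rewrite (le_trans H1)// lee_fin.
apply/seteqP; split => w /= [Bw /[dup] H /andP[Tns sT]]; split=> //.
  have [uT|Tu] := ltP u%:E (Tn n w); [by right|left; split=> //].
  have uT : (Tn n w <= u%:E < Tn n.+1 w)%E.
    by rewrite Tu (le_lt_trans _ sT)// lee_fin.
  by rewrite -(jump_time_const (Z_jump w) uT).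
case: Bw => [[Tu]|[]//].
have uT : (Tn n w <= u%:E < Tn n.+1 w)%E.
  by rewrite Tu (le_lt_trans _ sT)// lee_fin.
by rewrite -(jump_time_const (Z_jump w) uT).
move=> {}A nA; split; first exact: P_complete.
move=> t _; apply: filtration_negligible.
by apply: negligibleS nA => w [].
Qed.

End filtration.

(** * First jumps from a deterministic time *)

Section indicators.
Context (T : Type) (R : realType).
Implicit Types (A B : set T).

Lemma indic1 A w : A w -> \1_A w = 1 :> R.
Proof. by move=> Aw; rewrite indicE mem_set. Qed.

Lemma indicN A w : ~ A w -> \1_A w = 0 :> R.
Proof. by move=> Aw; rewrite indicE memNset. Qed.

Lemma indic_ge0 A w : 0 <= \1_A w :> R.
Proof. by rewrite indicE. Qed.

Lemma indic_le1 A w : \1_A w <= 1 :> R.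
Proof. by rewrite indicE; case: (_ \in _). Qed.

Lemma indic_norm_le1 A w : `|\1_A w| <= 1 :> R.
Proof. by rewrite ger0_norm ?indic_le1 ?indic_ge0. Qed.

Lemma indic01 A w : 0 <= (\1_A w : R) <= 1.
Proof. by rewrite indic_ge0 indic_le1. Qed.

Lemma prod01 (x y : R) : 0 <= x <= 1 -> 0 <= y <= 1 -> 0 <= x * y <= 1.
Proof. by move=> /andP[? ?] /andP[? ?]; rewrite mulr_ge0//= mulr_ile1. Qed.

Lemma indicM A B w : \1_A w * \1_B w = \1_(A `&` B) w :> R.
Proof.
rewrite !indicE in_setI; case: (w \in A); case: (w \in B) => /=; by
  rewrite ?mulr1 ?mulr0.
Qed.

Lemma weight_indic (F : set_system T) A (b : T -> R) : sigma_algebra setT F ->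
  F A -> (forall w, 0 <= b w) -> (forall x, F [set w | x <= b w]) ->
  forall x, F [set w | x <= \1_A w * b w].
Proof.
move=> HF FA b0 Fb x.
apply: (sa_iff HF (B := [set w | (A w /\ x <= b w) \/ (~ A w /\ x <= 0)])).
  move=> w /=; have [Aw|nAw] := pselect (A w).
    by rewrite indic1// mul1r; split=> [?|[[]|[]]//]; left.
  by rewrite indicN// mul0r; split=> [?|[[]|[]]//]; right.
apply: (sa_or HF); first exact: (sa_and HF FA (Fb x)).
apply: (sa_and HF); first exact: (sa_not HF FA).
by have [x0|x0] := pselect (x <= 0); [exact: (sa_true HF)|exact: (sa_false HF)].
Qed.

End indicators.
Arguments indic1 {T R A w}.
Arguments indicN {T R A w}.

Lemma indic_congr (R : realType) (T T' : Type) (A : set T) (B : set T') w v :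
  (A w <-> B v) -> \1_A w = \1_B v :> R.
Proof.
move=> AB; have [Aw|nAw] := pselect (A w); first by rewrite !indic1//; exact/AB.
by rewrite !indicN// => /AB.
Qed.

Lemma le_of_eq (R : realType) (x y : R) : x = y -> x <= y.
Proof. by move=> ->. Qed.

Lemma measurable_lt_set d (T : measurableType d) (R : realType)
    (f g : T -> \bar R) : measurable_fun setT f -> measurable_fun setT g ->
  measurable [set x | (f x < g x)%E].
Proof.
by move=> mf mg; rewrite -[X in measurable X]setTI; exact: measurable_lte.
Qed.

(** Inversion is continuous off [0], and the single point [0] is treated apart. *)
Lemma measurable_funV d (T : measurableType d) (R : realType) (f : T -> R) :
  measurable_fun setT f -> measurable_fun setT (fun x => (f x)^-1).
Proof.
suff mV : measurable_fun setT (GRing.inv : R -> R) by move=> mf; exact: measurableT_comp.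
have o0 : open [set r : R | r != 0] by exact: open_neq.
have -> : [set: R] = [set r : R | r != 0] `|` [set 0].
  by apply/seteqP; split => r // _ /=; have [->|r0] := eqVneq r 0; [right|left].
apply/measurable_funU; [exact: open_measurable|by []|split].
  apply: open_continuous_measurable_fun => //; apply/in_setP => x /= x0.
  exact: inv_continuous.
exact: measurable_fun_set1.
Qed.

(** The upper bound on the exponential comes from [expR (- x) * (1 + x) <= 1 <= 1 + x ^+ 3 = (1 - x
    + x ^+ 2) * (1 + x)]. *)
Lemma exp_second_order (R : realType) (x : R) : 0 <= x ->
  0 <= 1 - expR (- x) <= x /\ `|1 - expR (- x) - x| <= x ^+ 2.
Proof.
move=> x0; have h1 : 1 - x <= expR (- x) by rewrite expR_ge1Dx.
have h2 : expR (- x) <= 1 by rewrite -expR0 ler_expR oppr_le0.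
have h3 : expR (- x) * (1 + x) <= 1.
  by have := ler_wpM2l (expR_ge0 (- x)) (expR_ge1Dx x); rewrite -expRD addNr expR0.
have h4 : expR (- x) <= 1 - x + x ^+ 2.
  have p : 0 < 1 + x by rewrite ltr_wpDr.
  rewrite -(ler_pM2r p) (le_trans h3)//.
  rewrite (_ : (1 - x + x ^+ 2) * (1 + x) = 1 + x ^+ 3); last by ring.
  by rewrite lerDl exprn_ge0.
by split; [apply/andP; split; lra|rewrite ler_norml; apply/andP; split; lra].
Qed.

(** * Adapted random times in place of deterministic ones *)

Section random_substitution.
Context d (Om : measurableType d) (R : realType) (P : probability Om R).
Variables (F : set_system Om) (Phi : R -> Om -> R) (M N : R) (u : Om -> R).
Hypothesis HF : sigma_algebra setT F.
Hypothesis FM : forall A, F A -> measurable A.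
Hypothesis mPhi : forall x, measurable_fun setT (Phi x).
Hypothesis PhiM : forall x w, `|Phi x w| <= M.
Hypothesis Phi0 : forall x A, 0 <= x -> F A ->
  \int[P]_w (\1_A w * Phi x w) = 0.
Hypothesis Phir : forall w x, 0 <= x -> exists2 e : R, 0 < e &
  forall y, x <= y < x + e -> Phi y w = Phi x w.
Hypothesis uN : forall w, 0 <= u w <= N.
Hypothesis Fu : forall x, F [set w | x <= u w].

(* u is approached from the right by the grid points (j + 1) / (k + 1). *)
Lemma random_substitution A : F A ->
  measurable_fun setT (fun w => Phi (u w) w) /\
  \int[P]_w (\1_A w * Phi (u w) w) = 0.
Proof.
move=> FA.
pose g (k : nat) (j : nat) : R := j.+1%:R / k.+1%:R.
pose cell k j := [set w | j%:R / k.+1%:R <= u w] `&`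
                 [set w | ~ (j.+1%:R / k.+1%:R <= u w)].
have Fcell k j : F (cell k j).
  by apply: (sa_setI HF); [exact: Fu|apply: (sa_not HF); exact: Fu].
pose J k := (Num.truncn (N * k.+1%:R)).+1.
pose Psi k w := \sum_(j < J k) (\1_(cell k j) w * Phi (g k j) w).
have PsiE k w : Psi k w = Phi (g k (Num.truncn (u w * k.+1%:R))) w.
  have k0 : 0 < k.+1%:R :> R by rewrite ltr0n.
  have /andP[u0 uwN] := uN w.
  have uk0 : 0 <= u w * k.+1%:R by rewrite mulr_ge0.
  set j := Num.truncn _.
  have jJ : (j < J k)%N.
    by rewrite ltnS; apply: le_truncn; rewrite ler_wpM2r.
  rewrite /Psi (bigD1 (Ordinal jJ))//= indic1; last first.
    split=> /=; first by rewrite ler_pdivrMr// truncn_le.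
    by apply/negP; rewrite -ltNge ltr_pdivlMr// truncnS_gt.
  rewrite mul1r big1 ?addr0// => i ij; rewrite indicN ?mul0r// => -[/= H1 /negP].
  rewrite -ltNge ltr_pdivlMr// => H2; move: H1; rewrite ler_pdivrMr// => H1.
  move/negP: ij; apply; apply/eqP/val_inj => /=; apply/esym/eqP.
  by rewrite /j truncn_eq// H1 H2.
have mcell k j : measurable (cell k j) by exact: FM.
have BPhi x : Bb (Phi x) by apply: (Bb_le (mPhi x)) => w; exact: PhiM.
have BPsi k : Bb (Psi k).
  apply: (@Bb_sum _ _ _ (J k) (fun j w => \1_(cell k j) w * Phi (g k j) w)).
  by move=> j _; apply: Bb_mul => //; exact: Bb_ind.
have lim w : Psi k w @[k --> \oo] --> Phi (u w) w.
  have /andP[u0 _] := uN w; have [e e0 He] := Phir w u0.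
  apply: cvg_near_cst; near=> k; rewrite PsiE; apply: He.
  have k0 : 0 < k.+1%:R :> R by rewrite ltr0n.
  rewrite /g ler_pdivlMr// ltW ?truncnS_gt//= ltr_pdivrMr// mulrDl.
  rewrite -natr1 ler_ltD ?truncn_le ?mulr_ge0//.
  rewrite -ltr_pdivrMr// div1r; near: k.
  exact: (near_infty_natSinv_lt (PosNum e0)).
have PsiM k w : `|Psi k w| <= M by rewrite PsiE.
have BA : Bb (fun w => \1_A w : R) by exact/Bb_ind/FM.
have PT : (P setT < +oo)%E by exact: probabilityT_lty.
have [|Bu _] := @bounded_cvg_int _ _ _ P PT Psi (fun w => Phi (u w) w) M _ PsiM lim.
  by move=> k; exact/Bb_meas/BPsi.
split; first exact: Bb_meas.
have Psi0 k : \int[P]_w (\1_A w * Psi k w) = 0.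
  under eq_Rintegral => w _ do rewrite /Psi mulr_sumr.
  rewrite (@int_sum _ _ _ _ PT (J k) (fun j w => \1_A w * (\1_(cell k j) w * Phi (g k j) w))).
    apply: big1 => j _; under eq_Rintegral do rewrite mulrA indicM.
    by apply: Phi0; [rewrite divr_ge0|exact: (sa_setI HF)].
  by move=> j _; apply: Bb_mul => //; apply: Bb_mul => //; exact: Bb_ind.
have [|||_] := @bounded_cvg_int _ _ _ P PT (fun k w => \1_A w * Psi k w)
  (fun w => \1_A w * Phi (u w) w) M.
- by move=> k; apply: Bb_meas; exact: Bb_mul.
- by move=> k w; rewrite normrM (le_trans _ (PsiM k w))// ler_piMl// indic_norm_le1.
- by move=> w; apply: cvgM => //; exact: cvg_cst.
under eq_fun do rewrite Psi0.
by move=> /(cvg_unique (@Rhausdorff R)); apply; exact: cvg_cst.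
Unshelve. all: by end_near. Qed.

End random_substitution.

(** * Law of the first jump of [X] after a deterministic time *)

Section rates.
Context d (Om : measurableType d) (R : realType) (P : probability Om R).
Hypothesis P_complete : measure_is_complete P.
Context d' (E : measurableType d').
Variables (U : (set E)^nat) (US : separates_points U).
Variable X : R -> Om -> E.
Hypothesis X_meas : forall t, 0 <= t -> measurable_fun setT (X t).
Hypothesis X_jump : forall w, pure_jump_path (X^~ w).
Variables (lam : R.-fker E ~> E) (L : R).
Hypothesis lamL : forall x, (lam x setT <= L%:E)%E.
Hypothesis X_rate : has_rate P X lam.
Implicit Types (r s t u : R) (n : nat) (A : set Om) (B : set E) (w : Om)
  (f : E -> R) (c : R).

Local Notation F := (filtration P X).
Local Notation Tn n w := (jump_time (X^~ w) n).
Local Notation Sn n := (stopped_sigma_algebra F (fun w => Tn n w)).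
Let HF t := filtration_sigma P X t.
Let HSn n : sigma_algebra setT (Sn n).
Proof. exact: (stopped_sigma P US). Qed.
Let PT : (P setT < +oo)%E := probabilityT_lty P.

Definition total_rate (x : E) : R := fine (lam x setT).
Definition jump_prob B (x : E) : R := fine (lam x B) / total_rate x.

Lemma rate_fin x : (lam x setT < +oo)%E.
Proof. by rewrite (le_lt_trans (lamL x))// ltry. Qed.

Lemma rate_fin_num x B : measurable B -> lam x B \is a fin_num.
Proof.
move=> mB; rewrite ge0_fin_numE// (le_lt_trans _ (rate_fin x))//.
by rewrite le_measure// inE.
Qed.

Lemma total_rate_bounds x : 0 <= total_rate x <= L.
Proof.
by rewrite fine_ge0//= -lee_fin fineK ?rate_fin_num.
Qed.

Lemma rate_bound_ge0 : 0 <= L.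
Proof. by have /andP[l0] := total_rate_bounds point; exact: le_trans. Qed.

Lemma jump_prob_bounds B x : measurable B -> 0 <= jump_prob B x <= 1.
Proof.
move=> mB; have /andP[l0 _] := total_rate_bounds x.
rewrite /jump_prob divr_ge0 ?fine_ge0//=.
have [->|l1] := eqVneq (total_rate x) 0; first by rewrite invr0 mulr0.
rewrite ler_pdivrMr ?lt0r ?l1// mul1r fine_le ?rate_fin_num//.
by rewrite le_measure// inE.
Qed.

(* In an absorbing state the quotient is 0 / 0 = 0. *)
Lemma jump_prob_total B x : measurable B ->
  jump_prob B x * jump_prob setT x = jump_prob B x.
Proof.
move=> mB; rewrite /jump_prob -/(total_rate x).
have [->|l1] := eqVneq (total_rate x) 0; first by rewrite invr0 !mulr0.
by rewrite divff// mulr1.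
Qed.

Let jumps n r B := [set w | (Tn n w + r%:E < Tn n.+1 w)%E /\ (Tn n.+1 w < +oo)%E /\
  B (X (fine (Tn n.+1 w)) w)].

(** The version, prescribed by [has_rate], of the conditional probability of [jumps n r B] given the
    past up to the [n]-th jump. *)
Let wt n r B w : R := \1_[set w | (Tn n w < +oo)%E] w *
  (jump_prob B (X (fine (Tn n w)) w) *
   expR (- total_rate (X (fine (Tn n w)) w) * r)).

Let HM := @sigma_algebra_measurable _ Om.

Let mTn n : measurable_fun setT (fun w => Tn n w).
Proof. exact: (jump_time_measurable P_complete US). Qed.

Let mTlt n : measurable [set w | (Tn n w < +oo)%E].
Proof.
exact: (measurable_lt_set (mTn n) (measurable_cst _)).
Qed.

Let mjumps n r B : measurable B -> measurable (jumps n r B).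
Proof.
move=> mB; apply: (sa_and HM).
  apply: (measurable_lt_set _ (mTn n.+1)).
  by apply: emeasurable_funD => //; exact: measurable_cst.
apply: (sa_and HM); first exact: mTlt.
rewrite -[X in measurable X]setTI.
exact: (jump_pos_measurable P_complete US X_meas X_jump).
Qed.

Let exp_rate_le1 x r : 0 <= r -> 0 <= expR (- total_rate x * r) <= 1.
Proof.
move=> r0; have /andP[l0 _] := total_rate_bounds x.
by rewrite expR_ge0/= -expR0 ler_expR mulNr oppr_le0 mulr_ge0.
Qed.

Let wt_bounds n r B w : 0 <= r -> measurable B -> 0 <= wt n r B w <= 1.
Proof.
move=> r0 mB; apply: prod01 (indic01 _ _ _) _.
exact: prod01 (jump_prob_bounds _ mB) (exp_rate_le1 _ r0).
Qed.

Let wt_cond n r B : 0 <= r -> measurable B ->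
  [/\ Bb (wt n r B), (forall x, Sn n [set w | x <= wt n r B w]) &
   forall A, Sn n A -> \int[P]_w (\1_A w * wt n r B w) =
     \int[P]_w (\1_A w * \1_(jumps n r B) w)].
Proof.
move=> r0 mB; have [] := X_rate n r0 mB; rewrite filtrationE => H1 H2 H3.
have Swt x : Sn n [set w | x <= wt n r B w].
  have := H1 `[x, +oo[%classic (measurable_itv _); congr (Sn n _).
  by apply/seteqP; split => w /=; rewrite in_itv/= andbT.
have mw : measurable_fun setT (wt n r B).
  by move=> _ C mC; rewrite setTI; exact: (H1 C mC).1.
split => //.
  by apply: (Bb_le mw (M := 1)) => w; have /andP[? ?] := wt_bounds n w r0 mB;
    rewrite ger0_norm.
move=> A SA; have mA : measurable A := SA.1.
rewrite -(int_setE P (wt n r B) mA) -(int_setE P (\1_(jumps n r B)) mA).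
exact: H3.
Qed.

Let Sn_meas n A : Sn n A -> measurable A. Proof. by case. Qed.

Let weighted_rate n r B (b : Om -> R) c : 0 <= r -> measurable B ->
  (forall w, 0 <= b w <= c) -> (forall x, Sn n [set w | x <= b w]) ->
  measurable_fun setT b ->
  \int[P]_w (b w * wt n r B w) = \int[P]_w (b w * \1_(jumps n r B) w).
Proof.
move=> r0 mB bc Sb mb; have [Bw _ Hw] := wt_cond n r0 mB.
have Bb_b : Bb b.
  by apply: (Bb_le mb (M := c)) => w; have /andP[? ?] := bc w; rewrite ger0_norm.
have Bj : Bb (fun w => \1_(jumps n r B) w : R) by exact/Bb_ind/mjumps.
apply/eqP; rewrite -subr_eq0 -intB//; [|exact: Bb_mul|exact: Bb_mul].
under eq_Rintegral do rewrite -mulrBr.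
apply/eqP; apply: (@weight_eq0 _ _ _ P (Sn n) _ b c) => //.
- exact: Sn_meas.
- exact: Bb_sub.
- move=> A SA; under eq_Rintegral do rewrite mulrBr.
  have BA : Bb (fun w => \1_A w : R) by exact/Bb_ind/(Sn_meas SA).
  by rewrite intB//; [rewrite Hw// subrr|exact: Bb_mul|exact: Bb_mul].
Qed.

(** Exponentials multiply and the indicator is idempotent; [jump_prob setT] is 1, except in an
    absorbing state, where [jump_prob B] vanishes as well. *)
Let wtM n r u B w : measurable B ->
  wt n r B w * wt n u setT w = wt n (u + r) B w.
Proof.
move=> mB; rewrite /wt; set x := X _ w; set i := \1_(_) w.
have ii : i * i = i.
  by rewrite /i indicE; case: (_ \in _); rewrite ?mulr1 ?mulr0.
rewrite mulrDr expRD; set e1 := expR _; set e2 := expR _.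
transitivity (i * i * (jump_prob B x * jump_prob setT x) * (e2 * e1)); first by ring.
by rewrite ii jump_prob_total// !mulrA.
Qed.

Let sj n u := [set w | (Tn n w + u%:E < Tn n.+1 w)%E].

Let msj n u : measurable (sj n u).
Proof.
apply: (measurable_lt_set _ (mTn n.+1)).
by apply: emeasurable_funD => //; exact: measurable_cst.
Qed.

(** Since [wt n (u + r) B] factors as [wt n r B * wt n u setT], the first factor becomes an adapted
    weight and the rate is applied to the second. *)
Let memoryless n u r B A : 0 <= u -> 0 <= r -> measurable B -> Sn n A ->
  \int[P]_w (\1_A w * \1_(jumps n (u + r) B) w) =
  \int[P]_w (\1_A w * (wt n r B w * \1_(sj n u) w)).
Proof.
move=> u0 r0 mB SA; have ur0 : 0 <= u + r by rewrite addr_ge0.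
have [Bw Sw _] := wt_cond n r0 mB.
have BA : Bb (fun w => \1_A w : R) by exact/Bb_ind/(Sn_meas SA).
pose b w := \1_A w * wt n r B w.
have Bb_b : Bb b by exact: Bb_mul.
have b01 w : 0 <= b w <= 1.
  exact: prod01 (indic01 _ _ _) (wt_bounds _ _ _ _).
have Sb x : Sn n [set w | x <= b w].
  apply: (weight_indic (HSn n)) => // w.
  by have /andP[] := wt_bounds n w r0 mB.
have mb := Bb_meas Bb_b.
have E1 : \int[P]_w (b w * wt n u setT w) = \int[P]_w (\1_A w * \1_(jumps n (u + r) B) w).
  under eq_Rintegral do rewrite -mulrA wtM//.
  by have [_ _ ->] := wt_cond n ur0 mB.
have E2 := weighted_rate u0 measurableT b01 Sb mb.
(* Unlike [jumps n u setT], the event [sj n u] contains the paths that never jump again. The rate at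
   [u = 0] shows that the weight [b] carries no mass on them. *)
have E3 := weighted_rate (lexx 0) measurableT b01 Sb mb.
have bwt w : b w * wt n 0 setT w = b w.
  by rewrite -mulrA wtM// add0r.
have Bj v : Bb (fun w => \1_(jumps n v setT) w : R) by exact/Bb_ind/mjumps.
have Bsj v : Bb (fun w => \1_(sj n v) w : R) by exact/Bb_ind/msj.
rewrite -E1 E2; under [RHS]eq_Rintegral do rewrite mulrA -/(b _).
apply/eqP; rewrite eq_le; apply/andP; split.
  apply: int_le => //; [exact: Bb_mul|exact: Bb_mul|] => w.
  apply: ler_wpM2l; first by have /andP[] := b01 w.
  have [jw|jw] := pselect (jumps n u setT w); last by rewrite indicN ?indic_ge0.
  by rewrite !indic1//; case: jw.
rewrite -subr_le0 -intB//; [|exact: Bb_mul|exact: Bb_mul].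
apply: (@le_trans _ _ (\int[P]_w (b w - b w * \1_(jumps n 0 setT) w))).
  apply: int_le => //; [by apply: Bb_sub; exact: Bb_mul|
    by apply: Bb_sub => //; exact: Bb_mul|] => w.
  rewrite -mulrBr -[X in _ <= X - _]mulr1 -mulrBr.
  apply: ler_wpM2l; first by have /andP[] := b01 w.
  have [jw|jw] := pselect (jumps n 0 setT w).
    have [kw|kw] := pselect (sj n u w); last first.
      by rewrite (indicN kw) (indic1 jw) subrr sub0r oppr_le0 indic_ge0.
    rewrite (indic1 kw) (indic1 jw) subrr subr_le0 indic1//.
    by split=> //; case: jw => _ [].
  by rewrite (indicN jw) subr0 lerBlDr (le_trans (indic_le1 _ _ _))// lerDl indic_ge0.
rewrite intB//; last exact: Bb_mul.
by rewrite -E3; under [X in _ - X]eq_Rintegral do rewrite bwt; rewrite subrr.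
Qed.

Let between n s := [set w | (Tn n w <= s%:E < Tn n.+1 w)%E].

(* The position s - T_n is not deterministic: the memoryless property is
   applied at the random time shift u = (s - T_n)^+. *)
Let rate_between n s r B A : 0 <= s -> 0 <= r -> measurable B -> Sn n A ->
  A `<=` [set w | (Tn n w <= s%:E)%E] ->
  \int[P]_w (\1_A w * (\1_[set w | ((s + r)%:E < Tn n.+1 w)%E /\
    (Tn n.+1 w < +oo)%E /\ B (X (fine (Tn n.+1 w)) w)] w -
    wt n r B w * \1_(between n s) w)) = 0.
Proof.
move=> s0 r0 mB SA As.
(* The default 0 keeps [u] adapted with values in [[0, s]]; on [A] the first branch applies. *)
pose u w : R := if (Tn n w <= s%:E)%E then s - fine (Tn n w) else 0.
pose Phi v w : R := \1_(jumps n (v + r) B) w - wt n r B w * \1_(sj n v) w.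
have [Bw Sw _] := wt_cond n r0 mB.
have Bj v : Bb (fun w => \1_(jumps n v B) w : R) by exact/Bb_ind/mjumps.
have Bsj v : Bb (fun w => \1_(sj n v) w : R) by exact/Bb_ind/msj.
have BPhi v : Bb (Phi v) by apply: Bb_sub => //; exact: Bb_mul.
have [|||||| _] := @random_substitution _ _ _ P (Sn n) Phi 2 s u (HSn n)
  (@Sn_meas n) _ _ _ _ _ _ A SA.
- by move=> v; exact: Bb_meas.
- move=> v w; rewrite /Phi; have /andP[? ?] := wt_bounds n w r0 mB.
  have /andP[? ?] := indic01 R (jumps n (v + r) B) w.
  have /andP[? ?] := prod01 (wt_bounds n w r0 mB) (indic01 R (sj n v) w).
  by rewrite ler_norml; apply/andP; split; lra.
- move=> v C v0 SC; rewrite /Phi; under eq_Rintegral do rewrite mulrBr.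
  have BC : Bb (fun w => \1_C w : R) by exact/Bb_ind/(Sn_meas SC).
  rewrite intB//; last 2 first.
  + exact: Bb_mul.
  + by apply: Bb_mul => //; exact: Bb_mul.
  by rewrite memoryless// subrr.
- move=> w v v0.
  have rc (x : R) : exists2 e : R, 0 < e & forall y, x <= y < x + e ->
      (Tn n w + y%:E < Tn n.+1 w)%E = (Tn n w + x%:E < Tn n.+1 w)%E.
    have [->|[a a0 ->]] := jump_time_cases (X_jump w) n.
      by exists 1 => // y _; rewrite !addye.
    have [->|[b b0 ->]] := jump_time_cases (X_jump w) n.+1.
      by exists 1 => // y _; rewrite -!EFinD !ltry.
    have [abx|abx] := ltP (a + x) b; last first.
      exists 1 => // y /andP[xy _]; rewrite -!EFinD !lte_fin !ltNge abx.
      by rewrite (le_trans abx)// lerD2l.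
    exists (b - (a + x)); first by rewrite subr_gt0.
    move=> y /andP[xy yx]; rewrite -!EFinD !lte_fin abx; apply/idP; lra.
  have [e1 e10 H1] := rc (v + r); have [e2 e20 H2] := rc v.
  exists (Num.min e1 e2); first by rewrite lt_min e10.
  move=> y /andP[vy]; rewrite -ltrBlDl lt_min => /andP[ye1 ye2].
  rewrite /Phi; congr (_ - _ * _); apply: indic_congr.
    rewrite /jumps /= H1//; apply/andP; split; lra.
  rewrite /sj /= H2//; apply/andP; split; lra.
- move=> w; rewrite /u; case: ifPn => [Ts|_]; last by rewrite lexx s0.
  have : 0 <= fine (Tn n w) by exact/fine_ge0/jump_time_ge0.
  move: Ts; have [->|[a a0 ->]] := jump_time_cases (X_jump w) n.
    by rewrite leye_eq.
  by rewrite lee_fin => ? _ /=; apply/andP; split; lra.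
- move=> x; have [x0|x0] := leP x 0.
    apply: (sa_true (HSn n)) => w; rewrite /u /=; case: ifPn => // Ts.
    move: Ts; have [->|[a a0 ->]] := jump_time_cases (X_jump w) n.
      by rewrite leye_eq.
    by rewrite lee_fin => /= ?; lra.
  have [sx|sx] := leP 0 (s - x); last first.
    apply: (sa_false (HSn n)) => w; rewrite /u /=; case: ifPn; last by lra.
    have [->|[a a0 ->]] := jump_time_cases (X_jump w) n.
      by rewrite leye_eq.
    by rewrite lee_fin => /= ? ?; lra.
  apply: (sa_iff (HSn n) (B := [set w | (Tn n w <= (s - x)%:E)%E])); last first.
    exact: (stopped_jump_time_le P_complete US).
  move=> w; rewrite /u /=.
  have [->|[a a0 ->]] := jump_time_cases (X_jump w) n.
    by rewrite !leye_eq /=; split => //; lra.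
  rewrite !lee_fin /=; case: ifPn => [? |/negP ?]; split; lra.
move=> H; rewrite -[RHS]H; apply: eq_Rintegral => w _.
have [Aw|nAw] := pselect (A w); last by rewrite (indicN nAw) !mul0r.
congr (_ * _); have := As _ Aw; rewrite /= /Phi /u => Ts; rewrite Ts.
move: Ts; have [->|[a a0 Ta]] := jump_time_cases (X_jump w) n.
  by rewrite leye_eq.
rewrite Ta lee_fin /= => as_; congr (_ - _ * _); apply: indic_congr.
  by rewrite /jumps /= Ta -EFinD (_ : a + (s - a + r) = s + r)//; ring.
by rewrite /sj /between /= Ta -EFinD lee_fin as_ subrKC.
Qed.

Lemma measurable_rate B : measurable B ->
  measurable_fun setT (fun x => fine (lam x B)).
Proof.
by move=> mB; apply: measurableT_comp (fine_measurable measurableT) _;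
  exact: measurable_kernel.
Qed.

Lemma Bb_total_rate : Bb total_rate.
Proof.
apply: (Bb_le (M := L)); first exact: measurable_rate.
by move=> x; have /andP[? ?] := total_rate_bounds x; rewrite ger0_norm.
Qed.

Lemma Bb_jump_prob B : measurable B -> Bb (jump_prob B).
Proof.
move=> mB; apply: (Bb_le (M := 1)).
  apply: measurable_funM; first exact: measurable_rate.
  by apply: measurable_funV; exact: measurable_rate.
by move=> x; have /andP[? ?] := jump_prob_bounds x mB; rewrite ger0_norm.
Qed.

Lemma Bb_exp_rate r : 0 <= r -> Bb (fun x => expR (- total_rate x * r)).
Proof.
move=> r0; apply: (Bb_le (M := 1)).
  apply: measurableT_comp => //; apply: measurable_funM => //.
  by apply: measurableT_comp => //; exact: (Bb_meas Bb_total_rate).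
by move=> x; have /andP[? ?] := exp_rate_le1 x r0; rewrite ger0_norm.
Qed.

Lemma Bb_at t (f : E -> R) : 0 <= t -> Bb f -> Bb (fun w => f (X t w)).
Proof.
move=> t0 /BbP[mf [M fM]]; apply: (Bb_le (M := M)) => //.
exact: measurableT_comp mf (X_meas t0).
Qed.

Local Notation fj s w := (first_jump (X^~ w) s).

Let mfj s : 0 <= s -> measurable_fun setT (fun w => fj s w).
Proof. exact: (first_jump_measurable P_complete US). Qed.

Let fine_fj_ge0 s w : 0 <= s -> 0 <= fine (fj s w).
Proof.
move=> s0; apply: fine_ge0; apply: le_trans (ltW (first_jump_gt (X_jump w) s0)).
by rewrite lee_fin.
Qed.

Lemma jump_target_measurable s : 0 <= s ->
  measurable_fun setT (fun w => X (fine (fj s w)) w).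
Proof.
move=> s0; apply: evaluation_measurable => // [w|]; first exact: fine_fj_ge0.
by apply: measurableT_comp (fine_measurable measurableT) _; exact: mfj.
Qed.

Definition jumped s r B := [set w | ((s + r)%:E < fj s w)%E /\ (fj s w < +oo)%E /\
  B (X (fine (fj s w)) w)].

Let mjumped s r B : 0 <= s -> measurable B -> measurable (jumped s r B).
Proof.
move=> s0 mB; apply: (sa_and HM).
  by apply: measurable_lt_set (mfj s0); exact: measurable_cst.
apply: (sa_and HM); first by apply: measurable_lt_set (mfj s0) _; exact: measurable_cst.
rewrite -[X in measurable X]setTI; exact: jump_target_measurable.
Qed.

Let Fmeas t A : F t A -> measurable A.
Proof. exact: (filtration_measurable P_complete X_meas). Qed.

Let mbetween n s : measurable (between n s).
Proof. apply: Fmeas; exact: (filtration_between P US X_jump n s). Qed.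

Let trivbetween s A : trivIset setT (fun n => A `&` between n s).
Proof.
by move=> i j _ _ [w [[_ wi] [_ wj]]]; exact: (jump_time_locate_unique (X_jump w) wi wj).
Qed.

Let bigbetween s A : 0 <= s -> \bigcup_n (A `&` between n s) = A.
Proof.
move=> s0; apply/seteqP; split => w; first by case=> n _ [].
by move=> Aw; have [n wn] := jump_time_locate (X_jump w) s0; exists n.
Qed.

(** Split according to the number [n] of jumps up to [s]. On each piece [A] agrees with a set known
    at the [n]-th jump, [X s] is the position at that jump, and the first jump after [s] is the next
    one. *)
Lemma first_jump_rate s r B A : 0 <= s -> 0 <= r -> measurable B -> F s A ->
  \int[P]_w (\1_A w * (\1_(jumped s r B) w -
    jump_prob B (X s w) * expR (- total_rate (X s w) * r))) = 0.
Proof.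
move=> s0 r0 mB FA; rewrite -{1}(bigbetween A s0).
have BU : Bb (fun w => \1_(jumped s r B) w -
    jump_prob B (X s w) * expR (- total_rate (X s w) * r)).
  apply: Bb_sub; first exact/Bb_ind/mjumped.
  by apply: Bb_mul; [exact: Bb_at (Bb_jump_prob mB)|exact: Bb_at (Bb_exp_rate r0)].
apply: int_eq0_bigcup => //; first by move=> n; apply: measurableI; [exact: Fmeas FA|].
move=> n; have [A' SA' AA'] := trace_stopped P_complete US X_meas X_jump n s0 FA.
pose A'' := A' `&` [set w | (Tn n w <= s%:E)%E].
have SA'' : Sn n A''.
  by apply: (sa_setI (HSn n)) => //; exact: (stopped_jump_time_le P_complete US).
have sub : A'' `<=` [set w | (Tn n w <= s%:E)%E] by move=> w [].
rewrite -[RHS](rate_between s0 r0 mB SA'' sub); apply: eq_Rintegral => w _.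
have [wb|wb] := pselect (between n s w); last first.
  rewrite indicN; last by case.
  have [Aw|Aw] := pselect (A'' w); last by rewrite (indicN Aw) !mul0r.
  set C := [set w | ((s + r)%:E < Tn n.+1 w)%E /\ _].
  suff nC : ~ C w by rewrite (indicN wb) (indicN nC) mulr0 subr0 mulr0 mul0r.
  move=> -[H _]; apply: wb; rewrite /between /= (sub _ Aw); apply: le_lt_trans H.
  by rewrite lee_fin lerDl.
have -> : \1_(A `&` between n s) w = \1_A'' w :> R.
  apply: indic_congr; rewrite -/(between n s) in AA'; rewrite AA'; split.
    by move=> [? /andP[? _]].
  by move=> [].
have fjT := jump_time_first_jump (X_jump w) wb.
have Xs := jump_time_const (X_jump w) wb.
rewrite (indic1 wb) mulr1 /wt (@indic1 _ _ [set w | (Tn n w < +oo)%E]) /=; last first.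
  by case/andP: wb => Ts _; rewrite (le_lt_trans Ts)// ltry.
rewrite mul1r -Xs; congr (_ * (_ - _)); apply: indic_congr.
by rewrite /jumped /= fjT.
Qed.

Definition two_jumps s r := [set w | (fj s w <= (s + r)%:E)%E /\
  (first_jump (X^~ w) (fine (fj s w)) <= (s + r)%:E)%E].

Definition bounded_jump s r := [set w | (fj s w <= (s + r)%:E)%E].

Let mbounded_jump s r : 0 <= s -> measurable (bounded_jump s r).
Proof. by move=> s0; apply: Fmeas (filtration_first_jump_le P US X_jump _ s0). Qed.

Let bounded_jumpE s r B w : 0 <= s -> 0 <= r ->
  \1_(bounded_jump s r) w * \1_B (X (fine (fj s w)) w) =
  \1_(jumped s 0 B) w - \1_(jumped s r B) w :> R.
Proof.
move=> s0 r0; have [fi|[u su fu]] := first_jump_cases (X_jump w) s0.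
  rewrite indicN ?mul0r; last by rewrite /bounded_jump /= fi leye_eq.
  by rewrite !indicN ?subrr// /jumped /= fi => -[_ []].
have [ur|ru] := leP u (s + r).
  rewrite indic1 ?mul1r; last by rewrite /bounded_jump /= fu lee_fin.
  rewrite (@indicN _ _ (jumped s r B)) ?subr0; last first.
    by rewrite /jumped /= fu lte_fin ltNge ur => -[].
  apply: indic_congr; rewrite /jumped /= fu lte_fin addr0 su ltry.
  by split=> [|[_ []]].
rewrite indicN ?mul0r; last by rewrite /bounded_jump /= fu lee_fin leNgt ru.
apply/esym/eqP; rewrite subr_eq0; apply/eqP/indic_congr.
by rewrite /jumped /= fu !lte_fin addr0 su ru.
Qed.

Lemma bounded_jump_rate s r B A : 0 <= s -> 0 <= r -> measurable B -> F s A ->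
  \int[P]_w (\1_A w * (\1_(bounded_jump s r) w * \1_B (X (fine (fj s w)) w))) =
  \int[P]_w (\1_A w * (jump_prob B (X s w) *
    (1 - expR (- total_rate (X s w) * r)))).
Proof.
move=> s0 r0 mB FA.
have BA : Bb (fun w => \1_A w : R) by exact/Bb_ind/Fmeas/FA.
have BV v : 0 <= v -> Bb (fun w => \1_A w * (\1_(jumped s v B) w -
    jump_prob B (X s w) * expR (- total_rate (X s w) * v))).
  move=> v0; apply: Bb_mul => //; apply: Bb_sub; first exact/Bb_ind/mjumped.
  by apply: Bb_mul; [exact: Bb_at (Bb_jump_prob mB)|exact: Bb_at (Bb_exp_rate v0)].
have E0 := first_jump_rate s0 (lexx 0) mB FA.
have Er := first_jump_rate s0 r0 mB FA.
have BJ v : Bb (fun w => \1_(jumped s v B) w : R) by exact/Bb_ind/mjumped.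
have BR : Bb (fun w => \1_A w * (jump_prob B (X s w) *
    (1 - expR (- total_rate (X s w) * r)))).
  apply: Bb_mul => //; apply: Bb_mul; first exact: Bb_at (Bb_jump_prob mB).
  by apply: Bb_sub; [exact: Bb_const|exact: Bb_at (Bb_exp_rate r0)].
apply/eqP; rewrite -subr_eq0; apply/eqP.
under [X in X - _]eq_Rintegral do rewrite bounded_jumpE//.
rewrite -intB//; last by apply: Bb_mul => //; exact: Bb_sub.
transitivity (\int[P]_w (\1_A w * (\1_(jumped s 0 B) w -
    jump_prob B (X s w) * expR (- total_rate (X s w) * 0)) -
   \1_A w * (\1_(jumped s r B) w -
    jump_prob B (X s w) * expR (- total_rate (X s w) * r)))).
  by apply: eq_Rintegral => w _; rewrite mulr0 expR0; ring.
rewrite intB//; [by rewrite E0 Er subrr|exact: BV|exact: BV].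
Qed.

Lemma bounded_jump_le s r A : 0 <= s -> 0 <= r -> F s A ->
  \int[P]_w (\1_A w * \1_(bounded_jump s r) w) <= L * r * \int[P]_w \1_A w.
Proof.
move=> s0 r0 FA; have BA : Bb (fun w => \1_A w : R) by exact/Bb_ind/Fmeas/FA.
have := bounded_jump_rate s0 r0 measurableT FA.
under eq_Rintegral do rewrite (@indic1 _ _ [set: E])// mulr1.
move=> ->; rewrite -intZ//; apply: int_le => //.
- apply: Bb_mul => //; apply: Bb_mul; first exact: Bb_at (Bb_jump_prob _).
  by apply: Bb_sub; [exact: Bb_const|exact: Bb_at (Bb_exp_rate r0)].
- by apply: Bb_mul => //; exact: Bb_const.
move=> w; rewrite mulrC; apply: ler_wpM2r; first exact: indic_ge0.
have /andP[l0 lL] := total_rate_bounds (X s w).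
have [/andP[e0 e1] _] := exp_second_order (mulr_ge0 l0 r0).
have /andP[q0 q1] := jump_prob_bounds (X s w) measurableT.
rewrite -mulNr in e0 e1.
apply: (@le_trans _ _ (total_rate (X s w) * r)); last exact: ler_wpM2r.
by apply: le_trans e1; rewrite ler_piMl.
Qed.

Lemma two_jumps_measurable s r : 0 <= s -> measurable (two_jumps s r).
Proof.
move=> s0; apply: (sa_iff HM (B := [set w | exists n,
  (Tn n w <= s%:E < Tn n.+1 w)%E /\ (Tn n.+2 w <= (s + r)%:E)%E])).
  move=> w; split.
    move=> [H1 H2]; have [n wn] := jump_time_locate (X_jump w) s0; exists n; split=> //.
    have fjT := jump_time_first_jump (X_jump w) wn; rewrite fjT in H1 H2.
    case: (jump_time_cases (X_jump w) n.+1) H1 H2 => [->|[u u0 Tu]]; first by rewrite leye_eq.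
    by rewrite (jump_timeS Tu) Tu.
  move=> [n [wn Tr]]; have fjT := jump_time_first_jump (X_jump w) wn.
  have T1 : (Tn n.+1 w <= (s + r)%:E)%E.
    exact: le_trans (jump_time_le (X_jump w) _) Tr.
  split; rewrite fjT //.
  case: (jump_time_cases (X_jump w) n.+1) T1 => [->|[u u0 Tu] _]; first by rewrite leye_eq.
  by rewrite (jump_timeS Tu) in Tr; rewrite Tu.
apply: (sa_exn HM) => n; apply: (sa_and HM); first exact: mbetween.
by apply: Fmeas (filtration_jump_time_le P US X_jump _ _).
Qed.

(** The second jump is counted from a random time, so its rate is taken from [has_rate] at index
    [n.+1], the first jump after [s]: one more jump within [r] costs a factor [L * r], on top of the
    factor given by [bounded_jump_le]. *)
Lemma two_jumps_le s r A : 0 <= s -> 0 <= r -> F s A ->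
  \int[P]_w (\1_A w * \1_(two_jumps s r) w) <= (L * r) ^+ 2 * \int[P]_w \1_A w.
Proof.
move=> s0 r0 FA; have mA := Fmeas FA.
have BA : Bb (fun w => \1_A w : R) by exact/Bb_ind.
have B2 : Bb (fun w => \1_(two_jumps s r) w : R) by exact/Bb_ind/two_jumps_measurable.
have B1 : Bb (fun w => \1_(bounded_jump s r) w : R) by exact/Bb_ind/mbounded_jump.
have L0 := rate_bound_ge0; have Lr0 : 0 <= L * r by rewrite mulr_ge0.
pose D w : R := \1_(two_jumps s r) w - L * r * \1_(bounded_jump s r) w.
have BD : Bb D by apply: Bb_sub => //; apply: Bb_mul => //; exact: Bb_const.
suff H : \int[P]_w (\1_A w * D w) <= 0.
  have : \int[P]_w (\1_A w * \1_(two_jumps s r) w) <=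
      L * r * \int[P]_w (\1_A w * \1_(bounded_jump s r) w).
    rewrite -subr_le0 -intZ//; last exact: Bb_mul.
    rewrite -intB//; [|exact: Bb_mul|by apply: Bb_mul; [exact: Bb_const|exact: Bb_mul]].
    by apply: le_trans H; apply: le_of_eq; apply: eq_Rintegral => w _; rewrite /D; ring.
  move=> /le_trans; apply; rewrite expr2 -(mulrA (L * r)).
  by apply: ler_wpM2l => //; exact: bounded_jump_le.
rewrite -{1}(bigbetween A s0); apply: int_le0_bigcup => //.
  by move=> n; exact: measurableI.
move=> n; pose C := (A `&` between n s) `&` [set w | (Tn n.+1 w <= (s + r)%:E)%E].
have sr : s <= s + r by rewrite lerDl.
have FC : F (s + r) C.
  apply: (sa_setI (HF _)); last exact: (filtration_jump_time_le P US X_jump).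
  apply: filtration_mono sr _; apply: (sa_setI (HF _)) => //.
  exact: (filtration_between P US X_jump n s).
(* [C] is known at the jump of index [n.+1] because on [C] this jump comes after [s]. *)
have SC : Sn n.+1 C.
  split; first exact: Fmeas FC.
  move=> t t0; have [ts|st] := leP t s.
    apply: (sa_false (HF _)) => w [[[_ /andP[_ sT]] _] Tt].
    by have := lt_le_trans sT Tt; rewrite lte_fin ltNge ts.
  apply: (sa_iff (HF t) (B := (A `&` between n s) `&`
     [set w | (Tn n.+1 w <= (Num.min t (s + r))%:E)%E])).
    move=> w; rewrite /C /= EFin_min le_min; split.
      by move=> [[? ->] ->].
    by move=> [? /andP[-> ->]].
  apply: (sa_setI (HF _)).
    apply: filtration_mono (ltW st) _; apply: (sa_setI (HF _)) => //.
    exact: (filtration_between P US X_jump n s).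
  apply: filtration_mono (filtration_jump_time_le P US X_jump _ _).
  by rewrite ge_min lexx.
have [Bw0 _ H0] := wt_cond n.+1 (lexx 0) measurableT.
have [Bwr _ Hr] := wt_cond n.+1 r0 measurableT.
have BC : Bb (fun w => \1_C w : R) by exact/Bb_ind/Fmeas/FC.
have BJ v : Bb (fun w => \1_(jumps n.+1 v setT) w : R) by exact/Bb_ind/mjumps.
(* Two jumps up to [s + r] force a finite waiting time of at most [r] after the jump [n.+1];
   [two_jumps] is enlarged to that event, whose conditional probability is explicit. *)
apply: (@le_trans _ _ (\int[P]_w (\1_C w * (\1_(jumps n.+1 0 setT) w -
   \1_(jumps n.+1 r setT) w) - L * r * \1_C w))).
  apply: int_le => //.
  + by apply: Bb_mul => //; apply: Bb_ind; exact: measurableI.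
  + apply: Bb_sub; first by apply: Bb_mul => //; exact: Bb_sub.
    by apply: Bb_mul => //; exact: Bb_const.
  move=> w; have [Aw|Aw] := pselect ((A `&` between n s) w); last first.
    rewrite (indicN Aw) (indicN (A := C)) ?mul0r ?mulr0 ?subr0//.
    by move=> [].
  have fjT := jump_time_first_jump (X_jump w) Aw.2.
  rewrite (indic1 Aw) mul1r /D.
  have -> : \1_C w = \1_(bounded_jump s r) w :> R.
    apply: indic_congr; rewrite /C /bounded_jump /= fjT.
    by split=> [[]|].
  rewrite lerD2r.
  have [w2|w2] := pselect (two_jumps s r w); last first.
    rewrite (indicN w2) mulr_ge0 ?indic_ge0// subr_ge0.
    have [jw|jw] := pselect (jumps n.+1 r setT w); last by rewrite (indicN jw) indic_ge0.
    rewrite (indic1 jw) indic1//; case: jw => j1 [j2 _]; split=> //.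
    apply: le_lt_trans j1; apply: leeD => //.
  have w1 : bounded_jump s r w by case: w2.
  rewrite (indic1 w2) (indic1 w1) mul1r; case: w2 => _; rewrite fjT.
  case: (jump_time_cases (X_jump w) n.+1) => [Ti|[u u0 Tu]].
    by rewrite /bounded_jump /= fjT Ti leye_eq in w1.
  have su : s < u by case: Aw => _ /andP[_]; rewrite Tu lte_fin.
  rewrite Tu /= -(jump_timeS Tu) => T2.
  rewrite indic1; last first.
    split; last by split=> //; rewrite (le_lt_trans T2) ?ltry.
    by rewrite adde0; apply: (jump_time_lt (X_jump w)); rewrite Tu ltry.
  rewrite indicN ?subr0// => -[+ _]; rewrite Tu -EFinD => /lt_le_trans/(_ T2).
  by rewrite lte_fin ltrD2r ltNge (ltW su).
have wle w : wt n.+1 0 setT w - wt n.+1 r setT w <= L * r.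
  rewrite /wt -mulrBr; set x := X _ w; rewrite mulr0 expR0 -mulrBr.
  have /andP[l0 lL] := total_rate_bounds x.
  have [/andP[e0 e1] _] := exp_second_order (mulr_ge0 l0 r0).
  have /andP[q0 q1] := jump_prob_bounds x measurableT.
  rewrite -mulNr in e0 e1.
  have p0 : 0 <= jump_prob setT x * (1 - expR (- total_rate x * r)) by rewrite mulr_ge0.
  apply: (le_trans (ler_piMl p0 (indic_le1 _ _ _))).
  apply: (@le_trans _ _ (total_rate x * r)); last exact: ler_wpM2r.
  by apply: le_trans e1; rewrite ler_piMl.
apply: (@le_trans _ _ (\int[P]_w (\1_C w * (wt n.+1 0 setT w - wt n.+1 r setT w) -
   L * r * \1_C w))).
  apply: le_of_eq.
  have BLC : Bb (fun w => L * r * \1_C w) by apply: Bb_mul => //; exact: Bb_const.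
  rewrite intB//; last by apply: Bb_mul => //; exact: Bb_sub.
  rewrite intB//; last by apply: Bb_mul => //; exact: Bb_sub.
  congr (_ - _); under eq_Rintegral do rewrite mulrBr.
  under [RHS]eq_Rintegral do rewrite mulrBr.
  rewrite intB//; [|exact: Bb_mul|exact: Bb_mul].
  rewrite intB//; [|exact: Bb_mul|exact: Bb_mul].
  by rewrite H0// Hr.
rewrite -[leRHS](mul0r (fine (P setT))) -(int_cst P); apply: int_le => //.
- apply: Bb_sub; first by apply: Bb_mul => //; exact: Bb_sub.
  by apply: Bb_mul => //; exact: Bb_const.
- exact: Bb_const.
move=> w; rewrite [L * r * _]mulrC -mulrBr mulr_ge0_le0 ?indic_ge0//.
by rewrite subr_le0.
Qed.

(** The integral of [expR (- total_rate x * u)] over [u] in [[0, r]], that is, the mean time spent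
    at [x] before the jump or the time [r]. At rate 0 the value is 0 instead of [r], which is
    harmless: it only multiplies integrals against [lam x], then the zero measure. *)
Definition clock_weight r (x : E) : R :=
  (1 - expR (- total_rate x * r)) / total_rate x.

Let clock_weightM r x : 0 <= r ->
  clock_weight r x * total_rate x = 1 - expR (- total_rate x * r).
Proof.
move=> r0; rewrite /clock_weight; have [->|l0] := eqVneq (total_rate x) 0.
  by rewrite mulr0 oppr0 mul0r expR0 subrr.
by rewrite divfK.
Qed.

Let Bb_clock_weight r : 0 <= r -> Bb (clock_weight r).
Proof.
move=> r0; apply: (Bb_le (M := r)).
  apply: measurable_funM; last exact/measurable_funV/(Bb_meas Bb_total_rate).
  by apply: Bb_meas; apply: Bb_sub; [exact: Bb_const|exact: Bb_exp_rate].
move=> x; have /andP[l0 lL] := total_rate_bounds x.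
have [/andP[e0 e1] _] := exp_second_order (mulr_ge0 l0 r0).
rewrite -mulNr in e0 e1; rewrite /clock_weight ger0_norm ?divr_ge0//.
have [->|l1] := eqVneq (total_rate x) 0; first by rewrite invr0 mulr0.
by rewrite ler_pdivrMr ?lt0r ?l1// [r * _]mulrC.
Qed.

(** The rectangles needed by [conditional_law] come from [bounded_jump_rate] on [A] cut by a
    condition on [X s]; [jump_prob B x * (1 - expR (- total_rate x * r))] regroups as
    [clock_weight r x] times [lam x B]. *)
Lemma jump_law s r A (g : E * E -> R) : 0 <= s -> 0 <= r -> F s A -> Bb g ->
  \int[P]_w (\1_A w * \1_(bounded_jump s r) w * g (X s w, X (fine (fj s w)) w)) =
  \int[P]_w (\1_A w * clock_weight r (X s w) * \int[lam (X s w)]_z g (X s w, z)).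
Proof.
move=> s0 r0 FA Bg; have mA := Fmeas FA.
have BA : Bb (fun w => \1_A w : R) by exact/Bb_ind.
apply: (@conditional_law _ _ _ Om E E R P (X s) (fun w => X (fine (fj s w)) w)
  (fun w => lam (X s w)) _ _ L (X_meas s0) (jump_target_measurable s0) _ _ _ _ _ g Bg).2.
- by move=> w; exact: lamL.
- by move=> B mB; exact: (measurableT_comp (measurable_kernel lam B mB) (X_meas s0)).
- by apply: Bb_mul => //; exact/Bb_ind/mbounded_jump.
- by apply: Bb_mul => //; exact: Bb_at (Bb_clock_weight r0).
move=> A0 B mA0 mB.
have FA0 : F s (A `&` [set w | A0 (X s w)]).
  by apply: (sa_setI (HF s)) => //; apply: filtration_gen => //; rewrite s0 lexx.
have := bounded_jump_rate s0 r0 mB FA0.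
under eq_Rintegral => w _.
  rewrite -indicM (_ : \1_[set w0 | A0 (X s w0)] w = \1_A0 (X s w)); last exact: indic_congr.
  rewrite (_ : _ * _ = \1_A w * \1_(bounded_jump s r) w *
    (\1_A0 (X s w) * \1_B (X (fine (fj s w)) w))); last by ring.
  over.
move=> ->; apply: eq_Rintegral => w _.
rewrite -indicM (_ : \1_[set w0 | A0 (X s w0)] w = \1_A0 (X s w)); last exact: indic_congr.
rewrite /jump_prob /clock_weight; ring.
Qed.

Lemma kernel_integral_bound x (f : E -> R) c : Bb f -> (forall z, `|f z| <= c) ->
  `|\int[lam x]_z f z| <= c * total_rate x.
Proof. by move=> Bf fc; exact: (int_bound (rate_fin x)). Qed.

Lemma Bb_kernel_pair (g : E * E -> R) : Bb g ->
  Bb (fun x => \int[lam x]_z g (x, z)).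
Proof.
move=> Bg.
(* With zero weights, only the measurability clause of [conditional_law] is kept. *)
apply: (@conditional_law _ _ _ E E E R (dirac (point : E)) id id (fun x => lam x)
  (fun=> 0) (fun=> 0) L _ _ _ _ _ _ _ g Bg).1 => //; try exact: Bb_const.
- by move=> B mB; exact: measurable_kernel.
- by move=> A B mA mB; apply: eq_Rintegral => x _; rewrite !mul0r.
Qed.

Lemma Bb_pair1 (g : E * E -> R) x : Bb g -> Bb (fun z => g (x, z)).
Proof.
move=> /BbP[mg [M gM]]; apply/BbP; split; last by exists M => w.
by apply: (measurableT_comp mg); exact: measurable_pair1.
Qed.

(** Replacing [clock_weight r] by [r] costs, once multiplied by the rate [l], the quantity [|1 -
    expR (- (l * r)) - l * r| <= (l * r) ^+ 2]. *)
Lemma jump_estimate s r A (g : E * E -> R) c : 0 <= s -> 0 <= r -> F s A ->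
  Bb g -> (forall p, `|g p| <= c) ->
  `|\int[P]_w (\1_A w * (\1_(bounded_jump s r) w * g (X s w, X (fine (fj s w)) w) -
     r * \int[lam (X s w)]_z g (X s w, z)))| <= c * (L * r) ^+ 2 * \int[P]_w \1_A w.
Proof.
move=> s0 r0 FA Bg gc; have mA := Fmeas FA.
have BA : Bb (fun w => \1_A w : R) by exact/Bb_ind.
have Bbj : Bb (fun w => \1_(bounded_jump s r) w : R) by exact/Bb_ind/mbounded_jump.
have Bk := Bb_kernel_pair Bg.
have BkX : Bb (fun w => \int[lam (X s w)]_z g (X s w, z)) by exact: Bb_at Bk.
have BgX : Bb (fun w => g (X s w, X (fine (fj s w)) w)).
  move: Bg => /BbP[mg [M gM]]; apply/BbP; split; last by exists M => w.
  apply: (measurableT_comp mg); apply: measurable_fun_pair; first exact: X_meas.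
  exact: jump_target_measurable.
have Bc : Bb (fun w => clock_weight r (X s w)) by exact: Bb_at (Bb_clock_weight r0).
have -> : \int[P]_w (\1_A w * (\1_(bounded_jump s r) w * g (X s w, X (fine (fj s w)) w) -
     r * \int[lam (X s w)]_z g (X s w, z))) =
   \int[P]_w (\1_A w * ((clock_weight r (X s w) - r) *
       \int[lam (X s w)]_z g (X s w, z))).
  have BrX : Bb (fun w => \1_A w * (r * \int[lam (X s w)]_z g (X s w, z))).
    by apply: Bb_mul => //; apply: Bb_mul => //; exact: Bb_const.
  under eq_Rintegral do rewrite mulrBr mulrA.
  rewrite intB//; last by apply: Bb_mul => //; exact: Bb_mul.
  rewrite jump_law// -intB//; last by apply: Bb_mul => //; exact: Bb_mul.
  by apply: eq_Rintegral => w _; ring.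
rewrite -intZ//; apply: int_norm_le => //.
- by apply: Bb_mul => //; apply: Bb_mul => //; apply: Bb_sub => //; exact: Bb_const.
- by apply: Bb_mul => //; exact: Bb_const.
move=> w; rewrite !normrM (ger0_norm (indic_ge0 _ _ _)) mulrC ler_wpM2r ?indic_ge0//.
set x := X s w; have /andP[l0 lL] := total_rate_bounds x.
have c0 : 0 <= c by exact: le_trans (gc point).
apply: (@le_trans _ _ (`|clock_weight r x - r| * (c * total_rate x))).
  apply: ler_wpM2l => //; apply: kernel_integral_bound => //; exact: Bb_pair1.
have -> : `|clock_weight r x - r| * (c * total_rate x) =
    c * `|1 - expR (- (total_rate x * r)) - total_rate x * r|.
  rewrite mulrCA; congr (_ * _); rewrite -[X in _ * X](ger0_norm l0) -normrM.
  by rewrite mulrBl clock_weightM// mulNr [r * _]mulrC.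
apply: ler_wpM2l => //.
apply: (le_trans (exp_second_order (mulr_ge0 l0 r0)).2).
by rewrite ler_sqr ?nnegrE ?mulr_ge0 ?rate_bound_ge0// ler_wpM2r.
Qed.

(** * Jumps of [X] that the observation sees, and jumps that it misses *)

Variables (d2 : measure_display) (O : measurableType d2) (V : (set O)^nat).
Hypothesis VS : separates_points V.
Variable h : E -> O.
Hypothesis mh : measurable_fun setT h.

Definition same_fibre := [set p : E * E | h p.1 = h p.2].

Lemma measurable_same_fibre : measurable same_fibre.
Proof.
have HM2 := @sigma_algebra_measurable _ (E * E)%type.
apply: (sa_iff HM2 (B := [set p | ~ exists k, V k (h p.1) /\ ~ V k (h p.2)])).
  move=> p /=; split=> [-> [k []//]|H].
  by apply: contrapT => /(VS.2)[k Hk]; apply: H; exists k.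
apply: (sa_not HM2); apply: (sa_exn HM2) => k; apply: (sa_and HM2).
  rewrite -[X in measurable X]setTI.
  by apply: (measurableT_comp mh (@measurable_fst _ _ E E)) => //; exact: VS.1.
apply: (sa_not HM2); rewrite -[X in measurable X]setTI.
by apply: (measurableT_comp mh (@measurable_snd _ _ E E)) => //; exact: VS.1.
Qed.

(** The operator [K] of the overview. For the constant function 1 it is the opposite of [leave]:
    mass is lost at the rate at which the observation jumps. *)
Definition stay (f : E -> R) (x : E) : R :=
  \int[lam x]_z (\1_same_fibre (x, z) * f z - f x).

(** At an indicator of [B], the intensity with which [X] jumps from [x] into [B] while the
    observation jumps. *)
Definition leave (f : E -> R) (x : E) : R :=
  \int[lam x]_z (\1_(~` same_fibre) (x, z) * f z).

Let Bstay f : Bb f -> Bb (fun p : E * E => \1_same_fibre p * f p.2 - f p.1).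
Proof.
move=> /BbP[mf [M fM]].
have B2 : Bb (fun p : E * E => f p.2).
  by apply: (Bb_le (M := M)) => //; exact: measurableT_comp mf (@measurable_snd _ _ E E).
have B1 : Bb (fun p : E * E => f p.1).
  by apply: (Bb_le (M := M)) => //; exact: measurableT_comp mf (@measurable_fst _ _ E E).
by apply: Bb_sub B1; apply: Bb_mul B2; apply: Bb_ind; exact: measurable_same_fibre.
Qed.

Let Bleave f : Bb f -> Bb (fun p : E * E => \1_(~` same_fibre) p * f p.2).
Proof.
move=> /BbP[mf [M fM]].
have B2 : Bb (fun p : E * E => f p.2).
  by apply: (Bb_le (M := M)) => //; exact: measurableT_comp mf (@measurable_snd _ _ E E).
by apply: Bb_mul B2; exact: (Bb_ind _ (measurableC measurable_same_fibre)).
Qed.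

Lemma Bb_stay f : Bb f -> Bb (stay f).
Proof. by move=> Bf; exact: (Bb_kernel_pair (Bstay Bf)). Qed.

Lemma Bb_leave f : Bb f -> Bb (leave f).
Proof. by move=> Bf; exact: (Bb_kernel_pair (Bleave Bf)). Qed.

Let stay_bound2 f c : (forall x, `|f x| <= c) ->
  forall p : E * E, `|\1_same_fibre p * f p.2 - f p.1| <= 2 * c.
Proof.
move=> fc p; rewrite (le_trans (ler_normB _ _))// mulr_natl mulr2n lerD//.
by rewrite normrM (le_trans _ (fc p.2))// ler_piMl// indic_norm_le1.
Qed.

Let leave_bound1 f c : (forall x, `|f x| <= c) ->
  forall p : E * E, `|\1_(~` same_fibre) p * f p.2| <= c.
Proof.
move=> fc p.
by rewrite normrM (le_trans _ (fc p.2))// ler_piMl// indic_norm_le1.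
Qed.

Lemma stay_bound f c x : Bb f -> (forall x, `|f x| <= c) -> `|stay f x| <= 2 * c * L.
Proof.
move=> Bf fc; have c0 : 0 <= c by exact: le_trans (fc point).
have := kernel_integral_bound x (Bb_pair1 x (Bstay Bf)) (fun z => stay_bound2 fc (x, z)).
move=> /le_trans; apply; rewrite ler_wpM2l ?mulr_ge0//.
by have /andP[] := total_rate_bounds x.
Qed.

Lemma leave_bound f c x : Bb f -> (forall x, `|f x| <= c) -> `|leave f x| <= c * L.
Proof.
move=> Bf fc; have c0 : 0 <= c by exact: le_trans (fc point).
have := kernel_integral_bound x (Bb_pair1 x (Bleave Bf)) (fun z => leave_bound1 fc (x, z)).
move=> /le_trans; apply; rewrite ler_wpM2l//.
by have /andP[] := total_rate_bounds x.
Qed.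

Local Notation yj s w := (first_jump (fun t => h (X t w)) s).

Definition no_obs_jump s r := [set w | ((s + r)%:E < yj s w)%E].

Lemma obs_path_jump w : pure_jump_path (fun t => h (X t w)).
Proof.
move=> t t0; have [H1 H2] := X_jump w t0; split.
  by apply: filterS H1 => u /= ->.
move=> tp; have [a Ha] := H2 tp; exists (h a).
by apply: filterS Ha => u /= ->.
Qed.

Let one_jump s r w u : 0 <= s -> fj s w = u%:E -> u <= s + r ->
  ~ two_jumps s r w ->
  [/\ s < u, forall v, s <= v < u -> X v w = X s w &
    forall v, u <= v <= s + r -> X v w = X u w].
Proof.
move=> s0 fu ur nt; have su : s < u by rewrite -lte_fin -fu first_jump_gt.
split=> //.
  by move=> v /andP[sv vu]; apply: (@first_jump_const _ _ (X^~ w) s v sv); rewrite fu lte_fin.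
move=> v /andP[uv vr]; apply: (@first_jump_const _ _ (X^~ w) u v uv).
rewrite ltNge; apply/negP => H; apply: nt; rewrite /two_jumps /= fu lee_fin ur; split=> //.
by rewrite (le_trans H)// lee_fin.
Qed.

Let one_jump_obs s r w u : 0 <= s -> fj s w = u%:E -> u <= s + r ->
  ~ two_jumps s r w ->
  if pselect (h (X u w) = h (X s w)) then no_obs_jump s r w else yj s w = u%:E.
Proof.
move=> s0 fu ur nt; have [su H1 H2] := one_jump s0 fu ur nt.
have HY := obs_path_jump w; case: pselect => [e|ne] /=.
  rewrite /no_obs_jump /= ltNge; apply/negP => /(first_jump_leP HY _ s0)[v /andP[sv vr]].
  by have [vu|uv] := ltP v u; [rewrite H1 ?(ltW sv)|rewrite H2 ?uv].
apply/eqP; rewrite eq_le; apply/andP; split.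
  by apply/(first_jump_leP HY _ s0); exists u; rewrite ?su ?lexx.
apply: le_ereal_inf_tmp => _ [v [sv hv] <-]; rewrite lee_fin leNgt; apply/negP => vu.
by apply: hv; rewrite H1// ltW.
Qed.

Let no_jump s r w : 0 <= s -> 0 <= r -> ~ bounded_jump s r w ->
  no_obs_jump s r w /\ X (s + r) w = X s w.
Proof.
move=> s0 r0 /negP; rewrite -ltNge => fr.
have HY := obs_path_jump w; split.
  rewrite /no_obs_jump /= ltNge; apply/negP => /(first_jump_leP HY _ s0)[v /andP[sv vr]].
  rewrite (@first_jump_const _ _ (X^~ w) s v (ltW sv))//.
  by rewrite (le_lt_trans _ fr)// lee_fin.
by apply: first_jump_const fr; rewrite lerDl.
Qed.

(** Both sides agree on every path with at most one jump of [X] in the cell: after a single jump the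
    observation is unchanged exactly when the target lies in the fibre of [X s w]. The error is
    confined to [two_jumps]. *)
Lemma stay_step_path s r (f : E -> R) c w : 0 <= s -> 0 <= r ->
  (forall x, `|f x| <= c) ->
  `|\1_(no_obs_jump s r) w * f (X (s + r) w) - (f (X s w) +
     \1_(bounded_jump s r) w * (\1_same_fibre (X s w, X (fine (fj s w)) w) *
       f (X (fine (fj s w)) w) - f (X s w)))| <= 4 * c * \1_(two_jumps s r) w.
Proof.
move=> s0 r0 fc; have [bj|nbj] := pselect (bounded_jump s r w); last first.
  have [nj ->] := no_jump s0 r0 nbj; have ntj : ~ two_jumps s r w by case.
  by rewrite (indic1 nj) (indicN nbj) (indicN ntj) mul1r mul0r addr0 subrr normr0 mulr0.
have c0 : 0 <= c by exact: le_trans (fc point).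
rewrite (indic1 bj) mul1r addrCA subrr addr0.
have [tj|ntj] := pselect (two_jumps s r w).
  rewrite (indic1 tj) mulr1 (le_trans (ler_normB _ _))//.
  rewrite (_ : 4 * c = 2 * c + 2 * c); last by ring.
  have H (C : set Om) w' x : `|\1_C w' * f x| <= c.
    by rewrite normrM (le_trans _ (fc x))// ler_piMl// indic_norm_le1.
  rewrite lerD//; first by rewrite (le_trans (H _ _ _))// ler_peMl// ler1n.
  rewrite normrM (@le_trans _ _ c)// ?ler_peMl ?ler1n//.
  by rewrite (le_trans _ (fc (X (fine (fj s w)) w)))// ler_piMl// indic_norm_le1.
have [fi|[u su fu]] := first_jump_cases (X_jump w) s0.
  by move: bj; rewrite /bounded_jump /= fi leye_eq.
have ur : u <= s + r by move: bj; rewrite /bounded_jump /= fu lee_fin.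
have [_ _ H2] := one_jump s0 fu ur ntj.
have := one_jump_obs s0 fu ur ntj; rewrite fu /= (indicN ntj) mulr0.
rewrite (H2 (s + r)) ?ur ?lexx//; case: pselect => [e|ne] /= H.
  by rewrite (indic1 H) indic1//; rewrite subrr normr0.
rewrite !indicN; first by rewrite !mul0r subrr normr0.
  by move=> /= e; apply: ne.
by rewrite /no_obs_jump /= H lte_fin ltNge ur.
Qed.

Lemma leave_step_path s r (f : E -> R) c w : 0 <= s -> 0 <= r ->
  (forall x, `|f x| <= c) ->
  `|\1_(~` no_obs_jump s r) w * f (X (fine (yj s w)) w) -
     \1_(bounded_jump s r) w * (\1_(~` same_fibre) (X s w, X (fine (fj s w)) w) *
       f (X (fine (fj s w)) w))| <= 2 * c * \1_(two_jumps s r) w.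
Proof.
move=> s0 r0 fc; have [bj|nbj] := pselect (bounded_jump s r w); last first.
  have [nj _] := no_jump s0 r0 nbj; have ntj : ~ two_jumps s r w by case.
  have nn : ~ (~` no_obs_jump s r) w by apply.
  by rewrite (indicN nbj) (indicN nn) (indicN ntj) !mul0r subrr normr0 mulr0.
have c0 : 0 <= c by exact: le_trans (fc point).
rewrite (indic1 bj) mul1r.
have [tj|ntj] := pselect (two_jumps s r w).
  rewrite (indic1 tj) mulr1 (le_trans (ler_normB _ _))// mulr_natl mulr2n.
  by rewrite lerD// normrM; [rewrite (le_trans _ (fc (X (fine (yj s w)) w)))|
    rewrite (le_trans _ (fc (X (fine (fj s w)) w)))]; rewrite // ler_piMl// indic_norm_le1.
have [fi|[u su fu]] := first_jump_cases (X_jump w) s0.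
  by move: bj; rewrite /bounded_jump /= fi leye_eq.
have ur : u <= s + r by move: bj; rewrite /bounded_jump /= fu lee_fin.
have := one_jump_obs s0 fu ur ntj; rewrite fu /= (indicN ntj) mulr0.
case: pselect => [e|ne] /= H.
  by rewrite !indicN ?mul0r ?subrr ?normr0//; apply.
rewrite H /= !indic1 ?subrr ?normr0//; first by move=> /= e; apply: ne.
by rewrite /no_obs_jump /= H lte_fin ltNge ur.
Qed.

Let Y := fun t w => h (X t w).
Let Y_meas t : 0 <= t -> measurable_fun setT (Y t).
Proof. by move=> t0; exact: measurableT_comp mh (X_meas t0). Qed.

Lemma filtration_obs t A : filtration P Y t A -> F t A.
Proof.
move=> FA.
have [|G FG] := @filtration_trace _ _ _ P _ _ Y t (F t) setT (HF t) _
    (@filtration_negligible _ _ _ _ _ _ X t) A FA; last by rewrite !setIT => ->.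
move=> s B st mB; exists [set w | B (Y s w)] => //.
apply: (@filtration_gen _ _ _ P _ _ X s t [set x | B (h x)]) => //.
by rewrite -[X in measurable X]setTI; exact: mh.
Qed.

Lemma filtration_no_obs_jump s r : 0 <= s ->
  filtration P Y (s + r) (no_obs_jump s r).
Proof. by move=> s0; exact: (filtration_first_jump_gt P VS obs_path_jump _ s0). Qed.

Let mno_obs_jump s r : 0 <= s -> measurable (no_obs_jump s r).
Proof. by move=> s0; apply/Fmeas/filtration_obs/filtration_no_obs_jump. Qed.

Lemma obs_jump_target_measurable s : 0 <= s ->
  measurable_fun setT (fun w => X (fine (yj s w)) w).
Proof.
move=> s0; apply: (evaluation_measurable X_meas X_jump).
  by move=> w; rewrite fine_ge0// ltW// (le_lt_trans _ (first_jump_gt (obs_path_jump w) s0)).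
apply: (@measurableT_comp _ _ _ _ _ _ fine _ (fun w => yj s w)).
  exact: fine_measurable.
exact: (first_jump_measurable P_complete VS Y_meas obs_path_jump s0).
Qed.

(** [6 * c] is [4 * c] for the paths with two jumps plus [2 * c], the bound of the integrand passed
    to [jump_estimate]. *)
Lemma stay_step s r A (f : E -> R) c : 0 <= s -> 0 <= r -> F s A -> Bb f ->
  (forall x, `|f x| <= c) ->
  `|\int[P]_w (\1_A w * (\1_(no_obs_jump s r) w * f (X (s + r) w) -
     (f (X s w) + r * stay f (X s w))))| <= 6 * c * (L * r) ^+ 2 * \int[P]_w \1_A w.
Proof.
move=> s0 r0 FA Bf fc; have mA := Fmeas FA.
have BA : Bb (fun w => \1_A w : R) by exact/Bb_ind.
have B2 : Bb (fun w => \1_(two_jumps s r) w : R) by exact/Bb_ind/two_jumps_measurable.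
have sr0 : 0 <= s + r by rewrite addr_ge0.
pose g (p : E * E) := \1_same_fibre p * f p.2 - f p.1.
have Bg : Bb g by exact: Bstay.
have Bbj : Bb (fun w => \1_(bounded_jump s r) w : R) by exact/Bb_ind/mbounded_jump.
pose J w := \1_(bounded_jump s r) w * g (X s w, X (fine (fj s w)) w).
have BJ : Bb J.
  apply: Bb_mul Bbj _; have /BbP[mg [M gM]] := Bg; apply/BbP; split; last by exists M => w.
  apply: (measurableT_comp mg); apply: measurable_fun_pair; first exact: X_meas.
  exact: jump_target_measurable.
have BK : Bb (fun w => r * stay f (X s w)).
  by apply: Bb_mul; [exact: Bb_const|exact: Bb_at (Bb_stay Bf)].
pose D w := \1_(no_obs_jump s r) w * f (X (s + r) w) - (f (X s w) + J w).
have BD : Bb D.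
  apply: Bb_sub; last by apply: Bb_add BJ; exact: Bb_at Bf.
  by apply: Bb_mul; [exact/Bb_ind/mno_obs_jump|exact: Bb_at Bf].
have E1 := jump_estimate s0 r0 FA Bg (stay_bound2 fc).
have -> : \int[P]_w (\1_A w * (\1_(no_obs_jump s r) w * f (X (s + r) w) -
     (f (X s w) + r * stay f (X s w)))) =
  \int[P]_w (\1_A w * D w) + \int[P]_w (\1_A w * (J w - r * stay f (X s w))).
  rewrite -intD//; [|exact: Bb_mul|by apply: Bb_mul => //; exact: Bb_sub].
  by apply: eq_Rintegral => w _; rewrite /D; ring.
have c0 : 0 <= c by exact: le_trans (fc point).
have E2 : `|\int[P]_w (\1_A w * D w)| <= 4 * c * ((L * r) ^+ 2 * \int[P]_w \1_A w).
  apply: (@le_trans _ _ (\int[P]_w (4 * c * (\1_A w * \1_(two_jumps s r) w)))).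
    apply: int_norm_le => //; [exact: Bb_mul|by apply: Bb_mul; [exact: Bb_const|exact: Bb_mul]|].
    move=> w; rewrite normrM (ger0_norm (indic_ge0 _ _ _)) mulrCA.
    by apply: ler_wpM2l; [exact: indic_ge0|exact: stay_step_path].
  rewrite intZ//; last exact: Bb_mul.
  by rewrite ler_wpM2l ?mulr_ge0//; exact: two_jumps_le.
apply: (le_trans (ler_normD _ _)).
apply: (le_trans (lerD E2 E1)); apply: le_of_eq; ring.
Qed.

Lemma leave_step s r A (f : E -> R) c : 0 <= s -> 0 <= r -> F s A -> Bb f ->
  (forall x, `|f x| <= c) ->
  `|\int[P]_w (\1_A w * (\1_(~` no_obs_jump s r) w * f (X (fine (yj s w)) w) -
     r * leave f (X s w)))| <= 3 * c * (L * r) ^+ 2 * \int[P]_w \1_A w.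
Proof.
move=> s0 r0 FA Bf fc; have mA := Fmeas FA.
have BA : Bb (fun w => \1_A w : R) by exact/Bb_ind.
have B2 : Bb (fun w => \1_(two_jumps s r) w : R) by exact/Bb_ind/two_jumps_measurable.
pose g (p : E * E) := \1_(~` same_fibre) p * f p.2.
have Bg : Bb g by exact: Bleave.
have Bbj : Bb (fun w => \1_(bounded_jump s r) w : R) by exact/Bb_ind/mbounded_jump.
pose J w := \1_(bounded_jump s r) w * g (X s w, X (fine (fj s w)) w).
have BJ : Bb J.
  apply: Bb_mul Bbj _; have /BbP[mg [M gM]] := Bg; apply/BbP; split; last by exists M => w.
  apply: (measurableT_comp mg); apply: measurable_fun_pair; first exact: X_meas.
  exact: jump_target_measurable.
have BK : Bb (fun w => r * leave f (X s w)).
  by apply: Bb_mul; [exact: Bb_const|exact: Bb_at (Bb_leave Bf)].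
pose D w := \1_(~` no_obs_jump s r) w * f (X (fine (yj s w)) w) - J w.
have BD : Bb D.
  apply: Bb_sub BJ; apply: Bb_mul; first exact/Bb_ind/measurableC/mno_obs_jump.
  apply: (Bb_le (M := c)) => //.
  exact: measurableT_comp (Bb_meas Bf) (obs_jump_target_measurable s0).
have E1 := jump_estimate s0 r0 FA Bg (leave_bound1 fc).
have -> : \int[P]_w (\1_A w * (\1_(~` no_obs_jump s r) w * f (X (fine (yj s w)) w) -
     r * leave f (X s w))) =
  \int[P]_w (\1_A w * D w) + \int[P]_w (\1_A w * (J w - r * leave f (X s w))).
  rewrite -intD//; [|exact: Bb_mul|by apply: Bb_mul => //; exact: Bb_sub].
  by apply: eq_Rintegral => w _; rewrite /D; ring.
have c0 : 0 <= c by exact: le_trans (fc point).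
have E2 : `|\int[P]_w (\1_A w * D w)| <= 2 * c * ((L * r) ^+ 2 * \int[P]_w \1_A w).
  apply: (@le_trans _ _ (\int[P]_w (2 * c * (\1_A w * \1_(two_jumps s r) w)))).
    apply: int_norm_le => //; [exact: Bb_mul|by apply: Bb_mul; [exact: Bb_const|exact: Bb_mul]|].
    move=> w; rewrite normrM (ger0_norm (indic_ge0 _ _ _)) mulrCA.
    by apply: ler_wpM2l; [exact: indic_ge0|exact: leave_step_path].
  rewrite intZ//; last exact: Bb_mul.
  by rewrite ler_wpM2l ?mulr_ge0//; exact: two_jumps_le.
apply: (le_trans (ler_normD _ _)).
apply: (le_trans (lerD E2 E1)); apply: le_of_eq; ring.
Qed.

End rates.

(** * Adapted functions and small increments *)

Lemma sqr_self_ge0 (R : realDomainType) (x : R) : 0 <= x * x.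
Proof. by rewrite -expr2 sqr_ge0. Qed.

Section adapted.
Context d (Om : measurableType d) (R : realType) (P : probability Om R).
Variable F : set_system Om.
Hypothesis HF : sigma_algebra setT F.
Hypothesis FM : forall A, F A -> measurable A.
Implicit Types (b U : Om -> R) (A : set Om).
Let PT : (P setT < +oo)%E := probabilityT_lty P.

Let FT : F setT. Proof. exact: (sa_true HF). Qed.

Definition adapted b := forall B : set R, measurable B -> F (b @^-1` B).

Lemma adaptedP b :
  adapted b <-> measurable_fun setT (b : g_sigma_algebraType F -> R).
Proof.
split=> [H _ B mB|H B mB].
  by rewrite setTI; apply: sub_sigma_algebra; exact: H.
rewrite -(sigma_algebra_id HF); have := H measurableT B mB.
by rewrite setTI.
Qed.

Lemma adapted_cst (a : R) : adapted (fun=> a).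
Proof. exact/adaptedP/measurable_cst. Qed.

Lemma adapted_add b c : adapted b -> adapted c -> adapted (fun w => b w + c w).
Proof. by move=> /adaptedP mb /adaptedP mc; exact/adaptedP/measurable_funD. Qed.

Lemma adapted_sub b c : adapted b -> adapted c -> adapted (fun w => b w - c w).
Proof. by move=> /adaptedP mb /adaptedP mc; exact/adaptedP/measurable_funB. Qed.

Lemma adapted_mul b c : adapted b -> adapted c -> adapted (fun w => b w * c w).
Proof. by move=> /adaptedP mb /adaptedP mc; exact/adaptedP/measurable_funM. Qed.

Lemma adapted_indic A : F A -> adapted (fun w => \1_A w).
Proof.
by move=> FA; apply/adaptedP/measurable_indic; exact: sub_sigma_algebra.
Qed.

Lemma adapted_ge b (x : R) : adapted b -> F [set w | x <= b w].
Proof.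
move=> ab; have := ab `[x, +oo[%classic (measurable_itv _); congr F.
by apply/seteqP; split => w /=; rewrite in_itv/= andbT.
Qed.

Lemma adapted_gt b (x : R) : adapted b -> F [set w | x < b w].
Proof.
move=> ab; have := ab `]x, +oo[%classic (measurable_itv _); congr F.
by apply/seteqP; split => w /=; rewrite in_itv/= andbT.
Qed.

Lemma adapted_meas b : adapted b -> measurable_fun setT b.
Proof. by move=> ab _ B mB; rewrite setTI; apply/FM/ab. Qed.

Lemma adapted_Bb b (c : R) : adapted b -> (forall w, `|b w| <= c) -> Bb b.
Proof. by move=> ab; apply: Bb_le; exact: adapted_meas. Qed.

Let split_weight b (c : R) : adapted b -> (forall w, `|b w| <= c) -> Bb b ->
  forall A, F A -> [/\ (forall w, 0 <= \1_A w * (b w + c) <= 2 * c),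
    (forall x, F [set w | x <= \1_A w * (b w + c)]) & 0 <= c].
Proof.
move=> ab bc Bb_b A FA; have c0 : 0 <= c by exact: le_trans (bc point).
have bc0 w : 0 <= b w + c <= 2 * c.
  by have := bc w; rewrite ler_norml => /andP[? ?]; apply/andP; split; lra.
split=> // [w|x].
  have /andP[h1 h2] := bc0 w; rewrite mulr_ge0 ?indic_ge0//=.
  by rewrite (le_trans _ h2)// ler_piMl// indic_le1.
apply: adapted_ge; apply: adapted_mul; first exact: adapted_indic.
by apply: adapted_add => //; exact: adapted_cst.
Qed.

(** The shifted weight [b + c] is nonnegative with values up to [2 * c], and removing the constant
    [c] again costs one more [c]; hence the factor [3 * c]. *)
Lemma weight_approx_signed U b (c k : R) : Bb U ->
  (forall A, F A -> `|\int[P]_w (\1_A w * U w)| <= k * \int[P]_w \1_A w) ->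
  adapted b -> (forall w, `|b w| <= c) -> forall A, F A ->
  `|\int[P]_w (\1_A w * b w * U w)| <= 3 * c * k * \int[P]_w \1_A w.
Proof.
move=> BU HU ab bc A FA; have Bb_b := adapted_Bb ab bc.
have [b1 b2 c0] := split_weight ab bc Bb_b FA.
have BA : Bb (fun w => \1_A w : R) by exact/Bb_ind/FM.
have Bw : Bb (fun w => \1_A w * (b w + c)).
  by apply: Bb_mul => //; apply: Bb_add => //; exact: Bb_const.
have k0 : 0 <= k.
  have := HU setT FT; rewrite int_indic//.
  rewrite (congr1 fine (probability_setT P) : fine (P setT) = 1) mulr1.
  exact: le_trans.
have H1 := weight_approx FM BU HU b1 b2 (Bb_meas Bw).
have H2 := HU A FA.
have -> : \int[P]_w (\1_A w * b w * U w) =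
  \int[P]_w (\1_A w * (b w + c) * U w) - c * \int[P]_w (\1_A w * U w).
  rewrite -intZ//; last exact: Bb_mul.
  rewrite -intB//; [|exact: Bb_mul|by apply: Bb_mul; [exact: Bb_const|exact: Bb_mul]].
  by apply: eq_Rintegral => w _; ring.
have H3 : \int[P]_w (\1_A w * (b w + c)) <= 2 * c * \int[P]_w \1_A w.
  rewrite -intZ//; apply: int_le => //; first by apply: Bb_mul => //; exact: Bb_const.
  move=> w; rewrite mulrC ler_wpM2r ?indic_ge0//.
  by have := bc w; rewrite ler_norml => /andP[_ ?]; lra.
apply: (le_trans (ler_normB _ _)); rewrite normrM (ger0_norm c0).
apply: (le_trans (lerD H1 (ler_wpM2l c0 H2))).
apply: (le_trans (lerD (ler_wpM2l k0 H3) (lexx _))).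
by apply: le_of_eq; ring.
Qed.

Lemma weight_eq0_signed U b : Bb U ->
  (forall A, F A -> \int[P]_w (\1_A w * U w) = 0) ->
  adapted b -> Bb b -> \int[P]_w (b w * U w) = 0.
Proof.
move=> BU HU ab Bb_b; have [c _ bc] := Bb_exists_bound Bb_b.
have := @weight_approx_signed U b c 0 BU _ ab bc setT FT.
rewrite mulr0 mul0r normr_le0 => H.
transitivity (\int[P]_w (\1_[set: Om] w * b w * U w)).
  by apply: eq_Rintegral => w _; rewrite indic1// mul1r.
by apply/eqP/H => A FA; rewrite HU// normr0 mul0r.
Qed.

Lemma int_nonneg_eq0 U : Bb U -> (forall w, 0 <= U w) ->
  \int[P]_w U w <= 0 -> P [set w | 0 < U w] = 0%E.
Proof.
move=> BU U0 HU; have mU := Bb_meas BU.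
have -> : [set w | 0 < U w] = \bigcup_n [set w | n.+1%:R^-1 <= U w].
  apply/seteqP; split => w /=.
    by move=> /small_invS[n Hn]; exists n.
  by move=> [n _ /=]; apply: lt_le_trans; rewrite invr_gt0 ltr0n.
have mn n : measurable [set w | n.+1%:R^-1 <= U w].
  rewrite -[X in measurable X]setTI.
  by apply: measurable_fun_le => //; exact: measurable_cst.
suff H n : P [set w | n.+1%:R^-1 <= U w] = 0%E.
  apply/eqP; rewrite eq_le measure_ge0 andbT.
  have := @negligible_bigcup _ _ _ P _ (fun n => (negligibleP _ (mn n)).2 (H n)).
  move=> /negligibleP -> //; exact: bigcup_measurable.
have h : \int[P]_w (n.+1%:R^-1 * \1_[set w | n.+1%:R^-1 <= U w] w) <= 0.
  apply: le_trans HU; apply: int_le => //.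
    by apply: Bb_mul; [exact: Bb_const|exact: Bb_ind].
  move=> w; have [Hw|Hw] := pselect ([set w | n.+1%:R^-1 <= U w] w).
    by rewrite (indic1 Hw) mulr1.
  by rewrite (indicN Hw) mulr0.
rewrite intZ ?int_indic// in h; last exact: Bb_ind.
rewrite pmulr_rle0 ?invr_gt0 ?ltr0n// in h.
by apply/eqP; rewrite eq_le measure_ge0 andbT -(@fineK _ (P _)) ?fin_num_measure//.
Qed.

(** [U] is tested against itself, so the integral of its square vanishes. *)
Lemma adapted_eq0 U : Bb U -> adapted U ->
  (forall A, F A -> \int[P]_w (\1_A w * U w) = 0) -> {ae P, forall w, U w = 0}.
Proof.
move=> BU aU HU; have H := weight_eq0_signed BU HU aU BU.
have BUU : Bb (fun w => U w * U w) by exact: Bb_mul.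
have P0 := int_nonneg_eq0 BUU (fun w => sqr_self_ge0 (U w)) (le_of_eq H).
exists [set w | 0 < U w * U w]; split => //.
  exact/FM/(adapted_gt 0)/adapted_mul.
by move=> w /= /eqP Uw; rewrite -expr2 exprn_even_gt0.
Qed.

End adapted.

Lemma right_limit_le0 (R : realType) (g : R -> R) (t : R) :
  g s @[s --> t^'+] --> g t ->
  (exists2 e : R, 0 < e & forall q : rat, t < ratr q < t + e -> g (ratr q) <= 0) ->
  g t <= 0.
Proof.
move=> gt_ [e e0 He]; rewrite leNgt; apply/negP => gp.
have [|e' e'0 He'] := (near_rightP t _).1 (cvgR_dist _ gt_ (e := g t / 2) _).
  by rewrite divr_gt0.
have [|q /andP[tq]] := @rat_between _ t (t + Num.min e e').
  by rewrite ltrDl lt_min e0.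
rewrite -ltrBlDl lt_min !ltrBlDl => /andP[qe qe'].
have := He' (ratr q); rewrite tq qe' => /(_ isT).
have := He q; rewrite tq qe => /(_ isT) gq.
by rewrite ler_norml => /andP[h1 _]; lra.
Qed.

Lemma ae_count d (T : measurableType d) (R : realType)
    (m : {measure set T -> \bar R}) (C : countType) (Q : C -> T -> Prop) :
  (forall c, {ae m, forall x, Q c x}) -> {ae m, forall x, forall c, Q c x}.
Proof.
move=> H; have : {ae m, forall x, forall n,
    (if @unpickle C n is Some c then Q c x else True)}.
  by apply/ae_foralln => n; case: unpickle => [c|]; [exact: H|exact: aeW].
by apply: filterS => x Hx c; have := Hx (pickle c); rewrite pickleK.
Qed.

Lemma ae_imp d (T : measurableType d) (R : realType)
    (m : {measure set T -> \bar R}) (a : Prop) (Q : T -> Prop) :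
  (a -> {ae m, forall x, Q x}) -> {ae m, forall x, a -> Q x}.
Proof.
have [Ha /(_ Ha)|Ha _] := pselect a; first by apply: filterS => x ? _.
by apply: aeW => x /Ha.
Qed.

Lemma ae_null d (T : measurableType d) (R : realType)
    (m : {measure set T -> \bar R}) (D : set T) : measurable D -> m D = 0%E ->
  {ae m, forall x, ~ D x}.
Proof. by move=> mD D0; exists D; split=> // x /= /contrapT. Qed.

Lemma left_limit_le0 (R : realType) (g : R -> R) (t l : R) :
  g s @[s --> t^'-] --> l ->
  (exists2 e : R, 0 < e & forall q : rat, t - e < ratr q < t -> g (ratr q) <= 0) ->
  l <= 0.
Proof.
move=> gl [e e0 He]; rewrite leNgt; apply/negP => lp.
have [|e' e'0 He'] := (near_leftP t _).1 (cvgR_dist _ gl (e := l / 2) _).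
  by rewrite divr_gt0.
have [|q /andP[qe qt]] := @rat_between _ (t - Num.min e e') t.
  by rewrite ltrBlDr ltrDl lt_min e0.
move: qe; rewrite ltrBlDr -ltrBlDl lt_min !ltrBlDl => /andP[qe qe'].
have := He' (ratr q); rewrite ltrBlDr qe' qt => /(_ isT).
have := He q; rewrite ltrBlDr qe qt => /(_ isT) gq.
by rewrite ler_norml => /andP[h1 _]; lra.
Qed.

Lemma grid_locate (R : realType) (k u : R) : 0 < k -> 0 < u ->
  exists i : nat, i%:R * k < u <= i.+1%:R * k.
Proof.
move=> k0 u0; have ex : exists i : nat, u <= i.+1%:R * k.
  by exists (Num.truncn (u / k)); rewrite -ler_pdivrMr// ltW// truncnS_gt.
exists (ex_minn ex); case: ex_minnP => i -> Hi; rewrite andbT.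
case: i Hi => [_|i Hi]; first by rewrite mul0r.
by rewrite ltNge; apply/negP => /Hi; rewrite ltnn.
Qed.

(** Telescoping over [n.+1] equal steps gives [n.+1] errors of order [n.+1 ^- 2]. The constant [k]
    only limits the length of the steps. *)
Lemma quadratic_increments (R : realType) (g : R -> R) (a b k c : R) : a <= b -> 0 <= c ->
  (forall x y, a <= x <= y -> y <= b -> k * (y - x) < 1 -> `|g y - g x| <= c * (y - x) ^+ 2) ->
  g b = g a.
Proof.
move=> ab c0 Hg; apply/eqP; rewrite -subr_eq0 -normr_le0.
have H n : k * ((b - a) / n.+1%:R) < 1 -> `|g b - g a| <= c * (b - a) ^+ 2 * n.+1%:R^-1.
  move=> kn; have n0 : 0 < n.+1%:R :> R by rewrite ltr0n.
  pose x i : R := a + i%:R * ((b - a) / n.+1%:R).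
  have x0 : x 0 = a by rewrite /x mul0r addr0.
  have xn : x n.+1 = b by rewrite /x mulrC divfK ?subrKC// gt_eqF.
  have xS i : x i.+1 - x i = (b - a) / n.+1%:R by rewrite /x -natr1; ring.
  have x_ge i : a <= x i by rewrite /x lerDl mulr_ge0// divr_ge0// subr_ge0.
  have step i : (i < n.+1)%N -> `|g (x i.+1) - g (x i)| <= c * ((b - a) / n.+1%:R) ^+ 2.
    move=> ni; rewrite -(xS i); apply: Hg; last by rewrite xS.
      by rewrite x_ge/= -subr_ge0 xS divr_ge0// subr_ge0.
    rewrite -xn /x lerD2l; apply: ler_wpM2r; first by rewrite divr_ge0// subr_ge0.
    by rewrite ler_nat.
  have -> : g b - g a = \sum_(0 <= i < n.+1) (g (x i.+1) - g (x i)).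
    by rewrite telescope_sumr// xn x0.
  rewrite big_mkord (le_trans (ler_norm_sum _ _ _))//.
  apply: (@le_trans _ _ (\sum_(i < n.+1) c * ((b - a) / n.+1%:R) ^+ 2)).
    by apply: ler_sum => i _; exact: step.
  rewrite sumr_const card_ord -mulr_natl; apply: le_of_eq; field.
  by rewrite gt_eqF.
rewrite leNgt; apply/negP => gp; set x := `|g b - g a| in H gp.
(* The two terms exceed what is needed for steps with [k * (y - x) < 1] and for a total error below
   [x]. *)
pose m : R := `|k * (b - a)| + c * (b - a) ^+ 2 / x.
have q0 : 0 <= c * (b - a) ^+ 2 / x.
  by rewrite divr_ge0 ?(ltW gp)// mulr_ge0// sqr_ge0.
have m0 : 0 <= m by rewrite addr_ge0.
have mn := truncnS_gt m; set n := Num.truncn m in mn.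
have n0 : 0 < n.+1%:R :> R by rewrite ltr0n.
have := H n; rewrite mulrA ltr_pdivrMr// mul1r ler_pdivlMr// => {}H.
have : k * (b - a) < n.+1%:R.
  by apply: le_lt_trans mn; rewrite (le_trans (ler_norm _))// lerDl.
move=> /H; rewrite leNgt [x * _]mulrC -ltr_pdivrMr// => /negP; apply.
by apply: le_lt_trans mn; rewrite lerDr.
Qed.

(** The left limit at [u] is approached by the value at the left end of the grid cell containing
    [u]. Cells are open on the left, so that this end lies strictly before [u]. It yields both the
    adaptedness of left limits at random times and their measurability in time. *)
Lemma left_grid_cvg (R : realType) (f : R -> R) (l s r u : R) : s < u <= s + r ->
  f v @[v --> u^'-] --> l ->
  \sum_(i < (Num.truncn (r * k.+1%:R)).+1)
    \1_(`]s + i%:R * k.+1%:R^-1, s + i.+1%:R * k.+1%:R^-1]) u * f (s + i%:R * k.+1%:R^-1)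
    @[k --> \oo] --> l.
Proof.
move=> /andP[su ur] fl; apply: cvgR_distP => e e0.
have [e' e'0 He'] := (near_leftP _ _).1 (cvgR_dist _ fl e0).
near=> k; pose g (i : nat) : R := s + i%:R * k.+1%:R^-1.
have k0 : 0 < k.+1%:R :> R by rewrite ltr0n.
have ki : 0 < k.+1%:R^-1 :> R by rewrite invr_gt0.
have us : 0 < u - s by rewrite subr_gt0.
have [i iJ /andP[gi gi1]] : exists2 i, (i < (Num.truncn (r * k.+1%:R)).+1)%N & g i < u <= g i.+1.
  have [i /andP[i1 i2]] := grid_locate ki us.
  exists i; last by rewrite /g -ltrBrDl -lerBlDl i1 i2.
  rewrite ltnS -(natrK (R := R) i); apply: le_truncn.
  by rewrite -ler_pdivrMr//; apply: (le_trans (ltW i1)); rewrite lerBlDl.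
rewrite (bigD1 (Ordinal iJ))//= indic1 /=; last by rewrite in_itv/= gi gi1.
rewrite mul1r big1 ?addr0; last first.
  move=> j ji; rewrite indicN ?mul0r//= in_itv/= => /andP[h1 h2].
  have lt (p q : nat) : g p < g q.+1 -> (p <= q)%N.
    by rewrite /g ltrD2l ltr_pM2r ?invr_gt0// ltr_nat.
  move/negP: ji; apply; apply/eqP/val_inj/eqP => /=.
  by rewrite eqn_leq (lt j i) ?(lt i j)//; [exact: lt_le_trans h2|exact: lt_le_trans gi1].
apply: He'; rewrite gi andbT ltrBlDr (le_lt_trans gi1)//.
rewrite /g -natr1 mulrDl mul1r addrA ltrD2l; near: k.
exact: (near_infty_natSinv_lt (PosNum e'0)).
Unshelve. all: by end_near. Qed.

(** * The filter between jumps *)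

(** [19 = 15 + 2 + 2]: the defect is at most [15 * (c * (L * r))] because [10 * (L * r) < 1], and
    [y * (r * b)] and [r * a] give 2 each. Then [182 = 144 + 2 * 19], the last term coming from the
    replacement of [y] by [x] in front of [r * b]. *)
Lemma step_algebra (R : realType) (L c r y x a b : R) : 0 <= L -> 0 <= c -> 0 <= r ->
  10 * (L * r) < 1 -> `|y| <= c -> `|b| <= 2 * L -> `|a| <= 2 * c * L ->
  `|y * (1 + r * b) - (x + r * a)| <= 144 * c * (L * r) ^+ 2 ->
  `|y - x| <= 19 * c * (L * r) /\
  `|y - x - r * (a - x * b)| <= 182 * c * (L * r) ^+ 2.
Proof.
move=> L0 c0 r0 Lr yc bL aL H; have Lr0 : 0 <= L * r by rewrite mulr_ge0.
have rb : `|r * b| <= 2 * (L * r).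
  by rewrite normrM (ger0_norm r0) mulrC mulrA; exact: ler_wpM2r.
have ra : `|r * a| <= 2 * c * (L * r).
  by rewrite normrM (ger0_norm r0) mulrC mulrA; exact: ler_wpM2r.
have yrb : `|y * (r * b)| <= 2 * c * (L * r).
  rewrite normrM (_ : 2 * c * (L * r) = c * (2 * (L * r))); last by ring.
  by rewrite ler_pM.
have cL0 : 0 <= c * (L * r) by rewrite mulr_ge0.
have H2 : 144 * c * (L * r) ^+ 2 <= 15 * (c * (L * r)).
  rewrite (_ : 144 * c * _ = 144 / 10 * (c * (L * r) * (10 * (L * r)))); last by field.
  have : c * (L * r) * (10 * (L * r)) <= c * (L * r) * 1 by apply: ler_wpM2l => //; exact: ltW.
  by rewrite mulr1; lra.
have E : y - x = (y * (1 + r * b) - (x + r * a)) - y * (r * b) + r * a by ring.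
have D : `|y - x| <= 19 * c * (L * r).
  rewrite E (le_trans (ler_normD _ _))//.
  have := ler_normB (y * (1 + r * b) - (x + r * a)) (y * (r * b)).
  by rewrite (_ : 19 * c * (L * r) = 19 * (c * (L * r))); [lra|ring].
split=> //.
rewrite (_ : y - x - r * (a - x * b) =
  (y * (1 + r * b) - (x + r * a)) - (y - x) * (r * b)); last by ring.
rewrite (le_trans (ler_normB _ _))//.
have : `|(y - x) * (r * b)| <= 19 * c * (L * r) * (2 * (L * r)).
  by rewrite normrM ler_pM.
rewrite (_ : 182 * c * (L * r) ^+ 2 = 144 * c * (L * r) ^+ 2 + 38 * (c * (L * r) ^+ 2));
  last by ring.
rewrite (_ : 19 * c * (L * r) * (2 * (L * r)) = 38 * (c * (L * r) ^+ 2)); last by ring.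
by move=> ?; exact: lerD.
Qed.

(** * Measures carried by a fibre of [h] *)

Section fibres.
Context d (E : measurableType d) d2 (O : measurableType d2) (R : realType).
Variables (V : (set O)^nat) (VS : separates_points V) (h : E -> O).
Hypothesis mh : measurable_fun setT h.

Let mhV k : measurable (h @^-1` (V k)).
Proof. by rewrite -[X in measurable X]setTI; apply: mh => //; exact: VS.1. Qed.

(** Each separating set has mass 0 or 1 according to whether it contains [y]; countably many null
    sets are discarded. *)
Lemma fibre_ae (m : probability E R) (y : O) :
  (forall k, \int[m]_z (\1_(h @^-1` (V k)) z : R) = \1_(V k) y) ->
  {ae m, forall z, h z = y}.
Proof.
move=> H; have : {ae m, forall z, forall k, V k (h z) <-> V k y}.
  apply: ae_count => k; have := H k.
  rewrite int_indic//.
  have [Vy|Vy] := pselect (V k y).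
    rewrite (indic1 Vy) => m1; have : m (~` (h @^-1` V k)) = 0%E.
      by rewrite probability_setC// -[m _]fineK ?fin_num_measure// m1 subee.
    by move=> /(ae_null (measurableC (mhV k))); apply: filterS => z /contrapT.
  rewrite (indicN Vy) => m0; have : m (h @^-1` V k) = 0%E.
    by rewrite -[m _]fineK ?fin_num_measure// m0.
  by move=> /(ae_null (mhV k)); apply: filterS => z.
apply: filterS => z Hz; apply: contrapT => /(VS.2)[k [h1 h2]].
by apply: h2; apply/Hz.
Qed.

Variables (lam : R.-fker E ~> E) (L : R).
Hypothesis lamL : forall x, (lam x setT <= L%:E)%E.

(** [stay] does not mention the fibre, so it can be conditioned without a random parameter; [opA] is
    recovered once the filter is known to be carried by the fibre. *)
Lemma opA_stay (f : E -> R) (x : E) : Bb f ->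
  opA lam h (h x) f x = stay lam h f x.
Proof.
move=> Bf; have Bs : Bb (fun z => \1_(same_fibre h) (x, z) : R).
  exact: (Bb_pair1 x (Bb_ind R (measurable_same_fibre VS mh))).
have iE z : \1_(~` (h @^-1` [set h x])) z = 1 - \1_(same_fibre h) (x, z) :> R.
  have [e|ne] := pselect (h x = h z).
    by rewrite indicN ?indic1 ?subrr//= => /(_ (esym e)).
  by rewrite indic1 ?indicN ?subr0// => /= /esym.
have B1 := Bb_const E (1 : R).
rewrite /opA /generator /stay; under [X in _ - X]eq_Rintegral do rewrite iE.
rewrite -(intB (rate_fin lamL x) (Bb_sub Bf (Bb_const _ _)) (Bb_mul (Bb_sub B1 Bs) Bf)).
by apply: eq_Rintegral => z _; ring.
Qed.

Lemma ae_eq_int (m : probability E R) (f g : E -> R) : Bb f -> Bb g ->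
  {ae m, forall x, f x = g x} -> \int[m]_x f x = \int[m]_x g x.
Proof.
move=> Bf Bg fg; rewrite /Rintegral; congr fine; apply: ae_eq_integral => //.
- exact/measurable_EFinP/Bb_meas.
- exact/measurable_EFinP/Bb_meas.
- by apply: filterS fg => x -> _.
Qed.

End fibres.

Section filter.
Context d (Om : measurableType d) (R : realType) (P : probability Om R).
Hypothesis P_complete : measure_is_complete P.
Context d' (E : measurableType d').
Variables (U : (set E)^nat) (US : separates_points U).
Variable X : R -> Om -> E.
Hypothesis X_meas : forall t, 0 <= t -> measurable_fun setT (X t).
Hypothesis X_jump : forall w, pure_jump_path (X^~ w).
Variables (lam : R.-fker E ~> E) (L : R).
Hypothesis lamL : forall x, (lam x setT <= L%:E)%E.
Hypothesis X_rate : has_rate P X lam.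
Variables (d2 : measure_display) (O : measurableType d2) (V : (set O)^nat).
Hypothesis VS : separates_points V.
Variable h : E -> O.
Hypothesis mh : measurable_fun setT h.
Local Notation Y := (fun t w => h (X t w)).
Local Notation FY := (filtration P Y).
Variable pi : R -> Om -> probability E R.
Hypothesis pi_filter : forall t (f : E -> R), 0 <= t -> Bb f ->
  is_cond_exp P (FY t) (fun w => f (X t w)) (fun w => \int[pi t w]_x f x).
Hypothesis pi_rcont : forall w t A, 0 <= t -> measurable A ->
  pi s w A @[s --> t^'+] --> pi t w A.
Implicit Types (r s t : R) (A : set Om) (w : Om) (f : E -> R) (c : R).

Local Notation fl t w f := (\int[pi t w]_x f x).
Local Notation yj s w := (first_jump (fun t => h (X t w)) s).
Local Notation K f := (stay lam h f).
Let one : E -> R := fun=> 1.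
Let HFY t : sigma_algebra setT (FY t) := filtration_sigma P Y t.
Let PT : (P setT < +oo)%E := probabilityT_lty P.
Let HY w : pure_jump_path (Y^~ w) .
Proof. exact: (@obs_path_jump _ _ _ _ _ X X_jump _ _ h w). Qed.
Let Y_meas t : 0 <= t -> measurable_fun setT (Y t).
Proof. by move=> t0; exact: measurableT_comp mh (X_meas t0). Qed.

Let FYm t A : FY t A -> measurable A.
Proof. exact: (filtration_measurable P_complete Y_meas). Qed.

Lemma filter_bound t w f c : Bb f -> (forall x, `|f x| <= c) -> `|fl t w f| <= c.
Proof.
move=> Bf fc; have := int_bound (probabilityT_lty (pi t w)) Bf fc.
by rewrite (congr1 fine (probability_setT (pi t w)) : fine _ = 1) mulr1.
Qed.

Lemma filter_adapted t f : 0 <= t -> Bb f -> adapted (FY t) (fun w => fl t w f).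
Proof. by move=> t0 Bf B mB; have [H _ _] := pi_filter t0 Bf; exact: H. Qed.

Lemma Bb_filter t f : 0 <= t -> Bb f -> Bb (fun w => fl t w f).
Proof.
move=> t0 Bf; have [c _ fc] := Bb_exists_bound Bf.
apply: (adapted_Bb (@FYm t) (filter_adapted t0 Bf) (c := c)) => w.
exact: filter_bound.
Qed.

Let BbX t f : 0 <= t -> Bb f -> Bb (fun w => f (X t w)).
Proof.
move=> t0 Bf; have [c _ fc] := Bb_exists_bound Bf.
by apply: (Bb_le (M := c)) => //; exact: measurableT_comp (Bb_meas Bf) (X_meas t0).
Qed.

Lemma filter_cond t f A : 0 <= t -> Bb f -> FY t A ->
  \int[P]_w (\1_A w * fl t w f) = \int[P]_w (\1_A w * f (X t w)).
Proof.
move=> t0 Bf FA; have mA := FYm FA; have [_ _ H] := pi_filter t0 Bf.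
rewrite -(int_setE P (fun w => fl t w f) mA) -(int_setE P (fun w => f (X t w)) mA).
exact: H.
Qed.

Lemma filter_weight t f b : 0 <= t -> Bb f -> adapted (FY t) b -> Bb b ->
  \int[P]_w (b w * fl t w f) = \int[P]_w (b w * f (X t w)).
Proof.
move=> t0 Bf ab Bb_b; have B1 := Bb_filter t0 Bf; have B2 := BbX t0 Bf.
apply/eqP; rewrite -subr_eq0 -intB//; [|exact: Bb_mul|exact: Bb_mul].
under eq_Rintegral do rewrite -mulrBr; apply/eqP.
apply: (weight_eq0_signed (HFY t) (@FYm t)) => //; first exact: Bb_sub.
move=> A FA; have BA : Bb (fun w => \1_A w : R) by exact/Bb_ind/FYm/FA.
under eq_Rintegral do rewrite mulrBr.
by rewrite intB ?filter_cond ?subrr//; exact: Bb_mul.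
Qed.

Lemma obs_trace s r A : 0 <= s -> 0 <= r -> FY (s + r) A ->
  exists2 G, FY s G & A `&` no_obs_jump X h s r = G `&` no_obs_jump X h s r.
Proof.
move=> s0 r0; apply: filtration_trace; [exact: HFY| |exact: filtration_negligible].
move=> t B /andP[t0 tsr] mB; have [ts|st] := leP t s.
  by exists [set w | B (Y t w)] => //; apply: filtration_gen => //; rewrite t0.
exists [set w | B (Y s w)]; first by apply: filtration_gen => //; rewrite s0 lexx.
apply/seteqP; split=> w /= [Bw nw]; split=> //; move: Bw.
  by rewrite (first_jump_const (ltW st) (le_lt_trans _ nw))// lee_fin.
by rewrite (first_jump_const (ltW st) (le_lt_trans _ nw))// lee_fin.
Qed.

Let B1 : Bb one. Proof. exact: Bb_const. Qed.
Let one1 (x : E) : `|one x| <= 1. Proof. by rewrite normr1. Qed.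

Let NJ s r := no_obs_jump X h s r.
Let FNJ s r : 0 <= s -> FY (s + r) (NJ s r).
Proof. by move=> s0; exact: (filtration_no_obs_jump P X_jump VS h r s0). Qed.

Let increment s r f w := \1_(NJ s r) w * f (X (s + r) w) - (f (X s w) + r * K f (X s w)).

Let BK f : Bb f -> Bb (K f). Proof. exact: (Bb_stay lamL VS mh). Qed.

Let Bincrement s r f : 0 <= s -> 0 <= r -> Bb f -> Bb (increment s r f).
Proof.
move=> s0 r0 Bf; have sr0 : 0 <= s + r by rewrite addr_ge0.
apply: Bb_sub.
  by apply: Bb_mul (BbX sr0 Bf); exact/Bb_ind/FYm/FNJ.
apply: Bb_add (BbX s0 Bf) _; apply: Bb_mul (BbX s0 (BK Bf)); exact: Bb_const.
Qed.

Let increment_le s r f c b k A : 0 <= s -> 0 <= r -> Bb f -> (forall x, `|f x| <= c) ->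
  adapted (FY s) b -> (forall w, `|b w| <= k) -> FY s A ->
  `|\int[P]_w (\1_A w * b w * increment s r f w)| <=
  3 * k * (6 * c * (L * r) ^+ 2) * \int[P]_w \1_A w.
Proof.
move=> s0 r0 Bf fc ab bk FA.
apply: (weight_approx_signed (HFY s) (@FYm s)) => //; first exact: Bincrement.
move=> A' FA'; apply: (stay_step P_complete US X_meas X_jump lamL X_rate VS mh) => //.
exact: (@filtration_obs _ _ _ P _ _ X _ _ h mh s A' FA').
Qed.

(** The denominator of Bayes' formula to first order. Multiplying by it keeps [defect] a combination
    of filters with weights known at time [s]. *)
Let gain s r w := 1 + r * fl s w (K one).
Let prediction s r f w := fl s w f + r * fl s w (K f).
Let defect s r f w := fl (s + r) w f * gain s r w - prediction s r f w.

Let small_stay s r f c w : Bb f -> (forall x, `|f x| <= c) -> 0 <= r ->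
  10 * (L * r) <= 1 -> 5 * `|r * fl s w (K f)| <= c.
Proof.
move=> Bf fc r0 Lr; have c0 : 0 <= c by exact: le_trans (fc point).
have H : `|fl s w (K f)| <= 2 * c * L.
  by apply: filter_bound (BK Bf) _ => x; exact: (stay_bound lamL VS mh).
rewrite normrM (ger0_norm r0); apply: (@le_trans _ _ (5 * (r * (2 * c * L)))).
  by rewrite ler_wpM2l// ler_wpM2l.
rewrite (_ : 5 * (r * (2 * c * L)) = c * (10 * (L * r))); last by ring.
by rewrite -[leRHS]mulr1 ler_wpM2l.
Qed.

Let prediction_bound s r f c w : Bb f -> (forall x, `|f x| <= c) -> 0 <= r ->
  10 * (L * r) <= 1 -> `|prediction s r f w| <= 2 * c.
Proof.
move=> Bf fc r0 Lr; have c0 : 0 <= c by exact: le_trans (fc point).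
have H1 := small_stay s w Bf fc r0 Lr; have H2 := filter_bound s w Bf fc.
by rewrite /prediction (le_trans (ler_normD _ _))//; lra.
Qed.

Let gainE s r w : gain s r w = prediction s r one w.
Proof.
rewrite /prediction /gain; congr (_ + _).
rewrite (int_cst (pi s w)) mul1r.
by rewrite (congr1 fine (probability_setT (pi s w)) : fine _ = 1).
Qed.

Let prediction_adapted s r f : 0 <= s -> Bb f -> adapted (FY s) (prediction s r f).
Proof.
move=> s0 Bf; apply: (adapted_add (HFY s)); first exact: filter_adapted.
apply: (adapted_mul (HFY s)); first exact: (adapted_cst (HFY s)).
exact: filter_adapted s0 (BK Bf).
Qed.

Let Bprediction s r f : 0 <= s -> Bb f -> Bb (prediction s r f).
Proof.
move=> s0 Bf; apply: Bb_add; first exact: Bb_filter.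
by apply: Bb_mul; [exact: Bb_const|exact: Bb_filter s0 (BK Bf)].
Qed.

Let prediction_weight s r f b : 0 <= s -> Bb f -> adapted (FY s) b -> Bb b ->
  \int[P]_w (b w * prediction s r f w) =
  \int[P]_w (b w * (f (X s w) + r * K f (X s w))).
Proof.
move=> s0 Bf ab Bb_b.
have Bf1 := Bb_filter s0 Bf; have Bf2 := Bb_filter s0 (BK Bf).
have Bx1 := BbX s0 Bf; have Bx2 := BbX s0 (BK Bf).
under eq_Rintegral do rewrite /prediction mulrDr mulrCA.
under [RHS]eq_Rintegral do rewrite mulrDr mulrCA.
have Br : Bb (fun _ : Om => r) by exact: Bb_const.
rewrite intD//; [|exact: Bb_mul|by apply: Bb_mul => //; exact: Bb_mul].
rewrite intD//; [|exact: Bb_mul|by apply: Bb_mul => //; exact: Bb_mul].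
rewrite filter_weight//; congr (_ + _).
rewrite intZ//; last exact: Bb_mul.
rewrite intZ//; last exact: Bb_mul.
by rewrite filter_weight//; exact: BK.
Qed.

(** With [10 * (L * r) <= 1], the conditional probability of no observed jump is at least
    [1 - 2/10 - 18/100 > 1/2]: the loss [2 * (L * r)] from [stay] and the error [18 * (L * r) ^+ 2]
    of [increment_le]. *)
Let gain_ge s r w (G : set Om) : 0 <= s -> 0 <= r -> 10 * (L * r) <= 1 -> FY s G ->
  \int[P]_w \1_G w <= 2 * \int[P]_w \1_(G `&` NJ s r) w.
Proof.
move=> s0 r0 Lr FG.
have BG : Bb (fun w => \1_G w : R) by exact/Bb_ind/FYm/FG.
have BN : Bb (fun w => \1_(NJ s r) w : R) by exact/Bb_ind/FYm/FNJ.
have H := increment_le s0 r0 B1 one1 (adapted_cst (HFY s) 1) (fun=> one1 point) FG.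
have BI := Bincrement s0 r0 B1.
have L0 := rate_bound_ge0 lamL; have Lr0 : 0 <= L * r by rewrite mulr_ge0.
have H2 : \int[P]_w (\1_G w * (1 - 2 * (L * r))) <=
   \int[P]_w (\1_(G `&` NJ s r) w - \1_G w * 1 * increment s r one w).
  apply: int_le => //.
  - by apply: Bb_mul => //; exact: Bb_const.
  - apply: Bb_sub; first by apply: Bb_ind; apply: measurableI; [exact: FYm FG|exact/FYm/FNJ].
    by apply: Bb_mul => //; apply: Bb_mul => //; exact: Bb_const.
  move=> z; rewrite -indicM mulr1 -mulrBr; apply: ler_wpM2l; first exact: indic_ge0.
  rewrite /increment /one mulr1.
  have := stay_bound lamL VS mh (X s z) B1 one1; rewrite mulr1 ler_norml => /andP[h1 _].
  have : r * - (2 * L) <= r * K one (X s z) by exact: ler_wpM2l.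
  by rewrite /one; lra.
rewrite intB// in H2; last 2 first.
- by apply: Bb_ind; apply: measurableI; [exact: FYm FG|exact/FYm/FNJ].
- by apply: Bb_mul => //; apply: Bb_mul => //; exact: Bb_const.
have E0 : \int[P]_w (\1_G w * (1 - 2 * (L * r))) = (1 - 2 * (L * r)) * \int[P]_w \1_G w.
  by rewrite -intZ//; apply: eq_Rintegral => z _; rewrite mulrC.
move: H; rewrite ler_norml => /andP[H _].
have I0 : 0 <= \int[P]_w \1_G w by apply: int_ge0 => z; exact: indic_ge0.
have H3 : (L * r) ^+ 2 * \int[P]_w \1_G w <= 1 / 100 * \int[P]_w \1_G w.
  by apply: ler_wpM2r => //; rewrite expr2; nra.
have H4 : (L * r) * \int[P]_w \1_G w <= 1 / 10 * \int[P]_w \1_G w.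
  by apply: ler_wpM2r => //; lra.
have E1 : 3 * 1 * (6 * 1 * (L * r) ^+ 2) * (\int[P]_w \1_G w) =
  18 * ((L * r) ^+ 2 * \int[P]_w \1_G w) by ring.
have E2 : (1 - 2 * (L * r)) * (\int[P]_w \1_G w) =
  \int[P]_w \1_G w - 2 * (L * r * \int[P]_w \1_G w) by ring.
rewrite E1 in H; rewrite E0 E2 in H2; lra.
Qed.

Let sub_addr_cancel (x y z : R) : (x + z) - (y + z) = x - y.
Proof. by ring. Qed.

(** On [NJ s r] the event [D] is the trace of some [G] known at [s]. Conditioning at [s + r] and
    then at [s] leaves only the two [increment] terms, since the products
    [prediction one * prediction f] cancel. Each term contributes [36 * c], and [gain_ge] doubles
    the sum in passing from [G] back to [D]. *)
Lemma defect_le s r f c (D : set Om) : 0 <= s -> 0 <= r -> 10 * (L * r) <= 1 ->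
  Bb f -> (forall x, `|f x| <= c) -> FY (s + r) D -> D `<=` NJ s r ->
  `|\int[P]_w (\1_D w * defect s r f w)| <= 144 * c * (L * r) ^+ 2 * \int[P]_w \1_D w.
Proof.
move=> s0 r0 Lr Bf fc FD DN; have sr0 : 0 <= s + r by rewrite addr_ge0.
have c0 : 0 <= c by exact: le_trans (fc point).
have [G FG] := obs_trace s0 r0 FD; rewrite (setIidl DN) => DG.
have BG : Bb (fun w => \1_G w : R) by exact/Bb_ind/FYm/FG.
have BD : Bb (fun w => \1_D w : R) by exact/Bb_ind/FYm/FD.
have BN : Bb (fun w => \1_(NJ s r) w : R) by exact/Bb_ind/FYm/FNJ.
have Bg := Bprediction r s0 Bf; have Bb_b := Bprediction r s0 B1.
have ag := prediction_adapted r s0 Bf; have ab := prediction_adapted r s0 B1.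
have Bfl := Bb_filter sr0 Bf; have Bx := BbX sr0 Bf.
have BIf := Bincrement s0 r0 Bf; have BI1 := Bincrement s0 r0 B1.
have aG : adapted (FY s) (fun w => \1_G w : R) by exact: (adapted_indic (HFY s)).
have DE w : \1_D w = \1_G w * \1_(NJ s r) w :> R by rewrite DG indicM.
have mono (b : Om -> R) : adapted (FY s) b -> adapted (FY (s + r)) b.
  by move=> H B mB; apply: filtration_mono (H B mB); rewrite lerDl.
have aD : adapted (FY (s + r)) (fun w => \1_D w : R) by exact: (adapted_indic (HFY _)).
have abD : adapted (FY (s + r)) (fun w => \1_D w * prediction s r one w).
  exact: (adapted_mul (HFY (s + r)) aD (mono _ ab)).
have -> : \int[P]_w (\1_D w * defect s r f w) =
   \int[P]_w (\1_G w * prediction s r one w * increment s r f w) -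
   \int[P]_w (\1_G w * prediction s r f w * increment s r one w).
  have BDb : Bb (fun w => \1_D w * prediction s r one w) by exact: Bb_mul.
  have BGb : Bb (fun w => \1_G w * prediction s r one w) by exact: Bb_mul.
  have BGg : Bb (fun w => \1_G w * prediction s r f w) by exact: Bb_mul.
  have BDg : Bb (fun w => \1_D w * prediction s r f w) by exact: Bb_mul.
  have Bfx : Bb (fun w => f (X s w) + r * K f (X s w)).
    apply: Bb_add; first exact: BbX.
    by apply: Bb_mul; [exact: Bb_const|exact: BbX s0 (BK Bf)].
  have B1x : Bb (fun w => one (X s w) + r * K one (X s w)).
    apply: Bb_add; first exact: (BbX s0 B1).
    by apply: Bb_mul; [exact: Bb_const|exact: BbX s0 (BK B1)].
  transitivity (\int[P]_w (\1_D w * prediction s r one w * fl (s + r) w f) -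
     \int[P]_w (\1_D w * prediction s r f w)).
    rewrite -intB//; last exact: Bb_mul.
    apply: eq_Rintegral => w _; rewrite /defect gainE.
    move: (prediction s r one w) (prediction s r f w) (\1_D w : R) (fl _ w f) => a b e y.
    by ring.
  rewrite (filter_weight sr0 Bf abD BDb).
  have BGbI := Bb_mul BGb BIf; have BGgI := Bb_mul BGg BI1.
  have BGbx := Bb_mul BGb Bfx; have BGgx := Bb_mul BGg B1x.
  have W1 := prediction_weight r s0 Bf (adapted_mul (HFY s) aG ab) BGb.
  have W2 := prediction_weight r s0 B1 (adapted_mul (HFY s) aG ag) BGg.
  have E1 : \int[P]_w (\1_D w * prediction s r one w * f (X (s + r) w)) =
    \int[P]_w (\1_G w * prediction s r one w * increment s r f w) +
    \int[P]_w (\1_G w * prediction s r one w * (f (X s w) + r * K f (X s w))).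
    rewrite -(intD PT BGbI BGbx); apply: eq_Rintegral => w _; rewrite DE /increment.
    move: (prediction s r one w) (f (X s w) + _) (\1_G w : R) (f (X _ w)) => a b e y.
    by ring.
  have E2 : \int[P]_w (\1_D w * prediction s r f w) =
    \int[P]_w (\1_G w * prediction s r f w * increment s r one w) +
    \int[P]_w (\1_G w * prediction s r f w * (one (X s w) + r * K one (X s w))).
    rewrite -(intD PT BGgI BGgx).
    apply: eq_Rintegral => w _; rewrite DE /increment -[one (X (s + r) w)]/1.
    move: (prediction s r f w) (one (X s w) + _) (\1_G w : R) => a b e.
    by ring.
  have E3 : \int[P]_w (\1_G w * prediction s r one w * prediction s r f w) =
      \int[P]_w (\1_G w * prediction s r f w * prediction s r one w).
    by apply: eq_Rintegral => w _; rewrite mulrAC.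
  rewrite E1 E2 -[X in (_ + X) - _]W1 -[X in _ - (_ + X)]W2 E3; exact: sub_addr_cancel.
have I1 := increment_le s0 r0 Bf fc ab
  (fun w => prediction_bound s w B1 one1 r0 Lr) FG.
have I2 := increment_le s0 r0 B1 one1 ag
  (fun w => prediction_bound s w Bf fc r0 Lr) FG.
have I3 := gain_ge point s0 r0 Lr FG; rewrite -DG in I3.
apply: (le_trans (ler_normB _ _)); apply: (le_trans (lerD I1 I2)).
have k0 : 0 <= 72 * c * (L * r) ^+ 2 by rewrite mulr_ge0 ?sqr_ge0 ?mulr_ge0.
apply: (@le_trans _ _ (72 * c * (L * r) ^+ 2 * \int[P]_w \1_G w)).
  by apply: le_of_eq; ring.
apply: (le_trans (ler_wpM2l k0 I3)); by apply: le_of_eq; ring.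
Qed.

(** [defect_le] is applied to the event where the bound fails with a given sign, which must then be
    null. *)
Lemma filter_step s r f c : 0 <= s -> 0 <= r -> 10 * (L * r) <= 1 ->
  Bb f -> (forall x, `|f x| <= c) ->
  {ae P, forall w, ((s + r)%:E < yj s w)%E ->
    `|defect s r f w| <= 144 * c * (L * r) ^+ 2}.
Proof.
move=> s0 r0 Lr Bf fc; have sr0 : 0 <= s + r by rewrite addr_ge0.
set k := 144 * c * _.
have mono (b : Om -> R) : adapted (FY s) b -> adapted (FY (s + r)) b.
  by move=> H B mB; apply: filtration_mono (H B mB); rewrite lerDl.
have adef : adapted (FY (s + r)) (defect s r f).
  apply: (adapted_sub (HFY _)); last exact: (mono _ (prediction_adapted r s0 Bf)).
  apply: (adapted_mul (HFY _)); first exact: filter_adapted.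
  have -> : gain s r = prediction s r one by apply/funext => w; exact: gainE.
  exact: (mono _ (prediction_adapted r s0 B1)).
have Bdef : Bb (defect s r f).
  apply: Bb_sub; last exact: Bprediction.
  apply: Bb_mul; first exact: Bb_filter.
  have -> : gain s r = prediction s r one by apply/funext => w; exact: gainE.
  exact: Bprediction.
have H (e : R) : `|e| = 1 ->
    {ae P, forall w, ((s + r)%:E < yj s w)%E -> e * defect s r f w <= k}.
  move=> e1; pose D := NJ s r `&` [set w | k < e * defect s r f w].
  have FD : FY (s + r) D.
    apply: (sa_setI (HFY _)); first exact: FNJ.
    apply: adapted_gt; apply: (adapted_mul (HFY _)) adef.
    exact: (adapted_cst (HFY _)).
  have mD := FYm FD; have BD : Bb (fun w => \1_D w : R) by exact: Bb_ind.
  have Be : Bb (fun w => e * defect s r f w - k).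
    by apply: Bb_sub (Bb_const _ _); apply: Bb_mul => //; exact: Bb_const.
  have BDdef := Bb_mul BD Bdef; have BDe := Bb_mul BD Be.
  have U0 w : 0 <= \1_D w * (e * defect s r f w - k).
    have [Dw|nDw] := pselect (D w); last by rewrite (indicN nDw) mul0r.
    by rewrite (indic1 Dw) mul1r subr_ge0 ltW//; case: Dw.
  have I0 : \int[P]_w (\1_D w * (e * defect s r f w - k)) <= 0.
    have -> : \int[P]_w (\1_D w * (e * defect s r f w - k)) =
      e * \int[P]_w (\1_D w * defect s r f w) - k * \int[P]_w \1_D w.
      rewrite -(intZ PT e BDdef) -(intZ PT k BD).
      rewrite -(intB PT (Bb_mul (Bb_const _ e) BDdef) (Bb_mul (Bb_const _ k) BD)).
      apply: eq_Rintegral => w _.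
      by move: (defect s r f w) (\1_D w : R) => a b; ring.
    rewrite subr_le0; have := defect_le s0 r0 Lr Bf fc FD (@subIsetl _ _ _).
    by apply: le_trans; rewrite (le_trans (ler_norm _))// normrM e1 mul1r.
  have DE : [set w | 0 < \1_D w * (e * defect s r f w - k)] = D.
    apply/seteqP; split=> w /= [].
      by have [//|nDw] := pselect (D w); rewrite (indicN nDw) mul0r ltxx.
    by move=> ? ?; rewrite indic1 ?mul1r ?subr_gt0//.
  have := int_nonneg_eq0 BDe U0 I0; rewrite DE => /(ae_null mD).
  apply: filterS => w nD nj; rewrite leNgt; apply/negP => kd; exact: nD.
have := H (-1) (normrN1 _); have := H 1 (normr1 _); apply: filterS2 => w H1 H2 nj.
have := H1 nj; have := H2 nj; rewrite mul1r mulN1r => h1 h2.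
by rewrite ler_norml h2 andbT lerNl.
Qed.

Lemma filter_right_continuous t w f : 0 <= t -> Bb f ->
  fl s w f @[s --> t^'+] --> fl t w f.
Proof. by move=> t0; apply: setwise_cvg_int => A mA; exact: pi_rcont. Qed.

Let right_id t : s @[s --> t^'+] --> t.
Proof. by apply: cvg_at_right_filter; exact: cvg_id. Qed.

Let gap s t f c w := `|fl t w f * (1 + (t - s) * fl s w (K one)) -
  (fl s w f + (t - s) * fl s w (K f))| - 144 * c * (L * (t - s)) ^+ 2.

(** Rational pairs come first, so that one null set serves for all; then the end time and the
    starting time are approached from the right in turn. The strict mesh condition leaves room for
    moving the end time to the right. *)
Lemma filter_steps f c : Bb f -> (forall x, `|f x| <= c) ->
  {ae P, forall w s t, 0 <= s <= t -> (t%:E < yj s w)%E -> 10 * (L * (t - s)) < 1 ->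
    gap s t f c w <= 0}.
Proof.
move=> Bf fc; have L0 := rate_bound_ge0 lamL.
have : {ae P, forall w, forall pq : rat * rat,
  0 <= (ratr pq.1 : R) <= ratr pq.2 /\ 10 * (L * (ratr pq.2 - ratr pq.1)) <= 1 ->
  ((ratr pq.2 : R)%:E < yj (ratr pq.1) w)%E -> gap (ratr pq.1) (ratr pq.2) f c w <= 0}.
  apply: ae_count => -[p q] /=; apply: ae_imp => -[/andP[p0 pq] Lpq].
  have := filter_step p0 _ Lpq Bf fc; rewrite subr_ge0 => /(_ pq).
  apply: filterS => w Hw nj; rewrite /gap subr_le0; move: Hw.
  by rewrite /defect subrKC; exact.
apply: filterS => w Hw s t /andP[s0 st] tj Lst; have t0 := le_trans s0 st.
have step1 (p : rat) (v : R) : 0 <= (ratr p : R) <= v -> (v%:E < yj (ratr p) w)%E ->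
    10 * (L * (v - ratr p)) < 1 -> gap (ratr p) v f c w <= 0.
  move=> /andP[p0 pv] vj Lpv; have v0 := le_trans p0 pv.
  apply: (@right_limit_le0 _ (fun v => gap (ratr p) v f c w)).
    apply: cvgB.
      apply: cvg_norm; apply: cvgB.
        apply: cvgM; first exact: filter_right_continuous.
        apply: cvgD; first exact: cvg_cst.
        by apply: cvgM; [apply: cvgB; [exact: right_id|exact: cvg_cst]|exact: cvg_cst].
      apply: cvgD; first exact: cvg_cst.
      by apply: cvgM; [apply: cvgB; [exact: right_id|exact: cvg_cst]|exact: cvg_cst].
    apply: cvgM; first exact: cvg_cst.
    have H : L * (u - ratr p) @[u --> v^'+] --> L * (v - ratr p).
      by apply: cvgM; [exact: cvg_cst|apply: cvgB; [exact: right_id|exact: cvg_cst]].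
    by under eq_fun do rewrite expr2; exact: cvgM.
  have [e1 e10 He1] : exists2 e : R, 0 < e & ((v + e)%:E < yj (ratr p) w)%E.
    have [->|[u pu ju]] := first_jump_cases (HY w) p0; first by exists 1; rewrite ?ltry.
    move: vj; rewrite ju lte_fin => vu; exists ((u - v) / 2); first by lra.
    by rewrite lte_fin; lra.
  (* The second bound preserves the mesh condition at [q]; [L + 1] avoids a division by zero. *)
  exists (Num.min e1 ((1 - 10 * (L * (v - ratr p))) / (10 * (L + 1)))).
    rewrite lt_min e10 divr_gt0 ?subr_gt0//; lra.
  move=> q /andP[vq]; rewrite -ltrBlDl lt_min => /andP[q1 q2].
  apply: (Hw (p, q)) => /=; last first.
    by rewrite (le_lt_trans _ He1)// lee_fin -lerBlDl ltW.
  rewrite p0 (le_trans pv (ltW vq)); split=> //.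
  move: q2; rewrite ltr_pdivlMr; last by lra.
  move=> q2; have : 10 * (L * (ratr q - v)) <= (ratr q - v) * (10 * (L + 1)) by nra.
  lra.
move: st; rewrite le_eqVlt => /predU1P[->|st].
  rewrite /gap subrr !mul0r !addr0 mulr1 subrr normr0 mulr0 expr2 mulr0 mulr0.
  by rewrite subrr.
apply: (@right_limit_le0 _ (fun s => gap s t f c w)).
  have T : t - u @[u --> s^'+] --> t - s.
    by apply: cvgB; [exact: cvg_cst|exact: right_id].
  apply: cvgB.
    apply: cvg_norm; apply: cvgB.
      apply: cvgM; first exact: cvg_cst.
      apply: cvgD; first exact: cvg_cst.
      by apply: (cvgM T); exact: filter_right_continuous s0 (BK B1).
    apply: cvgD; first exact: filter_right_continuous.
    by apply: (cvgM T); exact: filter_right_continuous s0 (BK Bf).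
  apply: cvgM; first exact: cvg_cst.
  have H : L * (t - u) @[u --> s^'+] --> L * (t - s) by apply: cvgM => //; exact: cvg_cst.
  by under eq_fun do rewrite expr2; exact: cvgM.
exists (t - s); first by rewrite subr_gt0.
move=> q /andP[sq]; rewrite subrKC => qt; apply: step1.
- by rewrite (le_trans s0 (ltW sq)) ltW.
- rewrite (first_jump_id (ltW sq))// (le_lt_trans _ tj)// lee_fin ltW//.
- apply: le_lt_trans Lst; rewrite ler_wpM2l// ler_wpM2l// lerB// ltW//.
Qed.

Definition filter_drift t w f := fl t w (K f) - fl t w f * fl t w (K one).

Lemma filter_expansion f c : Bb f -> (forall x, `|f x| <= c) ->
  {ae P, forall w s t, 0 <= s <= t -> (t%:E < yj s w)%E -> 10 * (L * (t - s)) < 1 ->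
    `|fl t w f - fl s w f| <= 19 * c * (L * (t - s)) /\
    `|fl t w f - fl s w f - (t - s) * filter_drift s w f| <=
      182 * c * (L * (t - s)) ^+ 2}.
Proof.
move=> Bf fc; have L0 := rate_bound_ge0 lamL; have c0 : 0 <= c by exact: le_trans (fc point).
have := filter_steps Bf fc; apply: filterS => w Hw s t st tj Lst.
have := Hw s t st tj Lst; rewrite /gap /filter_drift subr_le0.
move: st => /andP[s0 st]; have r0 : 0 <= t - s by rewrite subr_ge0.
have b1 := filter_bound t w Bf fc.
have b2 : `|fl s w (K one)| <= 2 * L.
  have := filter_bound s w (BK B1) (fun x => stay_bound lamL VS mh x B1 one1).
  by rewrite mulr1.
have b3 := filter_bound s w (BK Bf) (fun x => stay_bound lamL VS mh x Bf fc).
move: (t - s) r0 Lst b1 b2 b3 => r r0 Lr.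
move: (fl t w f) (fl s w f) (fl s w (K f)) (fl s w (K one)) => y x a b b1 b2 b3 H.
exact: step_algebra.
Qed.

Variable pi_left : R -> Om -> probability E R.
Hypothesis pi_llim : forall w t (A : set E), 0 < t -> measurable A ->
  pi s w A @[s --> t^'-] --> pi_left t w A.

Lemma filter_left_limit t w f : 0 < t -> Bb f ->
  fl s w f @[s --> t^'-] --> \int[pi_left t w]_x f x.
Proof. by move=> t0; apply: setwise_cvg_int => A mA; exact: pi_llim. Qed.

(** The filter of a separating set is the conditional mean of the adapted variable [\1_(V k) (Y t)],
    hence equal to it almost surely at all rational times. One-sided limits extend this to every [t]
    and to the left limits, with a single null set. *)
Lemma filter_fibre : {ae P, forall w,
  (forall t, 0 <= t -> {ae pi t w, forall z, h z = h (X t w)}) /\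
  (forall t a, 0 < t -> (\forall s \near t^'-, h (X s w) = a) ->
    {ae pi_left t w, forall z, h z = a})}.
Proof.
pose g k : E -> R := \1_(h @^-1` (V k)).
have mhV k : measurable (h @^-1` (V k)).
  by rewrite -[X in measurable X]setTI; apply: mh => //; exact: VS.1.
have Bg k : Bb (g k) by exact: Bb_ind.
have : {ae P, forall w, forall qk : rat * nat, 0 <= (ratr qk.1 : R) ->
    fl (ratr qk.1) w (g qk.2) = \1_(V qk.2) (h (X (ratr qk.1) w))}.
  apply: ae_count => -[q k] /=; apply: ae_imp => q0; set t := ratr q.
  have FV : FY t [set w | V k (h (X t w))].
    by apply: filtration_gen; [rewrite q0 lexx|exact: VS.1].
  have BV : Bb (fun w => \1_(V k) (h (X t w)) : R) by exact: (BbX q0 (Bg k)).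
  have Bfl := Bb_filter q0 (Bg k).
  have aV : adapted (FY t) (fun w => \1_(V k) (h (X t w)) : R).
    have := adapted_indic (R := R) (HFY t) FV; congr (adapted _ _).
  have := adapted_eq0 (HFY t) (@FYm t) (Bb_sub Bfl BV)
    (adapted_sub (HFY t) (filter_adapted q0 (Bg k)) aV).
  move=> H; have : {ae P, forall w, fl t w (g k) - \1_(V k) (h (X t w)) = 0}.
    apply: H => A FA; have BA : Bb (fun w => \1_A w : R) by exact/Bb_ind/FYm/FA.
    under eq_Rintegral do rewrite mulrBr.
    rewrite (intB PT (Bb_mul BA Bfl) (Bb_mul BA BV)) (filter_cond q0 (Bg k) FA).
    by rewrite subrr.
  by apply: filterS => w /eqP; rewrite subr_eq0 => /eqP.
apply: filterS => w Hw; split.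
  move=> t t0; apply: (fibre_ae VS mh) => k; apply/eqP; rewrite -subr_eq0 -normr_le0.
  have [e e0 He] := path_right (HY w) t0.
  apply: (@right_limit_le0 _ (fun s => `|fl s w (g k) - \1_(V k) (h (X t w))|)).
    by apply: cvg_norm; apply: cvgB (cvg_cst _); exact: filter_right_continuous.
  exists e => // q /andP[tq qe]; have q0 : 0 <= (ratr q : R) by rewrite (le_trans t0)// ltW.
  by rewrite (Hw (q, k) q0) /= He ?(ltW tq)// subrr normr0.
move=> t a t0 /near_leftP[e e0 He]; apply: (fibre_ae VS mh) => k.
apply/eqP; rewrite -subr_eq0 -normr_le0.
apply: (@left_limit_le0 _ (fun s => `|fl s w (g k) - \1_(V k) a|) t).
  by apply: cvg_norm; apply: cvgB (cvg_cst _); exact: filter_left_limit.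
exists (Num.min e t); first by rewrite lt_min e0.
move=> q /andP[]; rewrite ltrBlDr -ltrBlDl lt_min !ltrBlDl => /andP[qe q0] qt.
have q0' : 0 <= (ratr q : R) by apply: ltW; rewrite -(ltrD2r t) add0r.
rewrite (Hw (q, k) q0') /=.
by rewrite He ?subrr ?normr0// qt andbT ltrBlDr.
Qed.

End filter.

(** * The filter at jumps *)

#[local] Arguments jump_time : simpl never.

Lemma int_norm_le_ae d (T : measurableType d) (R : realType) (m : probability T R)
    (f g : T -> R) : Bb f -> Bb g -> (forall x, 0 <= g x) ->
  {ae m, forall x, `|f x| <= g x} -> `|\int[m]_x f x| <= \int[m]_x g x.
Proof.
move=> Bf Bg g0 fg; pose D := [set x | `|f x| <= g x].
have mD : measurable D.
  rewrite -[X in measurable X]setTI; apply: measurable_fun_le => //.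
    exact/Bb_meas/Bb_norm.
  exact: Bb_meas.
have BDf : Bb (fun x => \1_D x * f x) by apply: Bb_mul => //; exact: Bb_ind.
rewrite (ae_eq_int Bf BDf); last by apply: filterS fg => x fx; rewrite indic1// mul1r.
apply: int_norm_le => //; first exact: probabilityT_lty.
move=> x; have [Dx|nD] := pselect (D x); first by rewrite (indic1 Dx) mul1r.
by rewrite (indicN nD) mul0r normr0.
Qed.

(** The exceptional events may depend on the precision [x]; those for [x = k.+1%:R^-1] have a null
    intersection. *)
Lemma small_cover_ae d (T : measurableType d) (R : realType) (m : probability T R)
    (Q : T -> Prop) :
  (forall x : R, 0 < x -> exists D, [/\ measurable D, fine (m D) <= x &
     {ae m, forall w, ~ D w -> Q w}]) -> {ae m, forall w, Q w}.
Proof.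
move=> H; have H' (k : nat) := H k.+1%:R^-1 (ltac:(by rewrite invr_gt0)).
have [D HD] := choice H'.
have mD k : measurable (D k) by case: (HD k).
have mI : measurable (\bigcap_k D k) by exact: bigcap_measurable.
have I0 : m (\bigcap_k D k) = 0%E.
  apply/eqP; rewrite eq_le measure_ge0 andbT -(@fineK _ (m _)) ?fin_num_measure// lee_fin.
  rewrite leNgt; apply/negP => /small_invS[k].
  have [_ Dk _] := HD k.+1.
  have : fine (m (\bigcap_k D k)) <= fine (m (D k.+1)).
    rewrite fine_le ?fin_num_measure// le_measure ?inE//.
    by move=> w; exact.
  move=> h1 h2; have := le_trans h2 (le_trans h1 Dk).
  by rewrite lef_pV2 ?posrE// ler_nat ltnn.
have Hae : {ae m, forall w, forall k, ~ D k w -> Q w}.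
  by apply/ae_foralln => k; case: (HD k).
move: Hae (ae_null mI I0); apply: filterS2 => w Hw nI.
apply: contrapT => nQ; apply: nI => k _; apply: contrapT => nD; exact: nQ (Hw k nD).
Qed.

Lemma finite_cover d (T : measurableType d) (R : realType) (m : probability T R)
    (Q : nat -> set T -> Prop) (N : nat) (x : R) :
  (forall i, (i < N)%N -> exists D, [/\ measurable D, fine (m D) <= x & Q i D]) ->
  exists D, [/\ measurable D, fine (m D) <= N%:R * x &
    forall i, (i < N)%N -> exists2 D', D' `<=` D & Q i D'].
Proof.
elim: N => [|N IH] H.
  by exists set0; split=> //; rewrite measure0 mul0r.
have [|D [mD PD HD]] := IH; first by move=> i iN; apply: H; exact: ltnW.
have [D' [mD' PD' HD']] := H N (ltnSn N).
exists (D `|` D'); split; first exact: measurableU.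
  rewrite -natr1 mulrDl mul1r (le_trans _ (lerD PD PD'))//.
  rewrite -fineD ?fin_num_measure// fine_le ?fin_num_measure ?measureU2//.
    exact: measurableU.
  by rewrite fin_numD !fin_num_measure.
move=> i; rewrite ltnS leq_eqVlt => /predU1P[->|iN]; first by exists D' => // w; right.
by have [D2 D2D Q2] := HD i iN; exists D2 => // w /D2D; left.
Qed.

Section jumps.
Context d (Om : measurableType d) (R : realType) (P : probability Om R).
Hypothesis P_complete : measure_is_complete P.
Context d' (E : measurableType d').
Variables (U : (set E)^nat) (US : separates_points U).
Variable X : R -> Om -> E.
Hypothesis X_meas : forall t, 0 <= t -> measurable_fun setT (X t).
Hypothesis X_jump : forall w, pure_jump_path (X^~ w).
Variables (lam : R.-fker E ~> E) (L : R).
Hypothesis lamL : forall x, (lam x setT <= L%:E)%E.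
Hypothesis X_rate : has_rate P X lam.
Variables (d2 : measure_display) (O : measurableType d2) (V : (set O)^nat).
Hypothesis VS : separates_points V.
Variable h : E -> O.
Hypothesis mh : measurable_fun setT h.
Local Notation Y := (fun t w => h (X t w)).
Local Notation FY := (filtration P Y).
Variable pi : R -> Om -> probability E R.
Hypothesis pi_filter : forall t (f : E -> R), 0 <= t -> Bb f ->
  is_cond_exp P (FY t) (fun w => f (X t w)) (fun w => \int[pi t w]_x f x).
Hypothesis pi_rcont : forall w t A, 0 <= t -> measurable A ->
  pi s w A @[s --> t^'+] --> pi t w A.
Implicit Types (r s t : R) (A : set Om) (w : Om) (f : E -> R) (c : R).

Variable pi_left : R -> Om -> probability E R.
Hypothesis pi_llim : forall w t (A : set E), 0 < t -> measurable A ->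
  pi s w A @[s --> t^'-] --> pi_left t w A.

Local Notation fl t w f := (\int[pi t w]_x f x).
Local Notation yj s w := (first_jump (fun t => h (X t w)) s).
Let HFY t : sigma_algebra setT (FY t) := filtration_sigma P Y t.
Let PT : (P setT < +oo)%E := probabilityT_lty P.
Let HY w : pure_jump_path (fun t => h (X t w)).
Proof. exact: (@obs_path_jump _ _ _ _ _ X X_jump _ _ h w). Qed.
Let Y_meas t : 0 <= t -> measurable_fun setT (Y t).
Proof. by move=> t0; exact: measurableT_comp mh (X_meas t0). Qed.

Let FYm t A : FY t A -> measurable A.
Proof. exact: (filtration_measurable P_complete Y_meas). Qed.

Let BbX t f : 0 <= t -> Bb f -> Bb (fun w => f (X t w)).
Proof.
move=> t0 Bf; have [c _ fc] := Bb_exists_bound Bf.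
by apply: (Bb_le (M := c)) => //; exact: measurableT_comp (Bb_meas Bf) (X_meas t0).
Qed.

Let Bfl t f : 0 <= t -> Bb f -> Bb (fun w => fl t w f).
Proof. exact: (Bb_filter P_complete X_meas mh pi_filter). Qed.

Let afl t f : 0 <= t -> Bb f -> adapted (FY t) (fun w => fl t w f).
Proof. exact: (filter_adapted pi_filter). Qed.

Let filter_left t w f : 0 < t -> Bb f ->
  fl s w f @[s --> t^'-] --> \int[pi_left t w]_x f x.
Proof. exact: (filter_left_limit pi_llim). Qed.

(** The left limit is taken in [filter_expansion]. The time [t] may be the jump itself, as only
    earlier times enter. *)
Lemma filter_left_lipschitz f c : Bb f -> (forall x, `|f x| <= c) ->
  {ae P, forall w s t, 0 <= s < t -> (t%:E <= yj s w)%E -> 10 * (L * (t - s)) < 1 ->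
    `|\int[pi_left t w]_x f x - fl s w f| <= 19 * c * (L * (t - s))}.
Proof.
move=> Bf fc; have L0 := rate_bound_ge0 lamL; have c0 : 0 <= c by exact: le_trans (fc point).
have := filter_expansion P_complete US X_meas X_jump lamL X_rate VS mh pi_filter pi_rcont Bf fc; apply: filterS => w Hw s t /andP[s0 st] tj Lst.
have t0 := le_lt_trans s0 st; rewrite -subr_le0.
apply: (@left_limit_le0 _ (fun v => `|fl v w f - fl s w f| - 19 * c * (L * (t - s))) t).
  apply: cvgB (cvg_cst _); apply: cvg_norm; apply: cvgB (cvg_cst _).
  exact: filter_left.
exists (t - s); first by rewrite subr_gt0.
move=> q; rewrite subKr => /andP[sq qt]; rewrite subr_le0.
have qs : ratr q - s <= t - s by rewrite lerB// ltW.
have [|||H _] := Hw s (ratr q).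
- by rewrite s0 ltW.
- by rewrite (lt_le_trans _ tj)// lte_fin.
- by apply: le_lt_trans Lst; rewrite ler_wpM2l// ler_wpM2l.
apply: (le_trans H); apply: ler_wpM2l; first by rewrite mulr_ge0.
exact: ler_wpM2l.
Qed.

Let BM f : Bb f -> Bb (leave lam h f). Proof. exact: (Bb_leave lamL VS mh). Qed.

Let leave_le f c (x : E) : Bb f -> (forall x, `|f x| <= c) -> `|leave lam h f x| <= c * L.
Proof. move=> Bf fc; exact: (leave_bound lamL VS mh). Qed.

(** The jump measures and the disintegrated mean stay abstract: what enters is the mass formula
    [jmE] and the integrated identity [eta_disint], so that no topology of [E] appears. *)
Variable jm : probability E R -> O -> {finite_measure set E -> \bar R}.
Hypothesis jmE : forall nu y (B : set E), measurable B ->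
  jm nu y B = kernel_mixture lam nu (B `&` ~` (h @^-1` [set y])).
Variables (phi : E -> R) (eta : finite_measure_space E R * O -> R).
Hypothesis phi_Bb : Bb phi.
Hypothesis eta_Bb : Bb eta.
Hypothesis eta_disint : forall (nu : finite_measures E R) (B : set O), measurable B ->
  \int[nu]_z (\1_B (h z) * (phi z - eta (nu : finite_measure_space E R, h z))) = 0.

Let mfibre x : measurable (h @^-1` [set h x]).
Proof.
have [mI _] := Bb_pair1 x (Bb_ind R (measurable_same_fibre VS mh)).
have := mI measurableT [set 1] (measurable_set1 _); rewrite setTI; congr measurable.
apply/seteqP; split=> z /=.
  have [sf|ns] := pselect (same_fibre h (x, z)); first by move=> _; rewrite -(sf : h x = h z).
  by rewrite (indicN ns) => /esym/eqP; rewrite oner_eq0.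
by move=> hz; rewrite indic1// /same_fibre /= hz.
Qed.

Let leave_indic (B : set E) x : measurable B ->
  lam x (B `&` ~` (h @^-1` [set h x])) = (leave lam h \1_B x)%:E.
Proof.
move=> mB; have mBf : measurable (B `&` ~` (h @^-1` [set h x])).
  by apply: measurableI => //; exact: measurableC.
rewrite -(fineK (rate_fin_num lamL x mBf)) -(int_indic _ mBf); congr EFin.
apply: eq_Rintegral => z _; rewrite -indicM mulrC; congr (_ * _).
by apply: indic_congr; rewrite /same_fibre /=; split=> H e; apply: H.
Qed.

(** * The first observed jump in one time cell *)

Section cell.
Variables s r : R.
Hypothesis s0 : 0 <= s.
Hypothesis r0 : 0 <= r.
Implicit Types (a b : R) (C : set Om).
Let sr0 : 0 <= s + r. Proof. by rewrite addr_ge0. Qed.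

Let jt w := fine (yj s w).
Let S := [set w | (yj s w <= (s + r)%:E)%E].

Lemma first_obs_jump_gt w : (s%:E < yj s w)%E.
Proof. by have := first_jump_gt (HY w) s0. Qed.

Let SE w : S w -> yj s w = (jt w)%:E /\ s < jt w <= s + r.
Proof.
rewrite /S /jt /=; have := first_obs_jump_gt w.
by case: (yj s w) => [u| |]//=; rewrite lte_fin lee_fin => -> ->.
Qed.

(* The integral of f against the jump measure at the first jump after s. *)
Let N f w := \1_S w * \int[pi_left (jt w) w]_x leave lam h f x.

Let N_bound f c w : Bb f -> (forall x, `|f x| <= c) -> `|N f w| <= c * L.
Proof.
move=> Bf fc; rewrite /N normrM.
have H : `|\int[pi_left (jt w) w]_x leave lam h f x| <= c * L.
  have := int_bound (probabilityT_lty (pi_left (jt w) w)) (BM Bf) (fun x => leave_le x Bf fc).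
  by rewrite (congr1 fine (probability_setT (pi_left (jt w) w)) : fine _ = 1) mulr1.
by rewrite (le_trans _ H)// ler_piMl// indic_norm_le1.
Qed.

(* Sets describing the observation strictly before its first jump after s. *)
Definition before_jump : set_system Om :=
  <<s [set C | exists a A, [/\ s <= a, FY a A & C = A `&` [set w | (a%:E < yj s w)%E]]] >>.

Lemma before_jump_sigma : sigma_algebra setT before_jump.
Proof. exact: g_sigma_algebraP. Qed.
Let HB := before_jump_sigma.

Lemma before_jump_gen a A : s <= a -> FY a A ->
  before_jump (A `&` [set w | (a%:E < yj s w)%E]).
Proof. by move=> sa FA; apply: sub_sigma_algebra; exists a, A. Qed.

Lemma before_jump_gt a : s <= a -> before_jump [set w | (a%:E < yj s w)%E].
Proof.
move=> sa; rewrite -[X in before_jump X]setTI; apply: before_jump_gen => //.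
exact: (sa_true (HFY a)).
Qed.

Lemma before_jump_start A : FY s A -> before_jump A.
Proof.
move=> FA; have := before_jump_gen (lexx s) FA; congr before_jump.
by apply/setIidl => w _; exact: first_obs_jump_gt.
Qed.

Lemma before_jump_measurable C : before_jump C -> measurable C.
Proof.
apply: smallest_sub; first exact: sigma_algebra_measurable.
move=> _ [a [A [sa FA ->]]]; apply: measurableI; first exact: FYm FA.
exact: (FYm (filtration_first_jump_gt P VS HY a s0)).
Qed.

Let BS : before_jump S.
Proof.
apply: (sa_iff HB (B := [set w | ~ ((s + r)%:E < yj s w)%E])).
  by move=> w; rewrite /S /= leNgt; split=> /negP.
by apply: (sa_not HB); apply: before_jump_gt; rewrite lerDl.
Qed.

(** The left limit at the jump is approximated by the filter at the left end [g k i] of the grid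
    cell containing the jump. Cut down to the event that the jump comes after [g k i], this value is
    known strictly before the jump. *)
Let N_adapted f : Bb f -> adapted before_jump (N f).
Proof.
move=> Bf; apply/(adaptedP HB).
pose g (k : nat) i : R := s + i%:R * k.+1%:R^-1.
pose cell k i := [set w | ((g k i)%:E < yj s w)%E] `&` [set w | ~ ((g k i.+1)%:E < yj s w)%E].
pose J k := (Num.truncn (r * k.+1%:R)).+1.
pose b k w := \1_S w * \sum_(i < J k) (\1_(cell k i) w * fl (g k i) w (leave lam h f)).
have gs k i : s <= g k i by rewrite lerDl mulr_ge0.
have mb k : measurable_fun setT (b k : g_sigma_algebraType before_jump -> R).
  apply: measurable_funM.
    by apply: measurable_indic; exact: sub_sigma_algebra BS.
  apply: measurable_sum => i.
  have -> : (fun w => \1_(cell k i) w * fl (g k i) w (leave lam h f)) =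
    (fun w => \1_[set w | ~ ((g k i.+1)%:E < yj s w)%E] w *
      (\1_[set w | ((g k i)%:E < yj s w)%E] w * fl (g k i) w (leave lam h f))).
    by apply/funext => w; rewrite mulrA indicM setIC.
  apply: measurable_funM.
    apply: measurable_indic; apply: sub_sigma_algebra.
    by apply: (sa_not HB); exact: before_jump_gt.
  apply/(adaptedP HB) => B mB.
  have FB : FY (g k i) ((fun w => fl (g k i) w (leave lam h f)) @^-1` B).
    by apply: afl => //; [exact: le_trans (gs k i)|exact: BM].
  apply: (sa_iff HB (B := [set w |
    (((fun w => fl (g k i) w (leave lam h f)) @^-1` B) `&` [set w | ((g k i)%:E < yj s w)%E]) w
    \/ (~ ((g k i)%:E < yj s w)%E /\ B 0)])).
    move=> w /=; have [H|H] := pselect ((g k i)%:E < yj s w)%E.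
      by rewrite indic1// mul1r; split=> [?|[[]|[]]//]; left.
    by rewrite indicN// mul0r; split=> [?|[[]|[]]//]; right.
  apply: (sa_or HB); first exact: before_jump_gen.
  apply: (sa_and HB); first by apply: (sa_not HB); exact: before_jump_gt.
  by have [?|?] := pselect (B 0); [exact: (sa_true HB)|exact: (sa_false HB)].
suff lim (w : Om) : b k w @[k --> \oo] --> N f w.
  by apply: (@measurable_fun_cvg _ _ _ setT
    (fun k => b k : g_sigma_algebraType before_jump -> R)) => // w _; exact: lim.
have [Sw|nSw] := pselect (S w); last first.
  by rewrite /b /N (indicN nSw) mul0r; under eq_fun do rewrite mul0r; exact: cvg_cst.
have [ju /andP[sj jr]] := SE Sw.
have j0 : 0 < jt w by exact: le_lt_trans sj.
rewrite /b /N (indic1 Sw) mul1r; under eq_fun do rewrite mul1r.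
have fll : fl v w (leave lam h f) @[v --> (jt w)^'-] --> \int[pi_left (jt w) w]_x leave lam h f x.
  exact: filter_left j0 (BM Bf).
have sjr : s < jt w <= s + r by rewrite sj.
suff -> : (fun k => \sum_(i < J k) \1_(cell k i) w * fl (g k i) w (leave lam h f)) =
  (fun k => \sum_(i < J k) \1_(`]g k i, g k i.+1]) (jt w) * fl (g k i) w (leave lam h f)).
  exact: left_grid_cvg sjr fll.
apply/funext => k; apply: eq_bigr => i _; congr (_ * _); apply: indic_congr.
rewrite /cell /= ju !lte_fin in_itv/=; split=> [[-> /negP]|/andP[-> ?]].
  by rewrite -leNgt.
by split=> //; apply/negP; rewrite -leNgt.
Qed.

Let Bjump f : Bb f -> Bb (fun w => f (X (jt w) w)).
Proof.
move=> Bf; have [c _ fc] := Bb_exists_bound Bf; apply: (Bb_le (M := c)) => //.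
apply: measurableT_comp (Bb_meas Bf) _.
exact: (obs_jump_target_measurable P_complete X_meas X_jump VS mh s0).
Qed.

Let BN f : Bb f -> Bb (N f).
Proof.
move=> Bf; have [c _ fc] := Bb_exists_bound Bf.
by apply: (adapted_Bb before_jump_measurable (N_adapted Bf) (c := c * L)) => w; exact: N_bound.
Qed.

Let one : E -> R := fun=> 1.
Let B1 : Bb one. Proof. exact: Bb_const. Qed.
Let one1 (x : E) : `|one x| <= 1. Proof. by rewrite normr1. Qed.
Let L0 : 0 <= L. Proof. exact: rate_bound_ge0 lamL. Qed.

Let late b k := [set w | (yj s w <= (b + k)%:E)%E].

Let late_jump b k w : s <= b -> (b%:E < yj s w)%E ->
  yj b w = yj s w /\ (late b k w <-> (~` no_obs_jump X h b k) w).
Proof.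
move=> sb bj; have E0 := first_jump_id sb bj; split=> //.
by rewrite /late /no_obs_jump /= E0 leNgt; split=> /negP.
Qed.

Let late_indic b k A w : s <= b -> A `<=` [set w | (b%:E < yj s w)%E] ->
  \1_A w * \1_(late b k) w = \1_A w * \1_(~` no_obs_jump X h b k) w :> R.
Proof.
move=> sb AJ; have [Aw|nA] := pselect (A w); last by rewrite (indicN nA) !mul0r.
by congr (_ * _); apply: indic_congr; exact: (late_jump k sb (AJ _ Aw)).2.
Qed.

Let leave_err b k f w := \1_(~` no_obs_jump X h b k) w * f (X (fine (yj b w)) w) -
  k * leave lam h f (X b w).

Let leave_errB b k f : 0 <= b -> Bb f -> Bb (leave_err b k f).
Proof.
move=> b0 Bf; have [c _ fc] := Bb_exists_bound Bf; apply: Bb_sub.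
  apply: Bb_mul.
    apply/Bb_ind/measurableC/FYm; exact: (filtration_no_obs_jump P X_jump VS h k b0).
  apply: (Bb_le (M := c)) => //; apply: measurableT_comp (Bb_meas Bf) _.
  exact: (obs_jump_target_measurable P_complete X_meas X_jump VS mh b0).
by apply: Bb_mul; [exact: Bb_const|exact: BbX b0 (BM Bf)].
Qed.

Let leave_err_le b k f c n m A : 0 <= b -> 0 <= k -> Bb f -> (forall x, `|f x| <= c) ->
  adapted (FY b) n -> (forall w, `|n w| <= m) -> FY b A ->
  `|\int[P]_w (\1_A w * n w * leave_err b k f w)| <= 9 * m * c * (L * k) ^+ 2.
Proof.
move=> b0 k0 Bf fc an nm FA; have c0 : 0 <= c by exact: le_trans (fc point).
have m0 : 0 <= m by exact: le_trans (nm point).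
have H A' : FY b A' -> `|\int[P]_w (\1_A' w * leave_err b k f w)| <=
    3 * c * (L * k) ^+ 2 * \int[P]_w \1_A' w.
  move=> FA'; apply: (leave_step P_complete US X_meas X_jump lamL X_rate VS mh) => //.
  exact: (@filtration_obs _ _ _ P _ _ X _ _ h mh b A' FA').
have := weight_approx_signed (HFY b) (@FYm b) (leave_errB k b0 Bf) H an nm FA.
move=> /le_trans; apply; rewrite int_indic; last exact: FYm FA.
have A1 : fine (P A) <= 1.
  rewrite -(congr1 fine (probability_setT P) : fine (P setT) = 1).
  by rewrite fine_le ?fin_num_measure ?le_measure ?inE//; exact: FYm FA.
rewrite (_ : 9 * m * c * (L * k) ^+ 2 = 3 * m * (3 * c * (L * k) ^+ 2) * 1); last by ring.
by apply: ler_wpM2l => //; rewrite !mulr_ge0// sqr_ge0.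
Qed.

Let late_le b k A : s <= b -> 0 <= k -> 10 * (L * k) < 1 -> FY b A ->
  A `<=` [set w | (b%:E < yj s w)%E] ->
  \int[P]_w (\1_A w * \1_(late b k) w) <= 2 * (L * k).
Proof.
move=> sb k0 Lk FA AJ; have b0 := le_trans s0 sb.
have Lk0 : 0 <= L * k by rewrite mulr_ge0.
have BA : Bb (fun w => \1_A w : R) by exact/Bb_ind/FYm/FA.
have := leave_err_le b0 k0 B1 one1 (adapted_cst (HFY b) 1) (fun=> one1 point) FA.
rewrite ler_norml => /andP[_ H].
have BD : Bb (fun w => \1_A w * 1 * leave_err b k one w).
  by apply: Bb_mul (leave_errB k b0 B1); apply: Bb_mul BA _; exact: Bb_const.
have : \int[P]_w (\1_A w * \1_(late b k) w) <=
    \int[P]_w (\1_A w * 1 * leave_err b k one w + L * k).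
  apply: int_le => //.
  - apply: Bb_mul => //; apply/Bb_ind/(FYm (filtration_first_jump_le P VS HY (b + k) s0)).
  - by apply: Bb_add => //; exact: Bb_const.
  move=> w; rewrite (late_indic k w sb AJ) /leave_err /one !mulr1.
  have [Aw|nA] := pselect (A w); last by rewrite (indicN nA) !mul0r add0r.
  rewrite (indic1 Aw) !mul1r -addrA lerDl.
  have := leave_le (X b w) B1 one1; rewrite mul1r ler_norml => /andP[_ h1].
  by rewrite addrC subr_ge0 mulrC ler_wpM2r.
rewrite (intD PT BD (Bb_const _ _)) int_cst.
rewrite (congr1 fine (probability_setT P) : fine (P setT) = 1) mulr1.
(* The error [9 * (L * k) ^+ 2] is at most [9/10 * (L * k)]; with the main term [L * k] this stays
   below [2 * (L * k)]. *)
rewrite expr2 in H; nra.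
Qed.

(** [94 = 76 + 18]: the cost of freezing the filter at [b], and two errors [9 * c * L] of
    [leave_err_le]. *)
Let increment b k A f c : s <= b -> 0 <= k -> b + k <= s + r -> 10 * (L * k) < 1 ->
  Bb f -> (forall x, `|f x| <= c) -> FY b A -> A `<=` [set w | (b%:E < yj s w)%E] ->
  `|\int[P]_w (\1_A w * (\1_(late b k) w * (f (X (jt w) w) * N one w - N f w)))| <=
  94 * c * L * (L * k) ^+ 2.
Proof.
move=> sb k0 bk Lk Bf fc FA AJ; have b0 := le_trans s0 sb.
have c0 : 0 <= c by exact: le_trans (fc point).
have Lk0 : 0 <= L * k by rewrite mulr_ge0.
have BA : Bb (fun w => \1_A w : R) by exact/Bb_ind/FYm/FA.
pose n g w := fl b w (leave lam h g).
have Bn g : Bb g -> Bb (n g) by move=> Bg; exact: Bfl b0 (BM Bg).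
have an g : Bb g -> adapted (FY b) (n g) by move=> Bg; exact: afl b0 (BM Bg).
have nb g (cg : R) w : Bb g -> (forall x, `|g x| <= cg) -> `|n g w| <= cg * L.
  by move=> Bg gc; apply: filter_bound (BM Bg) _ => x; exact: leave_le.
have Bl : Bb (fun w => \1_(late b k) w : R).
  exact/Bb_ind/(FYm (filtration_first_jump_le P VS HY (b + k) s0)).
pose W w : R := \1_A w * \1_(late b k) w.
have BW : Bb W by exact: Bb_mul.
pose D w := f (X (jt w) w) * (N one w - n one w) - (N f w - n f w).
have BD : Bb D.
  apply: Bb_sub; last exact: Bb_sub (BN Bf) (Bn _ Bf).
  by apply: Bb_mul (Bjump Bf) _; exact: Bb_sub (BN B1) (Bn _ B1).
have BV : Bb (fun w => f (X (jt w) w) * n one w - n f w).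
  by apply: Bb_sub (Bn _ Bf); exact: Bb_mul (Bjump Bf) (Bn _ B1).
have -> : \int[P]_w (\1_A w * (\1_(late b k) w * (f (X (jt w) w) * N one w - N f w))) =
  \int[P]_w (W w * (f (X (jt w) w) * n one w - n f w)) + \int[P]_w (W w * D w).
  rewrite -(intD PT (Bb_mul BW BV) (Bb_mul BW BD)); apply: eq_Rintegral => w _.
  rewrite /W /D; move: (N one w) (N f w) (n one w) (n f w) (f _) => x1 x2 x3 x4 x5.
  by ring.
(* Freezing the filter at [b] costs [19 * c * L * (L * k)] for each of the two left limits, on an
   event of probability at most [2 * (L * k)]. *)
have H2 : `|\int[P]_w (W w * D w)| <= 76 * c * L * (L * k) ^+ 2.
  apply: (@le_trans _ _ (\int[P]_w (38 * c * L * (L * k) * W w))).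
    apply: int_norm_le_ae.
    - exact: Bb_mul.
    - by apply: Bb_mul => //; exact: Bb_const.
    - by move=> w; rewrite !mulr_ge0 ?indic_ge0.
    have H1 := filter_left_lipschitz (BM B1) (fun x => leave_le x B1 one1).
    have Hf := filter_left_lipschitz (BM Bf) (fun x => leave_le x Bf fc).
    move: H1 Hf; apply: filterS2 => w H1 Hf.
    have [Ww|nW] := pselect ((A `&` late b k) w); last first.
      by rewrite /W indicM (indicN nW) mul0r mulr0 normr0.
    rewrite /W indicM (indic1 Ww) mul1r mulr1 /D.
    case: Ww => Aw lw; have [jE _] := late_jump k sb (AJ _ Aw).
    have Sw : S w by rewrite /S /= (le_trans lw)// lee_fin.
    have [ju _] := SE Sw.
    have bj : b < jt w by rewrite -lte_fin -ju; exact: AJ.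
    have jk : jt w <= b + k by rewrite -lee_fin -ju.
    have LL : L * (jt w - b) <= L * k by rewrite ler_wpM2l// lerBlDl.
    have L10 : 10 * (L * (jt w - b)) < 1 by rewrite (le_lt_trans _ Lk)// ler_wpM2l.
    have b0j : 0 <= b < jt w by rewrite b0.
    have jj : ((jt w)%:E <= yj b w)%E by rewrite jE ju.
    have h1 := H1 b (jt w) b0j jj L10; have h2 := Hf b (jt w) b0j jj L10.
    rewrite /N (indic1 Sw) !mul1r.
    have g1 := le_trans h1 (ler_wpM2l (mulr_ge0 (ler0n _ 19) (mulr_ge0 ler01 L0)) LL).
    have g2 := le_trans h2 (ler_wpM2l (mulr_ge0 (ler0n _ 19) (mulr_ge0 c0 L0)) LL).
    rewrite (le_trans (ler_normB _ _))// normrM.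
    rewrite (_ : 38 * c * L * (L * k) = c * (19 * (1 * L) * (L * k)) + 19 * (c * L) * (L * k)).
      by apply: lerD => //; rewrite ler_pM.
    by ring.
  rewrite intZ//; have := late_le sb k0 Lk FA AJ => H.
  apply: (le_trans (ler_wpM2l _ H)); first by rewrite !mulr_ge0.
  by apply: le_of_eq; ring.
have BAn g : Bb g -> Bb (fun w => \1_A w * n g w) by move=> Bg; exact: Bb_mul BA (Bn _ Bg).
have aAn g : Bb g -> adapted (FY b) (fun w => \1_A w * n g w).
  by move=> Bg; apply: (adapted_mul (HFY b)) (an _ Bg); exact: (adapted_indic (HFY b)).
(* The terms of order [k] cancel: conditioning [leave] at [X b] on the past of the observation turns
   both into the integral of [\1_A * n one * n f]. *)
have H1 : \int[P]_w (W w * (f (X (jt w) w) * n one w - n f w)) =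
  \int[P]_w (\1_A w * n one w * leave_err b k f w) -
  \int[P]_w (\1_A w * n f w * leave_err b k one w).
  have BX g : Bb g -> Bb (fun w => leave lam h g (X b w)).
    by move=> Bg; exact: BbX b0 (BM Bg).
  have P1 := filter_weight P_complete X_meas mh pi_filter b0 (BM Bf) (aAn _ B1) (BAn _ B1).
  have P2 := filter_weight P_complete X_meas mh pi_filter b0 (BM B1) (aAn _ Bf) (BAn _ Bf).
  have P3 : \int[P]_w (\1_A w * n one w * leave lam h f (X b w)) =
            \int[P]_w (\1_A w * n f w * leave lam h one (X b w)).
    rewrite -P1 -P2; apply: eq_Rintegral => w _; rewrite /n.
    by move: (fl b w _) (fl b w _) => x1 x2; ring.
  pose Q w := \1_A w * n one w * leave lam h f (X b w) - \1_A w * n f w * leave lam h one (X b w).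
  have BQ : Bb Q by apply: Bb_sub; apply: Bb_mul; [exact: BAn|exact: BX|exact: BAn|exact: BX].
  have Q0 : \int[P]_w (k * Q w) = 0.
    rewrite intZ// (intB PT (Bb_mul (BAn _ B1) (BX _ Bf)) (Bb_mul (BAn _ Bf) (BX _ B1))).
    by rewrite P3 subrr mulr0.
  have BR1 := Bb_mul (BAn _ B1) (leave_errB k b0 Bf).
  have BR2 := Bb_mul (BAn _ Bf) (leave_errB k b0 B1).
  rewrite -(intB PT BR1 BR2) -[RHS]addr0 -Q0.
  rewrite -(intD PT (Bb_sub BR1 BR2) (Bb_mul (Bb_const _ k) BQ)).
  apply: eq_Rintegral => w _; rewrite /W (late_indic k w sb AJ) /Q /leave_err.
  have [Aw|nA] := pselect (A w); last by rewrite (indicN nA) !mul0r subrr mulr0 addr0.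
  have [jE _] := late_jump k sb (AJ _ Aw); rewrite /jt -jE -[one (X _ w)]/1.
  move: (n one w) (n f w) (leave _ _ f _) (leave _ _ one _) (f _) => x1 x2 x3 x4 x5.
  by ring.
have G1 := leave_err_le b0 k0 Bf fc (an _ B1) (fun w => nb _ _ w B1 one1) FA.
have G2 := leave_err_le b0 k0 B1 one1 (an _ Bf) (fun w => nb _ _ w Bf fc) FA.
rewrite H1; apply: (le_trans (ler_normD _ _)).
apply: (le_trans (lerD (le_trans (ler_normB _ _) (lerD G1 G2)) H2)).
by apply: le_of_eq; ring.
Qed.

(** For a generating event, let the cut-off [b] of the jump time run from [a] to [s + r]: the
    integral vanishes at [b = a] and has quadratic increments, hence vanishes at the end. For
    [a > s + r] the function [N] is zero on the event. *)
Lemma jump_target_rate f C : Bb f -> before_jump C ->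
  \int[P]_w (\1_C w * (f (X (jt w) w) * N one w - N f w)) = 0.
Proof.
move=> Bf; have [c c0' fc] := Bb_exists_bound Bf; have c0 := ltW c0'.
have BU : Bb (fun w => f (X (jt w) w) * N one w - N f w).
  by apply: Bb_sub (BN Bf); apply: Bb_mul (Bjump Bf) (BN B1).
have gen0 a A : s <= a -> FY a A ->
    \int[P]_w (\1_(A `&` [set w | (a%:E < yj s w)%E]) w *
      (f (X (jt w) w) * N one w - N f w)) = 0.
  move=> sa FA; set C0 := A `&` _.
  have a0 : 0 <= a by exact: le_trans sa.
  have FC0 : FY a C0.
    by apply: (sa_setI (HFY a)) => //; exact: (filtration_first_jump_gt P VS HY a s0).
  have BC0 : Bb (fun w => \1_C0 w : R) by exact/Bb_ind/FYm/FC0.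
  have [ar|ra] := leP a (s + r); last first.
    have -> : (fun w => \1_C0 w * (f (X (jt w) w) * N one w - N f w)) = fun=> 0.
      apply/funext => w; have [[_ aw]|nC] := pselect (C0 w); last by rewrite (indicN nC) mul0r.
      have nS : ~ S w.
        by rewrite /S /= => H; have := lt_le_trans aw H; rewrite lte_fin ltNge (ltW ra).
      by rewrite /N (indicN nS) !mul0r mulr0 subrr mulr0.
    by rewrite int_cst mul0r.
  pose g b := \int[P]_w (\1_C0 w * (\1_[set w | (yj s w <= b%:E)%E] w *
    (f (X (jt w) w) * N one w - N f w))).
  have Bl b : s <= b -> Bb (fun w => \1_[set w | (yj s w <= b%:E)%E] w : R).
    by move=> sb; apply/Bb_ind/(FYm (filtration_first_jump_le P VS HY b s0)).
  have gE : g (s + r) = \int[P]_w (\1_C0 w * (f (X (jt w) w) * N one w - N f w)).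
    apply: eq_Rintegral => w _; congr (_ * _).
    have [Sw|nS] := pselect (S w); first by rewrite (indic1 Sw) mul1r.
    by rewrite /N (indicN nS) !mul0r mulr0 subrr.
  rewrite -gE (@quadratic_increments _ g a (s + r) (10 * L) (94 * c * L * L ^+ 2) ar).
  - rewrite /g; have -> : (fun w => \1_C0 w * (\1_[set w | (yj s w <= a%:E)%E] w *
        (f (X (jt w) w) * N one w - N f w))) = fun=> 0.
      apply/funext => w; have [[_ aw]|nC] := pselect (C0 w); last by rewrite (indicN nC) mul0r.
      by rewrite (@indicN _ _ [set w | (yj s w <= a%:E)%E]) ?mul0r ?mulr0//= leNgt aw.
    by rewrite int_cst mul0r.
  - by rewrite mulr_ge0// ?sqr_ge0// mulr_ge0// mulr_ge0.
  move=> b b' /andP[ab bb'] b'r kb.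
  pose A' := C0 `&` [set w | (b%:E < yj s w)%E].
  have sb := le_trans sa ab.
  have FA' : FY b A'.
    apply: (sa_setI (HFY b)); first exact: filtration_mono ab FC0.
    exact: (filtration_first_jump_gt P VS HY b s0).
  have -> : g b' - g b = \int[P]_w (\1_A' w * (\1_(late b (b' - b)) w *
      (f (X (jt w) w) * N one w - N f w))).
    rewrite /g -(intB PT (Bb_mul BC0 (Bb_mul (Bl b' (le_trans sb bb')) BU))
      (Bb_mul BC0 (Bb_mul (Bl b sb) BU))); apply: eq_Rintegral => w _.
    rewrite -mulrBr -mulrBl /late subrKC.
    have [Cw|nC] := pselect (C0 w); last first.
      by rewrite (indicN nC) (@indicN _ _ A') ?mul0r// => -[].
    rewrite (indic1 Cw) mul1r mulrA; congr (_ * _).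
    have [H|H] := pselect ((b%:E < yj s w)%E).
      rewrite (@indic1 _ _ A')// (@indicN _ _ [set w | (yj s w <= b%:E)%E]) ?subr0 ?mul1r//=.
      by rewrite leNgt H.
    rewrite (@indicN _ _ A') ?mul0r; last by move=> [].
    move/negP: H; rewrite -leNgt => H.
    by rewrite !indic1 ?subrr//= (le_trans H)// lee_fin.
  rewrite -mulrA -exprMn; apply: increment => //.
  - by rewrite subr_ge0.
  - by rewrite subrKC.
  - by move: kb; rewrite mulrA.
  - by move=> w [].
apply: (int_eq0_generated PT _ _ BU).
- move=> _ _ [a [A [sa FA ->]]] [a' [A' [sa' FA' ->]]].
  exists (Num.max a a'), (A `&` A'); split; first by rewrite le_max sa.
    by apply: (sa_setI (HFY _)); [apply: filtration_mono FA|apply: filtration_mono FA'];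
      rewrite le_max lexx ?orbT.
  apply/seteqP; split=> w /=; rewrite EFin_max gt_max.
    by move=> [[? ->] [? ->]].
  by move=> [[? ?] /andP[]].
- by move=> A; exact: before_jump_measurable.
- have := gen0 s setT (lexx s) (sa_true (HFY s) (fun=> I)).
  move=> <-; apply: eq_Rintegral => w _; rewrite indic1 ?mul1r//; split => //.
  exact: first_obs_jump_gt.
- by move=> _ [a [A [sa FA ->]]]; exact: gen0.
Qed.

Let cell_measure w : finite_measures E R := jm (pi_left (jt w) w) (h (X s w)).

Let good := [set w | S w -> forall B, measurable B ->
  cell_measure w B = (\int[pi_left (jt w) w]_x leave lam h \1_B x)%:E].

(** Just before the jump the filter is carried by the fibre over [h (X s w)]; for [x] in that fibre,
    leaving it is leaving the fibre of [x], which is what [leave] measures. *)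
Let good_ae : {ae P, forall w, good w}.
Proof.
have := filter_fibre P_complete X_meas X_jump VS mh pi_filter pi_rcont pi_llim.
apply: filterS => w [_ Hw] Sw B mB; have [ju /andP[sj _]] := SE Sw.
have j0 := le_lt_trans s0 sj.
have near_const : \forall v \near (jt w)^'-, h (X v w) = h (X s w).
  apply/near_leftP; exists (jt w - s); first by rewrite subr_gt0.
  move=> v; rewrite subKr => /andP[sv vj].
  by apply: (@first_jump_const _ _ (fun t => h (X t w)) s v (ltW sv)); rewrite ju lte_fin.
have Hae := Hw (jt w) (h (X s w)) j0 near_const.
have Bi : Bb (\1_B : E -> R) by exact: Bb_ind.
rewrite /cell_measure jmE// /kernel_mixture.
have mBf : measurable (B `&` ~` (h @^-1` [set h (X s w)])).
  by apply: measurableI => //; exact/measurableC/mfibre.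
transitivity (\int[pi_left (jt w) w]_x (leave lam h \1_B x)%:E)%E.
  apply: ae_eq_integral => //.
  - exact: measurable_kernel.
  - exact/measurable_EFinP/Bb_meas/BM.
  - by apply: filterS Hae => x hx _; rewrite -hx leave_indic.
rewrite /Rintegral fineK//; apply: integrable_fin_num => //.
exact: (@Bb_int _ _ _ (pi_left (jt w) w) (probabilityT_lty _) _ (BM Bi)).
Qed.

Let Fgood t : FY t good.
Proof.
apply: (sa_iff (HFY t) (B := [set w | ~ (~` good) w])).
  by move=> w; split=> [? []//|/contrapT].
by apply: (sa_not (HFY t)); exact: filtration_negligible.
Qed.

(** Zero off [good] and off [S], so that the mass formula [ME] holds for every [w] and [M] is
    measurable for the completed past before the jump. *)
Let M w : finite_measures E R :=
  if pselect ((good `&` S) w) then cell_measure w else (mzero : {finite_measure set E -> \bar R}).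

Let ME w B : measurable B -> M w B = (\1_good w * N \1_B w)%:E.
Proof.
move=> mB; rewrite /M /N; case: pselect => [[gw Sw]|H] /=.
  by rewrite (gw Sw)// !indic1// !mul1r.
have [gw|ng] := pselect (good w); last by rewrite (indicN ng) mul0r.
rewrite (@indicN _ _ S) ?mul0r ?mulr0//; by move=> Sw; apply: H.
Qed.

Let n w := \1_good w * N one w.

Let n_bound w : `|n w| <= L.
Proof.
rewrite /n normrM -[leRHS]mul1r; apply: ler_pM => //; first exact: indic_norm_le1.
by have := N_bound w B1 one1; rewrite mul1r.
Qed.

Let Bgood : before_jump good. Proof. exact: before_jump_start (Fgood s). Qed.

Let n_adapted : adapted before_jump n.
Proof.
by apply: (adapted_mul HB) (N_adapted B1); exact: (adapted_indic HB).
Qed.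

Let Bn : Bb n. Proof. exact: (adapted_Bb before_jump_measurable n_adapted n_bound). Qed.

Let M_measurable (C : set (finite_measure_space E R)) : measurable C -> before_jump (M @^-1` C).
Proof.
move=> mC.
have mM : measurable_fun setT (M : g_sigma_algebraType before_jump -> finite_measure_space E R).
  apply: (@measurability _ _ (g_sigma_algebraType before_jump) (finite_measure_space E R)
    setT M (@evaluation_preimages _ E R)) => //.
  move=> _ [_ [A [B [mA mB ->]] <-]]; rewrite setTI; apply: sub_sigma_algebra.
  have aN : adapted before_jump (fun w => \1_good w * N \1_A w).
    by apply: (adapted_mul HB) (N_adapted (Bb_ind R mA)); exact: (adapted_indic HB).
  have := aN (EFin @^-1` B); rewrite (_ : _ @^-1` (EFin @^-1` B) = M @^-1` [set m | B (m A)]).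
    by apply; rewrite -[X in measurable X]setTI; exact: EFin_measurable.
  by apply/seteqP; split=> w /=; rewrite ME.
by rewrite -(sigma_algebra_id HB); have := mM measurableT C mC; rewrite setTI.
Qed.

Let mX : measurable_fun setT (fun w => X (jt w) w).
Proof. exact: (obs_jump_target_measurable P_complete X_meas X_jump VS mh s0). Qed.

Let mMO : measurable_fun setT (M : Om -> finite_measure_space E R).
Proof. by move=> _ C mC; rewrite setTI; exact: before_jump_measurable (M_measurable mC). Qed.

Let ebar w := eta (M w : finite_measure_space E R, h (X (jt w) w)).

Let Bebar : Bb ebar.
Proof.
have [ce _ ec] := Bb_exists_bound eta_Bb; apply: (Bb_le (M := ce)); last by move=> w; exact: ec.
apply: measurableT_comp (Bb_meas eta_Bb) _; apply: measurable_fun_pair; first exact: mMO.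
exact: measurableT_comp mh mX.
Qed.

(** [conditional_law] with the random measure [M] as conditioning variable and as kernel. The inner
    integral is then taken for a fixed measure [M w], where [eta_disint] makes it vanish. The weight
    [n] is the total mass of [M]. *)
Lemma jump_target_law G (B : set O) : before_jump G -> measurable B ->
  \int[P]_w (\1_(G `&` [set w | B (h (X (jt w) w))]) w *
    (n w * (phi (X (jt w) w) - ebar w))) = 0.
Proof.
move=> BG mB.
pose g (p : finite_measure_space E R * E) : R :=
  \1_B (h p.2) * (phi p.2 - eta (p.1, h p.2)).
have mhB : measurable (h @^-1` B) by rewrite -[X in measurable X]setTI; exact: mh.
have m2 := @measurable_snd _ _ (finite_measure_space E R) E.
have m1 := @measurable_fst _ _ (finite_measure_space E R) E.
have Bg : Bb g.
  have [c _ fc] := Bb_exists_bound phi_Bb; have [ce _ ec] := Bb_exists_bound eta_Bb.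
  apply: (@Bb_le _ _ _ _ (c + ce)).
    apply: measurable_funM.
      exact: (measurableT_comp (Bb_meas (Bb_ind R mB)) (measurableT_comp mh m2)).
    apply: measurable_funB; first exact: measurableT_comp (Bb_meas phi_Bb) m2.
    apply: (measurableT_comp (Bb_meas eta_Bb)); apply: measurable_fun_pair => //.
    exact: measurableT_comp mh m2.
  move=> p; rewrite /g normrM -[leRHS]mul1r; apply: ler_pM => //; first exact: indic_norm_le1.
  by apply: (le_trans (ler_normB _ _)); exact: lerD.
have BGi : Bb (fun w => \1_G w : R) by exact/Bb_ind/before_jump_measurable.
have kT w : (M w setT <= L%:E)%E.
  rewrite ME// lee_fin (le_trans (ler_norm _))// normrM -[leRHS]mul1r.
  apply: ler_pM => //; first exact: indic_norm_le1.
  rewrite -[leRHS]mul1r; apply: N_bound => [|x]; first exact: Bb_ind.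
  exact: indic_norm_le1.
have BgN B' : measurable B' -> Bb (fun w => \1_good w * N \1_B' w).
  move=> mB'; apply: Bb_mul; last exact: BN (Bb_ind R mB').
  by apply: Bb_ind; exact: FYm (Fgood 0).
have mk B' : measurable B' -> measurable_fun setT (fun w => M w B').
  move=> mB'; rewrite (_ : (fun w => M w B') = EFin \o (fun w => \1_good w * N \1_B' w)).
    exact/measurable_EFinP/Bb_meas/BgN.
  by apply/funext => w; exact: ME.
have rect (A : set (finite_measure_space E R)) (B' : set E) : measurable A -> measurable B' ->
    \int[P]_w (\1_G w * n w * (\1_A (M w : finite_measure_space E R) * \1_B' (X (jt w) w))) =
    \int[P]_w (\1_G w * (\1_A (M w : finite_measure_space E R) * fine (M w B'))).
  move=> mA mB'; have Bi : Bb (\1_B' : E -> R) by exact: Bb_ind.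
  pose G' := (G `&` good) `&` (M @^-1` A).
  have BG' : before_jump G'.
    by apply: (sa_setI HB); [exact: (sa_setI HB)|exact: M_measurable].
  have G'E w : \1_G' w = \1_G w * \1_good w * \1_A (M w : finite_measure_space E R) :> R.
    by rewrite /G' -indicM -indicM; congr (_ * _); exact: indic_congr.
  have BG'i : Bb (fun w => \1_G' w : R) by exact/Bb_ind/before_jump_measurable.
  have BT : Bb (fun w => \1_B' (X (jt w) w) * N one w) by exact: Bb_mul (Bjump Bi) (BN B1).
  apply/eqP; rewrite -subr_eq0 -(jump_target_rate Bi BG'); apply/eqP.
  transitivity (\int[P]_w (\1_G' w * (\1_B' (X (jt w) w) * N one w)) -
      \int[P]_w (\1_G' w * N \1_B' w)); last first.
    rewrite -(intB PT (Bb_mul BG'i BT) (Bb_mul BG'i (BN Bi))).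
    by apply: eq_Rintegral => w _; rewrite mulrBr.
  congr (_ - _); apply: eq_Rintegral => w _; rewrite G'E.
    rewrite /n; move: (N one w) => x; ring.
  rewrite ME//=; move: (N _ w) => x; ring.
have [_] := @conditional_law _ _ _ Om (finite_measure_space E R) E R P M
  (fun w => X (jt w) w) (fun w => M w) (fun w => \1_G w * n w) (fun w => \1_G w) L
  mMO mX kT mk (Bb_mul BGi Bn) BGi rect g Bg.
have -> : \int[P]_w (\1_G w * \int[M w]_z g (M w, z)) = 0.
  under eq_Rintegral => w _ do rewrite /g /= eta_disint// mulr0.
  by rewrite int_cst mul0r.
move=> <-; apply: eq_Rintegral => w _; rewrite /g /= -indicM /ebar.
rewrite (_ : \1_[set w | B (h (X (jt w) w))] w = \1_B (h (X (jt w) w))); first by ring.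
exact: indic_congr.
Qed.

(* Sets describing the observation up to its first jump after s. *)
Let up_to_jump : set_system Om := <<s [set C | exists G B,
  [/\ before_jump G, measurable B & C = G `&` [set w | B (h (X (jt w) w))]]] >>.

Let HU : sigma_algebra setT up_to_jump. Proof. exact: g_sigma_algebraP. Qed.

Let U_before G : before_jump G -> up_to_jump G.
Proof.
move=> BG; apply: sub_sigma_algebra; exists G, setT; split=> //.
by rewrite setIidl.
Qed.

Let U_target (B : set O) : measurable B -> up_to_jump [set w | B (h (X (jt w) w))].
Proof.
move=> mB; apply: sub_sigma_algebra; exists setT, B; split=> //; last by rewrite setTI.
exact: (sa_true HB).
Qed.

Let Um C : up_to_jump C -> measurable C.
Proof.
apply: smallest_sub; first exact: sigma_algebra_measurable.
move=> _ [G [B [BG mB ->]]]; apply: measurableI; first exact: before_jump_measurable.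
by rewrite -[X in measurable X]setTI; exact: (measurableT_comp mh mX).
Qed.

Let jump_law_up_to C : up_to_jump C ->
  \int[P]_w (\1_C w * (n w * (phi (X (jt w) w) - ebar w))) = 0.
Proof.
have BUu : Bb (fun w => n w * (phi (X (jt w) w) - ebar w)).
  by apply: Bb_mul Bn _; exact: Bb_sub (Bjump phi_Bb) Bebar.
apply: (int_eq0_generated PT _ Um BUu).
- move=> _ _ [G [B [BG mB ->]]] [G' [B' [BG' mB' ->]]].
  exists (G `&` G'), (B `&` B'); split; [exact: (sa_setI HB)|exact: measurableI|].
  by rewrite setIACA.
- have := jump_target_law (sa_true HB (A := setT) (fun=> Logic.I)) measurableT.
  move=> <-; apply: eq_Rintegral => w _; rewrite indic1 ?mul1r//.
- by move=> _ [G [B [BG mB ->]]]; exact: jump_target_law.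
Qed.

(** Exactly one observed jump in the cell. On this event the observation is [h (X s w)] before the
    jump and [h (X (jt w) w)] after it, so [FY (s + r)] and [up_to_jump] have the same trace;
    [trace_up_to] and [trace_filtration] are the two inclusions. *)
Let once := [set w | (yj s w <= (s + r)%:E < yj (jt w) w)%E].

Let onceS : once `<=` S. Proof. by move=> w /andP[]. Qed.

Let once_const w v : once w -> jt w <= v <= s + r -> h (X v w) = h (X (jt w) w).
Proof.
move=> /andP[_ wr] /andP[jv vr].
apply: (@first_jump_const _ _ (fun t => h (X t w)) (jt w) v jv).
by rewrite (le_lt_trans _ wr)// lee_fin.
Qed.

Let Fonce : FY (s + r) once.
Proof.
pose T k w := jump_time (fun t => h (X t w)) k.
apply: (sa_iff (HFY _) (B := [set w | exists k, (T k w <= s%:E < T k.+1 w)%E /\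
   (T k.+1 w <= (s + r)%:E < T k.+2 w)%E])).
  move=> w; split.
    move=> wo; have [ju _] := SE (onceS wo); move: wo => /andP[jr rj].
    have [k wk] := jump_time_locate (HY w) s0; exists k; split=> //.
    have jT := jump_time_first_jump (HY w) wk; rewrite /T -jT jr /=.
    by move: jT; rewrite ju => /esym jT; rewrite (jump_timeS jT).
  move=> [k [wk /andP[kr rk]]]; have jT := jump_time_first_jump (HY w) wk.
  rewrite /once /= jT -/(T k.+1 w) kr /=.
  have Sw : S w by rewrite /S /= jT.
  have [ju _] := SE Sw; rewrite (_ : yj (jt w) w = T k.+2 w)//.
  by apply/esym/jump_timeS; rewrite -jT ju.
apply: (sa_exn (HFY _)) => k; apply: (sa_and (HFY _)).
  apply: (@filtration_mono _ _ _ _ _ _ _ s); first by rewrite lerDl.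
  exact: (filtration_between P VS HY k s).
exact: (filtration_between P VS HY k.+1 (s + r)).
Qed.

Let trace_up_to D : FY (s + r) D -> exists2 G, up_to_jump G & D `&` once = G `&` once.
Proof.
apply: filtration_trace => //; last first.
  by move=> A nA; apply: U_before; apply: before_jump_start; exact: filtration_negligible.
move=> v B /andP[v0 vr] mB; have [vs|sv] := leP v s.
  exists [set w | B (h (X v w))] => //; apply: U_before; apply: before_jump_start.
  by apply: filtration_gen => //; rewrite v0.
pose lt_jump := [set w | (v%:E < yj s w)%E].
have Ul : up_to_jump lt_jump by apply: U_before; apply: before_jump_gt; exact: ltW.
exists [set w | (lt_jump w /\ B (h (X s w))) \/ (~ lt_jump w /\ B (h (X (jt w) w)))].
  apply: (sa_or HU); apply: (sa_and HU) => //; [|exact: (sa_not HU)|exact: U_target].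
  by apply: U_before; apply: before_jump_start; apply: filtration_gen => //; rewrite s0 lexx.
apply/seteqP; split=> w /= [H wo]; split=> //.
  have [lw|nl] := pselect (lt_jump w); [left|right]; split=> //.
    by rewrite -(@first_jump_const _ _ (fun t => h (X t w)) s v (ltW sv) lw).
  have [ju _] := SE (onceS wo); rewrite -(once_const (v := v))// vr andbT.
  by move/negP: nl; rewrite /lt_jump /= -leNgt ju lee_fin.
case: H => -[lw Bw].
  by rewrite (@first_jump_const _ _ (fun t => h (X t w)) s v (ltW sv) lw).
have [ju _] := SE (onceS wo); rewrite (once_const (v := v))// vr andbT.
by move/negP: lw; rewrite /lt_jump /= -leNgt ju lee_fin.
Qed.

Let trace_filtration C : up_to_jump C -> FY (s + r) (C `&` once).
Proof.
have H G : before_jump G -> FY (s + r) (G `&` once).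
  apply: (@trace_sub _ _ (FY (s + r)) once (HFY _) Fonce).
  move=> _ [a [A [sa FA ->]]]; have [ar|ra] := leP a (s + r).
    apply: (sa_setI (HFY _)) => //; apply: (sa_setI (HFY _)).
      exact: filtration_mono FA.
    apply: filtration_mono ar _; exact: (filtration_first_jump_gt P VS HY a s0).
  apply: (sa_false (HFY _)) => w [[_ /= aw] /onceS /= Sw].
  by have := lt_le_trans aw Sw; rewrite lte_fin ltNge (ltW ra).
apply: (@trace_sub _ _ (FY (s + r)) once (HFY _) Fonce).
move=> _ [G [B [BG mB ->]]].
apply: (sa_iff (HFY _) (B := (G `&` once) `&` [set w | B (h (X (s + r) w))])).
  move=> w; have E1 : once w -> h (X (s + r) w) = h (X (jt w) w).
    move=> wo; apply: once_const => //.
    by have [_ /andP[_ ->]] := SE (onceS wo); rewrite lexx.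
  split=> [[[Gw Bw] wo]|[[Gw wo] Bw]]; split=> //=; first by rewrite E1.
  by rewrite -E1.
apply: (sa_setI (HFY _)); first exact: H.
by apply: filtration_gen => //; rewrite sr0 lexx.
Qed.

Let trace_adapted (b : Om -> R) : adapted up_to_jump b ->
  adapted (FY (s + r)) (fun w => \1_once w * b w).
Proof.
move=> ab B mB.
apply: (sa_iff (HFY _) (B := [set w | ((b @^-1` B) `&` once) w \/ (~ once w /\ B 0)])).
  move=> w /=; have [wo|nw] := pselect (once w).
    by rewrite indic1// mul1r; split=> [?|[[]|[]]//]; left.
  by rewrite indicN// mul0r; split=> [?|[[]|[]]//]; right.
apply: (sa_or (HFY _)); first exact: (trace_filtration (ab _ mB)).
apply: (sa_and (HFY _)); first exact: (sa_not (HFY _)).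
by have [?|?] := pselect (B 0); [exact: (sa_true (HFY _))|exact: (sa_false (HFY _))].
Qed.

Let ebar_adapted : adapted up_to_jump ebar.
Proof.
have mM : measurable_fun setT (M : g_sigma_algebraType up_to_jump -> finite_measure_space E R).
  move=> _ C mC; rewrite setTI; apply: sub_sigma_algebra; apply: U_before; exact: M_measurable.
have mT : measurable_fun setT
    ((fun w => h (X (jt w) w)) : g_sigma_algebraType up_to_jump -> O).
  by move=> _ B mB; rewrite setTI; apply: sub_sigma_algebra; exact: U_target.
apply/(adaptedP HU).
by apply: (measurableT_comp (Bb_meas eta_Bb)); exact: (measurable_fun_pair mM mT).
Qed.

Let n_adaptedU : adapted up_to_jump n.
Proof. by move=> B mB; apply: U_before; exact: n_adapted. Qed.

(** An observed jump is a jump of [X]; if it is the only one in the cell, [X] stays where it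
    landed. *)
Let isolated w : S w -> ~ two_jumps X s r w -> once w /\ X (s + r) w = X (jt w) w.
Proof.
move=> Sw nt; have [ju /andP[sj jr]] := SE Sw.
have Xj : X (jt w) w <> X s w.
  by move=> e; have := first_jump_neq (HY w) s0 ju; rewrite e.
have fj : (first_jump (X^~ w) s <= (jt w)%:E)%E.
  by apply/(first_jump_leP (X_jump w) _ s0); exists (jt w); rewrite ?sj ?lexx.
have [fi|[u su fu]] := first_jump_cases (X_jump w) s0.
  by rewrite fi leye_eq in fj.
rewrite fu lee_fin in fj.
have fr : ((s + r)%:E < first_jump (X^~ w) u)%E.
  rewrite ltNge; apply/negP => H; apply: nt; split; rewrite fu //= lee_fin.
  exact: le_trans jr.
have const v : u <= v <= s + r -> X v w = X u w.
  move=> /andP[uv vr]; apply: (@first_jump_const _ _ (X^~ w) u v uv).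
  by rewrite (le_lt_trans _ fr)// lee_fin.
have jc v : jt w <= v <= s + r -> X v w = X (jt w) w.
  move=> /andP[jv vr]; rewrite (const v); last by rewrite (le_trans fj jv).
  by rewrite (const (jt w))// fj.
split; last by rewrite jc// jr lexx.
rewrite /once /= (_ : (yj s w <= _)%E = true)//= ltNge; apply/negP.
have j0 : 0 <= jt w by rewrite (le_trans s0)// ltW.
move=> /(first_jump_leP (HY w) _ j0)[v /andP[jv vr]]; apply.
by rewrite jc// vr (ltW jv).
Qed.

Let two_jumps_prob : Bb (fun w => \1_(two_jumps X s r) w : R) /\
  \int[P]_w \1_(two_jumps X s r) w <= (L * r) ^+ 2.
Proof.
have m2 := two_jumps_measurable P_complete US X_meas X_jump r s0.
split; first exact: Bb_ind.
have := two_jumps_le P_complete US X_meas X_jump lamL X_rate s0 r0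
  (sa_true (filtration_sigma P X s) (A := setT) (fun=> Logic.I)).
rewrite [X in _ * X]int_indic// (congr1 fine (probability_setT P) : fine (P setT) = 1) mulr1.
by apply: le_trans; apply: le_of_eq; apply: eq_Rintegral => w _; rewrite (@indic1 _ _ [set: Om])// mul1r.
Qed.

(** The filter at [s + r] is the conditional mean of [phi (X (s + r) w)], and under the weight [n]
    the variable [ebar] is that of [phi (X (jt w) w)]. These two values of [phi] can differ only on
    [two_jumps], where two terms of size [2 * c * L] remain. *)
Let target_error c D : (forall x, `|phi x| <= c) -> (forall p, `|eta p| <= c) ->
  FY (s + r) D -> D `<=` once ->
  `|\int[P]_w (\1_D w * n w * (fl (s + r) w phi - ebar w))| <= 4 * c * L * (L * r) ^+ 2.
Proof.
move=> pc ec FD Do; have [G UG] := trace_up_to FD; rewrite (setIidl Do) => DG.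
have c0 : 0 <= c by exact: le_trans (pc point).
have BD : Bb (fun w => \1_D w : R) by exact/Bb_ind/FYm/FD.
have BG : Bb (fun w => \1_G w : R) by exact/Bb_ind/Um.
have Bfx : Bb (fun w => phi (X (s + r) w)) by exact: BbX.
have Bf := Bfl sr0 phi_Bb; have [B2 P2] := two_jumps_prob.
have BDn : Bb (fun w => \1_D w * n w) by exact: Bb_mul.
have aDn : adapted (FY (s + r)) (fun w => \1_D w * n w).
  have -> : (fun w => \1_D w * n w) = (fun w => \1_D w * (\1_once w * n w)).
    apply/funext => w; have [Dw|nD] := pselect (D w); last by rewrite (indicN nD) !mul0r.
    by rewrite (indic1 (Do _ Dw)) mul1r.
  apply: (adapted_mul (HFY _)) (trace_adapted n_adaptedU).
  exact: (adapted_indic (HFY _)).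
have BV : Bb (fun w => n w * (phi (X (jt w) w) - ebar w)).
  by apply: Bb_mul Bn _; exact: Bb_sub (Bjump phi_Bb) Bebar.
pose Rm w := \1_D w * n w * (phi (X (s + r) w) - ebar w) -
  \1_G w * (n w * (phi (X (jt w) w) - ebar w)).
have BR : Bb Rm by apply: Bb_sub (Bb_mul BG BV); apply: Bb_mul BDn (Bb_sub Bfx Bebar).
have -> : \int[P]_w (\1_D w * n w * (fl (s + r) w phi - ebar w)) = \int[P]_w Rm w.
  have E1 := filter_weight P_complete X_meas mh pi_filter sr0 phi_Bb aDn BDn.
  rewrite (intB PT (Bb_mul BDn (Bb_sub Bfx Bebar)) (Bb_mul BG BV)) jump_law_up_to// subr0.
  have -> : (fun w => \1_D w * n w * (fl (s + r) w phi - ebar w)) =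
    (fun w => \1_D w * n w * fl (s + r) w phi - \1_D w * n w * ebar w).
    by apply/funext => w; rewrite mulrBr.
  have -> : (fun w => \1_D w * n w * (phi (X (s + r) w) - ebar w)) =
    (fun w => \1_D w * n w * phi (X (s + r) w) - \1_D w * n w * ebar w).
    by apply/funext => w; rewrite mulrBr.
  rewrite (intB PT (Bb_mul BDn Bf) (Bb_mul BDn Bebar)) E1.
  by rewrite (intB PT (Bb_mul BDn Bfx) (Bb_mul BDn Bebar)).
apply: (@le_trans _ _ (\int[P]_w (4 * c * L * \1_(two_jumps X s r) w))); last first.
  by rewrite intZ//; apply: ler_wpM2l => //; rewrite !mulr_ge0.
apply: int_norm_le => //; first by apply: Bb_mul => //; exact: Bb_const.
move=> w; have [tw|ntw] := pselect (two_jumps X s r w).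
  rewrite (indic1 tw) mulr1 /Rm.
  have dif x : `|phi x - ebar w| <= 2 * c.
    by rewrite (le_trans (ler_normB _ _))// mulr_natl mulr2n; apply: lerD => //; exact: ec.
  have H (A : set Om) x : `|\1_A w * (n w * (phi x - ebar w))| <= 2 * c * L.
    rewrite normrM (@le_trans _ _ `|n w * (phi x - ebar w)|)//.
      by rewrite ler_piMl// indic_norm_le1.
    by rewrite normrM mulrC ler_pM.
  rewrite (le_trans (ler_normB _ _))// -mulrA.
  by rewrite (_ : 4 * c * L = 2 * c * L + 2 * c * L); [exact: lerD|ring].
rewrite (indicN ntw) mulr0 /Rm; have [Sw|nS] := pselect (S w).
  have [ow ->] := isolated Sw ntw.
  rewrite (_ : \1_D w = \1_G w); first by rewrite -mulrA subrr normr0.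
  by rewrite DG -indicM (indic1 ow) mulr1.
by rewrite /n /N (indicN nS) !mul0r !mulr0 !mul0r mulr0 subrr normr0.
Qed.

(** A Chebyshev bound: on [D] both [n] and the gap of sign [e'] exceed [e], so [e ^+ 2] times the
    probability of [D] is at most the integral of their product. *)
Let gap_prob c e e' : (forall x, `|phi x| <= c) -> (forall p, `|eta p| <= c) -> 0 < e -> `|e'| = 1 ->
  exists D, [/\ measurable D, fine (P D) <= 4 * c * L / e ^+ 2 * (L * r) ^+ 2 &
    forall w, once w -> e < n w -> e < e' * (fl (s + r) w phi - ebar w) -> D w].
Proof.
move=> pc ec e0 e1; pose dif w := e' * (\1_once w * (fl (s + r) w phi) - \1_once w * ebar w).
have Bf := Bfl sr0 phi_Bb.
have ad : adapted (FY (s + r)) dif.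
  apply: (adapted_mul (HFY _)); first exact: (adapted_cst (HFY _)).
  apply: (adapted_sub (HFY _)) (trace_adapted ebar_adapted).
  by apply: (adapted_mul (HFY _)) (afl sr0 phi_Bb); exact: (adapted_indic (HFY _)).
pose D := [set w | e < \1_once w * n w] `&` [set w | e < dif w].
have FD : FY (s + r) D.
  by apply: (sa_setI (HFY _)); apply: adapted_gt => //; exact: trace_adapted n_adaptedU.
have Do : D `<=` once.
  move=> w [/= + _]; have [//|nw] := pselect (once w).
  by rewrite (indicN nw) mul0r ltNge (ltW e0).
have DE w : D w -> e < n w /\ e < e' * (fl (s + r) w phi - ebar w).
  by move=> Dw; case: (Dw) => /=; rewrite /dif (indic1 (Do _ Dw)) !mul1r.
exists D; split.
- exact: FYm FD.
- have H := target_error pc ec FD Do.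
  have BD : Bb (fun w => \1_D w : R) by exact/Bb_ind/FYm/FD.
  have BT : Bb (fun w => \1_D w * n w * (fl (s + r) w phi - ebar w)).
    by apply: Bb_mul (Bb_sub Bf Bebar); exact: Bb_mul.
  rewrite -[leLHS](int_indic P (FYm FD)).
  rewrite (_ : 4 * c * L / e ^+ 2 * _ = 4 * c * L * (L * r) ^+ 2 / e ^+ 2); last by ring.
  rewrite ler_pdivlMr ?exprn_gt0// mulrC -(intZ PT _ BD).
  apply: le_trans H; apply: (@le_trans _ _ (\int[P]_w (e' * (\1_D w * n w * (fl (s + r) w phi - ebar w))))).
    apply: int_le => //; [by apply: Bb_mul => //; exact: Bb_const|
      by apply: Bb_mul => //; exact: Bb_const|].
    move=> w; have [Dw|nD] := pselect (D w); last by rewrite (indicN nD) !mul0r !mulr0.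
    rewrite (indic1 Dw) mulr1 mul1r mulrCA expr2; have [h1 h2] := DE w Dw.
    by apply: ler_pM; rewrite ?ltW.
  by rewrite intZ// (le_trans (ler_norm _))// normrM e1 mul1r.
- move=> w wo nw dw; split; first by rewrite /= (indic1 wo) mul1r.
  by rewrite /= /dif (indic1 wo) !mul1r.
Qed.

(** A jump with vanishing jump measure has to be excluded, as [gap_prob] is silent there. If
    [N one <= 0], the filtered intensity at [s] is at most [19 * L * (L * r)] by the Lipschitz
    bound, and an observed jump within [r] then has probability at most
    [(19 + 9) * (L * r) ^+ 2]. *)
Let small_prob : 10 * (L * r) < 1 ->
  exists D, [/\ measurable D, fine (P D) <= 28 * (L * r) ^+ 2 &
    {ae P, forall w, S w -> N one w <= 0 -> D w}].
Proof.
move=> Lr; pose A := [set w | fl s w (leave lam h one) <= 19 * L * (L * r)].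
have al := afl s0 (BM B1).
have FA : FY s A.
  apply: (sa_iff (HFY s) (B := [set w | ~ (19 * L * (L * r) < fl s w (leave lam h one))])).
    by move=> w; rewrite /A /= leNgt; split=> /negP.
  by apply: (sa_not (HFY s)); exact: adapted_gt.
have mA := FYm FA; have BA : Bb (fun w => \1_A w : R) by exact: Bb_ind.
have mS := before_jump_measurable BS.
have mAS : measurable (A `&` S) by exact: measurableI.
exists (A `&` S); split=> //.
- rewrite -[leLHS](int_indic P mAS).
  have := leave_err_le s0 r0 B1 one1 (adapted_cst (HFY s) 1) (fun=> one1 point) FA.
  rewrite ler_norml => /andP[_ H].
  have Bx : Bb (fun w => leave lam h one (X s w)) by exact: BbX s0 (BM B1).
  have Bf := Bfl s0 (BM B1).
  have BI : Bb (fun w => \1_A w * 1 * leave_err s r one w).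
    by apply: Bb_mul (leave_errB r s0 B1); apply: Bb_mul BA _; exact: Bb_const.
  have -> : \int[P]_w \1_(A `&` S) w = \int[P]_w (\1_A w * 1 * leave_err s r one w) +
      r * \int[P]_w (\1_A w * fl s w (leave lam h one)).
    rewrite (filter_cond P_complete X_meas mh pi_filter s0 (BM B1) FA).
    rewrite -(intZ PT r (Bb_mul BA Bx)) -(intD PT BI (Bb_mul (Bb_const _ r) (Bb_mul BA Bx))).
    apply: eq_Rintegral => w _; rewrite -indicM /leave_err -[one (X _ w)]/1 !mulr1.
    have -> : \1_S w = \1_(~` no_obs_jump X h s r) w :> R.
      by apply: indic_congr; exact: (late_jump r (lexx s) (first_obs_jump_gt w)).2.
    by move: (leave _ _ _ _) => x; ring.
  have H2 : \int[P]_w (\1_A w * fl s w (leave lam h one)) <= 19 * L * (L * r).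
    have BAc : Bb (fun w => 19 * L * (L * r) * \1_A w) by apply: Bb_mul => //; exact: Bb_const.
    apply: (@le_trans _ _ (\int[P]_w (19 * L * (L * r) * \1_A w))).
      apply: int_le => //; first exact: Bb_mul.
      move=> w; have [Aw|nA] := pselect (A w); last by rewrite (indicN nA) mul0r mulr0.
      by rewrite (indic1 Aw) mul1r mulr1.
    rewrite intZ// int_indic// ler_piMr ?mulr_ge0//.
    rewrite -(congr1 fine (probability_setT P) : fine (P setT) = 1).
    by rewrite fine_le ?fin_num_measure ?le_measure ?inE.
  apply: (le_trans (lerD H (ler_wpM2l r0 H2))); apply: le_of_eq; ring.
- have := filter_left_lipschitz (BM B1) (fun x => leave_le x B1 one1).
  apply: filterS => w Hw Sw; rewrite /N (indic1 Sw) mul1r => N0; split=> //.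
  have [ju /andP[sj jr]] := SE Sw.
  have LL : L * (jt w - s) <= L * r by rewrite ler_wpM2l// lerBlDl.
  have L10 : 10 * (L * (jt w - s)) < 1 by rewrite (le_lt_trans _ Lr)// ler_wpM2l.
  have s0j : 0 <= s < jt w by rewrite s0.
  have := Hw s (jt w) s0j _ L10; rewrite ju lexx => /(_ isT).
  rewrite mul1r ler_norml => /andP[h1 _].
  have : 19 * L * (L * (jt w - s)) <= 19 * L * (L * r) by rewrite ler_wpM2l// mulr_ge0.
  by rewrite /A /=; lra.
Qed.

(** [29 = 1 + 28] accounts for two jumps of [X] and for a vanishing jump measure, [8 = 2 * 4] for
    the two signs of [gap_prob]. The alternative of a small mass is removed later, in
    [jump_formula]. *)
Lemma cell_estimate c e : (forall x, `|phi x| <= c) -> (forall p, `|eta p| <= c) -> 0 < e ->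
  10 * (L * r) < 1 ->
  exists D, [/\ measurable D, fine (P D) <= (29 + 8 * c * L / e ^+ 2) * (L * r) ^+ 2 &
    {ae P, forall w, (yj s w <= (s + r)%:E)%E -> ~ D w ->
      let m := jm (pi_left (fine (yj s w)) w) (h (X s w)) in
      [/\ ((s + r)%:E < yj (fine (yj s w)) w)%E, 0 < fine (m setT) &
        fine (m setT) <= e \/
        `|fl (s + r) w phi - eta (m : finite_measure_space E R, h (X (fine (yj s w)) w))| <= e]}].
Proof.
move=> pc ec e0 Lr.
have [D1 [mD1 PD1 HD1]] := gap_prob pc ec e0 (normr1 R).
have [D2 [mD2 PD2 HD2]] := gap_prob pc ec e0 (normrN1 R).
have [D3 [mD3 PD3 HD3]] := small_prob Lr.
have m2 := two_jumps_measurable P_complete US X_meas X_jump r s0.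
exists (two_jumps X s r `|` D3 `|` D1 `|` D2); split.
- by apply: measurableU => //; apply: measurableU => //; exact: measurableU.
- have U2 A B : measurable A -> measurable B -> fine (P (A `|` B)) <= fine (P A) + fine (P B).
    move=> mA mB; rewrite -fineD ?fin_num_measure// fine_le ?fin_num_measure//.
    + exact: measurableU.
    + by rewrite fin_numD !fin_num_measure.
    + exact: measureU2.
  have [_] := two_jumps_prob; rewrite int_indic// => P2.
  have := U2 _ _ (measurableU _ _ (measurableU _ _ m2 mD3) mD1) mD2.
  have := U2 _ _ (measurableU _ _ m2 mD3) mD1.
  have := U2 _ _ m2 mD3.
  rewrite (_ : (29 + 8 * c * L / e ^+ 2) * (L * r) ^+ 2 = (L * r) ^+ 2 + 28 * (L * r) ^+ 2 +
    4 * c * L / e ^+ 2 * (L * r) ^+ 2 + 4 * c * L / e ^+ 2 * (L * r) ^+ 2); last by ring.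
  by move=> h1 h2 h3; rewrite (le_trans h3)// lerD// (le_trans h2)// lerD// (le_trans h1)// lerD.
move: HD3 good_ae; apply: filterS2 => w H3 gw Sw0 nD; have Sw : S w := Sw0.
set m := jm _ _.
have nt : ~ two_jumps X s r w by move=> ?; apply: nD; left; left; left.
have [ow _] := isolated Sw nt.
have nE : n w = fine (m setT).
  rewrite /m -/(jt w) -[jm _ _]/(cell_measure w) (gw Sw)// /n (indic1 gw) mul1r /N (indic1 Sw) mul1r.
  by have -> : \1_[set: E] = one by apply/funext => x; rewrite indic1.
have MmE : M w = m by rewrite /M; case: pselect => // -[].
have eE : ebar w = eta (m : finite_measure_space E R, h (X (fine (yj s w)) w)).
  by rewrite /ebar MmE.
split.
- by move: ow => /andP[_].
- rewrite -nE /n (indic1 gw) mul1r ltNge; apply/negP => N0; apply: nD; left; left; right; exact: H3.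
rewrite -nE -eE; have [ne|en] := leP (n w) e; [by left|right].
rewrite ler_norml lerNl; apply/andP; split; rewrite leNgt; apply/negP => H; apply: nD.
  by right; apply: HD2 => //; rewrite mulN1r.
by left; right; apply: HD1 => //; rewrite mul1r.
Qed.

End cell.

(** Off the exceptional event a cell contains at most one observed jump, so the given jump is the
    first one after the left end of its cell. Moving the filter from the right end back to the jump
    costs the second [e]. *)
Lemma jump_formula_approx c (e : R) (T : nat) : (forall x, `|phi x| <= c) ->
  (forall p, `|eta p| <= c) -> 0 < e ->
  {ae P, forall w k, (jump_time (fun t => h (X t w)) k.+1 <= T%:R%:E)%E ->
    let t := fine (jump_time (fun t => h (X t w)) k.+1) in
    let m := jm (pi_left t w) (h (X (fine (jump_time (fun t => h (X t w)) k)) w)) in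
    0 < fine (m setT) /\ (fine (m setT) <= e \/
      `|fl t w phi - eta (m : finite_measure_space E R, h (X t w))| <= 2 * e)}.
Proof.
move=> pc ec e0; have L0 := rate_bound_ge0 lamL.
have c0 : 0 <= c by exact: le_trans (pc point).
apply: small_cover_ae => x x0.
pose C := (29 + 8 * c * L / e ^+ 2) * (L * T%:R) ^+ 2 : R.
have C1 : 0 <= 29 + 8 * c * L / e ^+ 2.
  by rewrite addr_ge0// divr_ge0 ?sqr_ge0// mulr_ge0// mulr_ge0.
have C0 : 0 <= C by rewrite mulr_ge0 ?sqr_ge0.
have LT0 : 0 <= L * T%:R by rewrite mulr_ge0.
have cLT0 : 0 <= 19 * c * (L * T%:R) / e by rewrite divr_ge0 ?(ltW e0)// !mulr_ge0.
have Cx0 : 0 <= C / x by rewrite divr_ge0 ?(ltW x0).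
(* The three terms make [K] large enough for the mesh condition, for a variation of the filter of at
   most [e] within a cell, and for a total exceptional probability of at most [x]. *)
pose q : R := 10 * (L * T%:R) + 19 * c * (L * T%:R) / e + C / x.
have q0 : 0 <= q by rewrite !addr_ge0// mulr_ge0.
have qN := truncnS_gt q; set K := (Num.truncn q).+1 in qN.
have K0 : 0 < K%:R :> R by rewrite ltr0n.
pose r := T%:R / K%:R : R.
have r0 : 0 <= r by rewrite divr_ge0.
have rK : K%:R * r = T%:R by rewrite mulrC divfK// gt_eqF.
have LrE : L * r = L * T%:R / K%:R by rewrite mulrA.
have Lr10 : 10 * (L * r) < 1.
  rewrite LrE mulrA ltr_pdivrMr// mul1r (le_lt_trans _ qN)// /q -addrA lerDl.
  exact: addr_ge0.
have Lre : 19 * c * (L * r) <= e.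
  rewrite LrE mulrA ler_pdivrMr// [e * _]mulrC -ler_pdivrMr//.
  by rewrite ltW// (le_lt_trans _ qN)// /q -addrA addrCA lerDl addr_ge0// mulr_ge0.
have KC : K%:R * ((29 + 8 * c * L / e ^+ 2) * (L * r) ^+ 2) <= x.
  rewrite LrE (_ : _ * _ = C / K%:R); last by rewrite /C; field; rewrite !gt_eqF.
  rewrite ler_pdivrMr// [x * _]mulrC -ler_pdivrMr// ltW// (le_lt_trans _ qN)// /q.
  by rewrite lerDr addr_ge0// mulr_ge0.
pose cell_ok (i : nat) (D : set Om) w := (yj (i%:R * r) w <= (i%:R * r + r)%:E)%E -> ~ D w ->
      let m := jm (pi_left (fine (yj (i%:R * r) w)) w) (h (X (i%:R * r) w)) in
      [/\ ((i%:R * r + r)%:E < yj (fine (yj (i%:R * r) w)) w)%E, 0 < fine (m setT) &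
        fine (m setT) <= e \/
        `|fl (i%:R * r + r) w phi - eta (m : finite_measure_space E R, h (X (fine (yj (i%:R * r) w)) w))| <= e].
have cellQ i : (i < K)%N -> exists D, [/\ measurable D,
    fine (P D) <= (29 + 8 * c * L / e ^+ 2) * (L * r) ^+ 2 & {ae P, forall w, cell_ok i D w}].
  move=> _; have s0 : 0 <= i%:R * r by exact: mulr_ge0.
  by have [D HD] := cell_estimate s0 r0 pc ec e0 Lr10; exists D.
have [D [mD PD HD]] := finite_cover cellQ.
exists D; split=> //; first exact: le_trans KC.
have Hlip := filter_expansion P_complete US X_meas X_jump lamL X_rate VS mh pi_filter pi_rcont phi_Bb pc.
have : {ae P, forall w, forall i, (i < K)%N -> cell_ok i D w}.
  apply/ae_foralln => i; apply: ae_imp => iK; have [Di DiD] := HD i iK.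
  by apply: filterS => w Hw ji nD; apply: Hw => // Diw; apply: nD; exact: DiD.
move: Hlip; apply: filterS2 => w Hlip Hcell nD k TT.
have [E0|[a a0 Tk]] := jump_time_cases (HY w) k.
  by move: TT; rewrite jump_timeS_pinfty// leye_eq.
have Tk1 := jump_timeS Tk.
have [TE|[u u0 Tu]] := jump_time_cases (HY w) k.+1; first by move: TT; rewrite TE leye_eq.
have au : a < u by have := jump_time_lt (HY w) (n := k); rewrite Tk Tu lte_fin ltry; apply.
have up : 0 < u by exact: le_lt_trans au.
have uT : u <= T%:R by move: TT; rewrite Tu lee_fin.
have rp : 0 < r.
  by rewrite divr_gt0//; rewrite (lt_le_trans up uT).
have [i /andP[i1 i2]] := grid_locate rp up.
have iK : (i < K)%N by rewrite -(ltr_nat R) -(ltr_pM2r rp) rK (lt_le_trans i1).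
have s0 : 0 <= i%:R * r by exact: mulr_ge0.
set s := i%:R * r in s0 i1.
have {}i2 : u <= s + r by rewrite /s -[X in _ + X]mul1r -mulrDl natr1.
have Ya v : a <= v < u -> h (X v w) = h (X a w).
  move=> /andP[av vu]; apply: (@first_jump_const _ _ (fun t => h (X t w)) a v av).
  by rewrite -Tk1 Tu lte_fin.
have Yu : h (X u w) <> h (X a w).
  by apply: (@first_jump_neq _ _ (fun t => h (X t w)) (HY w) a u a0); rewrite -Tk1.
have nconst v : v < u -> ~ (u%:E < yj v w)%E.
  move=> vu H; apply: Yu; rewrite (@first_jump_const _ _ (fun t => h (X t w)) v u (ltW vu) H).
  rewrite -(Ya (Num.max a v)); last by rewrite le_max lexx gt_max au.
  apply/esym; apply: (@first_jump_const _ _ (fun t => h (X t w)) v); first by rewrite le_max lexx orbT.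
  by rewrite (le_lt_trans _ H)// lee_fin ge_max !ltW.
have ju : (yj s w <= u%:E)%E by rewrite leNgt; apply/negP/nconst.
have [|g1 g2 g3] := Hcell i iK _ nD; first by rewrite (le_trans ju)// lee_fin.
rewrite -/s in g1 g2 g3.
have [fi|[u' su' fu]] := first_jump_cases (HY w) s0; first by rewrite fi leye_eq in ju.
(* A first jump before [u] would put two observed jumps into the cell, against [g1]. *)
have uu : u' = u.
  apply/eqP; rewrite eq_le; rewrite fu lee_fin in ju; rewrite ju leNgt /=.
  apply/negP => u'u; apply: (nconst u' u'u); rewrite fu /= in g1.
  by rewrite (le_lt_trans _ g1)// lee_fin.
rewrite fu uu /= in g1 g2 g3.
have Ys : h (X s w) = h (X a w).
  rewrite -(Ya (Num.max a s)); last by rewrite le_max lexx gt_max au.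
  apply/esym; apply: (@first_jump_const _ _ (fun t => h (X t w)) s); first by rewrite le_max lexx orbT.
  by rewrite fu uu lte_fin gt_max au.
rewrite Ys in g2 g3; rewrite Tk Tu /=; split=> //; case: g3 => [g3|g3]; [by left|right].
have us0 : 0 <= u <= s + r by rewrite ltW.
have dr : s + r - u <= r by rewrite lerBlDl lerD2r ltW.
have Ldr : L * (s + r - u) <= L * r by rewrite ler_wpM2l.
have [|H1 _] := Hlip u (s + r) us0 g1; first by rewrite (le_lt_trans _ Lr10)// ler_wpM2l.
have {}H1 : `|fl (s + r) w phi - fl u w phi| <= e.
  by rewrite (le_trans H1)// (le_trans _ Lre)// ler_wpM2l// mulr_ge0.
rewrite (_ : 2 * e = e + e); last by ring.
rewrite -[_ - _](subrKA (fl (s + r) w phi)) (le_trans (ler_normD _ _))// lerD//.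
by rewrite distrC.
Qed.

(** The mass [fine (m setT)] is positive and independent of the precision, so along a fixed path the
    alternative of a small mass fails for small [e], and the gap is then below every positive
    bound. *)
Theorem jump_formula :
  {ae P, forall w k, (jump_time (fun t => h (X t w)) k.+1 < +oo)%E ->
    let t := fine (jump_time (fun t => h (X t w)) k.+1) in
    let m := jm (pi_left t w) (h (X (fine (jump_time (fun t => h (X t w)) k)) w)) in
    fl t w phi = eta (m : finite_measure_space E R, h (X t w))}.
Proof.
have [c1 c10 pc] := Bb_exists_bound phi_Bb; have [c2 c20 ec] := Bb_exists_bound eta_Bb.
have pc' x : `|phi x| <= c1 + c2 by rewrite (le_trans (pc x))// lerDl ltW.
have ec' p : `|eta p| <= c1 + c2 by rewrite (le_trans (ec p))// lerDr ltW.
have : {ae P, forall w, forall jT : nat * nat, forall k,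
  (jump_time (fun t => h (X t w)) k.+1 <= jT.2%:R%:E)%E ->
    let t := fine (jump_time (fun t => h (X t w)) k.+1) in
    let m := jm (pi_left t w) (h (X (fine (jump_time (fun t => h (X t w)) k)) w)) in
    0 < fine (m setT) /\ (fine (m setT) <= jT.1.+1%:R^-1 \/
      `|fl t w phi - eta (m : finite_measure_space E R, h (X t w))| <= 2 * jT.1.+1%:R^-1)}.
  apply: ae_count => -[j T] /=; apply: (jump_formula_approx T pc' ec').
  by rewrite invr_gt0.
apply: filterS => w Hw k Tk; cbv zeta in Hw |- *.
set t := fine (jump_time _ k.+1); set m := jm _ _.
have [T HT] : exists T : nat, (jump_time (fun t => h (X t w)) k.+1 <= T%:R%:E)%E.
  have [E0|[u u0 ->]] := jump_time_cases (HY w) k.+1; first by rewrite E0 in Tk.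
  by exists (Num.truncn u).+1; rewrite lee_fin ltW// truncnS_gt.
apply/eqP; rewrite -subr_eq0 -normr_le0 leNgt; apply/negP => gp.
have [m0 _] := Hw (0, T)%N k HT.
have no1 (y i : R) : 0 < y -> i <= y / 2 -> ~ (y <= i) by move=> ? ? ?; lra.
have no2 (y i : R) : 0 < y -> i <= y / 4 -> ~ (y <= 2 * i) by move=> ? ? ?; lra.
set x := `|_| in gp.
have [j Hj] : exists j, j.+1%:R^-1 <= Num.min (fine (m setT) / 2) (x / 4).
  by apply: small_invS; rewrite lt_min !divr_gt0.
move: Hj; rewrite le_min => /andP[h1 h2].
have [_ []] := Hw (j, T)%N k HT => /=; rewrite -/t -/m.
  exact: no1 m0 h1.
exact: no2 gp h2.
Qed.

End jumps.

(** * Disintegration along h *)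

Lemma countable_base (R : realType) (T : completeMetricType R) : separable T ->
  exists W : (set T)^nat, (forall k, open (W k)) /\
    forall U x, open U -> U x -> exists k, W k x /\ W k `<=` U.
Proof.
move=> [D [/countable_injP[f finj] dD]].
(* As [f] is injective on [D], the union contains at most one ball. Interiors make these sets
   open. *)
pose W0 (p : nat * nat) : set T :=
  \bigcup_(a in [set a | D a /\ f a = p.1]) (ball a (p.2.+1%:R^-1 : R))^°.
have W0_open p : open (W0 p) by apply: bigcup_open => a _; exact: open_interior.
exists (fun k => if @unpickle (nat * nat)%type k is Some p then W0 p else set0); split.
  by move=> k; case: unpickle => // ; exact: open0.
move=> U x oU Ux.
have /nbhs_ballP[e /= e0 eU] : nbhs x U by exact: open_nbhs_nbhs.
have [k ke] := small_invS (divr_gt0 e0 (ltr0n R 2)).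
have k0 : 0 < k.+1%:R^-1 :> R by rewrite invr_gt0.
have [a [/interior_subset ax Da]] : (ball x (k.+1%:R^-1 / 2 : R))^° `&` D !=set0.
  apply: dD; [exists x|exact: open_interior].
  by apply: nbhsx_ballx; rewrite divr_gt0.
exists (pickle (f a, k)); rewrite pickleK; split.
  exists a => //=; apply/nbhs_ballP; exists (k.+1%:R^-1 / 2) => /=; first by rewrite divr_gt0.
  move=> y xy; rewrite (splitr k.+1%:R^-1); apply: ball_triangle xy.
  exact: ball_sym.
move=> y [b [Db fb] /interior_subset]; rewrite /= in fb.
have -> : b = a by apply: finj; rewrite ?inE.
move=> ay; apply: eU; apply: (@le_ball _ _ _ (k.+1%:R^-1 / 2 + k.+1%:R^-1)); last first.
  exact: ball_triangle ay.
move: k0 ke; set z := _^-1 => k0 ke; lra.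
Qed.

Lemma borel_open (T : ptopologicalType) (A : set T) : open A ->
  measurable (A : set (borel T)).
Proof. exact: sub_sigma_algebra. Qed.

Lemma base_separates (R : realType) (T : completeMetricType R) (W : (set T)^nat) :
  (forall k, open (W k)) ->
  (forall U x, open U -> U x -> exists k, W k x /\ W k `<=` U) ->
  separates_points (W : (set (borel T))^nat).
Proof.
move=> oW HW; split=> [k|x y xy]; first exact: borel_open.
have oy : open (~` [set y] : set T).
  rewrite openC.
  exact/accessible_closed_set1/hausdorff_accessible/metric_hausdorff.
by have [k [Wx Wy]] := HW _ x oy xy; exists k; split=> // /Wy; apply.
Qed.

Section image_integral.
Context d d' (T : measurableType d) (T' : measurableType d') (R : realType).
Variables (m : {measure set T -> \bar R}) (m' : {measure set T' -> \bar R}).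
Variable Z : T -> T'.
Hypothesis mZ : measurable_fun setT Z.
Hypothesis mT : (m setT < +oo)%E.
Hypothesis ZE : forall A, measurable A -> m (Z @^-1` A) = m' A.

Lemma int_image (f : T' -> R) : Bb f -> \int[m]_x f (Z x) = \int[m']_y f y.
Proof.
have mT' : (m' setT < +oo)%E by rewrite -ZE// preimage_setT.
have BZ (g : T' -> R) : Bb g -> Bb (fun x => g (Z x)).
  move=> Bg; have [c _ gc] := Bb_exists_bound Bg; apply: (Bb_le (M := c)) => //.
  exact: measurableT_comp (Bb_meas Bg) mZ.
have mZA A : measurable A -> measurable (Z @^-1` A).
  by move=> mA; rewrite -[X in measurable X]setTI; exact: mZ.
elim/Bb_induction.
- move=> A mA; rewrite (int_indic m' mA) -ZE// -(int_indic m (mZA A mA)).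
  by apply: eq_Rintegral => x _; exact: indic_congr.
- by move=> g1 g2 B1 B2 H1 H2; rewrite !intD ?H1 ?H2//; exact: BZ.
- by move=> a g Bg H1; rewrite !intZ ?H1//; exact: BZ.
- move=> G g Bg BG HG Gg; have [c _ gc] := Bb_exists_bound Bg.
  have Gc n x : `|G n x| <= c + 1.
    rewrite -[G n x](subrK (g x)) (le_trans (ler_normD _ _))// addrC lerD//.
    by rewrite (le_trans (Gg n x))// invf_le1 ?ltr0n// ler1n.
  have lim x : G n x @[n --> \oo] --> g x.
    apply: cvgR_distP => e e0; near=> n; apply: (le_trans (Gg n x)).
    apply: ltW; near: n; exact: (near_infty_natSinv_lt (PosNum e0)).
  have [_ h1] := bounded_cvg_int mT' (fun n => Bb_meas (BG n)) Gc lim.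
  have [_ h2] := bounded_cvg_int mT (fun n => Bb_meas (BZ _ (BG n)))
    (fun n x => Gc n (Z x)) (fun x => lim (Z x)).
  have E : (fun n => \int[m]_x G n (Z x)) = (fun n => \int[m']_x G n x).
    by apply/funext => n; exact: HG.
  by rewrite E in h2; exact: (cvg_unique (@Rhausdorff R) h2 h1).
Unshelve. all: by end_near. Qed.

End image_integral.

Section disintegration.
Local Open Scope charge_scope.
Context (R : realType) (I O : completeMetricType R) (h : {mfun borel I >-> borel O}).
Hypothesis sepO : separable O.
Variable H : {finite_measure set (borel I) -> \bar R} -> O -> probability (borel I) R.
Hypothesis H_disint : disintegration_operator h H.
Variables (phi : borel I -> R) (c : R).
Hypothesis phi_Bb : Bb phi.
Hypothesis phi_le : forall x, `|phi x| <= c.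
Implicit Types (nu : {finite_measure set (borel I) -> \bar R}).

Let D : set (finite_measure_space (borel I) R * borel O) :=
  [set p | msupport (image_law h (p.1 : finite_measures (borel I) R)) p.2].

Let mh : measurable_fun setT (h : borel I -> borel O).
Proof. exact: measurable_funPT. Qed.

Let mhB (B : set (borel O)) : measurable B -> measurable (h @^-1` B).
Proof. by move=> mB; rewrite -[X in measurable X]setTI; exact: mh. Qed.

Let evaluation_measurable (A : set (borel I)) : measurable A ->
  measurable_fun setT (fun m : finite_measure_space (borel I) R =>
    (m : finite_measures (borel I) R) A).
Proof.
move=> mA _ B mB; rewrite setTI; apply: sub_sigma_algebra.
by exists A, B.
Qed.

Let supportP nu (y : O) (W : (set O)^nat) : (forall k, open (W k)) ->
  (forall U x, open U -> U x -> exists k, W k x /\ W k `<=` U) ->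
  msupport (image_law h nu) y <-> forall k, W k y -> (0 < nu (h @^-1` (W k)))%E.
Proof.
move=> oW HW; split=> [Hy k Wy|Hy V oV Vy]; first exact: Hy.
have [k [Wy WV]] := HW V y oV Vy; apply: (lt_le_trans (Hy k Wy)).
rewrite /image_law /pushforward le_measure ?inE//.
- by apply: mhB; exact: borel_open.
- by apply: mhB; exact: borel_open.
- by move=> x /WV.
Qed.

(** With a countable base, belonging to the support means that each basic set around the point is
    charged: countably many conditions, jointly measurable in the measure and the point. *)
Lemma support_measurable : measurable D.
Proof.
have [W [oW HW]] := countable_base sepO.
have HM := @sigma_algebra_measurable _ (finite_measure_space (borel I) R * borel O)%type.
apply: (sa_iff HM (B := [set p | forall k, W k p.2 ->
    (0 < (p.1 : finite_measures (borel I) R) (h @^-1` (W k)))%E])).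
  by move=> p; exact: supportP.
apply: (sa_all HM) => k; apply: (sa_imp HM).
  rewrite -[X in measurable X]setTI; apply: measurable_snd => //.
  exact: borel_open.
rewrite -[X in measurable X]setTI.
apply: (measurable_lte measurableT (measurable_cst _)).
apply: (measurableT_comp (evaluation_measurable (mhB (borel_open (oW k))))).
exact: measurable_fst.
Qed.

(** The complement of the support is the union of the countably many basic sets that are not
    charged. *)
Lemma support_full nu : nu (h @^-1` (~` msupport (image_law h nu))) = 0%E.
Proof.
have [W [oW HW]] := countable_base sepO.
pose N k := if nu (h @^-1` (W k)) == 0%E then h @^-1` (W k) else set0.
have mN k : measurable (N k).
  by rewrite /N; case: ifPn => // _; apply: mhB; exact: borel_open.
have N0 k : nu.-negligible (N k).
  apply/negligibleP => //; rewrite /N; case: ifPn => [/eqP//|_]; exact: measure0.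
have E : h @^-1` (~` msupport (image_law h nu)) = \bigcup_k N k.
  apply/seteqP; split=> x /=.
    move=> nS; apply: contrapT => nU; apply: nS; apply/(supportP _ _ oW HW) => k Wx.
    rewrite lt_neqAle measure_ge0 andbT; apply/negP => /eqP W0; apply: nU.
    by exists k => //; rewrite /N -W0 eqxx.
  move=> [k _]; rewrite /N; case: ifPn => // /eqP W0 Wx /(supportP _ _ oW HW)/(_ k Wx).
  by rewrite W0 ltxx.
rewrite E; apply/negligibleP; first exact: bigcup_measurable.
exact: negligible_bigcup.
Qed.

(* The value c + 1 off the support is out of the range of any mean of phi, so
   that a mean of phi can only equal [disint_mean] on the support. *)
Definition disint_mean (p : finite_measure_space (borel I) R * borel O) : R :=
  if pselect (D p) then \int[H p.1 p.2]_x phi x else c + 1.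

Let c0 : 0 <= c. Proof. exact: le_trans (phi_le point). Qed.

Let H_le nu y : `|\int[H nu y]_x phi x| <= c.
Proof.
have := int_bound (probabilityT_lty (H nu y)) phi_Bb phi_le.
by rewrite (congr1 fine (probability_setT (H nu y)) : fine _ = 1) mulr1.
Qed.

Lemma disint_mean_bound p : `|disint_mean p| <= c + 1.
Proof.
rewrite /disint_mean; case: pselect => _ /=; last by rewrite ger0_norm// addr_ge0.
by rewrite (le_trans (H_le _ _))// lerDl.
Qed.

Lemma disint_mean_eq (p : probability (borel I) R) nu (y : O) :
  \int[p]_x phi x = disint_mean ((nu : finite_measures (borel I) R), y) ->
  \int[p]_x phi x = \int[H nu y]_x phi x.
Proof.
rewrite /disint_mean; case: pselect => // nDy e; exfalso.
have := int_bound (probabilityT_lty p) phi_Bb phi_le.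
rewrite (congr1 fine (probability_setT p) : fine _ = 1) mulr1 e ger0_norm ?addr_ge0//.
by rewrite gerDl ler10.
Qed.

Lemma Bb_disint_mean : Bb disint_mean.
Proof.
apply: (Bb_le (M := c + 1)) disint_mean_bound.
have mD := support_measurable; have [_ _ _ H4] := H_disint.
have mH f : Bb f -> measurable_fun D (fun p => \int[H p.1 p.2]_x f x).
  elim/Bb_induction.
  - move=> A mA; under eq_fun do rewrite int_indic//.
    by apply: (measurable_comp measurableT) (H4 A mA) => //; exact: fine_measurable.
  - move=> f1 f2 B1 B2 H1 H2; under eq_fun do rewrite intD ?probabilityT_lty//.
    exact: measurable_funD.
  - move=> a f1 B1 H1; under eq_fun do rewrite intZ ?probabilityT_lty//.
    by apply: measurable_funM => //; exact: measurable_cst.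
  - move=> G g Bg BG HG Gg.
    apply: (@measurable_fun_cvg _ _ _ D (fun n p => \int[H p.1 p.2]_x G n x)) => // p _.
    apply: cvgR_distP => e e0; near=> n.
    have := @int_close_prob _ _ _ (H p.1 p.2) _ _ _ (BG n) Bg (Gg n); move=> /le_trans; apply.
    apply: ltW; near: n; exact: (near_infty_natSinv_lt (PosNum e0)).
have HM := @sigma_algebra_measurable _ (finite_measure_space (borel I) R * borel O)%type.
move=> _ B mB; rewrite setTI.
apply: (sa_iff HM (B := [set p | (D `&` (fun p => \int[H p.1 p.2]_x phi x) @^-1` B) p \/
   (~ D p /\ B (c + 1))])).
  move=> p; rewrite /disint_mean /preimage /=; case: pselect => Dp /=.
    by split=> [|[[]|[]]//]; left.
  by split=> [|[[]|[]]//]; right.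
apply: (sa_or HM); first exact: mH.
apply: (sa_and HM); first exact: (sa_not HM).
by have [?|?] := pselect (B (c + 1)); [exact: (sa_true HM)|exact: (sa_false HM)].
Unshelve. all: by end_near. Qed.

(** Integration over [B] absorbs the exceptional null set of the Radon-Nikodym derivative, which
    depends on [nu]. The identity then holds for every [nu] without exception and can be used at a
    random measure. *)
Lemma disint_mean_int nu (B : set (borel O)) : measurable B ->
  \int[nu]_z (\1_B (h z) *
    (phi z - disint_mean ((nu : finite_measures (borel I) R), h z))) = 0.
Proof.
move=> mB; have [H1 _ _ _] := H_disint.
pose il : {finite_measure set (borel O) -> \bar R} := image_law h nu; pose dm y := disint_mean ((nu : finite_measures (borel I) R), y).
have nuT : (nu setT < +oo)%E by rewrite ltey_eq fin_num_measure.
have Bdm : Bb (dm : borel O -> R).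
  apply: (Bb_le (M := c + 1)) (fun y => disint_mean_bound _).
  apply: (measurableT_comp (Bb_meas Bb_disint_mean)).
  exact: (measurable_pair1 (nu : finite_measure_space (borel I) R)).
have iphi : nu.-integrable setT (EFin \o phi) := Bb_integrable nu phi_Bb.
have RN := H1 nu phi iphi phi_Bb.
have dom : image_charge h (induced_charge iphi) `<< il.
  apply/null_content_dominatesP => A mA A0.
  rewrite /image_charge /pushforward /induced_charge; apply: null_set_integral => //.
  - exact: mhB.
  - by apply/measurable_EFinP; apply: measurable_funTS; exact: Bb_meas phi_Bb.
have mS : measurable (~` msupport il : set (borel O)).
  apply: measurableC; have := support_measurable.
  move=> /(measurable_xsection (nu : finite_measure_space (borel I) R)); congr measurable.
  by apply/seteqP; split=> y; rewrite /xsection /= ?inE.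
have supp_ae : {ae il, forall y : borel O, msupport il y}.
  have S0 : il (~` msupport il) = 0%E by exact: support_full.
  have := ae_null mS S0; apply: filterS => y /contrapT; exact.
have E1 := Radon_Nikodym_integral dom mB.
have E2 : (\int[il]_(y in B) ('d (image_charge h (induced_charge iphi)) '/d il) y =
    \int[il]_(y in B) (dm y)%:E)%E.
  apply: ae_eq_integral => //.
  - by apply: measurable_funTS; apply: measurable_int; exact: Radon_Nikodym_integrable dom.
  - by apply/measurable_EFinP; apply: measurable_funTS; exact: Bb_meas Bdm.
  move: RN supp_ae; apply: filterS2 => y yE Sy _; rewrite yE /dm /disint_mean.
  by case: pselect.
have E3 : \int[nu]_z (\1_B (h z) * dm (h z)) = \int[nu]_z (\1_B (h z) * phi z).
  rewrite (@int_image _ _ _ _ _ nu il h mh nuT _ (fun y => \1_B y * dm y)) //; last first.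
    by apply: Bb_mul => //; exact: Bb_ind.
  rewrite -(int_setE il dm mB) /Rintegral -E2 -E1.
  rewrite /image_charge /pushforward /induced_charge -[LHS]/(\int[nu]_(t in h @^-1` B) phi t).
  by rewrite (int_setE nu phi (mhB mB)); apply: eq_Rintegral => z _; congr (_ * _); exact: indic_congr.
have mhBi : Bb (fun z => \1_B (h z) : R).
  by have := Bb_ind R (mhB mB); congr Bb; apply/funext => z; exact: indic_congr.
have Bdmh : Bb (fun z => dm (h z)).
  apply: (Bb_le (M := c + 1)) (fun z => disint_mean_bound _).
  exact: measurableT_comp (Bb_meas Bdm) mh.
under eq_Rintegral do rewrite mulrBr.
by rewrite (intB nuT (Bb_mul mhBi phi_Bb) (Bb_mul mhBi Bdmh)) E3 subrr.
Qed.

End disintegration.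

(** * The filter equation along a path *)

#[local] Arguments jump_time : simpl never.

Section integral_increments.
Context (R : realType).
Local Notation mu := (@lebesgue_measure R).
Implicit Types (f : R -> R) (x y a e : R).

Lemma bounded_integrable f (A : set R) (c : R) : measurable A -> (mu A < +oo)%E ->
  measurable_fun A f -> (forall x, A x -> `|f x| <= c) -> mu.-integrable A (EFin \o f).
Proof.
move=> mA A1 mf fc; apply: measurable_bounded_integrable => //.
exists c; split; first exact: num_real.
by move=> M cM x Ax; exact: le_trans (fc x Ax) (ltW cM).
Qed.

Lemma integral_increment f x y a e : 0 <= x <= y ->
  mu.-integrable `[0, y] (EFin \o f) -> (forall s, x < s <= y -> `|f s - a| <= e) ->
  `|\int[mu]_(s in `[0, y]) f s - \int[mu]_(s in `[0, x]) f s - (y - x) * a| <= (y - x) * e.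
Proof.
move=> /andP[x0 xy] fi fe.
have sub : `]x, y] `<=` `[0, y]%classic.
  by move=> s /=; rewrite !in_itv/= => /andP[xs ->]; rewrite (le_trans x0)// ltW.
have mI : measurable (`]x, y]%classic : set (measurableTypeR R)) by exact: measurable_itv.
have fi' : mu.-integrable `]x, y] (EFin \o f) by exact: integrableS fi.
have mI0 : mu `]x, y]%classic = (y - x)%:E.
  rewrite lebesgue_measure_itv /= lte_fin; case: ltP => //.
  by move=> yx; rewrite (@le_anti _ _ x y) ?subrr// xy.
have ci (b : R) : mu.-integrable `]x, y] (EFin \o (fun=> b)).
  by apply: (@bounded_integrable _ _ `|b|) => //; rewrite mI0 ltry.
have cI (b : R) : \int[mu]_(s in `]x, y]) b = (y - x) * b.
  by rewrite (Rintegral_cst mu mI b) (congr1 fine mI0 : fine _ = y - x) mulrC.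
rewrite (Rintegral_itvB fi) ?bnd_simp// -cI -(RintegralB mI fi' (ci a)).
have di : mu.-integrable `]x, y] (EFin \o (fun s => f s - a)).
  by have := integrableB mI fi' (ci a); apply: eq_integrable.
apply: (le_trans (le_normr_Rintegral mI di)); rewrite -cI.
apply: le_Rintegral => //; first by have := integrable_norm di; apply: eq_integrable.
Qed.

End integral_increments.

(* f0, f1, f2 stand for the filter applied to phi, stay phi and stay 1 along one
   path y of the observation, and g0, g1, g2 for their left limits. *)
Section filter_path.
Context (R : realType) (T : Type) (y : R -> T).
Hypothesis yJ : pure_jump_path y.
Local Notation mu := (@lebesgue_measure R).
Variables (f0 f1 f2 g0 g1 g2 : R -> R) (c k C : R).
Hypothesis c0 : 0 <= c.
Hypothesis k0 : 0 <= k.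
Hypothesis C0 : 0 <= C.
Hypothesis f0c : forall t, `|f0 t| <= c.
Hypothesis f2c : forall t, `|f2 t| <= c.
Hypothesis g0c : forall t, `|g0 t| <= c.
Hypothesis g1c : forall t, `|g1 t| <= c.
Hypothesis g2c : forall t, `|g2 t| <= c.
(** The inequality [t <= first_jump y s] is not strict: the left limit at the next jump is still
    governed by the stay before it. *)
Definition close_on_stays (f g : R -> R) := forall s t, 0 <= s < t ->
  (t%:E <= first_jump y s)%E -> k * (t - s) < 1 -> `|g t - f s| <= C * (t - s).
Definition lipschitz_on_stays (f : R -> R) := forall s t, 0 <= s <= t ->
  (t%:E < first_jump y s)%E -> k * (t - s) < 1 -> `|f t - f s| <= C * (t - s).
Hypothesis f0L : lipschitz_on_stays f0.
Hypothesis f1L : lipschitz_on_stays f1.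
Hypothesis f2L : lipschitz_on_stays f2.
Hypothesis g0L : close_on_stays f0 g0.
Hypothesis g1L : close_on_stays f1 g1.
Hypothesis g2L : close_on_stays f2 g2.
Let drift s := f1 s - f0 s * f2 s.
Hypothesis f0E : forall s t, 0 <= s <= t -> (t%:E < first_jump y s)%E -> k * (t - s) < 1 ->
  `|f0 t - f0 s - (t - s) * drift s| <= C * (t - s) ^+ 2.
Hypothesis f0_left : forall t, 0 < t -> f0 s @[s --> t^'-] --> g0 t.
Hypothesis f1_left : forall t, 0 < t -> f1 s @[s --> t^'-] --> g1 t.
Hypothesis f2_left : forall t, 0 < t -> f2 s @[s --> t^'-] --> g2 t.
Implicit Types (s t u : R) (n : nat).
Local Notation Tn := (jump_time y).

(** A Lipschitz constant of [drift] on a stay: [C] from [f1] and [2 * (c * C)] from the product of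
    [f0] and [f2]. *)
Let C3 := C + 2 * (c * C).
Let C30 : 0 <= C3. Proof. by rewrite addr_ge0// mulr_ge0// mulr_ge0. Qed.

Let product_close (a b p a' b' p' d : R) : `|b'| <= c -> `|p| <= c ->
  `|a' - a| <= d -> `|b' - b| <= d -> `|p' - p| <= d -> 0 <= d ->
  `|(a' - b' * p') - (a - b * p)| <= (1 + 2 * c) * d.
Proof.
move=> b'c pc ad bd pd d0.
rewrite (_ : (a' - b' * p') - (a - b * p) = (a' - a) - b' * (p' - p) - (b' - b) * p); last by ring.
rewrite (le_trans (ler_normB _ _))// (_ : (1 + 2 * c) * d = d + c * d + d * c); last by ring.
apply: lerD; last by rewrite normrM ler_pM.
by rewrite (le_trans (ler_normB _ _))// lerD// normrM ler_pM.
Qed.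

Let drift_lipschitz s t : 0 <= s <= t -> (t%:E < first_jump y s)%E -> k * (t - s) < 1 ->
  `|drift t - drift s| <= C3 * (t - s).
Proof.
move=> st tj kt; have ts0 : 0 <= t - s by rewrite subr_ge0; case/andP: st.
rewrite (_ : C3 * (t - s) = (1 + 2 * c) * (C * (t - s))); last by rewrite /C3; ring.
apply: product_close => //; [exact: f1L|exact: f0L|exact: f2L|exact: mulr_ge0].
Qed.

(** For [s > t] the expansion is taken at [t]; for [s < t] it is taken at [s], and the drift is
    moved to [t] by its Lipschitz bound. At the jump time [Tn n] itself the limit is a right
    derivative. *)
Lemma filter_path_derivative n t : (Tn n <= t%:E < Tn n.+1)%E ->
  (f0 s - f0 t) / (s - t) @[s --> within [set s | (Tn n <= s%:E < Tn n.+1)%E] t^'] -->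
  drift t.
Proof.
move=> tn; have T0 := jump_time_ge0 yJ n.
have jT s : (Tn n <= s%:E < Tn n.+1)%E -> 0 <= s /\ first_jump y s = Tn n.+1.
  move=> sn; split; first by rewrite -lee_fin (le_trans T0)//; case/andP: sn.
  exact: jump_time_first_jump.
have [t0 jt] := jT t tn.
have quot (a b r e : R) : 0 < r -> `|a - r * b| <= e * r -> `|a / r - b| <= e.
  move=> r0; rewrite (_ : a - r * b = (a / r - b) * r); last by field; rewrite gt_eqF.
  by rewrite normrM (gtr0_norm r0) ler_pM2r.
have bound s : s != t -> (Tn n <= s%:E < Tn n.+1)%E -> k * `|s - t| < 1 ->
    `|(f0 s - f0 t) / (s - t) - drift t| <= (C + C3) * `|s - t|.
  move=> st sn; have [s0 js] := jT s sn.
  case: (ltgtP s t) st => // [lt|gt] _.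
    rewrite distrC gtr0_norm ?subr_gt0// => ks.
    have tj : (t%:E < first_jump y s)%E by rewrite js; case/andP: tn.
    have s0t : 0 <= s <= t by rewrite s0 ltW.
    have H1 := f0E s0t tj ks; have H2 := drift_lipschitz s0t tj ks.
    rewrite -[f0 s - f0 t]opprB -[s - t]opprB invrN mulrNN.
    rewrite (_ : _ - drift t = ((f0 t - f0 s) / (t - s) - drift s) - (drift t - drift s)); last by ring.
    rewrite [(C + C3) * _]mulrDl (le_trans (ler_normB _ _))// lerD//.
    apply: quot; rewrite ?subr_gt0//; by rewrite -mulrA -expr2.
  rewrite gtr0_norm ?subr_gt0// => ks.
  have sj : (s%:E < first_jump y t)%E by rewrite jt; case/andP: sn.
  have t0s : 0 <= t <= s by rewrite t0 ltW.
  have H1 := f0E t0s sj ks.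
  apply: (@le_trans _ _ (C * (s - t))); last by rewrite ler_wpM2r ?lerDl// subr_ge0 ltW.
  by apply: quot; rewrite ?subr_gt0//; rewrite -mulrA -expr2.
apply: cvgR_distP => e e0.
have CC : 0 < C + C3 + 1 by rewrite ltr_wpDl// addr_ge0.
have k1 : 0 < k + 1 by rewrite ltr_wpDl.
apply/nbhs_ballP; exists (Num.min (k + 1)^-1 (e / (C + C3 + 1))) => /=.
  by rewrite lt_min invr_gt0 k1 divr_gt0.
move=> s; rewrite /ball /= lt_min distrC => /andP[h1 h2] st sn.
apply: (le_trans (bound s st sn _)).
  rewrite (@le_lt_trans _ _ ((k + 1) * `|s - t|))//; first by rewrite ler_wpM2r// lerDl.
  by rewrite mulrC -ltr_pdivlMr// div1r.
rewrite (@le_trans _ _ ((C + C3 + 1) * `|s - t|))//; first by rewrite ler_wpM2r// lerDl.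
by rewrite mulrC -ler_pdivlMr// ltW.
Qed.

Let left_measurable (f g : R -> R) (t : R) : (forall u, 0 < u -> f s @[s --> u^'-] --> g u) ->
  measurable_fun (`]0, t] : set R) g.
Proof.
move=> fg; apply: (@measurable_fun_cvg _ _ _ (`]0, t]%classic)
  (fun j u => \sum_(i < (Num.truncn (t * j.+1%:R)).+1)
    \1_(`]0 + i%:R * j.+1%:R^-1, 0 + i.+1%:R * j.+1%:R^-1]) u * f (0 + i%:R * j.+1%:R^-1))) => //.
  move=> j; apply: measurable_funTS; apply: measurable_sum => i.
  by apply: measurable_funM; [exact: measurable_indic|exact: measurable_cst].
move=> u /=; rewrite in_itv/= => /andP[u0 ut].
by apply: left_grid_cvg; [rewrite add0r u0|exact: fg].
Qed.

(** The integrands of the equation agree with the left limits at positive times only, as there is no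
    left limit at 0; one point does not affect the integrals. *)
Variables p1 p2 : R -> R.
Hypothesis p1E : forall s, 0 < s -> p1 s = g1 s.
Hypothesis p2E : forall s, 0 < s -> p2 s = g0 s * g2 s.

Let extend_integrable (p g : R -> R) (e t : R) : (forall s, 0 < s -> p s = g s) ->
  (forall s, 0 < s -> `|g s| <= e) -> measurable_fun (`]0, t] : set R) g ->
  mu.-integrable `[0, t] (EFin \o p).
Proof.
move=> pg ge mg; have mp : measurable_fun (`]0, t] : set R) p.
  apply: eq_measurable_fun mg => s; rewrite inE/= in_itv/= => /andP[s0 _].
  by rewrite pg.
apply: (@bounded_integrable _ _ _ (Num.max e `|p 0|)) => //.
- by rewrite lebesgue_measure_itv /=; case: ifP => // _; rewrite -EFinD ltry.
- have [t0|t0] := ltP t 0; first by rewrite set_itv_ge ?bnd_simp -?ltNge//; exact: measurable_fun_set0.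
  rewrite -(@setU1itv _ _ (BRight t) 0 false) ?bnd_simp//; apply/measurable_funU => //; split=> //.
  exact: measurable_fun_set1.
- move=> s /=; rewrite in_itv/= => /andP[]; rewrite le_eqVlt => /predU1P[<- _|s0 _].
    by rewrite le_max lexx orbT.
  by rewrite pg// le_max ge.
Qed.

Let p1_int t : mu.-integrable `[0, t] (EFin \o p1).
Proof. by apply: extend_integrable p1E (fun s _ => g1c s) _; exact: left_measurable f1_left. Qed.

Let p2_int t : mu.-integrable `[0, t] (EFin \o p2).
Proof.
apply: (@extend_integrable p2 (fun s => g0 s * g2 s) (c * c) t p2E).
  by move=> s _; rewrite normrM ler_pM.
by apply: measurable_funM; [exact: left_measurable f0_left|exact: left_measurable f2_left].
Qed.

Let p s := p1 s - p2 s.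
Let p_int t : mu.-integrable `[0, t] (EFin \o p).
Proof.
have mI : measurable (`[0, t]%classic : set (measurableTypeR R)) by exact: measurable_itv.
by have := integrableB mI (p1_int t) (p2_int t); apply: eq_integrable.
Qed.

Let I t := \int[mu]_(s in `[0, t]) p s.
Let J t := f0 t - I t.

(** [f0] and [I] have the same first-order increment [(t - s) * drift s], so the increments of [J]
    are quadratic. *)
Let J_stay a b : 0 <= a <= b -> (b%:E < first_jump y a)%E -> J b = J a.
Proof.
move=> /andP[a0 ab] bj; apply: (@quadratic_increments _ J a b k (C + C3)) => //.
  exact: addr_ge0.
move=> s t /andP[as_ st] tb kst; have s0 := le_trans a0 as_.
have js : first_jump y s = first_jump y a.
  by apply: first_jump_id => //; rewrite (le_lt_trans _ bj)// lee_fin (le_trans st).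
have tj : (t%:E < first_jump y s)%E by rewrite js (le_lt_trans _ bj)// lee_fin.
have s0t : 0 <= s <= t by rewrite s0.
have H1 := f0E s0t tj kst; have ts0 : 0 <= t - s by rewrite subr_ge0.
have H2 : `|I t - I s - (t - s) * drift s| <= (t - s) * (C3 * (t - s)).
  apply: (integral_increment s0t (p_int t)) => v /andP[sv vt]; have v0 : 0 < v by exact: le_lt_trans sv.
  have vs : v - s <= t - s by rewrite lerB.
  have s0v : 0 <= s < v by rewrite s0.
  have vj : (v%:E <= first_jump y s)%E by rewrite (le_trans _ (ltW tj))// lee_fin.
  have kv : k * (v - s) < 1 by rewrite (le_lt_trans _ kst)// ler_wpM2l.
  have Cv : C * (v - s) <= C * (t - s) by rewrite ler_wpM2l.
  rewrite /p p1E// p2E// (_ : C3 * (t - s) = (1 + 2 * c) * (C * (t - s))); last by rewrite /C3; ring.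
  apply: product_close => //; last exact: mulr_ge0.
  - exact: le_trans (g1L s0v vj kv) Cv.
  - exact: le_trans (g0L s0v vj kv) Cv.
  - exact: le_trans (g2L s0v vj kv) Cv.
rewrite /J (_ : f0 t - I t - (f0 s - I s) =
  (f0 t - f0 s - (t - s) * drift s) - (I t - I s - (t - s) * drift s)); last by ring.
rewrite (le_trans (ler_normB _ _))// (le_trans (lerD H1 H2))//.
by apply: le_of_eq; ring.
Qed.

(** [J] keeps the value [J a] up to [u], so [J a] is its left limit there; [I] is continuous at [u]
    and only [f0] jumps. *)
Let J_jump n a u : Tn n = a%:E -> Tn n.+1 = u%:E -> J u = J a + (f0 u - g0 u).
Proof.
move=> Ta Tu; have Tj := jump_timeS Ta.
have a0 : 0 <= a by rewrite -lee_fin -Ta; exact: jump_time_ge0.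
have au : a < u by have := jump_time_lt yJ (n := n); rewrite Ta Tu lte_fin ltry; apply.
have u0 : 0 < u by exact: le_lt_trans au.
suff -> : J a = g0 u - I u by rewrite /J; ring.
have lim : f0 s - J a @[s --> u^'-] --> g0 u - J a.
  by apply: cvgB (cvg_cst _); exact: f0_left.
suff H : f0 s - J a @[s --> u^'-] --> I u.
  by rewrite -(cvg_unique (@Rhausdorff R) lim H); ring.
pose M := c + c * c.
have M0 : 0 <= M by rewrite addr_ge0// mulr_ge0.
apply: cvgR_distP => e e0.
apply/near_leftP; exists (Num.min (u - a) (e / (M + 1))).
  by rewrite lt_min subr_gt0 au divr_gt0// ltr_wpDl.
move=> s /andP[]; rewrite ltrBlDr -ltrBlDl lt_min => /andP[].
rewrite ltrD2l ltrN2 => as_ su' su.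
have s0 : 0 <= s by rewrite (le_trans a0)// ltW.
have -> : f0 s - J a = I s.
  rewrite -(@J_stay a s); first by rewrite /J; ring.
    by rewrite a0 ltW.
  by rewrite -Tj Tu lte_fin.
have s0u : 0 <= s <= u by rewrite s0 ltW.
have := integral_increment (a := 0) s0u (p_int u) (e := M) _.
rewrite mulr0 subr0 distrC => H; apply: (le_trans (H _)).
  move=> v /andP[sv vu]; have v0 : 0 < v by exact: le_lt_trans sv.
  rewrite subr0 /p p1E// p2E// (le_trans (ler_normB _ _))// lerD//.
  by rewrite normrM ler_pM.
rewrite (@le_trans _ _ ((u - s) * (M + 1)))//.
  by rewrite ler_wpM2l ?subr_ge0 ?ltW// ltrDl.
by rewrite -ler_pdivlMr ?ltr_wpDl// ltW.
Qed.

Lemma filter_path_integral t : 0 <= t ->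
  f0 t = f0 0 + \int[mu]_(s in `[0, t]) p1 s - \int[mu]_(s in `[0, t]) p2 s +
    \sum_(n \in [set n | (0 < Tn n <= t%:E)%E]) (f0 (fine (Tn n)) - g0 (fine (Tn n))).
Proof.
move=> t0; have [n tn] := jump_time_locate yJ t0.
have IE : I t = \int[mu]_(s in `[0, t]) p1 s - \int[mu]_(s in `[0, t]) p2 s.
  exact: RintegralB.
have T00 : Tn 0 = 0%:E by [].
have J0 : J 0 = f0 0.
  rewrite /J /I (_ : `[0, 0]%classic = [set (0 : R)]); last by rewrite set_itv1.
  by rewrite Rintegral_set1 subr0.
have Jn m a : Tn m = a%:E ->
    J a = f0 0 + \sum_(i < m) (f0 (fine (Tn i.+1)) - g0 (fine (Tn i.+1))).
  elim: m a => [|m IH] u Tu; first by rewrite big_ord0 addr0 -J0; move: Tu => [->].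
  have [E0|[a a0 Ta]] := jump_time_cases yJ m.
    by rewrite (jump_timeS_pinfty E0) in Tu.
  by rewrite big_ord_recr/= addrA -(IH a Ta) (J_jump Ta Tu) Tu.
have [E0|[a a0 Ta]] := jump_time_cases yJ n; first by move: tn; rewrite E0 leye_eq.
have at_ : 0 <= a <= t by move: tn; rewrite a0 Ta lee_fin => /andP[->].
have Jt : J t = J a.
  by apply: J_stay => //; rewrite -(jump_timeS Ta); case/andP: tn.
(* The jump times in []0, t]] have indices 1 to [n]; index 0 is the time 0 and drops out. *)
have -> : \sum_(m \in [set m | (0 < Tn m <= t%:E)%E]) (f0 (fine (Tn m)) - g0 (fine (Tn m))) =
    \sum_(i < n) (f0 (fine (Tn i.+1)) - g0 (fine (Tn i.+1))).
  rewrite (@fsbig_ord _ _ _ n (fun i => f0 (fine (Tn i.+1)) - g0 (fine (Tn i.+1)))).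
  rewrite (_ : [set m | _] = succn @` `I_n).
    by rewrite fsbig_image// => i j _ _ /succn_inj.
  apply/seteqP; split=> m /=.
    case: m => [|m]; first by rewrite T00 ltxx.
    move=> /andP[_ mt]; exists m => //; rewrite ltnNge; apply/negP => nm.
    have := jump_time_mono yJ (n := n.+1) (m := m.+1) nm.
    by case/andP: tn => _ tn1 /(lt_le_trans tn1); rewrite ltNge mt.
  move=> [i iN <-]; apply/andP; split.
    rewrite (le_lt_trans (jump_time_ge0 yJ i))// (jump_time_lt yJ)//.
    by rewrite (le_lt_trans (jump_time_mono yJ (ltnW iN)))// Ta ltry.
  by rewrite (le_trans (jump_time_mono yJ (n := i.+1) (m := n) iN))//; case/andP: tn.
have := Jn n a Ta; rewrite -Jt /J IE => H.
by rewrite -[LHS](subrK (I t)) IE H; ring.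
Qed.

End filter_path.

(** * The filtering equation *)

(** The completed past at time 0 is generated by the events on [h (X 0 w)] and the null sets; on the
    former the identity is the integrated disintegration of [mu]. Both sides are adapted, so equal
    integrals over that past give almost sure equality. *)
Lemma initial_filter d (Om : measurableType d) (R : realType) (P : probability Om R)
    d' (E : measurableType d') d2 (O : measurableType d2) (h : E -> O)
    (X : R -> Om -> E) (mu : probability E R) (p0 : Om -> probability E R)
    (phi : E -> R) (q : O -> R) :
  measure_is_complete P -> measurable_fun setT h ->
  (forall t, 0 <= t -> measurable_fun setT (X t)) ->
  (forall A, measurable A -> P (X 0 @^-1` A) = mu A) ->
  Bb phi -> Bb q ->
  is_cond_exp P (filtration P (fun t w => h (X t w)) 0) (fun w => phi (X 0 w))
    (fun w => \int[p0 w]_x phi x) ->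
  (forall B, measurable B -> \int[mu]_z (\1_B (h z) * (phi z - q (h z))) = 0) ->
  {ae P, forall w, \int[p0 w]_x phi x = q (h (X 0 w))}.
Proof.
move=> Pc mh mX XE Bphi Bq [aW _ W_eq] q_eq.
set F0 := filtration P _ 0 in aW W_eq; pose W w := \int[p0 w]_x phi x.
have PT : (P setT < +oo)%E := probabilityT_lty P.
have HF : sigma_algebra setT F0 := filtration_sigma P _ 0.
have mY t : 0 <= t -> measurable_fun setT (fun w => h (X t w)).
  by move=> t0; exact: measurableT_comp mh (mX t t0).
have Fm A : F0 A -> measurable A by exact: (filtration_measurable Pc mY).
have Bat (f : E -> R) : Bb f -> Bb (fun w => f (X 0 w)).
  move=> Bf; have [c _ fc] := Bb_exists_bound Bf; apply: (Bb_le (M := c)) => //.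
  exact: measurableT_comp (Bb_meas Bf) (mX 0 (lexx 0)).
have Bqh : Bb (fun z => q (h z)).
  have [c _ qc] := Bb_exists_bound Bq; apply: (Bb_le (M := c)) => //.
  exact: measurableT_comp (Bb_meas Bq) mh.
have BW : Bb W.
  have [c _ fc] := Bb_exists_bound Bphi; apply: (adapted_Bb Fm (c := c)) => [B mB|w].
    exact: aW.
  have := int_bound (probabilityT_lty (p0 w)) Bphi fc.
  by rewrite (congr1 fine (probability_setT (p0 w)) : fine _ = 1) mulr1.
have Bx := Bat _ Bphi; have Bqx := Bat _ Bqh.
have aq : adapted F0 (fun w => q (h (X 0 w))).
  move=> B mB; apply: (@filtration_gen _ _ _ P _ _ (fun t w => h (X t w)) 0 0 (q @^-1` B)).
    by rewrite lexx.
  by rewrite -[X in measurable X]setTI; exact: (Bb_meas Bq).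
have H A : F0 A -> \int[P]_w (\1_A w * (phi (X 0 w) - q (h (X 0 w)))) = 0.
  have BU : Bb (fun w => phi (X 0 w) - q (h (X 0 w))) by exact: Bb_sub.
  have law B : measurable B ->
      \int[P]_w (\1_[set w | B (h (X 0 w))] w * (phi (X 0 w) - q (h (X 0 w)))) = 0.
    move=> mB; rewrite -[RHS](q_eq B mB).
    have Bg : Bb (fun z => \1_B (h z) * (phi z - q (h z))).
      apply: Bb_mul (Bb_sub Bphi Bqh).
      have mhB : measurable (h @^-1` B) by rewrite -[X in measurable X]setTI; exact: mh.
      by have := Bb_ind R mhB; congr Bb; apply/funext => z; exact: indic_congr.
    rewrite -(int_image (mX 0 (lexx 0)) PT XE Bg).
    by apply: eq_Rintegral => w _; congr (_ * _); exact: indic_congr.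
  move: A; rewrite /F0 -filtrationE; apply: (int_eq0_generated PT _ _ BU).
  - move=> A1 A2 [[s1 [C1 [s10 mC1 ->]]]|n1] [[s2 [C2 [s20 mC2 ->]]]|n2];
      [left|right|right|right].
    + have s1E : s1 = 0 by apply/eqP; rewrite eq_le andbC.
      have s2E : s2 = 0 by apply/eqP; rewrite eq_le andbC.
      exists 0, (C1 `&` C2); split; [by rewrite lexx|exact: measurableI|].
      by rewrite s1E s2E preimage_setI.
    + exact: negligibleS (@subIsetr _ _ _) n2.
    + exact: negligibleS (@subIsetl _ _ _) n1.
    + exact: negligibleS (@subIsetl _ _ _) n1.
  - by move=> A FA; apply: Fm; rewrite /F0 -filtrationE.
  - have := law setT measurableT; rewrite (_ : [set w | _] = setT)//.
    by move=> H0; rewrite -[RHS]H0; apply: eq_Rintegral => w _; rewrite indic1// mul1r.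
  - move=> A [[s [B [s0 mB ->]]]|nA].
      have sE : s = 0 by apply/eqP; rewrite eq_le andbC.
      by rewrite sE; exact: law.
    have mA : measurable A by exact/Fm/filtration_negligible.
    rewrite -(int_setE P _ mA) /Rintegral null_set_integral//.
    + by apply/measurable_EFinP; apply: measurable_funTS; exact: Bb_meas BU.
    + exact/negligibleP.
suff U0 A : F0 A -> \int[P]_w (\1_A w * (W w - q (h (X 0 w)))) = 0.
  have := adapted_eq0 HF Fm (Bb_sub BW Bqx) (adapted_sub HF (fun B mB => aW B mB) aq) U0.
  by apply: filterS => w /eqP; rewrite subr_eq0 => /eqP.
move=> FA; have mA := Fm A FA; have BA : Bb (fun w => \1_A w : R) by exact: Bb_ind.
rewrite -[RHS](H A FA); have := W_eq A FA.
rewrite (int_setE P (fun w => \int[p0 w]_x phi x) mA) (int_setE P (fun w => phi (X 0 w)) mA) => E1.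
under eq_Rintegral do rewrite mulrBr; under [RHS]eq_Rintegral do rewrite mulrBr.
rewrite (intB PT (Bb_mul BA BW) (Bb_mul BA Bqx)) (intB PT (Bb_mul BA Bx) (Bb_mul BA Bqx)).
by rewrite -E1.
Qed.

Lemma left_lim_const (R : realType) (T : completeMetricType R) (x : R -> T) (t : R) (a : T) :
  (\forall s \near t^'-, x s = a) -> left_lim x t = a.
Proof.
move=> H; apply: cvg_lim; first exact: metric_hausdorff.
by apply: cvg_near_cst.
Qed.

Lemma opA_int (R : realType) (I O : completeMetricType R) (h : {mfun borel I >-> borel O})
    (V : (set (borel O))^nat) (VS : separates_points V)
    (lam : R.-fker borel I ~> borel I) (L : R) (lamL : forall x, (lam x setT <= L%:E)%E)
    (m : probability (borel I) R) (y : O) (f : borel I -> R) : Bb f ->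
  {ae m, forall z, h z = y} ->
  \int[m]_x opA lam h y f x = \int[m]_x stay lam h f x.
Proof.
move=> Bf hy; have mh : measurable_fun setT (h : borel I -> borel O) by exact: measurable_funPT.
apply: ae_eq_int.
- apply: Bb_opA => //; rewrite -[X in measurable X]setCK; apply: measurableC.
  exact: measurable_off_fiber.
- exact: (Bb_stay lamL VS mh Bf).
- by apply: filterS hy => x <-; exact: (opA_stay VS mh lamL x Bf).
Qed.

(** The almost sure facts concern only [phi], [stay] of [phi] and [stay] of 1, so they hold together
    on one event. The rest is deterministic along one path, where the fibre property turns [stay]
    back into [opA]. *)
Theorem theorem2p5
  (R : realType)
  (I O : completeMetricType R) (sepI : separable I) (sepO : separable O)
  (h : {mfun borel I >-> borel O})
  (h_surj : forall y : O, exists x : I, h x = y)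
  (h_ninj : ~ injective h)
  (h_ncst : ~ exists y : O, forall x : I, h x = y)
  (d : measure_display) (Om : measurableType d) (P : probability Om R)
  (P_complete : measure_is_complete P)
  (mu : probability (borel I) R)
  (lam : R.-fker (borel I) ~> (borel I))
  (lam_diag : forall x : borel I, lam x [set x] = 0%E)
  (X : R -> Om -> borel I)
  (X_meas : forall t, 0 <= t -> measurable_fun setT (X t))
  (X_jump : forall w, pure_jump_path (X^~ w))
  (X_init : forall A, measurable A -> P (X 0 @^-1` A) = mu A)
  (X_markov : homogeneous_markov P X)
  (X_rate : has_rate P X lam)
  (Y : R -> Om -> borel O)
  (Y_def : forall t w, Y t w = h (X t w))
  (tau : nat -> Om -> \bar R)
  (tau_def : forall n w, tau n w = jump_time (Y^~ w) n)
  (pi : R -> Om -> probability (borel I) R)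
  (pi_filter : forall t (phi : borel I -> R), 0 <= t -> Bb phi ->
     is_cond_exp P (completed_natural_filtration P Y t)
       (fun w => phi (X t w)) (fun w => \int[pi t w]_x phi x))
  (pi_left : R -> Om -> probability (borel I) R)
  (pi_rcont : forall w t A, 0 <= t -> measurable A ->
     pi s w A @[s --> t^'+] --> pi t w A)
  (pi_llim : forall w t A, 0 < t -> measurable A ->
     pi s w A @[s --> t^'-] --> pi_left t w A)
  (H : {finite_measure set (borel I) -> \bar R} -> O ->
       probability (borel I) R)
  (H_disint : disintegration_operator h H)
  (Y_left : R -> Om -> O)
  (Y_left_def : forall t w, Y_left t w = left_lim (Y^~ w : R -> O) t)
  (mu_ : nat -> Om -> {finite_measure set (borel I) -> \bar R})
  (mu_0 : forall w, mu_ 0%N w = mu)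
  (mu_S : forall n w, (tau n.+1 w < +oo)%E ->
     mu_ n.+1 w = jump_measure h lam (pi_left (fine (tau n.+1 w)) w)
                    (Y_left (fine (tau n.+1 w)) w))
  (phi : borel I -> R) (phi_Bb : Bb phi) :
  {ae P, forall w,
    (forall t, 0 <= t ->
       \int[pi t w]_x phi x =
         \int[H mu (Y 0 w)]_x phi x
         + \int[lebesgue_measure]_(s in `[0, t])
             (\int[pi_left s w]_x opA lam h (Y_left s w) phi x)
         - \int[lebesgue_measure]_(s in `[0, t])
             ((\int[pi_left s w]_x phi x) *
              \int[pi_left s w]_x opA lam h (Y_left s w) (cst 1) x)
         + \sum_(n \in [set n | (0 < tau n w <= t%:E)%E])
             (\int[H (mu_ n w) (Y (fine (tau n w)) w)]_x phi x
              - \int[pi_left (fine (tau n w)) w]_x phi x)) /\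
    (forall n, (tau n w < +oo)%E ->
       \int[pi (fine (tau n w)) w]_x phi x =
         \int[H (mu_ n w) (Y (fine (tau n w)) w)]_x phi x) /\
    (forall n t, (tau n w <= t%:E < tau n.+1 w)%E ->
       let y := Y (fine (tau n w)) w in
       (\int[pi s w]_x phi x - \int[pi t w]_x phi x) / (s - t)
         @[s --> within [set s | (tau n w <= s%:E < tau n.+1 w)%E] t^'] -->
       \int[pi t w]_x opA lam h y phi x
         - (\int[pi t w]_x phi x) * \int[pi t w]_x opA lam h y (cst 1) x)}.
Proof.
have YE : Y = fun t w => h (X t w) by apply/funext => t; apply/funext => w.
subst Y; clear Y_def.
have [WI [oWI HWI]] := countable_base sepI; have US := base_separates oWI HWI.
have [WO [oWO HWO]] := countable_base sepO; have VS := base_separates oWO HWO.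
have mh : measurable_fun setT (h : borel I -> borel O) by exact: measurable_funPT.
have /measure_fam_uubP[L0 HL] := measure_uub lam.
pose L : R := L0%:num; have lamL x : (lam x setT <= L%:E)%E by exact: ltW (HL x).
have L_ge0 : 0 <= L by exact: (rate_bound_ge0 lamL).
have [c cp phi_le] := Bb_exists_bound phi_Bb; have c_ge0 := ltW cp.
have pi_cond t f : 0 <= t -> Bb f -> is_cond_exp P (filtration P (fun t w => h (X t w)) t)
    (fun w => f (X t w)) (fun w => \int[pi t w]_x f x).
  by rewrite -filtrationE; exact: pi_filter.
have HY w : pure_jump_path (fun t => h (X t w)).
  exact: (@obs_path_jump _ _ _ _ _ X X_jump _ _ h w).
pose one : borel I -> R := cst 1.
have B1 : Bb one by exact: Bb_cst.
pose K f := stay lam h f.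
have BK f : Bb f -> Bb (K f) by exact: (Bb_stay lamL VS mh).
have Beta := Bb_disint_mean sepO H_disint phi_Bb phi_le.
have eta_int nu B mB := disint_mean_int sepO H_disint phi_Bb phi_le nu mB (B := B).
have jmE nu y B : measurable B ->
    jump_measure h lam nu y B = kernel_mixture lam nu (B `&` ~` (h @^-1` [set y])) by [].
have jumps_ae := jump_formula P_complete US X_meas X_jump lamL X_rate VS mh pi_cond
  pi_rcont pi_llim jmE phi_Bb Beta eta_int.
have start_ae : {ae P, forall w, \int[pi 0 w]_x phi x =
    disint_mean h H phi c ((mu : finite_measures (borel I) R), h (X 0 w))}.
  apply: (@initial_filter _ _ _ _ _ _ _ _ h X mu _ phi
    (fun y => disint_mean h H phi c ((mu : finite_measures (borel I) R), y))) => //.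
  - have c1_ge0 : 0 <= c + 1 by rewrite addr_ge0.
    apply: (Bb_le (M := c + 1)) (fun y => disint_mean_bound _ _ phi_Bb phi_le _).
    apply: (measurableT_comp (Bb_meas Beta)).
    exact: (measurable_pair1 (mu : finite_measure_space (borel I) R)).
  - exact: pi_cond.
  - by move=> B mB; exact: (eta_int mu B mB).
have fibre_ae := filter_fibre P_complete X_meas X_jump VS mh pi_cond pi_rcont pi_llim.
have [cK cKp cKP] := Bb_exists_bound (BK _ phi_Bb).
have [c1 c1p c1P] := Bb_exists_bound (BK _ B1).
(* One bound for [phi], [K phi] and [K one], so that their expansions share the same constants. *)
pose b := c + cK + c1.
have b_phi x : `|phi x| <= b by rewrite (le_trans (phi_le x))// /b -addrA lerDl addr_ge0// ltW.
have b_K x : `|K phi x| <= b by rewrite (le_trans (cKP x))// /b addrAC lerDr addr_ge0// ltW.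
have b_1 x : `|K one x| <= b by rewrite (le_trans (c1P x))// /b lerDr addr_ge0// ltW.
have b_ge0 : 0 <= b by exact: le_trans (b_phi point).
have expand f (fb : forall x, `|f x| <= b) (Bf : Bb f) :=
  filter_expansion P_complete US X_meas X_jump lamL X_rate VS mh pi_cond pi_rcont Bf fb.
have left_lip f (fb : forall x, `|f x| <= b) (Bf : Bb f) :=
  filter_left_lipschitz P_complete US X_meas X_jump lamL X_rate VS mh pi_cond pi_rcont pi_llim Bf fb.
have e0 := expand _ b_phi phi_Bb; have e1 := expand _ b_K (BK _ phi_Bb).
have e2 := expand _ b_1 (BK _ B1).
have l0 := left_lip _ b_phi phi_Bb; have l1 := left_lip _ b_K (BK _ phi_Bb).
have l2 := left_lip _ b_1 (BK _ B1).
have ae_and (A B : Om -> Prop) : {ae P, forall w, A w} -> {ae P, forall w, B w} ->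
    {ae P, forall w, A w /\ B w} by move=> HA HB; exact: filterI.
have good := ae_and _ _ (ae_and _ _ start_ae jumps_ae) (ae_and _ _ fibre_ae
  (ae_and _ _ (ae_and _ _ e0 (ae_and _ _ e1 e2)) (ae_and _ _ l0 (ae_and _ _ l1 l2)))).
clear e0 e1 e2 l0 l1 l2 start_ae jumps_ae fibre_ae; apply: filterS good => w.
move=> [[start jumps] [[fib fibl] [[E0 [E1 E2]] [G0 [G1 G2]]]]].
pose y := fun t => h (X t w); pose T n := jump_time y n.
have tauE n : tau n w = T n by exact: tau_def.
(* [C] dominates both the Lipschitz constant [19 * b * L] and the second-order constant
   [182 * b * L ^+ 2]; [k * (t - s) < 1] is the mesh condition. *)
pose k := 10 * L; pose C := 19 * b * L + 182 * b * L ^+ 2.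
have k_ge0 : 0 <= k by exact: mulr_ge0.
have C_ge0 : 0 <= C by rewrite addr_ge0// !mulr_ge0// sqr_ge0.
have C1 : 19 * b * L <= C by rewrite lerDl !mulr_ge0// sqr_ge0.
have C2 : 182 * b * L ^+ 2 <= C by rewrite lerDr !mulr_ge0.
have kE s t : k * (t - s) = 10 * (L * (t - s)) by rewrite /k mulrA.
have mean_le (m : probability (borel I) R) f e : Bb f -> (forall x, `|f x| <= e) ->
    `|\int[m]_x f x| <= e.
  move=> Bf fe; have := int_bound (probabilityT_lty m) Bf fe.
  by rewrite (congr1 fine (probability_setT m) : fine _ = 1) mulr1.
have etaH (m : finite_measures (borel I) R) v (p : probability (borel I) R) :
    \int[p]_x phi x = disint_mean h H phi c (m, v) ->
    \int[p]_x phi x = \int[H m v]_x phi x.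
  exact: (disint_mean_eq phi_Bb phi_le).
have Y_left_const t a : (\forall s \near t^'-, h (X s w) = a) -> Y_left t w = a.
  by move=> H0; rewrite Y_left_def; exact: left_lim_const.
have part2 n : (tau n w < +oo)%E -> \int[pi (fine (tau n w)) w]_x phi x =
    \int[H (mu_ n w) (h (X (fine (tau n w)) w))]_x phi x.
  case: n => [_|n tn].
    by rewrite mu_0 tauE /T /=; apply: etaH; exact: start.
  rewrite mu_S//; move: tn; rewrite !tauE => tn.
  have [T0|[a a0 Ta]] := jump_time_cases (HY w) n.
    by move: tn; rewrite /T (jump_timeS_pinfty T0).
  have [T0|[u u0 Tu]] := jump_time_cases (HY w) n.+1; first by move: tn; rewrite /T T0.
  have au : a < u by have := jump_time_lt (HY w) (n := n); rewrite Ta Tu lte_fin ltry; apply.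
  (* The jump formula refers to the observation at the previous jump; this is its left limit at [u],
     since it is constant on [[a, u[]. *)
  have := jumps n tn; cbv zeta; rewrite /T -/y Tu Ta -[fine u%:E]/u -[fine a%:E]/a => Hj; rewrite (Y_left_const u (h (X a w))).
    exact: etaH Hj.
  apply/near_leftP; exists (u - a); first by rewrite subr_gt0.
  move=> v; rewrite subKr => /andP[av vu].
  rewrite -[a]/(fine a%:E) -Ta; apply: (jump_time_const (HY w)).
  by rewrite Ta Tu lee_fin lte_fin vu ltW.
have stayE t f : 0 <= t -> Bb f ->
    \int[pi t w]_x opA lam h (h (X t w)) f x = \int[pi t w]_x K f x.
  by move=> t0 Bf; exact: (opA_int VS lamL Bf (fib t t0)).
have stay_leftE t f : 0 < t -> Bb f ->
    \int[pi_left t w]_x opA lam h (Y_left t w) f x = \int[pi_left t w]_x K f x.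
  move=> t0 Bf; have [e e0 [a He]] := path_left (HY w) t0.
  have ya : \forall s \near t^'-, h (X s w) = a by apply/near_leftP; exists e.
  by rewrite (Y_left_const t a ya); exact: (opA_int VS lamL Bf (fibl t a t0 ya)).
have scale (A t s : R) : A <= C -> s <= t -> A * (t - s) <= C * (t - s).
  by move=> AC st; rewrite ler_wpM2r// subr_ge0.
have F0 : lipschitz_on_stays y k C (fun t => \int[pi t w]_x phi x).
  move=> s t st tj; rewrite kE => ks; have [H1 _] := E0 s t st tj ks.
  by rewrite (le_trans H1)// mulrA scale//; case/andP: st.
have F1 : lipschitz_on_stays y k C (fun t => \int[pi t w]_x K phi x).
  move=> s t st tj; rewrite kE => ks; have [H1 _] := E1 s t st tj ks.
  by rewrite (le_trans H1)// mulrA scale//; case/andP: st.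
have F2 : lipschitz_on_stays y k C (fun t => \int[pi t w]_x K one x).
  move=> s t st tj; rewrite kE => ks; have [H1 _] := E2 s t st tj ks.
  by rewrite (le_trans H1)// mulrA scale//; case/andP: st.
have D0 : close_on_stays y k C (fun t => \int[pi t w]_x phi x)
    (fun t => \int[pi_left t w]_x phi x).
  move=> s t st tj; rewrite kE => ks; have H1 := G0 s t st tj ks.
  by rewrite (le_trans H1)// mulrA scale//; case/andP: st => _ /ltW.
have D1 : close_on_stays y k C (fun t => \int[pi t w]_x K phi x)
    (fun t => \int[pi_left t w]_x K phi x).
  move=> s t st tj; rewrite kE => ks; have H1 := G1 s t st tj ks.
  by rewrite (le_trans H1)// mulrA scale//; case/andP: st => _ /ltW.
have D2 : close_on_stays y k C (fun t => \int[pi t w]_x K one x)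
    (fun t => \int[pi_left t w]_x K one x).
  move=> s t st tj; rewrite kE => ks; have H1 := G2 s t st tj ks.
  by rewrite (le_trans H1)// mulrA scale//; case/andP: st => _ /ltW.
have FE s t : 0 <= s <= t -> (t%:E < first_jump y s)%E -> k * (t - s) < 1 ->
    `|\int[pi t w]_x phi x - \int[pi s w]_x phi x - (t - s) * (\int[pi s w]_x K phi x -
       \int[pi s w]_x phi x * \int[pi s w]_x K one x)| <= C * (t - s) ^+ 2.
  move=> st tj; rewrite kE => ks; have [_ H2] := E0 s t st tj ks.
  by rewrite (le_trans H2)// exprMn mulrA ler_wpM2r// sqr_ge0.
have ll f : Bb f -> forall t, 0 < t ->
    \int[pi s w]_x f x @[s --> t^'-] --> \int[pi_left t w]_x f x.
  by move=> Bf t t0; exact: (filter_left_limit pi_llim).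
have q0 s : `|\int[pi s w]_x phi x| <= b by exact: mean_le.
have q2 s : `|\int[pi s w]_x K one x| <= b by apply: mean_le => //; exact: BK.
have r0 s : `|\int[pi_left s w]_x phi x| <= b by exact: mean_le.
have r1 s : `|\int[pi_left s w]_x K phi x| <= b by apply: mean_le => //; exact: BK.
have r2 s : `|\int[pi_left s w]_x K one x| <= b by apply: mean_le => //; exact: BK.
split; [|split].
- move=> t t0.
  (* Only positive times: [Y_left] and [pi_left] are determined there. *)
  have p2E s : 0 < s -> (\int[pi_left s w]_x phi x) *
      \int[pi_left s w]_x opA lam h (Y_left s w) (cst 1) x =
      (\int[pi_left s w]_x phi x) * \int[pi_left s w]_x K one x.
    by move=> s0; rewrite (stay_leftE s one s0 B1).
  have -> := filter_path_integral (HY w) b_ge0 k_ge0 C_ge0 q2 r0 r1 r2 D0 D1 D2 FE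
    (ll _ phi_Bb) (ll _ (BK _ phi_Bb)) (ll _ (BK _ B1))
    (fun s s0 => stay_leftE s phi s0 phi_Bb) p2E t0.
  have -> : \int[pi 0 w]_x phi x = \int[H mu (h (X 0 w))]_x phi x by exact: etaH start.
  congr (_ + _).
  have -> : [set n | (0 < jump_time y n <= t%:E)%E] = [set n | (0 < tau n w <= t%:E)%E].
    by apply/seteqP; split=> n /=; rewrite tauE.
  apply: eq_fsbigr => n; rewrite inE /= => /andP[_ nt].
  by rewrite -[jump_time y n]/(T n) -tauE part2// (le_lt_trans nt)// ltry.
- exact: part2.
- move=> n t; cbv zeta; rewrite !tauE => tn.
  have t0 : 0 <= t by rewrite -lee_fin (le_trans (jump_time_ge0 (HY w) n))//; case/andP: tn.
  rewrite -[h (X (fine (T n)) w)](jump_time_const (HY w) tn).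
  rewrite (stayE t phi t0 phi_Bb) (stayE t one t0 B1).
  exact: (filter_path_derivative (HY w) b_ge0 k_ge0 C_ge0 q0 q2 F0 F1 F2 FE tn).
Qed.
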